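(* Let $N\ge 3$, let $\Omega\subset\mathbb{R}^N$ be a bounded open set, let $B>0$, and let $b:\Omega\to\mathbb{R}$ be measurable with $\alpha\le b(x)\le\beta$ for a.e. $x\in\Omega$, for some constants $\alpha,\beta>0$. Let $1\le\theta<2$, $p>0$ and $p>\theta-1$. Assume that $f\in L^m(\Omega)$ with $m\ge\frac{2N}{2N-\theta(N-2)}$, that $f$ is positive, and that $\operatorname{ess\,inf}\{f(x):x\in\omega\}>0$ for every $\omega\subset\subset\Omega$. Then there exists a function $u\in H^1_0(\Omega)$, strictly positive on $\Omega$, such that $\frac{|\nabla u|^2}{u^\theta}\in L^1(\Omega)$ and $$\int_\Omega \frac{b(x)}{(1+u)^p}\nabla u\cdot\nabla\varphi + B\int_\Omega \frac{|\nabla u|^2}{u^\theta}\varphi=\int_\Omega f\varphi$$ for every $\varphi\in H^1_0(\Omega)\cap L^\infty(\Omega)$.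
   Context: ''$f$ positive'' means $f>0$ a.e. in $\Omega$ (this is implied by the condition on the essential infima); ''$u$ strictly positive on $\Omega$'' means $u>0$ a.e. in $\Omega$. $\omega\subset\subset\Omega$ means that $\omega$ is compactly contained in $\Omega$. *)

(* Defs.v *)
From HB Require Import structures.
From mathcomp Require Import all_boot all_order all_algebra.
From mathcomp Require Import all_classical all_reals all_analysis.
From mathcomp Require Import ess_sup_inf.

Set Implicit Arguments.
Unset Strict Implicit.
Unset Printing Implicit Defensive.
Import Order.TTheory GRing.Theory Num.Theory.
Import numFieldNormedType.Exports.

Local Open Scope classical_set_scope.
Local Open Scope ring_scope.

(* The sigma-algebra generated by the coordinates, i.e. the Borel sets of R^n;
   same construction as the library's one on tuples. *)
Definition rV_display : measure_display.
Proof. exact: default_measure_display. Qed.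

Section measurable_rV.
Context (R : realType) (n : nat).

Let coord (i : 'I_n) (x : 'rV[R]_n) : R := x 0 i.

Let rV_set0 : g_sigma_preimage coord set0.
Proof. exact: sigma_algebra0. Qed.

Let rV_setC A : g_sigma_preimage coord A -> g_sigma_preimage coord (~` A).
Proof. exact: sigma_algebraC. Qed.

Let rV_bigcup (F : _^nat) : (forall i, g_sigma_preimage coord (F i)) ->
  g_sigma_preimage coord (\bigcup_i (F i)).
Proof. exact: sigma_algebra_bigcup. Qed.

HB.instance Definition _ := @isMeasurable.Build rV_display
  'rV[R]_n (g_sigma_preimage coord) rV_set0 rV_setC rV_bigcup.

Lemma measurable_coord (i : 'I_n) :
  measurable_fun [set: 'rV[R]_n] (fun x : 'rV[R]_n => x 0 i).
Proof.
move=> _ Y mY; rewrite setTI; apply: sub_sigma_algebra => /=.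
rewrite -bigcup_seq/=; exists i => /=; first by rewrite mem_index_enum.
by exists Y => //; rewrite setTI.
Qed.

Lemma measurable_fun_rV d (T : measurableType d) (f : T -> 'rV[R]_n) :
  (forall i, measurable_fun [set: T] (fun x => f x 0 i)) ->
  measurable_fun [set: T] f.
Proof.
move=> mf _ Y mY; rewrite setTI.
pose S := [set A : set 'rV[R]_n | measurable (f @^-1` A)].
suff sub : g_sigma_preimage coord `<=` S by exact: (sub Y mY).
apply: smallest_sub.
  split.
  - by rewrite /S /= preimage_set0.
  - by move=> A; rewrite /S /= setTD preimage_setC => mA; exact: measurableC.
  - move=> F mF; rewrite /S /= preimage_bigcup.
    by apply: bigcup_measurable => k _; exact: mF.
rewrite -bigcup_seq => A /= [i _ [B mB <-]]; rewrite /S /= setTI.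
by have := mf i measurableT B mB; rewrite setTI.
Qed.

End measurable_rV.

Section lebesgue_measure_rV.
Context (R : realType).

Definition cons_rV n (p : R * 'rV[R]_n) : 'rV[R]_n.+1 :=
  \row_i oapp (p.2 0) p.1 (unlift ord0 i).

Definition uncons_rV n (x : 'rV[R]_n.+1) : R * 'rV[R]_n :=
  (x 0 ord0, \row_j x 0 (lift ord0 j)).

Lemma cons_rV0 n (p : R * 'rV[R]_n) : cons_rV p 0 ord0 = p.1.
Proof. by rewrite mxE unlift_none. Qed.

Lemma cons_rVS n (p : R * 'rV[R]_n) j : cons_rV p 0 (lift ord0 j) = p.2 0 j.
Proof. by rewrite mxE liftK. Qed.

Lemma cons_rVK n : cancel (@cons_rV n) (@uncons_rV n).
Proof.
case=> a v; rewrite /uncons_rV cons_rV0; congr pair.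
by apply/rowP => j; rewrite mxE cons_rVS.
Qed.

Lemma measurable_cons_rV n : measurable_fun setT (@cons_rV n).
Proof.
apply: measurable_fun_rV => i; case: (unliftP ord0 i) => [j ->|->].
- under eq_fun do rewrite cons_rVS.
  exact: (measurableT_comp (@measurable_coord R n j) measurable_snd).
- under eq_fun do rewrite cons_rV0.
  exact: measurable_fst.
Qed.

Lemma measurable_uncons_rV n : measurable_fun setT (@uncons_rV n).
Proof.
apply/measurable_fun_pair; first exact: measurable_coord.
apply: measurable_fun_rV => i; under eq_fun do rewrite mxE.
exact: measurable_coord.
Qed.

Section cons_measure.
Context (n : nat) (m : {sigma_finite_measure set 'rV[R]_n -> \bar R}).

Definition cons_measure : set 'rV[R]_n.+1 -> \bar R :=
  pushforward (@lebesgue_measure R \x m)%E (@cons_rV n).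

Let cons_measure0 : cons_measure set0 = 0%E.
Proof. by rewrite /cons_measure /pushforward preimage_set0 measure0. Qed.

Let cons_measure_ge0 A : (0 <= cons_measure A)%E.
Proof. by rewrite /cons_measure /pushforward; exact: measure_ge0. Qed.

Let cons_measure_sigma_additive : semi_sigma_additive cons_measure.
Proof.
by apply: measure_semi_sigma_additive; exact: measurable_cons_rV.
Qed.

HB.instance Definition _ := isMeasure.Build _ _ _ cons_measure
  cons_measure0 cons_measure_ge0 cons_measure_sigma_additive.

Let cons_measure_sigma_finite : sigma_finite setT cons_measure.
Proof.
have /sigma_finiteP[F [TF ndF Foo]] := sigma_finiteT (@lebesgue_measure R).
have /sigma_finiteP[G [TG ndG Goo]] := sigma_finiteT m.
exists (fun k => @uncons_rV n @^-1` (F k `*` G k)).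
  rewrite -preimage_bigcup; apply/esym; rewrite -subTset => x _.
  have [i _ Fi] : (\bigcup_k F k) (uncons_rV x).1 by rewrite -TF.
  have [j _ Gj] : (\bigcup_k G k) (uncons_rV x).2 by rewrite -TG.
  exists (maxn i j) => //; split.
  - by move: Fi; exact/subsetPset/ndF/leq_maxl.
  - by move: Gj; exact/subsetPset/ndG/leq_maxr.
move=> k; have [mF Fk] := Foo k; have [mG Gk] := Goo k; split.
  rewrite -[X in measurable X]setTI.
  by apply: measurable_uncons_rV => //; exact: measurableX.
rewrite /cons_measure /pushforward -comp_preimage.
rewrite (_ : _ \o _ = id); last by apply/funext => x /=; rewrite cons_rVK.
by rewrite preimage_id product_measure1E// lte_mul_pinfty// ge0_fin_numE.
Qed.

HB.instance Definition _ := Measure_isSigmaFinite.Build _ _ _ cons_measure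
  cons_measure_sigma_finite.

End cons_measure.

Fixpoint lebesgue_rV n : {sigma_finite_measure set 'rV[R]_n -> \bar R} :=
  match n with
  | 0 => @dirac _ _ (0 : 'rV[R]_0) R
  | n'.+1 => cons_measure (lebesgue_rV n')
  end.

Lemma measurable_box n (A : 'I_n -> set R) : (forall i, measurable (A i)) ->
  measurable [set x : 'rV[R]_n | forall i, A i (x 0 i)].
Proof.
move=> mA.
rewrite (_ : mkset _ = \bigcap_(i in [set: 'I_n])
    ((fun x : 'rV[R]_n => x 0 i) @^-1` A i)); last first.
  by apply/seteqP; split => x /= Ax i; [move=> _|]; exact: Ax.
apply: fin_bigcap_measurable => // i _.
by rewrite -[X in measurable X]setTI; exact: measurable_coord.
Qed.

Lemma lebesgue_rV_box n (A : 'I_n -> set R) : (forall i, measurable (A i)) ->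
  lebesgue_rV n [set x | forall i, A i (x 0 i)] =
  (\prod_(i < n) lebesgue_measure (A i))%E.
Proof.
elim: n A => [|n IHn] A mA.
  by rewrite big_ord0 /= diracE mem_set//= => -[].
rewrite big_ord_recl -IHn//= /cons_measure /pushforward.
rewrite -product_measure1E; first last.
- exact: (@measurable_box n (fun i => A (lift ord0 i))).
- exact: mA.
congr product_measure1; apply/seteqP; split => -[t v] /=.
  move=> Atv; split=> [|j]; first by have := Atv ord0; rewrite cons_rV0.
  by have := Atv (lift ord0 j); rewrite cons_rVS.
move=> [At Av] i; case: (unliftP ord0 i) => [j ->|->]; last by rewrite cons_rV0.
by rewrite cons_rVS; exact: Av.
Qed.

End lebesgue_measure_rV.

Section sobolev.
Context (R : realType) (N : nat).
Implicit Types (Omega : set 'rV[R]_N) (p : \bar R).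
Local Notation mu := (lebesgue_rV R N).

Definition compactly_contained (omega Omega : set 'rV[R]_N) :=
  compact (closure omega) /\ closure omega `<=` Omega.

(* The measurable sets of 'rV[R]_N being the Borel sets, Lebesgue-measurable
   functions are those that agree a.e. with a Borel one. *)
Definition lebesgue_measurable_fun Omega (f : 'rV[R]_N -> R) :=
  exists2 g : 'rV[R]_N -> R,
    measurable_fun setT g & f = g %[ae mu in Omega].

Definition Lp_norm Omega p (f : 'rV[R]_N -> R) : \bar R :=
  'N[mu]_p[(EFin \o f) \_ Omega].

Definition in_Lp Omega p (f : 'rV[R]_N -> R) :=
  lebesgue_measurable_fun Omega f /\ (Lp_norm Omega p f < +oo)%E.

(* Set to +oo off omega so as not to influence the infimum. *)
Definition ess_inf_on (omega : set 'rV[R]_N) (f : 'rV[R]_N -> R) : \bar R :=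
  ess_inf mu (patch (cst +oo%E) omega (EFin \o f)).

Definition partial (i : 'I_N) (f : 'rV[R]_N -> R) : 'rV[R]_N -> R :=
  fun x => 'D_(delta_mx 0 i) f x.

Definition smooth (f : 'rV[R]_N -> R) :=
  forall s : seq 'I_N,
    continuous (foldr partial f s) /\
    forall i x, derivable (foldr partial f s) x (delta_mx 0 i).

(* C_c^oo(Omega), extended by zero to the whole space *)
Definition test_fun Omega (phi : 'rV[R]_N -> R) :=
  smooth phi /\ compactly_contained [set x | phi x != 0] Omega.

Definition dotv (x y : 'rV[R]_N) : R := \sum_i x 0 i * y 0 i.

Definition is_weak_grad Omega (u : 'rV[R]_N -> R) (Du : 'rV[R]_N -> 'rV[R]_N) :=
  forall phi, test_fun Omega phi -> forall i,
    \int[mu]_(x in Omega) (u x * partial i phi x) =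
    - \int[mu]_(x in Omega) (Du x 0 i * phi x).

(* u is in H^1(Omega) and Du is a representative of its gradient *)
Definition H1 Omega (u : 'rV[R]_N -> R) (Du : 'rV[R]_N -> 'rV[R]_N) :=
  [/\ in_Lp Omega 2%:E u,
      forall i, in_Lp Omega 2%:E (fun x => Du x 0 i) &
      is_weak_grad Omega u Du].

(* H^1_0(Omega): the closure of C_c^oo(Omega) in H^1(Omega) *)
Definition H10 Omega (u : 'rV[R]_N -> R) (Du : 'rV[R]_N -> 'rV[R]_N) :=
  H1 Omega u Du /\
  exists phi : nat -> 'rV[R]_N -> R,
    [/\ forall k, test_fun Omega (phi k),
        Lp_norm Omega 2%:E (phi k \- u) @[k --> \oo] --> 0%E &
        forall i, Lp_norm Omega 2%:E (fun x => partial i (phi k) x - Du x 0 i)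
          @[k --> \oo] --> 0%E].

End sobolev.

(* Main.v *)
(* The unknown u is transformed by 1 + u = E(w), where E solves E' = E^p,
   E(0) = 1; then E(w)^-p Du = Dw and the equation becomes
   - div(b Dw) + B g(w) |Dw|^2 = f with g = (E - 1)^-theta E^(2p), which is
   singular at w = 0.  Replacing g by Lipschitz functions increasing to g and
   |Dw|^2 by a bounded truncation gives problems that are solved by a
   contraction argument and monotone iteration; the solutions w_n decrease in n,
   and monotonicity of the energy makes them Cauchy in H^1_0, with limit w.
   Testing with phi exp(c w_n^-a) ((s0 - w_n)^+)^2, where 2a >= theta,
   theta <= 1 + a, gives w > 0 wherever f is locally bounded below.  Testing
   with (1 + u)^theta - 1, truncated, and bounding the source term by the
   Sobolev inequality, which is where the condition on m enters, bounds
   int |Du|^2 and shows that w stays inside the domain of E.  The weak equation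
   follows by testing with phi sigma_K(u), where sigma_K vanishes near 0 and
   near infinity and u |sigma_K'(u)| is bounded.

   H^1_0 is handled as the completion of test functions: pairs of a Borel
   function and a Borel gradient. *)
Require Import Defs.
From mathcomp Require Import all_boot all_order all_algebra.
From mathcomp Require Import all_classical all_reals all_analysis.
From mathcomp Require Import measurable_realfun ess_sup_inf zify ring lra.

Set Implicit Arguments.
Unset Strict Implicit.
Unset Printing Implicit Defensive.
Import Order.TTheory GRing.Theory Num.Theory.
Import numFieldNormedType.Exports.

Local Open Scope classical_set_scope.
Local Open Scope ring_scope.

(** * Real-valued integrals *)

(** The equation is quadratic in the gradient, so the gradients of the approximations must converge
    almost everywhere, not merely weakly. This is obtained without a compactness theorem: each
    approximate solution is a supersolution of the next problem, and testing with the nonnegative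
    difference of two of them bounds its energy by an increment of a monotone bounded sequence. Two
    degeneracies remain. Near [u = 0] the coefficient is singular like [u^-theta]; the logarithmic
    derivative of [exp(c w^-a)] has order [w^-(1+a)], and [theta < 2] allows [theta <= 1 + a] with
    [a < 1]. At infinity the diffusion degenerates, and for [p > 1] the domain of [E] is bounded
    above, so [w] might reach its end. There the gradient term provides the coercivity: tested with
    a function comparable to [u^theta] it controls the full Dirichlet energy, while the source grows
    only like the power [theta/2 < 1] of that energy. With [q = 2N/(N-2)], the lower bound on [m] is
    [q/(q - theta)], the exponent conjugate to [q/theta]; it makes [f |v|^theta] integrable for [v]
    in the Sobolev space. *)

Section real_integral.
Context d (T : measurableType d) (R : realType).
Variables (mu : {measure set T -> \bar R}) (D : set T) (mD : measurable D).
Local Notation I f := (\int[mu]_(x in D) f x).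

Definition intg (f : T -> R) := mu.-integrable D (EFin \o f).

Definition aeon (P : T -> Prop) := {ae mu, forall x, D x -> P x}.

Lemma aeonW (P : T -> Prop) : (forall x, D x -> P x) -> aeon P.
Proof. by move=> h; apply: nearW. Qed.

Lemma aeon_imp (P Q : T -> Prop) :
  (forall x, D x -> P x -> Q x) -> aeon P -> aeon Q.
Proof. by rewrite /aeon => h; apply: filterS => x hx Dx; apply: h (hx Dx). Qed.

Lemma aeon_imp2 (P Q S : T -> Prop) :
  (forall x, D x -> P x -> Q x -> S x) -> aeon P -> aeon Q -> aeon S.
Proof.
by rewrite /aeon => h; apply: filterS2 => x hx hy Dx; apply: h (hx Dx) (hy Dx).
Qed.

Lemma aeon_all (P : nat -> T -> Prop) :
  (forall n, aeon (P n)) -> aeon (fun x => forall n, P n x).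
Proof.
by rewrite /aeon => h; apply: filterS (ae_foralln h) => x hx Dx n; exact: hx.
Qed.

Lemma intg_meas f : intg f -> measurable_fun D f.
Proof. by move/measurable_int/measurable_EFinP. Qed.

Lemma intgD f g : intg f -> intg g -> intg (fun x => f x + g x).
Proof. by move=> hf hg; have := integrableD mD hf hg. Qed.

Lemma intgZ a f : intg f -> intg (fun x => a * f x).
Proof. by move=> hf; have := integrableZl mD a hf. Qed.

Lemma intgN f : intg f -> intg (fun x => - f x).
Proof.
by move/(@intgZ (-1)) => h; under eq_fun do rewrite -mulN1r.
Qed.

Lemma intgB f g : intg f -> intg g -> intg (fun x => f x - g x).
Proof. by move=> hf hg; apply: intgD => //; exact: intgN. Qed.

Lemma intg_dom f g : measurable_fun D f -> intg g ->
  aeon (fun x => `|f x : R| <= g x) -> intg f.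
Proof.
move=> mf ig fg; apply/integrableP; split; first exact/measurable_EFinP.
case/integrableP: (ig) => mg; apply: le_lt_trans.
apply: ae_ge0_le_integral => //.
- by apply: measurableT_comp => //; exact/measurable_EFinP.
- exact: measurableT_comp.
- move: fg; apply: aeon_imp => x _ h /=.
  by rewrite lee_fin (le_trans h)// ler_norm.
Qed.

Lemma intg_dom_le f g : measurable_fun D f -> intg g ->
  (forall x, D x -> `|f x : R| <= g x) -> intg f.
Proof. by move=> mf ig h; apply: intg_dom mf ig _; exact: aeonW. Qed.

Lemma intg_abs f : intg f -> intg (fun x => `|f x|).
Proof. exact: integrable_abse. Qed.

Lemma intg_sum (J : Type) (s : seq J) (P : pred J) (f : J -> T -> R) :
  (forall j, intg (f j)) -> intg (fun x => \sum_(j <- s | P j) f j x).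
Proof.
move=> h; elim: s => [|j s IH].
  under eq_fun do rewrite big_nil.
  exact: integrable0.
under eq_fun do rewrite big_cons.
by case: (P j) => //; exact: intgD.
Qed.

Lemma ID f g : intg f -> intg g -> I (fun x => f x + g x) = I f + I g.
Proof. exact: RintegralD. Qed.

Lemma IB f g : intg f -> intg g -> I (fun x => f x - g x) = I f - I g.
Proof. exact: RintegralB. Qed.

Lemma IZ a f : intg f -> I (fun x => a * f x) = a * I f.
Proof. exact: RintegralZl. Qed.

Lemma I_eq f g : (forall x, D x -> f x = g x) -> I f = I g.
Proof. by move=> h; apply: eq_Rintegral => x /set_mem/h. Qed.

Lemma I_sum (J : Type) (s : seq J) (P : pred J) (f : J -> T -> R) :
  (forall j, intg (f j)) ->
  I (fun x => \sum_(j <- s | P j) f j x) = \sum_(j <- s | P j) I (f j).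
Proof.
move=> h; elim: s => [|j s IH].
  rewrite big_nil -[RHS](mul0r (fine (mu D))) -Rintegral_cst//.
  by apply: I_eq => x _; rewrite big_nil.
rewrite big_cons -IH; case: ifPn => Pj.
  rewrite -ID//; last exact: intg_sum.
  by apply: I_eq => x _; rewrite big_cons Pj.
by apply: I_eq => x _; rewrite big_cons (negbTE Pj).
Qed.

Lemma I_ge0_ae f : intg f -> aeon (fun x => 0 <= f x) -> 0 <= I f.
Proof.
move=> hf f0; suff -> : I f = I (fun x => `|f x|).
  exact: Rintegral_ge0.
congr fine; apply: ae_eq_integral => //.
- by case/integrableP: hf.
- by case/integrableP: (intg_abs hf).
- by move: f0; rewrite /aeon; apply: filterS => x h Dx; rewrite ger0_norm// h.
Qed.

Lemma I_le_ae f g : intg f -> intg g -> aeon (fun x => f x <= g x) -> I f <= I g.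
Proof.
move=> hf hg h; rewrite -subr_ge0 -IB//; apply: I_ge0_ae; first exact: intgB.
by move: h; apply: aeon_imp => x _; rewrite subr_ge0.
Qed.

Lemma I_le f g : intg f -> intg g -> (forall x, D x -> f x <= g x) -> I f <= I g.
Proof. by move=> hf hg h; apply: I_le_ae => //; exact: aeonW. Qed.

Lemma I_eq_ae f g : measurable_fun D f -> measurable_fun D g ->
  aeon (fun x => f x = g x) -> I f = I g.
Proof.
move=> mf mg h; congr fine; apply: ae_eq_integral => //.
- exact/measurable_EFinP.
- exact/measurable_EFinP.
- by move: h; rewrite /aeon; apply: filterS => x h Dx; rewrite h.
Qed.

Lemma EFin_I f : intg f -> (I f)%:E = (\int[mu]_(x in D) (f x)%:E)%E.
Proof. by move=> hf; rewrite /Rintegral fineK//; exact: integrable_fin_num. Qed.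

Lemma I_eq0_ae f : intg f -> aeon (fun x => 0 <= f x) -> I f <= 0 ->
  aeon (fun x => f x = 0).
Proof.
move=> hf f0 If0.
have mf : measurable_fun D (EFin \o f) by case/integrableP: hf.
have : ae_eq mu D (EFin \o f) (cst 0%E).
  apply/ae_eq_integral_abs => //.
  have -> : (\int[mu]_(x in D) `|(EFin \o f) x| = \int[mu]_(x in D) (f x)%:E)%E.
    apply: ae_eq_integral => //; first exact: measurableT_comp.
    by move: f0; rewrite /aeon; apply: filterS => x h Dx /=; rewrite ger0_norm// h.
  rewrite -EFin_I//; congr EFin; apply/eqP; rewrite eq_le If0/=.
  exact: I_ge0_ae.
by rewrite /aeon; apply: filterS => x h Dx; have := h Dx => -[].
Qed.

Lemma dct (f_ : nat -> T -> R) (f g : T -> R) :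
  (forall n, measurable_fun D (f_ n)) -> measurable_fun D f ->
  aeon (fun x => f_ n x @[n --> \oo] --> f x) -> intg g ->
  aeon (fun x => forall n, `|f_ n x| <= g x) ->
  intg f /\ I (f_ n) @[n --> \oo] --> I f.
Proof.
move=> mf_ mf cf ig fg.
have [|||||] := @dominated_convergence _ _ _ mu D mD
  (fun n => EFin \o f_ n) (EFin \o f) (EFin \o g) => //.
- by move=> n; exact/measurable_EFinP.
- exact/measurable_EFinP.
- by move: cf; rewrite /aeon; apply: filterS => x h Dx; apply: cvg_EFin (h Dx); exact: nearW.
- by move: fg; rewrite /aeon; apply: filterS => x h n Dx; rewrite lee_fin; exact: h.
move=> intf _ cI; split => //.
apply: fine_cvg; rewrite fineK //; exact: integrable_fin_num.
Qed.

(** Fatou's lemma is applied to [min (f_ n) f], which converges to [f]. Only an eventual lower bound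
    is therefore required of the sequence, which may oscillate or blow up above [f], as the test
    functions of the positivity argument do. *)
Lemma fatouR (f_ : nat -> T -> R) (f : T -> R) (C : R) : measurable_fun D f ->
  (forall n, intg (f_ n)) -> (forall x, D x -> 0 <= f x) ->
  (forall n x, D x -> 0 <= f_ n x) ->
  (forall n, I (f_ n) <= C) ->
  aeon (fun x => forall e, 0 < e -> \forall n \near \oo, f x <= f_ n x + e) ->
  intg f /\ I f <= C.
Proof.
move=> mf hf_ f0 f_0 IC hlim.
pose h n x := Num.min (f_ n x) (f x).
have mh n : measurable_fun D (h n).
  by apply: measurable_minr => //; exact: intg_meas.
have h0 n x : D x -> 0 <= h n x by move=> Dx; rewrite le_min f_0// f0.
have ch : aeon (fun x => h n x @[n --> \oo] --> f x).
  move: hlim; apply: aeon_imp => x Dx hx.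
  apply/cvgrPdist_le => e e0; move: (hx e e0); apply: filterS => n hn.
  rewrite /h; case: (leP (f_ n x) (f x)) => hc; last by rewrite subrr normr0 ltW.
  by rewrite ger0_norm ?subr_ge0// lerBlDl.
have Ih n : (\int[mu]_(x in D) (h n x)%:E <= C%:E)%E.
  apply: (@le_trans _ _ (\int[mu]_(x in D) (f_ n x)%:E)%E).
    apply: ge0_le_integral => //.
    - by move=> x Dx; rewrite lee_fin h0.
    - exact/measurable_EFinP.
    - exact/measurable_EFinP/intg_meas.
    - by move=> x Dx; rewrite lee_fin ge_min lexx.
  by rewrite -EFin_I// lee_fin.
have If : (\int[mu]_(x in D) (f x)%:E <= C%:E)%E.
  have mh' n : measurable_fun D (EFin \o h n) by exact/measurable_EFinP.
  have -> : (\int[mu]_(x in D) (f x)%:E =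
      \int[mu]_(x in D) limn_einf (fun n => (h n x)%:E))%E.
    apply: ae_eq_integral => //; first exact/measurable_EFinP.
      rewrite (_ : (fun x => limn_einf _) =
          (fun x => - limn_esup (fun n => - (h n x)%:E))%E); last first.
        by apply/funext => x; rewrite limn_esupN oppeK.
      apply: measurableT_comp => //.
      apply: (@measurable_fun_limn_esup _ _ _ _ (fun n x => - (h n x)%:E)%E) => n.
      by apply: measurableT_comp => //; exact: mh'.
    move: ch; rewrite /aeon; apply: filterS => x hx Dx.
    have cE : (h n x)%:E @[n --> \oo] --> (f x)%:E.
      by apply: cvg_EFin (hx Dx); exact: nearW.
    by rewrite (cvg_limn_einf_sup cE).1.
  apply: (le_trans (@fatou _ _ _ mu D mD (fun n => EFin \o h n) mh' _)).
    by move=> n x Dx; rewrite lee_fin h0.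
  rewrite limn_einf_lim; apply: lime_le; first exact: is_cvg_einfs.
  by apply: nearW => n; apply: le_trans (Ih n); apply: ereal_inf_lbound; exists n => /=.
have intf : intg f.
  apply/integrableP; split; first exact/measurable_EFinP.
  apply: (@le_lt_trans _ _ C%:E); last exact: ltry.
  apply: le_trans If; rewrite le_eqVlt; apply/orP; left; apply/eqP.
  by apply: eq_integral => x /set_mem Dx /=; rewrite ger0_norm// f0.
by split => //; rewrite -lee_fin EFin_I.
Qed.

End real_integral.

(** * Subsequences and geometric convergence *)

Lemma increasing_choice (P : nat -> nat -> Prop) :
  (forall k, \forall n \near \oo, P k n) ->
  exists2 phi : nat -> nat, (forall k, (phi k < phi k.+1)%N) &
    forall k, P k (phi k).
Proof.
move=> h.
have {}h k m : exists n, (m <= n)%N /\ P k n.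
  by have [n _ hn] := h k; exists (maxn m n); split; [exact: leq_maxl|
    apply: hn => /=; exact: leq_maxr].
pose f k m := projT1 (cid (h k m)).
have fm k m : (m <= f k m)%N by rewrite /f; case: cid => n /= [].
have fP k m : P k (f k m) by rewrite /f; case: cid => n /= [].
pose phi := fix phi k := if k is k'.+1 then f k (phi k').+1 else f 0%N 0%N.
exists phi => [k|]; first exact: fm.
by case => [|k] /=; exact: fP.
Qed.

Lemma increasing_ge (phi : nat -> nat) :
  (forall k, (phi k < phi k.+1)%N) -> forall k, (k <= phi k)%N.
Proof. by move=> h; elim=> // k IH; exact: leq_ltn_trans (h k). Qed.

Lemma cvg_subseq (U : topologicalType) (u : nat -> U) (l : U) (phi : nat -> nat) :
  (forall k, (phi k < phi k.+1)%N) -> u n @[n --> \oo] --> l ->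
  u (phi k) @[k --> \oo] --> l.
Proof.
move=> h ul A /ul [n _ hn]; exists n => // k /= nk.
by apply: hn => /=; exact: leq_trans nk (increasing_ge h k).
Qed.

Lemma geometric_cauchy (R : realType) (a : nat -> R) (C : R) :
  (forall k, `|a k.+1 - a k| <= C * 2^-1 ^+ k) ->
  exists2 l, a n @[n --> \oo] --> l &
    forall k, `|a k - l| <= 2 * C * 2^-1 ^+ k.
Proof.
move=> h.
have tele k n : `|a (k + n)%N - a k| <= 2 * C * 2^-1 ^+ k.
  have C0 : 0 <= C by have := h 0%N; rewrite expr0 mulr1; exact: le_trans.
  (* The factor [1 - 2^-n] makes the telescoped bound exact, so that the induction on [n] closes. *)
  suff : `|a (k + n)%N - a k| <= 2 * C * 2^-1 ^+ k * (1 - 2^-1 ^+ n).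
    move/le_trans; apply; apply: ler_piMr.
      by rewrite !mulr_ge0// exprn_ge0// invr_ge0.
    by rewrite lerBlDr lerDl exprn_ge0// invr_ge0.
  elim: n => [|n IH]; first by rewrite addn0 subrr normr0 expr0 subrr mulr0.
  rewrite addnS -(subrKA (a (k + n)%N)) (le_trans (ler_normD _ _))//.
  apply: (le_trans (lerD (h _) IH)).
  by rewrite exprD exprS le_eqVlt; apply/orP; left; apply/eqP; field.
have cv : cvgn a.
  apply/cauchy_cvgP; apply: cauchy_exP => e e0.
  have [K _ hK] : \forall k \near \oo, 2 * C * 2^-1 ^+ k < e / 2.
    have : 2 * C * (2^-1 : R) ^+ k @[k --> \oo] --> 2 * C * 0.
      apply: cvgMr; apply: cvg_expr; rewrite ger0_norm; lra.
    rewrite mulr0 => /cvgrPdist_lt/(_ (e / 2)); rewrite divr_gt0// => /(_ isT).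
    by apply: filterS => k; rewrite sub0r normrN; exact: le_lt_trans (ler_norm _).
  have Kn n : (K <= n)%N -> `|a n - a K| < e / 2.
    move=> Kn; rewrite -(subnKC Kn).
    by apply: le_lt_trans (tele K _) (hK K _) => /=.
  exists (a K); exists K => // n /= Kn'.
  rewrite /ball/= distrC (lt_le_trans (Kn n Kn'))// ler_pdivrMr//; lra.
exists (limn a) => // k.
have : `|a k - a n| @[n --> \oo] --> `|a k - limn a|.
  by apply: cvg_norm; apply: cvgB => //; exact: cvg_cst.
move/cvg_lim => <- //; apply: limr_le.
  by apply: is_cvg_norm; apply: is_cvgB => //; exact: is_cvg_cst.
exists k => // n /= kn; rewrite distrC -(subnKC kn); exact: tele.
Qed.

(** * Square-integrable functions: dominated subsequences and completeness *)

Section L2.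
Context d (T : measurableType d) (R : realType).
Variables (mu : {measure set T -> \bar R}) (D : set T) (mD : measurable D).
Local Notation I f := (\int[mu]_(x in D) f x).
Local Notation intg := (intg mu D).
Local Notation aeon := (aeon mu D).

(** By monotone convergence the pointwise sum of the [r k] has integral at most 2, hence is finite
    almost everywhere; it dominates each term, and [fine] makes it real-valued. *)
Lemma summable_dominated (r : nat -> T -> R) :
  (forall k, intg (r k)) -> (forall k x, D x -> 0 <= r k x) ->
  (forall k, I (r k) <= 2^-1 ^+ k) ->
  exists S : T -> R, [/\ intg S, (forall x, D x -> 0 <= S x) &
    aeon (fun x => forall k, r k x <= S x)].
Proof.
move=> ir r0 Ir.
pose S (x : T) : \bar R := (\sum_(0 <= k <oo) (r k x)%:E)%E.
have mr k : measurable_fun D (EFin \o r k).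
  exact/measurable_EFinP/intg_meas.
have S0 x : D x -> (0 <= S x)%E.
  by move=> Dx; apply: nneseries_ge0 => k _ _; rewrite lee_fin r0.
have mS : measurable_fun D S.
  apply: (@ge0_emeasurable_sum _ _ _ _ (fun k x => (r k x)%:E) predT) => //.
    by move=> k x Dx _; rewrite lee_fin r0.
  by move=> k _; exact: mr.
have IS : (\int[mu]_(x in D) S x <= (2:R)%:E)%E.
  rewrite /S integral_nneseries//.
  apply: lime_le.
    apply: is_cvg_nneseries => k _ _.
    by apply: integral_ge0 => x Dx; rewrite lee_fin r0.
  apply: nearW => n.
  apply: (@le_trans _ _ (\sum_(0 <= k < n) (2^-1 ^+ k)%:E)%E).
    by apply: lee_sum => k _; rewrite -EFin_I// lee_fin.
  rewrite sumEFin lee_fin.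
  suff -> : \sum_(0 <= k < n) (2^-1 : R) ^+ k = 2 - 2 * 2^-1 ^+ n.
    by rewrite lerBlDr lerDl mulr_ge0// exprn_ge0// invr_ge0.
  elim: n => [|n IH]; first by rewrite big_nil expr0; lra.
  by rewrite big_nat_recr//= IH exprS; field.
have iS : mu.-integrable D S.
  apply/integrableP; split=> //; apply: (@le_lt_trans _ _ (2:R)%:E); last exact: ltry.
  apply: le_trans IS; rewrite le_eqVlt; apply/orP; left; apply/eqP.
  by apply: eq_integral => x /set_mem Dx; rewrite gee0_abs// S0.
exists (fine \o S); split.
  apply/integrableP; split.
    by apply/measurable_EFinP; exact: (measurableT_comp (fine_measurable measurableT) mS).
  case/integrableP: (iS) => _; apply: le_lt_trans.
  apply: ae_ge0_le_integral => //.
  - apply: measurableT_comp => //; apply/measurable_EFinP.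
    exact: (measurableT_comp (fine_measurable measurableT) mS).
  - exact: measurableT_comp.
  - by apply: filterS (integrable_ae mD iS) => x h Dx; have := h Dx; rewrite /=; case: (S x).
- by move=> x Dx; rewrite fine_ge0// S0.
- have := integrable_ae mD iS; rewrite /aeon.
  apply: filterS => x h Dx k; rewrite -lee_fin /= fineK ?h//.
  have := @nneseries_lim_ge R (fun j => (r j x)%:E) predT 0 k.+1.
  move=> /(_ (fun j _ _ => _)) H; apply: le_trans (H _) => [|j].
    rewrite big_nat_recr//= leeDr// sume_ge0// => j _.
    by rewrite lee_fin r0.
  by rewrite lee_fin r0.
Qed.

(** Along indices where the integral is at most [4^-k], the functions [2^k r] are still summable. A
    single integrable [S] then gives both almost everywhere convergence, at rate [2^-k], and the
    domination required by [dct]. *)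
Lemma cvg0_subseq_dominated (r : nat -> T -> R) :
  (forall k, intg (r k)) -> (forall k x, D x -> 0 <= r k x) ->
  I (r k) @[k --> \oo] --> 0 ->
  exists phi : nat -> nat, exists S : T -> R,
    [/\ forall k, (phi k < phi k.+1)%N, intg S, (forall x, D x -> 0 <= S x) &
    aeon (fun x => forall k, r (phi k) x <= 2^-1 ^+ k * S x)].
Proof.
move=> ir r0 Ir.
have [k|phi phim hphi] := @increasing_choice
    (fun k n => I (r n) <= 2^-1 ^+ k * 2^-1 ^+ k); last first.
  have [|||S [iS S0 hS]] := @summable_dominated
      (fun k x => 2 ^+ k * r (phi k) x).
  - by move=> k; exact: intgZ.
  - by move=> k x Dx; rewrite mulr_ge0// ?r0// exprn_ge0.
  - move=> k; rewrite IZ// (le_trans (ler_wpM2l _ (hphi k)))// ?exprn_ge0//.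
    by rewrite mulrA exprVn divff ?expf_neq0// mul1r.
  - exists phi, S; split => //; move: hS; apply: aeon_imp => x Dx h k.
    by rewrite exprVn ler_pdivlMl ?exprn_gt0.
move/cvgrPdist_le: Ir => /(_ (2^-1 ^+ k * 2^-1 ^+ k)).
rewrite mulr_gt0 ?exprn_gt0 ?invr_gt0// => /(_ isT).
by apply: filterS => n; rewrite sub0r normrN; apply: le_trans; exact: ler_norm.
Qed.

Definition L2 (f : T -> R) := measurable_fun D f /\ intg (fun x => f x ^+ 2).

Lemma L2M f g : L2 f -> L2 g -> intg (fun x => f x * g x).
Proof.
move=> [mf f2] [mg g2]; apply: (intg_dom_le mD _ (intgD mD f2 g2)).
  exact: measurable_funM.
move=> x _; rewrite normrM -(real_normK (num_real (f x))).
rewrite -[g x ^+ 2](real_normK (num_real (g x))).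
have := sqr_ge0 (`|f x| - `|g x|); have := normr_ge0 (f x).
by have := normr_ge0 (g x); nra.
Qed.

Lemma L2Z a f : L2 f -> L2 (fun x => a * f x).
Proof.
move=> [mf f2]; split; first exact: measurable_funM.
by under eq_fun do rewrite exprMn; exact: intgZ.
Qed.

Lemma L2D f g : L2 f -> L2 g -> L2 (fun x => f x + g x).
Proof.
move=> hf hg; split; first by apply: measurable_funD; [case: hf|case: hg].
under eq_fun do rewrite sqrrD.
apply: intgD => //; last by case: hg.
apply: intgD => //; first by case: hf.
by under eq_fun do rewrite -mulr_natl; apply: intgZ => //; exact: L2M.
Qed.

Lemma L2N f : L2 f -> L2 (fun x => - f x).
Proof. by move=> /(@L2Z (-1)); under eq_fun do rewrite mulN1r. Qed.

Lemma L2B f g : L2 f -> L2 g -> L2 (fun x => f x - g x).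
Proof. by move=> hf hg; apply: L2D => //; exact: L2N. Qed.

Lemma L2_dom f g : measurable_fun D f -> L2 g ->
  aeon (fun x => `|f x : R| <= `|g x : R|) -> L2 f.
Proof.
move=> mf [mg g2] fg; split => //.
apply: (intg_dom mD _ g2); first exact: measurable_funX.
move: fg; apply: aeon_imp => x _ h.
by rewrite normrX -[leRHS](real_normK (num_real _)) lerXn2r// nnegrE.
Qed.

Lemma I_sqrD f g : L2 f -> L2 g ->
  I (fun x => (f x + g x) ^+ 2) <=
  2 * I (fun x => f x ^+ 2) + 2 * I (fun x => g x ^+ 2).
Proof.
move=> hf hg; have [_ hf2] := hf; have [_ hg2] := hg.
have [_ hfg2] := L2D hf hg.
rewrite -!IZ// -ID//; [|exact: intgZ|exact: intgZ].
apply: I_le => // [|x _]; first by apply: intgD => //; exact: intgZ.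
by have := sqr_ge0 (f x - g x); nra.
Qed.

Lemma cvg_L2_sqr (f : nat -> T -> R) g : (forall k, L2 (f k)) -> L2 g ->
  I (fun x => (f k x - g x) ^+ 2) @[k --> \oo] --> 0 ->
  forall h, L2 h -> I (fun x => f k x * h x) @[k --> \oo] --> I (fun x => g x * h x).
Proof.
move=> Lf Lg c h Lh; apply/cvgrPdist_le => e e0.
pose C := I (fun x => h x ^+ 2) + 1.
have C0 : 0 < C by rewrite ltr_wpDl// Rintegral_ge0// => x _; exact: sqr_ge0.
(* Weight for Young's inequality, used in place of Cauchy-Schwarz; with this choice each of the two
   terms is at most [e/2]. *)
pose s := e / C; have s0 : 0 < s by exact: divr_gt0.
have se : 0 < e * s by exact: mulr_gt0.
move/cvgrPdist_le: c => /(_ _ se); apply: filterS => k; rewrite sub0r normrN => hk.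
have Lfg := L2B (Lf k) Lg.
rewrite -IB//; [|exact: L2M|exact: L2M].
apply: (le_trans (le_normr_Rintegral mD _)).
  by apply: intgB => //; exact: L2M.
apply: (@le_trans _ _ (I (fun x => 2^-1 * s^-1 * (f k x - g x) ^+ 2 + 2^-1 * s * h x ^+ 2))).
  apply: I_le => //.
  - by apply: intg_abs; apply: intgB => //; exact: L2M.
  - by apply: intgD => //; apply: intgZ => //; [case: Lfg|case: Lh].
  move=> x _; rewrite -mulrBl normrM distrC.
  rewrite -(real_normK (num_real (f k x - g x))) -(real_normK (num_real (h x))).
  have := sqr_ge0 (`|f k x - g x| - s * `|h x|); rewrite -(pmulr_rge0 _ (_ : 0 < 2^-1 * s^-1)); last by rewrite mulr_gt0 ?invr_gt0.
  rewrite -subr_ge0 => h1; rewrite -subr_ge0; move: h1; congr (_ <= _); field.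
  by rewrite gt_eqF.
rewrite ID//; [|by apply: intgZ => //; case: Lfg|by apply: intgZ => //; case: Lh].
rewrite !IZ//; [|by case: Lh|by case: Lfg].
have h1 : I (fun x => (f k x - g x) ^+ 2) <= e * s by apply: le_trans hk; exact: ler_norm.
have h2 : I (fun x => h x ^+ 2) <= C by rewrite lerDl.
apply: (@le_trans _ _ (2^-1 * s^-1 * (e * s) + 2^-1 * s * C)).
  by apply: lerD; apply: ler_wpM2l => //; rewrite mulr_ge0 ?invr_ge0// ltW.
by rewrite /s le_eqVlt; apply/orP; left; apply/eqP; field; rewrite !gt_eqF.
Qed.

(** Riesz-Fischer. Squared distances at most [8^-k] leave room for a factor [4^k]: the increments
    are then bounded pointwise by [2^-k] times the square root of an integrable function, and the
    subsequence converges geometrically. *)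
Lemma L2_complete (f : nat -> T -> R) :
  (forall k, measurable_fun setT (f k)) -> (forall k, L2 (f k)) ->
  (forall e, 0 < e -> \forall N \near \oo, forall m n, (N <= m)%N -> (N <= n)%N ->
    I (fun x => (f m x - f n x) ^+ 2) <= e) ->
  exists g, [/\ measurable_fun setT g, L2 g &
    I (fun x => (f k x - g x) ^+ 2) @[k --> \oo] --> 0].
Proof.
move=> mf Lf cf.
have [|phi phim hphi] := @increasing_choice
    (fun k N => forall m n, (N <= m)%N -> (N <= n)%N ->
       I (fun x => (f m x - f n x) ^+ 2) <= (2^-1 ^+ k) ^+ 3).
  by move=> k; apply: cf; rewrite !exprn_gt0 ?invr_gt0.
have [|||S [iS S0 hS]] := @summable_dominated
    (fun k x => (2 ^+ k) ^+ 2 * (f (phi k.+1) x - f (phi k) x) ^+ 2).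
- by move=> k; apply: intgZ => //; case: (L2B (Lf (phi k.+1)) (Lf (phi k))).
- by move=> k x _; rewrite mulr_ge0// sqr_ge0.
- move=> k; rewrite IZ//; last by case: (L2B (Lf (phi k.+1)) (Lf (phi k))).
  rewrite (le_trans (ler_wpM2l _ (hphi k _ _ _ _)))// ?sqr_ge0// ?(ltnW (phim k))//.
  rewrite exprVn le_eqVlt; apply/orP; left; apply/eqP; field.
  by rewrite expf_neq0.
pose r k x := (2 ^+ k) ^+ 2 * (f (phi k.+1) x - f (phi k) x) ^+ 2.
(* Measurable set where the domination holds for every [k]. Multiplying by its indicator makes the
   limit exist at every point, so that [g] is Borel on the whole space. *)
pose A := \bigcap_k (D `&` (fun x => S x - r k x) @^-1` `[0, +oo[%classic).
have mA : measurable A.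
  apply: bigcapT_measurable => k; apply: measurable_funB => //.
    exact: intg_meas iS.
  apply: measurable_funM => //; apply: measurable_funX.
  by apply: measurable_funB; [case: (Lf (phi k.+1))|case: (Lf (phi k))].
have AP x : A x <-> D x /\ forall k, r k x <= S x.
  split=> [Ax|[Dx h] k _].
    split=> [|k]; first by case: (Ax 0%N Logic.I).
    by case: (Ax k Logic.I) => _ /=; rewrite in_itv/= andbT subr_ge0.
  by split => //=; rewrite in_itv/= andbT subr_ge0.
have geom x : A x -> exists2 l, f (phi k) x @[k --> \oo] --> l &
    forall k, `|f (phi k) x - l| <= 2 * Num.sqrt (S x) * 2^-1 ^+ k.
  move=> /AP[Dx h]; apply: geometric_cauchy => k.
  have := h k; rewrite /r -ler_pdivlMl ?exprn_gt0// => /ler_wsqrtr.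
  rewrite sqrtr_sqr => /le_trans; apply.
  rewrite -exprVn sqrtrM ?sqr_ge0// sqrtr_sqr ger0_norm ?invr_ge0 ?exprn_ge0//.
  by rewrite mulrC exprVn.
pose g x := limn (fun k => \1_A x * f (phi k) x).
have gc x : \1_A x * f (phi k) x @[k --> \oo] --> g x.
  rewrite /g indicE; have [xA|xA] := boolP (x \in A); last first.
    rewrite /= [X in X @ _](_ : _ = cst 0); first by rewrite lim_cst//; exact: cvg_cst.
    by apply/funext => k; rewrite mul0r.
  have -> : (fun k => true%:R * f (phi k) x) = (fun k => f (phi k) x).
    by apply/funext => k; rewrite mul1r.
  by move/set_mem: xA => /geom[l cl _]; apply/cvg_ex; exists l.
have mg : measurable_fun setT g.
  apply: (@measurable_fun_cvg _ _ _ _ (fun k x => \1_A x * f (phi k) x)) => [k|x _].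
    by apply: measurable_funM => //; exact: measurable_indic.
  exact: gc.
have bnd : aeon (fun x => forall k, (f (phi k) x - g x) ^+ 2 <= 4 * S x * (2^-1 ^+ k) ^+ 2).
  move: hS; apply: aeon_imp => x Dx h.
  have Ax : A x by apply/AP; split.
  have [l cl hl] := geom x Ax.
  have gl : g x = l.
    rewrite /g; apply/cvg_lim => //.
    rewrite [X in X @ _](_ : _ = (fun k => f (phi k) x))//.
    by apply/funext => k; rewrite indicE mem_set// mul1r.
  move=> k; rewrite gl; have := hl k.
  rewrite -(ler_pXn2r (_ : 0 < 2)%N) ?nnegrE// ?mulr_ge0 ?sqrtr_ge0 ?exprn_ge0 ?invr_ge0//.
  rewrite real_normK ?num_real// => /le_trans; apply.
  rewrite !exprMn sqr_sqrtr ?S0//.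
  by rewrite le_eqVlt; apply/orP; left; apply/eqP; ring.
have mgD : measurable_fun D g by exact: measurable_funTS.
have Lg : L2 g.
  split => //.
  apply: (@intg_dom _ _ _ _ _ mD _ (fun x => 2 * (8 * S x) + 2 * f (phi 0%N) x ^+ 2)).
  - exact: measurable_funX.
  - apply: intgD => //; apply: intgZ => //; first exact: intgZ.
    by case: (Lf (phi 0%N)).
  move: bnd; apply: aeon_imp => x Dx /(_ 0%N); rewrite expr0 expr1n mulr1.
  move=> h; rewrite ger0_norm ?sqr_ge0//.
  have := sqr_ge0 (2 * f (phi 0%N) x - g x); have := S0 _ Dx; move: h; nra.
have sub : I (fun x => (f (phi k) x - g x) ^+ 2) @[k --> \oo] --> 0.
  have : 4 * I S * (2^-1 ^+ k) ^+ 2 @[k --> \oo] --> 4 * I S * 0 ^+ 2.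
    apply: cvgMr; apply: cvgM; apply: cvg_expr; rewrite ger0_norm; lra.
  rewrite expr0n mulr0; apply: squeeze_cvgr; last exact: cvg_cst.
  apply: nearW => k; rewrite Rintegral_ge0//=; last by move=> x _; exact: sqr_ge0.
  have [_ i2] := L2B (Lf (phi k)) Lg.
  apply: (@le_trans _ _ (I (fun x => (4 * (2^-1 ^+ k) ^+ 2) * S x))).
    apply: I_le_ae => //; first exact: intgZ.
    move: bnd; apply: aeon_imp => x Dx /(_ k) /le_trans; apply.
    by rewrite le_eqVlt; apply/orP; left; apply/eqP; ring.
  by rewrite IZ// le_eqVlt; apply/orP; left; apply/eqP; ring.
exists g; split => //; apply/cvgrPdist_le => e e0.
have e4 : 0 < e / 4 by exact: divr_gt0.
have [N _ hN] := cf _ e4.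
move/cvgrPdist_le: sub => /(_ _ e4) [K _ hK].
exists N => // n /= Nn; rewrite sub0r normrN ger0_norm; last first.
  by apply: Rintegral_ge0 => x _; exact: sqr_ge0.
pose k := maxn N K.
have Nk : (N <= phi k)%N by exact: leq_trans (leq_maxl _ _) (increasing_ge phim k).
have := I_sqrD (L2B (Lf n) (Lf (phi k))) (L2B (Lf (phi k)) Lg).
have -> : (fun x => (f n x - f (phi k) x + (f (phi k) x - g x)) ^+ 2) = (fun x => (f n x - g x) ^+ 2).
  by apply/funext => x; congr (_ ^+ 2); ring.
move/le_trans; apply.
have h1 := hN N (leqnn N) n (phi k) Nn Nk.
have := hK k (leq_maxr _ _); rewrite /= sub0r normrN => /(le_trans (ler_norm _)).
by move: h1; lra.
Qed.

End L2.

(** * Polynomial approximation *)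

Section bernstein.
Context (R : realType).

(** Bernstein polynomial of the values [g 0], ..., [g n], the expectation of [g] under a binomial
    law, in the form of de Casteljau's recursion. Monotonicity and moments then follow by induction,
    without binomial coefficients. *)
Fixpoint bern (n : nat) (g : nat -> R) : {poly R} :=
  if n is n'.+1 then
    'X * bern n' (fun k => g k.+1) + (1 - 'X) * bern n' g
  else (g 0%N)%:P.

Lemma bernS n g (x : R) : (bern n.+1 g).[x] =
  x * (bern n (fun k => g k.+1)).[x] + (1 - x) * (bern n g).[x].
Proof. by rewrite /= !hornerE. Qed.

Lemma bern_lin n a (f g : nat -> R) (x : R) :
  (bern n (fun k => a * f k + g k)).[x] = a * (bern n f).[x] + (bern n g).[x].
Proof.
elim: n f g => [|n IH] f g; first by rewrite /= !hornerC.
by rewrite !bernS !IH; ring.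
Qed.

Lemma bern_ext n (f g : nat -> R) : f =1 g -> bern n f = bern n g.
Proof. by move=> /funext ->. Qed.

Lemma bern_le n (f g : nat -> R) (x : R) : 0 <= x <= 1 ->
  (forall k, (k <= n)%N -> f k <= g k) -> (bern n f).[x] <= (bern n g).[x].
Proof.
move=> /andP[x0 x1]; elim: n f g => [|n IH] f g fg.
  by rewrite /= !hornerC; exact: fg.
rewrite !bernS lerD// ler_wpM2l ?subr_ge0//; apply: IH => k kn; apply: fg => //.
exact: leqW.
Qed.

Lemma bern_cst n c (x : R) : (bern n (fun=> c)).[x] = c.
Proof. by elim: n => [|n IH]; rewrite ?bernS ?IH /= ?hornerC//; ring. Qed.

(** Variance plus squared bias of the binomial law. The centre [c] is left free because the first
    branch of the recursion replaces it by [c - 1]. *)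
Lemma bern_sqr n (c x : R) : (bern n (fun k => (k%:R - c) ^+ 2)).[x] =
  n%:R * x * (1 - x) + (n%:R * x - c) ^+ 2.
Proof.
elim: n c => [|n IH] c; first by rewrite /= hornerC; ring.
rewrite bernS (bern_ext n (g := fun k => (k%:R - (c - 1)) ^+ 2)); last first.
  by move=> k; rewrite -natr1; congr (_ ^+ 2); ring.
by rewrite !IH -natr1; ring.
Qed.

(** A quadratic modulus is chosen because Bernstein polynomials have an explicit second moment.
    Close points are handled by uniform continuity on the compact interval; at distance at least [D]
    the oscillation is absorbed by [K D^2]. *)
Lemma continuous_modulus (h : R -> R) (a b e : R) : continuous h -> 0 < e ->
  exists2 K : R, 0 <= K & forall s t, a <= s <= b -> a <= t <= b ->
    `|h s - h t| <= e + K * (s - t) ^+ 2.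
Proof.
move=> ch e0.
have cI : compact `[a, b]%classic by exact: segment_compact.
have [B [_ hB]] : bounded_set (h @` `[a, b]%classic).
  by apply: compact_bounded; apply: continuous_compact => //; exact: continuous_subspaceT.
have Bs s : a <= s <= b -> `|h s| <= B + 1.
  by move=> sab; apply: hB; [rewrite ltrDl|exists s].
have [/= d d0 hd] : \forall d \near 0^'+, forall x, `[a, b]%classic x ->
    forall t, `|x - t| < d -> `|h x - h t| <= e.
  apply: ((compact_near_coveringP _).1 cI) => x _.
  have e2 : 0 < e / 2 by rewrite divr_gt0.
  have /cvgrPdist_lt/(_ _ e2) /nbhs_ballP[r /= r0 hr] := ch x.
  near=> y d => t ytd.
  have yr : `|x - y| < r / 2.
    by near: y; apply/nbhs_ballP; exists (r / 2) => //=; rewrite divr_gt0.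
  have dr : d < r / 2 by near: d; apply: nbhs_right_lt; rewrite divr_gt0.
  have h1 : `|h x - h y| < e / 2.
    by apply: hr; rewrite /ball/= (lt_trans yr)// ltr_pdivrMr// ltr_pMr// ltr1n.
  have h2 : `|h x - h t| < e / 2.
    apply: hr; rewrite /ball/= -(subrKA y) (le_lt_trans (ler_normD _ _))//.
    by rewrite [ltRHS]splitr ltrD// (lt_trans ytd).
  rewrite -(subrKA (h x)) (le_trans (ler_normD _ _))// distrC.
  by rewrite [leRHS]splitr lerD// ltW.
pose D := d / 2; have D0 : 0 < D by rewrite divr_gt0.
have {}hd s t : a <= s <= b -> `|s - t| < D -> `|h s - h t| <= e.
  move=> sab st; apply: (hd D) => //=.
  by rewrite sub0r normrN gtr0_norm// /D ltr_pdivrMr//; lra.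
exists (2 * `|B + 1| / D ^+ 2); first by rewrite divr_ge0 ?sqr_ge0 ?mulr_ge0.
move=> s t sab tab; have [st|st] := ltP `|s - t| D.
  rewrite (le_trans (hd _ _ sab st))// lerDl mulr_ge0 ?sqr_ge0//.
  by rewrite divr_ge0 ?sqr_ge0 ?mulr_ge0.
rewrite (le_trans (ler_normB _ _))//.
apply: (@le_trans _ _ (2 * `|B + 1|)).
  have := Bs _ sab; have := Bs _ tab; have := ler_norm (B + 1); lra.
rewrite -[leLHS]add0r lerD ?(ltW e0)// mulrAC -mulrA ler_peMr ?mulr_ge0//.
rewrite ler_pdivlMr ?exprn_gt0// mul1r -[leRHS]real_normK ?num_real//.
by rewrite lerXn2r// nnegrE ltW.
Unshelve. all: by end_near.
Qed.

Lemma weierstrass01 (h : R -> R) (e : R) : continuous h -> 0 < e ->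
  exists P : {poly R}, forall x : R, 0 <= x <= 1 -> `|P.[x] - h x| <= e.
Proof.
move=> ch e0; have e2 : 0 < e / 2 by rewrite divr_gt0.
have [K K0 hK] := continuous_modulus 0 1 ch e2.
(* The binomial variance [n x (1 - x)] divided by [n^2] is at most [1/n], so the quadratic part of
   the modulus costs at most [K/n <= e/2]. *)
pose n := (Num.truncn (K / (e / 2))).+1.
have n0 : 0 < n%:R :> R by rewrite ltr0n.
have Kn : K / n%:R <= e / 2.
  rewrite ler_pdivrMr// -ler_pdivrMl// mulrC.
  exact: ltW (truncnS_gt _).
clearbody n; exists (bern n (fun k => h (k%:R / n%:R))) => x x01.
have kb k : (k <= n)%N -> 0 <= (k%:R / n%:R : R) <= 1.
  by move=> kn; rewrite divr_ge0//= ler_pdivrMr// mul1r ler_nat.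
have bnd : (bern n (fun k => K / n%:R ^+ 2 * (k%:R - n%:R * x) ^+ 2 + e / 2)).[x] <= e.
  rewrite bern_lin bern_sqr bern_cst subrr expr0n addr0.
  apply: (@le_trans _ _ (K / n%:R + e / 2)); last lra.
  rewrite lerD2r (_ : _ * _ = K / n%:R * (x * (1 - x))); last by field; rewrite gt_eqF.
  rewrite ler_piMr//; first by rewrite divr_ge0// ltW.
  by move: x01 => /andP[x0 x1]; nra.
have hx (k : nat) : (k <= n)%N -> `|h (k%:R / n%:R) - h x| <= K / n%:R ^+ 2 * (k%:R - n%:R * x) ^+ 2 + e / 2.
  move=> kn; rewrite (le_trans (hK _ _ (kb _ kn) x01))// addrC lerD2r.
  by rewrite le_eqVlt; apply/orP; left; apply/eqP; field; rewrite gt_eqF.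
have E : (bern n (fun k => h (k%:R / n%:R))).[x] - h x = (bern n (fun k => 1 * h (k%:R / n%:R) + - h x)).[x].
  by rewrite bern_lin mul1r bern_cst.
rewrite E ler_norml; apply/andP; split; last first.
  apply: le_trans bnd; apply: bern_le => // k kn; rewrite mul1r.
  exact: le_trans (ler_norm _) (hx k kn).
rewrite lerNl; apply: le_trans bnd.
rewrite -[leLHS]addr0 -(bern_cst n 0 x) -mulN1r -bern_lin.
apply: bern_le => // k kn; rewrite mul1r addr0 mulN1r.
by apply: le_trans (hx k kn); rewrite -normrN ler_norm.
Qed.

Lemma weierstrass (h : R -> R) (M e : R) : continuous h -> 0 < e -> 0 < M ->
  exists P : {poly R}, forall x : R, `|x| <= M -> `|P.[x] - h x| <= e.
Proof.
move=> ch e0 M0.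
have [|P hP] := @weierstrass01 (fun x => h (M * (2 * x - 1))) e _ e0.
  move=> x; apply: (@continuous_comp _ _ _ (fun x : R => M * (2 * x - 1)) h); last exact: ch.
  apply: cvgM; first exact: cvg_cst.
  apply: cvgB; last exact: cvg_cst.
  by apply: cvgM; [exact: cvg_cst|exact: cvg_id].
exists (P \Po ((2 * M)^-1 *: ('X + M%:P))) => x; rewrite ler_norml => /andP[x1 x2].
rewrite horner_comp !hornerE.
have := hP ((2 * M)^-1 * (x + M)).
rewrite (_ : M * _ = x); last by field; rewrite gt_eqF.
apply; apply/andP; split; first by rewrite mulr_ge0 ?invr_ge0; lra.
by rewrite ler_pdivrMl; lra.
Qed.

Lemma poly_primitive (P : {poly R}) : exists2 Q : {poly R},
  Q^`() = P & Q.[0] = 0.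
Proof.
exists (\poly_(i < (size P).+1) (if i is j.+1 then P`_j / j.+1%:R else 0)).
  apply/polyP => i; rewrite coef_deriv coef_poly ltnS.
  case: ltnP => [_|iP]; last by rewrite mul0rn nth_default.
  by rewrite -[_ *+ i.+1]mulr_natr divfK// pnatr_eq0.
by rewrite horner_coef0 coef_poly.
Qed.

End bernstein.

(** * Calculus on row vectors and the Sobolev inequality *)

Lemma intg_indic d (T : measurableType d) (R : realType)
  (mu : {measure set T -> \bar R}) (D A : set T) : measurable D -> measurable A ->
  (mu (A `&` D) < +oo)%E -> intg mu D (\1_A).
Proof.
move=> mD mA muA; apply/integrableP; split.
  by apply/measurable_EFinP; exact: measurable_indic.
rewrite (_ : (\int[mu]_(x in D) _)%E = mu (A `&` D))//.
rewrite -integral_indic//; apply: eq_integral => x _ /=.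
by rewrite ger0_norm// indicE ler0n.
Qed.

Section rV_measurability.
Context (R : realType).

(** The sigma-algebra is generated by the coordinates, so [U] is written as the union of the boxes
    with rational endpoints that it contains; there are countably many. *)
Lemma open_measurable_rV n (U : set 'rV[R]_n) : open U -> measurable U.
Proof.
move=> oU.
pose box (q : {ffun 'I_n -> rat * rat}) : set 'rV[R]_n :=
  [set x | forall i, [set y : R | ratr (q i).1 < y < ratr (q i).2] (x 0 i)].
have mbox q : measurable (box q).
  apply: (@measurable_box R n (fun i => [set y : R | ratr (q i).1 < y < ratr (q i).2])) => i.
  rewrite [X in measurable X](_ : _ = `]ratr (q i).1, ratr (q i).2[%classic).
    exact: measurable_itv.
  by apply/seteqP; split => y /=; rewrite in_itv/=.
pose J := {q : {ffun 'I_n -> rat * rat} | `[<box q `<=` U>]}.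
suff -> : U = \bigcup_(q : J) box (val q).
  apply: countable_bigcupT_measurable => [|q]; last exact: mbox.
  exact: countableP.
apply/seteqP; split=> x; last by move=> [[q /= /asboolP qU] _ /=]; exact: qU.
move=> Ux; have /nbhs_ballP[e /= e0 eU] := open_nbhs_nbhs (conj oU Ux).
have e0' : 0 < e by [].
have h (i : 'I_n) : exists q : rat * rat,
    [/\ x 0 i - e < ratr q.1 :> R, ratr q.1 < x 0 i, x 0 i < ratr q.2 &
        ratr q.2 < x 0 i + e].
  have [|q1] := @rat_in_itvoo R (x 0 i - e) (x 0 i); first by rewrite gtrBl.
  rewrite in_itv/= => /andP[? ?].
  have [|q2] := @rat_in_itvoo R (x 0 i) (x 0 i + e); first by rewrite ltrDl.
  by rewrite in_itv/= => /andP[? ?]; exists (q1, q2).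
pose q := [ffun i => projT1 (cid (h i))].
have qU : `[<box q `<=` U>].
  apply/asboolP => y yq; apply: eU; split => // i j.
  rewrite ord1 /ball/=; move: (yq j); rewrite /= /q ffunE; case: cid => r /= [h1 h2 h3 h4].
  by move=> /andP[h5 h6]; rewrite ltr_norml; apply/andP; split; lra.
exists (exist _ q qU) => //= i.
by rewrite /q ffunE; case: cid => r /= [h1 h2 h3 h4]; apply/andP.
Qed.

Lemma continuous_measurable_rV n (f : 'rV[R]_n -> R) :
  continuous f -> measurable_fun setT f.
Proof.
move=> /continuousP cf; apply: (measurability _ (RGenOpens.measurableE R)) => //.
by move=> _ [_ [a [b ->] <-]]; apply: measurableI => //;
  apply: open_measurable_rV; apply: cf; exact: interval_open.
Qed.

End rV_measurability.

(** * Slicing along coordinates; bounded functions with bounded support *)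

Section slices.
Context (R : realType).
Local Notation mu n := (lebesgue_rV R n).
Local Notation la := (@lebesgue_measure R).

Definition setc n (i : 'I_n) (t : R) (x : 'rV[R]_n) : 'rV[R]_n :=
  \row_j if j == i then t else x 0 j.

Lemma setc_cons0 n t (s : R) (y : 'rV[R]_n) :
  setc ord0 t (cons_rV (s, y)) = cons_rV (t, y).
Proof.
apply/rowP => j; rewrite mxE; case: (unliftP ord0 j) => [k ->|->].
  by rewrite eq_sym (negbTE (neq_lift _ _)) !cons_rVS.
by rewrite eqxx cons_rV0.
Qed.

Lemma setc_consS n (i : 'I_n) t (s : R) (y : 'rV[R]_n) :
  setc (lift ord0 i) t (cons_rV (s, y)) = cons_rV (s, setc i t y).
Proof.
apply/rowP => j; rewrite mxE; case: (unliftP ord0 j) => [k ->|->].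
  by rewrite (inj_eq lift_inj) !cons_rVS mxE.
by rewrite (negbTE (neq_lift _ _)) !cons_rV0.
Qed.

Lemma measurable_setc n (i : 'I_n) :
  measurable_fun setT (fun p : R * 'rV[R]_n => setc i p.1 p.2).
Proof.
apply: measurable_fun_rV => j; rewrite /setc.
under eq_fun do rewrite mxE.
case: (eqVneq j i) => _; first exact: measurable_fst.
exact: (measurableT_comp (@measurable_coord R n j) measurable_snd).
Qed.

Lemma integral_consE n (f : 'rV[R]_n.+1 -> \bar R) : measurable_fun setT f ->
  (forall x, 0 <= f x)%E ->
  (\int[mu n.+1]_x f x = \int[la]_t \int[mu n]_y f (cons_rV (t, y)))%E.
Proof.
move=> mf f0; rewrite [LHS](_ : _ = \int[la \x mu n]_p (f \o @cons_rV R n) p)%E.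
  rewrite fubini_tonelli1//; last by move=> x; exact: f0.
  by apply: measurableT_comp => //; exact: measurable_cons_rV.
have := @ge0_integral_pushforward _ _ (measurableTypeR R * 'rV[R]_n)%type _ R _
  (@measurable_cons_rV R n) (product_measure1 la (mu n)) setT f measurableT mf
  (fun x _ => f0 x).
by rewrite preimage_setT.
Qed.

Lemma integral_consE2 n (f : 'rV[R]_n.+1 -> \bar R) : measurable_fun setT f ->
  (forall x, 0 <= f x)%E ->
  (\int[mu n.+1]_x f x = \int[mu n]_y \int[la]_t f (cons_rV (t, y)))%E.
Proof.
move=> mf f0; rewrite integral_consE//.
apply: (@fubini_tonelli _ _ _ _ _ la (mu n) (f \o @cons_rV R n)) => [|x]; last exact: f0.
by apply: measurableT_comp => //; exact: measurable_cons_rV.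
Qed.

Lemma measurable_cons1 n t : measurable_fun setT (fun y : 'rV[R]_n => cons_rV (t, y)).
Proof.
apply: (measurableT_comp (@measurable_cons_rV R n)).
exact: pair1_measurable.
Qed.

(** One constant bounds both the values and the support, in the sup norm. The class is stable under
    slicing and under products with bounded functions, so all integrals in the induction on the
    dimension are finite. *)
Definition bsupp n (M : R) (f : 'rV[R]_n -> R) :=
  [/\ measurable_fun setT f, (forall x, `|f x| <= M) &
   forall (x : 'rV[R]_n) i, M < `|x 0 i| -> f x = 0].

Lemma bsupp_integrable n M (f : 'rV[R]_n -> R) : bsupp M f ->
  (mu n).-integrable setT (EFin \o f).
Proof.
move=> [mf fM f0].
pose A := [set x : 'rV[R]_n | forall i, `[-M, M]%classic (x 0 i)].
have mA : measurable A by apply: (@measurable_box R n (fun=> `[-M, M]%classic)) => i; exact: measurable_itv.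
have M0 : 0 <= M by apply: le_trans (fM 0).
have muA : ((mu n) A < +oo)%E.
  rewrite /A (@lebesgue_rV_box R n (fun=> `[-M, M]%classic)); last by move=> i; exact: measurable_itv.
  under eq_bigr do rewrite lebesgue_measure_itv /=.
  rewrite (_ : \prod_(i < n) _ = ((2 * M) ^+ n)%:E)%E ?ltry//.
  rewrite big_const_ord; elim: n {f mf fM f0 A mA} => [|n IH] /=; first by rewrite expr0.
  rewrite IH; case: ifPn; rewrite lte_fin => h.
    by rewrite -EFinB -EFinM exprS; congr EFin; ring.
  by rewrite mul0e (_ : M = 0) ?mulr0 ?expr0n//; lra.
have : (mu n).-integrable setT (fun x => (M * \1_A x)%:E).
  apply: (@eq_integrable _ _ _ _ setT measurableT (fun x => M%:E * (\1_A x)%:E)%E) => //.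
  by apply: integrableZl => //; apply: intg_indic; rewrite // setIT.
apply: le_integrable => //; first exact/measurable_EFinP.
move=> x _ /=; rewrite lee_fin indicE.
have [xA|xA] := boolP (x \in A).
  by rewrite mulr1 (le_trans (fM x))// ler_norm.
rewrite mulr0 normr0 normr_le0; apply/eqP.
have [i hi] : exists i, M < `|x 0 i|.
  apply/not_existsP => h; move/negP: xA; apply; apply/mem_set => i /=.
  by rewrite in_itv/= -ler_norml leNgt; apply/negP; exact: h.
exact: f0 hi.
Qed.

Lemma bsupp_cons1 n M (f : 'rV[R]_n.+1 -> R) t : bsupp M f ->
  bsupp M (fun y => f (cons_rV (t, y))).
Proof.
move=> [mf fM f0]; split => [|y|y i yi].
- by apply: measurableT_comp => //; exact: measurable_cons1.
- exact: fM.
- by apply: (f0 _ (lift ord0 i)); rewrite cons_rVS.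
Qed.

Lemma bsupp_cons_gt n M (f : 'rV[R]_n.+1 -> R) t y : bsupp M f -> M < `|t| ->
  f (cons_rV (t, y)) = 0.
Proof. by move=> [_ _ f0] Mt; apply: (f0 _ ord0); rewrite cons_rV0. Qed.

Lemma bsupp_line n M (f : 'rV[R]_n -> R) i (x : 'rV[R]_n) : bsupp M f ->
  la.-integrable setT (fun t => (f (setc i t x))%:E).
Proof.
move=> [mf fM f0]; have M0 : 0 <= M by apply: le_trans (fM 0).
have ms : measurable_fun setT (fun t => setc i t x).
  exact: (measurableT_comp (@measurable_setc n i) (pair2_measurable x)).
apply: (@intg_dom_le _ _ _ la setT measurableT _ (fun t => M * \1_(`[-M, M]%classic) t)).
- exact: measurableT_comp.
- apply: intgZ => //; apply: intg_indic => //; rewrite setIT.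
  have := @lebesgue_measure_itv R `[-M, M]; rewrite /= => ->.
  by case: ifP => _; rewrite ?ltry// -EFinB ltry.
move=> t _; rewrite indicE.
have [tA|tA] := boolP (t \in _); first by rewrite mulr1 (le_trans (fM _)).
rewrite mulr0 normr_le0; apply/eqP; apply: (f0 _ i); rewrite mxE eqxx.
rewrite ltNge; apply: contra tA => h; apply/mem_set => /=.
by rewrite in_itv/= -ler_norml.
Qed.

End slices.

(** * The Gagliardo-Nirenberg inequality by induction on the dimension *)

Section gagliardo.
Context (R : realType).
Local Notation mu n := (lebesgue_rV R n).
Local Notation la := (@lebesgue_measure R).

Definition bs n (f : 'rV[R]_n -> R) := exists M, bsupp M f.

Lemma bsupp_le n M M' (f : 'rV[R]_n -> R) : M <= M' -> bsupp M f -> bsupp M' f.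
Proof.
move=> MM' [mf fM f0]; split => // [x|x i h]; first exact: le_trans MM'.
by apply: (f0 _ i); exact: le_lt_trans h.
Qed.

Lemma bs_meas n (f : 'rV[R]_n -> R) : bs f -> measurable_fun setT f.
Proof. by case=> M []. Qed.

Lemma bs_intg n (f : 'rV[R]_n -> R) : bs f -> intg (mu n) setT f.
Proof. by case=> M; exact: bsupp_integrable. Qed.

Lemma bs_dom n (f g : 'rV[R]_n -> R) K : bs f -> measurable_fun setT g ->
  (forall x, `|g x| <= K) -> (forall x, f x = 0 -> g x = 0) -> bs g.
Proof.
move=> [M [mf fM f0]] mg gK fg; exists (Num.max M K); split => // [x|x i].
  by rewrite le_max gK orbT.
by rewrite gt_max => /andP[h _]; apply: fg; exact: f0 h.
Qed.

Lemma bsM n (f g : 'rV[R]_n -> R) K : bs f -> measurable_fun setT g ->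
  (forall x, `|g x| <= K) -> bs (fun x => f x * g x).
Proof.
move=> bf mg gK; have [M [mf fM f0]] := bf.
apply: (bs_dom (K := M * K) bf) => [|x|x ->]; last by rewrite mul0r.
  exact: measurable_funM.
by rewrite normrM ler_pM.
Qed.

Lemma bs_bounded n (f : 'rV[R]_n -> R) : bs f -> exists K, forall x, `|f x| <= K.
Proof. by case=> M [_ fM _]; exists M. Qed.

Lemma bsZ n a (f : 'rV[R]_n -> R) : bs f -> bs (fun x => a * f x).
Proof.
move=> bf; under eq_fun do rewrite mulrC.
by apply: (bsM (K := `|a|) bf).
Qed.

Lemma bs_pow n a (f : 'rV[R]_n -> R) : 0 < a -> bs f -> bs (fun x => f x `^ a).
Proof.
move=> a0 bf; have [M [mf fM f0]] := bf.
(* The [1] covers negative values of [f]: there [ln] is 0 by convention, so the power equals 1. *)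
apply: (bs_dom (K := Num.max 1 (`|M| `^ a)) bf) => [|x|x ->].
- exact: (measurableT_comp (measurable_powR a) mf).
- rewrite ger0_norm ?powR_ge0//.
  have [fx0|fx0] := leP 0 (f x).
    rewrite le_max; apply/orP; right; apply: ge0_ler_powR; rewrite ?nnegrE ?(ltW a0)//.
    by rewrite (le_trans (ler_norm _))// (le_trans (fM x))// ler_norm.
  rewrite (_ : f x `^ a = 1) ?le_max ?lexx//.
  by rewrite /powR lt_eqF// ln0 ?ltW// mulr0 expR0.
- by rewrite powR0// gt_eqF.
Qed.

Lemma bs_cons1 n (f : 'rV[R]_n.+1 -> R) t : bs f -> bs (fun y => f (cons_rV (t, y))).
Proof. by case=> M /(bsupp_cons1 t) h; exists M. Qed.

Lemma Rint_cons n (f : 'rV[R]_n.+1 -> R) : bs f -> (forall x, 0 <= f x) ->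
  [/\ intg la setT (fun t => \int[mu n]_y f (cons_rV (t, y))) &
  \int[mu n.+1]_x f x = \int[la]_t \int[mu n]_y f (cons_rV (t, y))].
Proof.
move=> bf f0.
have mfE : measurable_fun setT (EFin \o f) by apply/measurable_EFinP; exact: bs_meas.
have E : (\int[mu n.+1]_x (f x)%:E =
    \int[la]_t (\int[mu n]_y f (cons_rV (t, y)))%:E)%E.
  rewrite (integral_consE mfE)//=.
  apply: eq_integral => t _; rewrite -EFin_I//.
  by apply: bs_intg; exact: bs_cons1.
split; last by congr fine.
apply/integrableP; split.
  have := @measurable_fun_fubini_tonelli_F _ _ _ _ R (mu n)
    (fun p : measurableTypeR R * 'rV[R]_n => (f (cons_rV p))%:E) _ _.
  move=> H; have {}H := H (measurableT_comp mfE (@measurable_cons_rV R n)) (fun p => _).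
  rewrite [X in measurable_fun _ X](_ : _ =
      fubini_F (mu n) (fun p : measurableTypeR R * 'rV[R]_n => (f (cons_rV p))%:E)); last first.
    apply/funext => t; rewrite /fubini_F /=  EFin_I//.
    by apply: bs_intg; exact: bs_cons1.
  by apply: H => p; rewrite lee_fin.
rewrite (_ : (\int[la]_x _)%E = \int[mu n.+1]_x (f x)%:E)%E; last first.
  rewrite E; apply: eq_integral => t _ /=; rewrite ger0_norm//.
  by apply: Rintegral_ge0 => y _.
by rewrite -EFin_I ?ltry//; exact: bs_intg.
Qed.

Lemma bs_int1 n (f : 'rV[R]_n.+1 -> R) : bs f -> (forall x, 0 <= f x) ->
  bs (fun y => \int[la]_t f (cons_rV (t, y))).
Proof.
move=> [M bf] f0; have [mf fM fs] := bf.
have M0 : 0 <= M by apply: le_trans (f0 0) (le_trans (ler_norm _) (fM 0)).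
have mfE : measurable_fun setT (EFin \o f) by exact/measurable_EFinP.
have il y : intg la setT (fun t => f (cons_rV (t, y))).
  have := bsupp_line ord0 (cons_rV (0, y)) bf.
  by rewrite /intg; under eq_fun do rewrite setc_cons0.
exists (Num.max M (M * (2 * M))); split => [|y|y i].
- have := @measurable_fun_fubini_tonelli_G _ _ _ _ R la
    (fun p : measurableTypeR R * 'rV[R]_n => (f (cons_rV p))%:E)
    (measurableT_comp mfE (@measurable_cons_rV R n)) (fun p => f0 _).
  rewrite [fubini_G _ _](_ : _ = EFin \o (fun y => \int[la]_t f (cons_rV (t, y)))).
    by move/measurable_EFinP.
  by apply/funext => y; rewrite /fubini_G /= EFin_I.
- rewrite ger0_norm; last by apply: Rintegral_ge0 => t _.
  rewrite le_max; apply/orP; right.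
  have ii : intg la setT (\1_(`[-M, M]%classic) : R -> R).
    apply: intg_indic => //; rewrite setIT.
    have := @lebesgue_measure_itv R `[-M, M]; rewrite /= => ->.
    by case: ifP => _; rewrite ?ltry// -EFinB ltry.
  apply: (@le_trans _ _ (\int[la]_t (M * \1_(`[-M, M]%classic) t))).
    apply: I_le => //; first exact: intgZ.
    move=> t _; rewrite indicE; have [tA|tA] := boolP (t \in _).
      by rewrite mulr1 (le_trans (ler_norm _)).
    rewrite mulr0 (fs _ ord0)// cons_rV0 ltNge.
    apply: contra tA => h; apply/mem_set => /=.
    by rewrite in_itv/= -ler_norml.
  rewrite IZ// ler_wpM2l// /Rintegral integral_indic// setIT.
  have := @lebesgue_measure_itv R `[-M, M]; rewrite /= => ->.
  by case: ifP => _ /=; [lra|rewrite mulr_ge0].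
- rewrite gt_max => /andP[h _].
  rewrite (_ : (fun t => _) = cst 0) ?Rintegral_cst ?mul0r//.
  by apply/funext => t; apply: (fs _ (lift ord0 i)); rewrite cons_rVS.
Qed.

Lemma Rint_cons2 n (f : 'rV[R]_n.+1 -> R) : bs f -> (forall x, 0 <= f x) ->
  \int[mu n.+1]_x f x = \int[mu n]_y \int[la]_t f (cons_rV (t, y)).
Proof.
move=> bf f0; have [M bf'] := bf.
have mfE : measurable_fun setT (EFin \o f) by apply/measurable_EFinP; exact: bs_meas.
congr fine; rewrite (integral_consE2 mfE)//.
apply: eq_integral => y _ /=; rewrite -EFin_I//.
have := bsupp_line ord0 (cons_rV (0, y)) bf'.
by rewrite /intg; under eq_fun do rewrite setc_cons0.
Qed.

(** Abstracts the fundamental theorem of calculus: for [u] of compact support, [h i] may be the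
    absolute value of the partial derivative in direction [i]. Only this consequence of
    differentiability enters the induction. *)
Definition slice_bound n (u : 'rV[R]_n -> R) (h : 'I_n -> 'rV[R]_n -> R) :=
  forall x i, u x <= \int[la]_t h i (setc i t x).

(** Normalised dual form of the embedding of [W^{1,1}] into [L^{n/(n-1)}]: [F^{1/n}] runs through
    nonnegative elements of the unit ball of [L^n]. This form also covers [n = 1], and it is the one
    that slicing consumes. *)
Definition gagliardo_bound n (C : R) := forall u h F,
  @bs n u -> (forall i, bs (h i)) -> @bs n F ->
  (forall x, 0 <= u x) -> (forall i x, 0 <= h i x) -> (forall x, 0 <= F x) ->
  slice_bound u h -> (forall i, \int[mu n]_x h i x <= 1) ->
  \int[mu n]_x F x <= 1 ->
  \int[mu n]_x (u x * F x `^ n%:R^-1) <= C.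

Lemma gagliardo1 : gagliardo_bound 1 1.
Proof.
move=> u h F bu bh bF u0 h0 F0 uh Ih IF.
have u1 x : u x <= 1.
  apply: le_trans (uh x ord0) _; have [_ E] := Rint_cons (bh ord0) (h0 ord0).
  apply: le_trans (Ih ord0); rewrite E le_eqVlt; apply/orP; left; apply/eqP.
  congr fine; apply: eq_integral => t _; congr EFin.
  (* The measure in dimension 0 is a Dirac mass, so the inner integral is an evaluation. *)
  rewrite /Rintegral /= integral_dirac//=; last first.
    apply/measurable_EFinP; apply: bs_meas; exact: bs_cons1.
  rewrite indicE in_setT mul1r; congr (h _ _); apply/rowP => j.
  by rewrite !mxE ord1 eqxx unlift_none.
apply: le_trans IF; apply: I_le => //; [|exact: bs_intg|].
  have bF1 : bs (fun x => F x `^ 1%:R^-1) by apply: bs_pow; rewrite ?invr_gt0.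
  have [K hK] := bs_bounded bF1.
  by apply: bs_intg; apply: (bsM bu _ hK); exact: bs_meas.
by move=> x _; rewrite invr1 powRr1// ler_piMl.
Qed.

(** On each slice with first coordinate [t], [u] is at most [f0], the integral of [h ord0] along the
    first axis, and [f0] has integral at most 1. So [u^a] may be replaced by [f0^a], and the bound
    in one dimension less applies on the slice after division by [K t], which dominates the slice
    integrals of the other [h j]. Integrating [C K t] in [t] gives the result. *)
Lemma gagliardo_pow n C : gagliardo_bound n.+1 C -> 0 <= C -> forall u h,
  @bs n.+2 u -> (forall i, bs (h i)) ->
  (forall x, 0 <= u x) -> (forall i x, 0 <= h i x) ->
  slice_bound u h -> (forall i, \int[mu n.+2]_x h i x <= 1) ->
  \int[mu n.+2]_x (u x * u x `^ n.+1%:R^-1) <= C * n.+2%:R.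
Proof.
move=> IH C0 u h bu bh u0 h0 uh Ih.
pose a : R := n.+1%:R^-1; have a0 : 0 < a by rewrite invr_gt0.
pose f0 y := \int[la]_t h ord0 (cons_rV (t, y)).
have bf0 : bs f0 by exact: bs_int1.
have f00 y : 0 <= f0 y by apply: Rintegral_ge0 => t _.
have If0 : \int[mu n.+1]_y f0 y <= 1 by rewrite -Rint_cons2.
have uf0 t y : u (cons_rV (t, y)) <= f0 y.
  have := uh (cons_rV (t, y)) ord0.
  by rewrite /f0 /Rintegral; under eq_integral do rewrite setc_cons0.
have [M0 bM0] := bu.
pose M := Num.max M0 1; have bM : bsupp M u by apply: bsupp_le bM0; rewrite le_max lexx.
have M1 : 1 <= M by rewrite le_max lexx orbT.
pose Ij (j : 'I_n.+1) t := \int[mu n.+1]_y h (lift ord0 j) (cons_rV (t, y)).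
have Ij0 j t : 0 <= Ij j t by apply: Rintegral_ge0 => y _.
have iI j : intg la setT (Ij j) by have [] := Rint_cons (bh (lift ord0 j)) (h0 _).
have IIj j : \int[la]_t Ij j t <= 1.
  by have [_ <-] := Rint_cons (bh (lift ord0 j)) (h0 _).
(* Makes [K t] positive on the slices that meet the support of [u], so that dividing by it is
   legitimate. Its integral is at most 1 and accounts for the last unit in [n.+2]. *)
pose eta t : R := (2 * M)^-1 * \1_(`[-M, M]%classic) t.
have ii : intg la setT (\1_(`[-M, M]%classic) : R -> R).
  apply: intg_indic => //; rewrite setIT.
  have := @lebesgue_measure_itv R `[-M, M]; rewrite /= => ->.
  by case: ifP => _; rewrite ?ltry// -EFinB ltry.
have ieta : intg la setT eta by exact: intgZ.
have Ieta : \int[la]_t eta t <= 1.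
  rewrite IZ// /Rintegral integral_indic// setIT.
  have := @lebesgue_measure_itv R `[-M, M]; rewrite /= => ->.
  case: ifP => _ /=; last by rewrite mulr0.
  by rewrite ler_pdivrMl; lra.
pose K t := \sum_j Ij j t + eta t.
have iK : intg la setT K by apply: intgD => //; exact: intg_sum.
have IK : \int[la]_t K t <= n.+2%:R.
  rewrite ID//; last exact: intg_sum.
  rewrite I_sum// -natr1 lerD//.
  rewrite (le_trans (ler_sum _ (fun j _ => IIj j)))//.
  by rewrite sumr_const card_ord.
have bup b : 0 < b -> bs (fun x => u x * u x `^ b).
  move=> b0; have [L hL] := bs_bounded (bs_pow b0 bu).
  by apply: (bsM bu _ hL); apply: bs_meas; exact: bs_pow.
have [iP ->] := Rint_cons (bup a a0) (fun x => mulr_ge0 (u0 x) (powR_ge0 _ _)).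
have main t : \int[mu n.+1]_y (u (cons_rV (t, y)) * u (cons_rV (t, y)) `^ a) <= C * K t.
  have K0 : 0 <= K t.
    by rewrite addr_ge0 ?sumr_ge0// mulr_ge0 ?invr_ge0 ?mulr_ge0//; lra.
  have [tM|tM] := ltP M `|t|.
    rewrite (_ : (fun y => _) = cst 0); first by rewrite Rintegral_cst ?mul0r ?mulr_ge0.
    by apply/funext => y; rewrite (bsupp_cons_gt _ bM)// mul0r.
  have Kp : 0 < K t.
    rewrite ltr_wpDl ?sumr_ge0// mulr_gt0 ?invr_gt0//; first lra.
    rewrite indicE mem_set//= in_itv/= -ler_norml; exact: tM.
  have bfa : bs (fun y => f0 y `^ a) by exact: bs_pow.
  have [L hL] := bs_bounded bfa.
  have bprod : bs (fun y => u (cons_rV (t, y)) * f0 y `^ a).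
    by apply: (bsM (bs_cons1 t bu) _ hL); exact: bs_meas.
  apply: (@le_trans _ _ (\int[mu n.+1]_y (u (cons_rV (t, y)) * f0 y `^ a))).
    apply: I_le => //; [|exact: bs_intg|].
      by apply: bs_intg; exact: (bs_cons1 t (bup a a0)).
    move=> y _; rewrite ler_wpM2l//; apply: ge0_ler_powR; rewrite ?nnegrE ?(ltW a0)//.
  have := IH (fun y => (K t)^-1 * u (cons_rV (t, y)))
    (fun j y => (K t)^-1 * h (lift ord0 j) (cons_rV (t, y))) f0 _ _ bf0 _ _ f00 _ _ If0.
  move=> H.
  have {}H : \int[mu n.+1]_y ((K t)^-1 * u (cons_rV (t, y)) * f0 y `^ n.+1%:R^-1) <= C.
    apply: H.
    - by apply: bsZ; exact: bs_cons1.
    - by move=> j; apply: bsZ; exact: bs_cons1.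
    - by move=> y; rewrite mulr_ge0// invr_ge0.
    - by move=> j y; rewrite mulr_ge0// invr_ge0.
    - move=> y j; have [Mj bj] := bh (lift ord0 j).
      have := uh (cons_rV (t, y)) (lift ord0 j).
      have il := bsupp_line (lift ord0 j) (cons_rV (t, y)) bj.
      move=> h1; rewrite IZ//; last first.
        by move: il; rewrite /intg; under eq_fun do rewrite setc_consS.
      rewrite ler_wpM2l ?invr_ge0//; move: h1.
      by rewrite /Rintegral; under eq_integral do rewrite setc_consS.
    - move=> j; rewrite IZ//; last by apply: bs_intg; exact: bs_cons1.
      rewrite ler_pdivrMl// mulr1 /K (bigD1 j)//= -/(Ij j t) -!addrA lerDl.
      by rewrite addr_ge0 ?sumr_ge0// mulr_ge0 ?invr_ge0 ?mulr_ge0//; lra.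
  move: H; rewrite (_ : (fun y => _) = fun y => (K t)^-1 * (u (cons_rV (t, y)) * f0 y `^ a)); last first.
    by apply/funext => y; rewrite mulrA.
  by rewrite IZ; [rewrite ler_pdivrMl// mulrC| |exact: bs_intg].
apply: (@le_trans _ _ (\int[la]_t (C * K t))).
  by apply: I_le => //; exact: intgZ.
by rewrite IZ// ler_wpM2l.
Qed.

(** With [a = 1/(n+1)] and [b = 1/(n+2)], the exponents [1 + a] and [1/b] are conjugate, so
    [u F^b <= u^(1+a) + F] pointwise. [gagliardo_pow] bounds the integral of the first term; the
    second contributes the added [1]. *)
Lemma gagliardo n : exists2 C, 0 <= C & gagliardo_bound n.+1 C.
Proof.
elim: n => [|n [C C0 IH]]; first by exists 1 => //; exact: gagliardo1.
exists (C * n.+2%:R + 1); first by rewrite addr_ge0// mulr_ge0.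
move=> u h F bu bh bF u0 h0 F0 uh Ih IF.
have hp := gagliardo_pow IH C0 bu bh u0 h0 uh Ih.
pose a : R := n.+1%:R^-1; have a0 : 0 < a by rewrite invr_gt0.
pose b : R := n.+2%:R^-1; have b0 : 0 < b by rewrite invr_gt0.
have bup : bs (fun x => u x * u x `^ a).
  have [L hL] := bs_bounded (bs_pow a0 bu).
  by apply: (bsM bu _ hL); apply: bs_meas; exact: bs_pow.
have buF : bs (fun x => u x * F x `^ b).
  have [L hL] := bs_bounded (bs_pow b0 bF).
  by apply: (bsM bu _ hL); apply: bs_meas; exact: bs_pow.
apply: (@le_trans _ _ (\int[mu n.+2]_x (u x * u x `^ a + F x))); last first.
  by rewrite ID//; [exact: lerD|exact: bs_intg|exact: bs_intg].
apply: I_le => //; [exact: bs_intg|apply: intgD => //; exact: bs_intg|].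
move=> x _.
have E : (u x * u x `^ a) `^ b = u x `^ a.
  rewrite -{1}(powRr1 (u0 x)) -powRD; last by rewrite gt_eqF ?addr_gt0// implybT.
  rewrite -powRrM; congr (_ `^ _); rewrite /a /b -[n.+2%:R]natr1.
  by field; rewrite nat1r natr1 !pnatr_eq0.
have [FU|UF] := leP (F x) (u x * u x `^ a).
  apply: (@le_trans _ _ (u x * u x `^ a)); last by rewrite lerDl.
  rewrite ler_wpM2l// -E; apply: ge0_ler_powR; rewrite ?nnegrE ?(ltW b0)//.
  by rewrite mulr_ge0// powR_ge0.
apply: (@le_trans _ _ (F x)); last by rewrite lerDr mulr_ge0// powR_ge0.
have F1 : F x = F x `^ (1 - b) * F x `^ b.
  rewrite -powRD ?subrK ?powRr1//; apply/implyP => _; apply/lt0r_neq0.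
  by apply: le_lt_trans UF; rewrite mulr_ge0// powR_ge0.
rewrite {2}F1 ler_wpM2r ?powR_ge0//.
have b1 : 0 <= 1 - b by rewrite subr_ge0 /b invf_le1// ler1n.
apply: (@le_trans _ _ ((u x * u x `^ a) `^ (1 - b))); last first.
  apply: ge0_ler_powR; rewrite ?nnegrE//; last exact: ltW.
  by rewrite mulr_ge0// powR_ge0.
rewrite -{2}(powRr1 (u0 x)) -powRD; last by rewrite gt_eqF ?addr_gt0// implybT.
rewrite -powRrM (_ : (1 + a) * (1 - b) = 1) ?powRr1// /a /b -[n.+2%:R]natr1.
by field; rewrite nat1r natr1 !pnatr_eq0.
Qed.

End gagliardo.

(** * The fundamental theorem of calculus with compact support; powers of the modulus *)

Section calculus1.
Context (R : realType).
Local Notation la := (@lebesgue_measure R).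

Lemma is_derive_cvg (V : normedModType R) (f : V -> R) x v l :
  h^-1 *: (f (h *: v + x) - f x) @[h --> 0^'] --> l -> is_derive x v f l.
Proof.
move=> cv; apply: DeriveDef; first by apply/cvg_ex; exists l.
exact/cvg_lim.
Qed.

Lemma is_derive_continuous (f : R -> R) (x l : R) :
  is_derive x 1 f l -> {for x, continuous f}.
Proof.
by move=> [df _]; apply: differentiable_continuous; exact/derivable1_diffP.
Qed.

Lemma powR_continuous (a x : R) : 0 < x -> {for x, continuous (fun y => y `^ a)}.
Proof. by move=> x0; have := is_derive1_powR a x0; exact: is_derive_continuous. Qed.

Lemma FTC_support (G g : R -> R) (M : R) :
  (forall t : R, is_derive t 1 G (g t)) -> continuous g ->
  (forall t : R, M < `|t| -> G t = 0) -> (forall t : R, M < `|t| -> g t = 0) ->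
  [/\ intg la setT g, \int[la]_t g t = 0 & forall t, `|G t| <= \int[la]_t `|g t|].
Proof.
move=> dG cg G0 g0.
pose a := `|M| + 1.
have a0 : 0 < a by rewrite ltr_wpDl.
have Ma (t : R) : a <= `|t| -> M < `|t|.
  by apply: lt_le_trans; rewrite /a (le_lt_trans (ler_norm M))// ltrDl.
have cG : continuous G by move=> t; exact: is_derive_continuous (dG t).
have ftc s t : s < t -> \int[la]_(x in `[s, t]) g x = G t - G s.
  move=> st; rewrite /Rintegral (@continuous_FTC2 _ g G s t st)//.
  - exact: continuous_subspaceT.
  - split.
    + by move=> x _; have [] := dG x.
    + by apply: cvg_at_right_filter; exact: cG.
    + by apply: cvg_at_left_filter; exact: cG.
  - by move=> x _; rewrite derive1E; have [_ ->] := dG x.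
have mg : measurable_fun setT g by exact: continuous_measurable_fun.
have ig : intg la setT g.
  have : intg la `[- a, a]%classic g.
    apply: continuous_compact_integrable; first exact: segment_compact.
    exact: continuous_subspaceT.
  have mI : measurable (`[- a, a]%classic : set (measurableTypeR R)) by exact: measurable_itv.
  move=> h; have := (@integrable_mkcond _ _ _ la _ (EFin \o g) mI).1 h; rewrite /intg.
  congr (integrable _ _ _); apply/funext => x; rewrite /patch.
  case: ifPn => // /negP xa; rewrite /= g0//; apply: Ma; rewrite leNgt.
  apply/negP => xa'; apply: xa; apply/mem_set => /=; rewrite in_itv/= -ler_norml.
  exact: ltW.
split => //.
  rewrite (_ : \int[la]_t g t = \int[la]_(t in `[- a, a]) g t).
    rewrite ftc; last by lra.
    by rewrite !G0 ?subrr//; apply: Ma; rewrite ?normrN ler_norm.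
  rewrite [RHS]Rintegral_mkcond; apply: eq_Rintegral => x _; rewrite /patch.
  case: ifPn => // /negP xa; rewrite /= g0//; apply: Ma; rewrite leNgt.
  apply/negP => xa'; apply: xa; apply/mem_set => /=; rewrite in_itv/= -ler_norml.
  exact: ltW.
move=> t; have [ta|ta] := ltP (- a) t; last first.
  rewrite G0 ?normr0; last by apply: Ma; rewrite lerNr in ta; rewrite (le_trans ta)// -normrN ler_norm.
  by apply: Rintegral_ge0 => x _.
have mI : measurable (`[- a, t]%classic : set (measurableTypeR R)) by exact: measurable_itv.
have := ftc _ _ ta; rewrite (G0 (- a)) ?subr0; last first.
  by apply: Ma; rewrite normrN ler_norm.
move=> <-.
have igI : intg la `[- a, t]%classic g by apply: integrableS ig.
apply: (le_trans (le_normr_Rintegral mI igI)).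
rewrite Rintegral_mkcond; apply: I_le => //.
- have := (@integrable_mkcond _ _ _ la _ (EFin \o (fun x => `|g x|)) mI).1 (intg_abs igI); rewrite /intg.
  by congr (integrable _ _ _); apply/funext => x; rewrite /patch /=; case: ifP.
- exact: intg_abs.
- by move=> x _; rewrite /patch; case: ifP => _ //; exact: normr_ge0.
Qed.

(** At 0 the difference quotient has modulus [|h|^(c-1)], which tends to 0 since [c > 1]; the factor
    [s] makes the formula give 0 there, whatever value the power with exponent [c - 2] takes at
    0. *)
Lemma is_derive_normpow (c s : R) : 1 < c ->
  is_derive s 1 (fun s => `|s| `^ c) (c * s * `|s| `^ (c - 2)).
Proof.
move=> c1.
have pos (t : R) : 0 < t -> is_derive t 1 (fun s => `|s| `^ c) (c * t * `|t| `^ (c - 2)).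
  move=> t0; have h := is_derive1_powR c t0.
  rewrite (_ : c * t * _ = c * t `^ (c - 1)).
    apply: (near_eq_is_derive _ h); near=> x.
    rewrite gtr0_norm//; near: x; exact: lt_nbhsr.
  rewrite gtr0_norm// -mulrA -{1}(powRr1 (ltW t0)) -powRD; last by rewrite (gt_eqF t0) implybT.
  by congr (_ * _ `^ _); ring.
have [s0|s0|->] := ltgtP s 0; last first.
- rewrite mulr0 mul0r; apply: is_derive_cvg.
  apply/cvgr0Pnorm_lt => e e0.
  pose d := Num.min 1 (e `^ (c - 1)^-1).
  have d0 : 0 < d by rewrite lt_min ltr01 powR_gt0.
  exists d => //= h /=; rewrite sub0r normrN => hd hn0.
  rewrite addr0 normr0 powR0 ?subr0; last by rewrite gt_eqF//; lra.
  rewrite normrM normfV (ger0_norm (powR_ge0 _ _)) /GRing.scale/= mulr1.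
  have hp : 0 < `|h| by rewrite normr_gt0.
  rewrite (_ : `|h|^-1 * `|h| `^ c = `|h| `^ (c - 1)); last first.
    rewrite -[in LHS](subrK 1 c) [in LHS]powRD; last by rewrite (gt_eqF hp) implybT.
    by rewrite powRr1 ?ltW// mulrCA mulVf ?mulr1// gt_eqF.
  have := hd; rewrite lt_min => /andP[_ hd2].
  have c10 : 0 < c - 1 by lra.
  have := gt0_ltr_powR c10 _ _ hd2; rewrite ?nnegrE normr_ge0 powR_ge0 => /(_ isT isT).
  by rewrite -powRrM mulVf ?lt0r_neq0// powRr1// ltW.
- exact: pos.
- have h : is_derive s 1 ((fun s : R => `|s| `^ c) \o -%R)
      (c * - s * `|- s| `^ (c - 2) * -1).
    by apply: is_derive1_comp; apply: pos; rewrite oppr_gt0.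
  rewrite (_ : c * s * _ = c * - s * `|- s| `^ (c - 2) * -1); last first.
    by rewrite normrN; ring.
  by apply: (near_eq_is_derive _ h); near=> x; rewrite /= normrN.
Unshelve. all: by end_near.
Qed.

Lemma continuous_normpow (c : R) : 1 < c ->
  continuous (fun s : R => c * s * `|s| `^ (c - 2)).
Proof.
move=> c1 s; have [->|s0] := eqVneq s 0.
  rewrite /continuous_at mulr0 mul0r; apply/cvgr0Pnorm_lt => e e0.
  have ec0 : 0 < e / c by rewrite divr_gt0//; lra.
  have c10 : 0 < c - 1 by lra.
  exists ((e / c) `^ (c - 1)^-1) => /=; first exact: powR_gt0.
  move=> h /=; rewrite sub0r normrN => hd.
  have [->|h0] := eqVneq h 0; first by rewrite mulr0 mul0r normr0.
  rewrite !normrM (ger0_norm (powR_ge0 _ _)) -mulrA (gtr0_norm (_ : 0 < c)); last lra.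
  have hp : 0 < `|h| by rewrite normr_gt0.
  rewrite mulrC -ltr_pdivlMr; last lra.
  rewrite -{1}(powRr1 (ltW hp)) -powRD; last by rewrite (gt_eqF hp) implybT.
  rewrite (_ : 1 + (c - 2) = c - 1); last by ring.
  have := gt0_ltr_powR c10 _ _ hd; rewrite ?nnegrE normr_ge0 powR_ge0 => /(_ isT isT).
  by rewrite -powRrM mulVf ?lt0r_neq0// powRr1// ltW.
apply: (@continuousM _ _ (fun s => c * s) (fun s => `|s| `^ (c - 2)) s).
  by apply: continuousM; [exact: cst_continuous|exact: cvg_id].
apply: (@continuous_comp _ _ _ (fun s : R => `|s|) (fun y => y `^ (c - 2))).
  exact: norm_continuous.
by apply: powR_continuous; rewrite normr_gt0.
Qed.

End calculus1.

(** * Smooth functions and test functions *)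

Section test_functions.
Context (R : realType) (n : nat).
Local Notation mu := (lebesgue_rV R n).
Local Notation la := (@lebesgue_measure R).
Implicit Types (f g : 'rV[R]_n -> R) (Omega : set 'rV[R]_n).

Definition ebase (i : 'I_n) : 'rV[R]_n := delta_mx 0 i.

Lemma setcE (i : 'I_n) (t : R) (x : 'rV[R]_n) : setc i t x = t *: ebase i + setc i 0 x.
Proof.
apply/rowP => j; rewrite !mxE eqxx /=; case: (eqVneq j i) => _.
  by rewrite mulr1 addr0.
by rewrite mulr0 add0r.
Qed.

Lemma setc_id (i : 'I_n) (x : 'rV[R]_n) : setc i (x 0 i) x = x.
Proof. by apply/rowP => j; rewrite mxE; case: eqP => [->|]. Qed.

Lemma is_derive_line f i x (t : R) : derivable f (setc i t x) (ebase i) ->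
  is_derive t 1 (fun s => f (setc i s x)) (partial i f (setc i t x)).
Proof.
move=> df; apply: is_derive_cvg.
have := df => /cvg_ex[l hl].
have -> : partial i f (setc i t x) = l by rewrite /partial; apply/cvg_lim.
apply: cvg_trans hl; apply: near_eq_cvg; near=> h.
congr (_ *: (f _ - _)).
by rewrite /= [h *: 1]mulr1 [RHS]setcE [setc i t x]setcE scalerDl addrA.
Unshelve. all: by end_near.
Qed.

Lemma continuous_setc (i : 'I_n) (x : 'rV[R]_n) : continuous (fun t : R => setc i t x).
Proof.
move=> t; under eq_fun do rewrite setcE.
apply: cvgD; last exact: cvg_cst.
by apply: cvgZr_tmp; exact: cvg_id.
Qed.

Lemma partial_supp f i x : ~ closure [set y | f y != 0] x -> partial i f x = 0.
Proof.
move=> h; have /(near_eq_derive (ebase i)) : \near x, f x = (cst 0 : 'rV[R]_n -> R) x.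
  have : nbhs x (~` closure [set y | f y != 0]).
    by apply: open_nbhs_nbhs; split => //; apply: closed_openC; exact: closed_closure.
  apply: filterS => y /= hy; apply/eqP; apply/negP => /negP fy.
  by apply: hy; exact: subset_closure.
by rewrite /partial => ->; exact: derive_cst.
Qed.

Lemma bs_compact f (A : set 'rV[R]_n) : continuous f -> compact A ->
  (forall x, ~ A x -> f x = 0) -> bs f.
Proof.
move=> cf cA f0.
have [M [_ hM]] := compact_bounded cA.
have [K [_ hK]] : bounded_set (f @` A).
  by apply: compact_bounded; apply: continuous_compact => //; exact: continuous_subspaceT.
exists (Num.max (M + 1) (Num.max 0 (K + 1))); split => [|x|x i h].
- exact: continuous_measurable_rV.
- have [Ax|/f0 ->] := pselect (A x); last by rewrite normr0 !le_max lexx !orbT.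
  by rewrite !le_max (hK (K + 1)) ?orbT ?ltrDl//; exists x.
- apply: f0 => Ax; have /= := hM (M + 1) _ x Ax; rewrite ltrDl => /(_ ltr01).
  move=> xM; move: h; rewrite gt_max => /andP[+ _]; rewrite ltNge => /negP; apply.
  apply: le_trans xM; rewrite /Num.norm/= mx_normrE.
  exact: (le_bigmax _ (fun ij => `|x ij.1 ij.2|) (0, i)).
Qed.

Lemma smooth_partial f i : smooth f -> smooth (partial i f).
Proof. by move=> sf s; have := sf (rcons s i); rewrite foldr_rcons. Qed.

Lemma smooth_continuous f : smooth f -> continuous f.
Proof. by move=> /(_ [::]) []. Qed.

Lemma smooth_derivable f i x : smooth f -> derivable f x (ebase i).
Proof. by move=> /(_ [::]) []. Qed.

(** Coinduction principle for smoothness: iterated partial derivatives never leave a class that is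
    stable under [partial]. Proofs of smoothness reduce to finding such a class. *)
Lemma smooth_closed (P : ('rV[R]_n -> R) -> Prop) :
  (forall f, P f -> [/\ continuous f, forall i x, derivable f x (ebase i) &
     forall i, P (partial i f)]) ->
  forall f, P f -> smooth f.
Proof.
move=> h f Pf s; suff /h[] : P (foldr (@partial R n) f s) by [].
by elim: s => //= i s /h[].
Qed.

Lemma partialD f g i : (forall x, derivable f x (ebase i)) ->
  (forall x, derivable g x (ebase i)) ->
  partial i (fun x => f x + g x) = fun x => partial i f x + partial i g x.
Proof. by move=> df dg; apply/funext => x; exact: deriveD. Qed.

Lemma partialM f g i : (forall x, derivable f x (ebase i)) ->
  (forall x, derivable g x (ebase i)) ->
  partial i (fun x => f x * g x) = fun x => f x * partial i g x + g x * partial i f x.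
Proof. by move=> df dg; apply/funext => x; exact: deriveM. Qed.

(** Products alone are not stable under partial derivatives; by Leibniz' rule their finite sums are,
    which is what [smooth_closed] requires. *)
Inductive sum_prod : ('rV[R]_n -> R) -> Prop :=
| sum_prodM f g : smooth f -> smooth g -> sum_prod (fun x => f x * g x)
| sum_prodD f g : sum_prod f -> sum_prod g -> sum_prod (fun x => f x + g x).

Lemma smoothM f g : smooth f -> smooth g -> smooth (fun x => f x * g x).
Proof.
move=> sf sg; apply: (@smooth_closed sum_prod); last exact: sum_prodM.
move=> {sf sg} h ph; elim: ph => {h f g} f g.
  move=> sf sg.
  have df i x : derivable f x (ebase i) by exact: smooth_derivable.
  have dg i x : derivable g x (ebase i) by exact: smooth_derivable.
  split => [x|i x|i].
  - by apply: continuousM; exact: smooth_continuous.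
  - exact: derivableM.
  - rewrite (partialM (df i) (dg i)); apply: sum_prodD; apply: sum_prodM.
    + exact: sf.
    + exact: smooth_partial sg.
    + exact: sg.
    + exact: smooth_partial sf.
move=> _ [cf df pf] _ [cg dg pg]; split => [x|i x|i].
- by apply: continuousD; [exact: cf|exact: cg].
- exact: derivableD.
- by rewrite partialD//; exact: sum_prodD.
Qed.

Lemma smooth_cst (c : R) : smooth (cst c : 'rV[R]_n -> R).
Proof.
apply: (@smooth_closed (fun f => exists c, f = cst c)); last by exists c.
move=> _ [a ->]; split => [x|i x|i].
- exact: cst_continuous.
- exact: derivable_cst.
- by exists 0; apply/funext => x; exact: derive_cst.
Qed.

Lemma smoothD f g : smooth f -> smooth g -> smooth (fun x => f x + g x).
Proof.
move=> sf sg; apply: (@smooth_closed (fun h => exists f g,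
  [/\ smooth f, smooth g & h = fun x => f x + g x])); last by exists f, g.
move=> _ [f' [g' [sf' sg' ->]]].
have df i x : derivable f' x (ebase i) by exact: smooth_derivable.
have dg i x : derivable g' x (ebase i) by exact: smooth_derivable.
split => [x|i x|i].
- by apply: continuousD; exact: smooth_continuous.
- exact: derivableD.
- exists (partial i f'), (partial i g').
  by split; [exact: smooth_partial|exact: smooth_partial|rewrite partialD].
Qed.

Lemma compactly_containedS (A B Omega : set 'rV[R]_n) :
  A `<=` B -> compactly_contained B Omega -> compactly_contained A Omega.
Proof.
move=> AB [cB BO]; have cAB := closure_subset AB; split.
  by apply: (subclosed_compact _ cB) => //; exact: closed_closure.
exact: subset_trans cAB BO.
Qed.

Lemma test_funM Omega f g : test_fun Omega f -> smooth g ->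
  test_fun Omega (fun x => f x * g x).
Proof.
move=> [sf cf] sg; split; first exact: smoothM.
apply: compactly_containedS cf => x /=; apply: contra => /eqP ->.
by rewrite mul0r.
Qed.

Lemma test_funD Omega f g : test_fun Omega f -> test_fun Omega g ->
  test_fun Omega (fun x => f x + g x).
Proof.
move=> [sf [cf fO]] [sg [cg gO]]; split; first exact: smoothD.
apply: (@compactly_containedS _ ([set x | f x != 0] `|` [set x | g x != 0])).
  move=> x /=; have [->|] := eqVneq (f x) 0; last by left.
  by rewrite add0r; right.
rewrite /compactly_contained closureU; split; first exact: compactU.
by rewrite subUset.
Qed.

Lemma test_funZ Omega (c : R) f : test_fun Omega f ->
  test_fun Omega (fun x => c * f x).
Proof.
move=> tf; under eq_fun do rewrite mulrC.
exact: test_funM tf (smooth_cst c).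
Qed.

Lemma test_fun0 Omega : test_fun Omega (fun=> 0).
Proof.
split; first exact: smooth_cst.
rewrite /compactly_contained (_ : [set x | _] = set0) ?closure0; last first.
  by apply/seteqP; split => x //=; rewrite eqxx.
by split; [exact: (@compact0 _)|exact: sub0set].
Qed.

Lemma test_fun_bs Omega f : test_fun Omega f -> bs f /\ forall i, bs (partial i f).
Proof.
move=> [sf [cA _]]; have sup x : ~ closure [set x | f x != 0] x -> f x = 0.
  move=> h; apply/eqP; apply/negP => /negP fx; apply: h.
  exact: subset_closure.
split; first exact: bs_compact (smooth_continuous sf) cA sup.
move=> i; apply: (bs_compact _ cA); last by move=> x; exact: partial_supp.
exact/smooth_continuous/smooth_partial.
Qed.

Lemma test_fun_line Omega f i x : test_fun Omega f ->
  \int[la]_t partial i f (setc i t x) = 0.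
Proof.
move=> tf; have [[M bM] bp] := test_fun_bs tf; have [K bK] := bp i.
have [sf _] := tf.
have [] // := @FTC_support R (fun t => f (setc i t x))
   (fun t => partial i f (setc i t x)) (Num.max M K).
- by move=> t; apply: is_derive_line; exact: smooth_derivable.
- move=> t; apply: continuous_comp; first exact: continuous_setc.
  exact/smooth_continuous/smooth_partial.
- move=> t; rewrite gt_max => /andP[h _]; have [_ _ f0] := bM.
  by apply: (f0 _ i); rewrite mxE eqxx.
- move=> t; rewrite gt_max => /andP[_ h]; have [_ _ f0] := bK.
  by apply: (f0 _ i); rewrite mxE eqxx.
Qed.

(** Provides the hypothesis [slice_bound] for [|f|^c]; the integrand is the modulus of its
    derivative along the line. *)
Lemma normpow_line Omega f i (c : R) : 1 < c -> test_fun Omega f -> forall x,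
  `|f x| `^ c <=
  \int[la]_t `|c * f (setc i t x) * `|f (setc i t x)| `^ (c - 2) * partial i f (setc i t x)|.
Proof.
move=> c1 tf x; have [[M bM] bp] := test_fun_bs tf; have [K bK] := bp i.
have [sf _] := tf; have c0 : c != 0 by lra.
have [] := @FTC_support R (fun t => `|f (setc i t x)| `^ c)
   (fun t => c * f (setc i t x) * `|f (setc i t x)| `^ (c - 2) *
     partial i f (setc i t x)) M.
- move=> t; apply: (@is_derive1_comp _ (fun s => `|s| `^ c) (fun t => f (setc i t x))).
    exact: is_derive_normpow.
  by apply: is_derive_line; exact: smooth_derivable.
- move=> t; apply: (@continuousM _ _ (fun t => c * f (setc i t x) * `|f (setc i t x)| `^ (c - 2))
     (fun t => partial i f (setc i t x))).
    apply: (@continuous_comp _ _ _ (fun t => f (setc i t x)) (fun s => c * s * `|s| `^ (c - 2))); last exact: continuous_normpow.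
    by apply: continuous_comp; [exact: continuous_setc|exact: smooth_continuous].
  apply: continuous_comp; first exact: continuous_setc.
  exact/smooth_continuous/smooth_partial.
- move=> t h; have [_ _ f0] := bM.
  by rewrite (f0 _ i) ?normr0 ?powR0// mxE eqxx.
- move=> t h; have [_ _ f0] := bM.
  by rewrite (f0 _ i) ?mulr0 ?mul0r// mxE eqxx.
move=> _ _ /(_ (x 0 i)); rewrite setc_id; apply: le_trans.
exact: ler_norm.
Qed.

End test_functions.

(** * Integration by parts and the Sobolev inequality for test functions *)

Section sobolev_inequality.
Context (R : realType).
Local Notation mu n := (lebesgue_rV R n).
Local Notation la := (@lebesgue_measure R).

Lemma bs_posneg n (g : 'rV[R]_n -> R) : bs g ->
  [/\ bs (fun x => Num.max (g x) 0), bs (fun x => Num.max (- g x) 0) &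
   forall x, g x = Num.max (g x) 0 - Num.max (- g x) 0].
Proof.
move=> bg; have [M [mg gM g0]] := bg.
have M0 : 0 <= M by apply: le_trans (gM 0).
split => [||x].
- apply: (bs_dom (K := M) bg) => [|x|x ->]; last by rewrite maxxx.
    exact: measurable_maxr.
  rewrite ger0_norm ?le_max ?lexx ?orbT// ge_max M0 andbT.
  exact: le_trans (ler_norm _) (gM x).
- apply: (bs_dom (K := M) bg) => [|x|x ->]; last by rewrite oppr0 maxxx.
    by apply: measurable_maxr => //; exact: measurableT_comp.
  rewrite ger0_norm ?le_max ?lexx ?orbT// ge_max M0 andbT.
  by apply: le_trans (ler_norm _) _; rewrite normrN.
- by case: (leP (g x) 0) => h; case: (leP (- g x) 0) => h'; lra.
Qed.

Lemma Rint_consS n (g : 'rV[R]_n.+1 -> R) : bs g ->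
  \int[mu n.+1]_x g x = \int[la]_t \int[mu n]_y g (cons_rV (t, y)) /\
  \int[mu n.+1]_x g x = \int[mu n]_y \int[la]_t g (cons_rV (t, y)).
Proof.
move=> bg; have [b1 b2 gE] := bs_posneg bg.
have p1 x : 0 <= Num.max (g x) 0 by rewrite le_max lexx orbT.
have p2 x : 0 <= Num.max (- g x) 0 by rewrite le_max lexx orbT.
have il h y : @bs R n.+1 h -> intg la setT (fun t => h (cons_rV (t, y))).
  move=> [M bM]; have := bsupp_line ord0 (cons_rV (0, y)) bM.
  by rewrite /intg; under eq_fun do rewrite setc_cons0.
rewrite (_ : \int[mu n.+1]_x g x = \int[mu n.+1]_x Num.max (g x) 0 - \int[mu n.+1]_x Num.max (- g x) 0); last first.
  rewrite -IB//; [|exact: bs_intg|exact: bs_intg].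
  by apply: I_eq => x _; rewrite -gE.
have [i1 e1] := Rint_cons b1 p1; have [i2 e2] := Rint_cons b2 p2.
split.
  rewrite e1 e2 -IB//; apply: I_eq => t _.
  rewrite -IB//; [|exact/bs_intg/(bs_cons1 t b1)|exact/bs_intg/(bs_cons1 t b2)].
  by apply: I_eq => y _; rewrite -gE.
rewrite (Rint_cons2 b1 p1) (Rint_cons2 b2 p2) -IB//; last 2 first.
- by apply: bs_intg; exact: bs_int1 b1 p1.
- by apply: bs_intg; exact: bs_int1 b2 p2.
apply: I_eq => y _; rewrite -IB//; [|exact: (il _ y b1)|exact: (il _ y b2)].
by apply: I_eq => t _; rewrite -gE.
Qed.

(** Induction on the dimension avoids permuting coordinates: if [i] is the first coordinate it is
    integrated first, otherwise the first coordinate is frozen and the lemma is applied on the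
    slice. *)
Lemma slice_int0 n (i : 'I_n) (g : 'rV[R]_n -> R) : bs g ->
  (forall x, \int[la]_t g (setc i t x) = 0) -> \int[mu n]_x g x = 0.
Proof.
elim: n i g => [[]//|n IH] i g bg g0; have [e1 e2] := Rint_consS bg.
have [j ij|i0] := unliftP ord0 i.
  rewrite e1 (_ : (fun t => _) = cst 0) ?Rintegral_cst ?mul0r//.
  apply/funext => t; apply: (IH j); first exact: bs_cons1.
  move=> y; have := g0 (cons_rV (t, y)); rewrite ij.
  by rewrite /Rintegral; under eq_integral do rewrite setc_consS.
rewrite e2 (_ : (fun y => _) = cst 0) ?Rintegral_cst ?mul0r//.
apply/funext => y; have := g0 (cons_rV (0, y)); rewrite i0.
by rewrite /Rintegral; under eq_integral do rewrite setc_cons0.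
Qed.

Lemma int_partial n (Omega : set 'rV[R]_n) f i : test_fun Omega f ->
  \int[mu n]_x partial i f x = 0.
Proof.
move=> tf; apply: (@slice_int0 _ i).
  by have [_] := test_fun_bs tf.
by move=> x; exact: test_fun_line tf.
Qed.

Lemma integration_by_parts_test n (Omega : set 'rV[R]_n) f g i :
  test_fun Omega f -> test_fun Omega g ->
  \int[mu n]_x (f x * partial i g x) = - \int[mu n]_x (partial i f x * g x).
Proof.
move=> tf tg; have [bf bpf] := test_fun_bs tf; have [bg bpg] := test_fun_bs tg.
have := int_partial i (test_funM tf tg.1).
rewrite partialM; [|by move=> x; apply: smooth_derivable tf.1|by move=> x; apply: smooth_derivable tg.1].
have ii h k : bs h -> bs k -> intg (mu n) setT (fun x => h x * k x).
  move=> bh bk; have [K hK] := bs_bounded bk.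
  by apply: bs_intg; apply: (bsM bh _ hK); exact: bs_meas.
rewrite ID//; [|exact: ii|exact: ii] => /eqP; rewrite addr_eq0 => /eqP ->.
by congr (- _); apply: I_eq => x _; rewrite mulrC.
Qed.

(** In dimension [N = n+3], [gagliardo_pow] is applied to [|f|^gam] with [gam = 2(N-1)/(N-2)]. Both
    relations on [gam] point to the same exponent [q = 2N/(N-2)]: [gam (1 + a) = q] on the left and
    [2 (gam - 1) = q] on the right. With [X] the integral of [|f|^q] this reads [X <= C1 X^e], where
    [e < 1]. *)
Lemma sobolev_test n : exists2 C : R, 0 <= C &
  forall (Omega : set 'rV[R]_n.+3) f, test_fun Omega f ->
  (forall i, \int[mu n.+3]_x (partial i f x) ^+ 2 <= 1) ->
  \int[mu n.+3]_x (`|f x| `^ (2 * n.+3%:R / n.+1%:R)) <= C.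
Proof.
pose N : R := n.+3%:R; pose gam : R := 2 * n.+2%:R / n.+1%:R.
have n1 : 0 < n.+1%:R :> R by []. have n2 : 0 < n.+2%:R :> R by [].
have n3 : 0 < n.+3%:R :> R by [].
have [C C0 hC] := gagliardo R n.+1.
pose a : R := n.+2%:R^-1; have a0 : 0 < a by rewrite invr_gt0.
pose q : R := 2 * n.+3%:R / n.+1%:R; have q0 : 0 < q by rewrite divr_gt0// mulr_gt0.
have gam1 : 1 < gam by rewrite ltr_pdivlMr// mul1r -!natrM ltr_nat; lia.
have E2 : n.+2%:R = n.+1%:R + 1 :> R by rewrite natr1.
have E3 : n.+3%:R = n.+1%:R + 2 :> R by rewrite -natrD addn2.
have gam0 : 0 < gam by exact: lt_trans ltr01 gam1.
have gamq : gam * (1 + a) = q.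
  rewrite /gam /a /q E2 E3; move: n1; set x := _%:R => x0; field.
  by rewrite !gt_eqF//; lra.
have gamq2 : 2 * (gam - 1) = q.
  rewrite /gam /q E2 E3; move: n1; set x := _%:R => x0; field.
  by rewrite gt_eqF.
pose C1 := C * n.+3%:R * gam `^ (1 + a).
pose e := (1 + a) / 2.
have e1 : e < 1.
  by rewrite ltr_pdivrMr// mul1r (_ : 2 = 1 + 1)// ltrD2l /a invf_lt1// ltr1n.
have C10 : 0 <= C1 by rewrite !mulr_ge0// powR_ge0.
exists (C1 `^ (1 - e)^-1); first exact: powR_ge0.
move=> Omega f tf Df; rewrite -/q; have aE : a = n.+2%:R^-1 by [].
clearbody gam q a.
have [bf bp] := test_fun_bs tf.
have bnf : bs (fun x => `|f x|).
  have [K hK] := bs_bounded bf.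
  apply: (bs_dom (K := K) bf) => [|x|x ->]; last by rewrite normr0.
    by apply: measurableT_comp => //; exact: bs_meas.
  by rewrite normr_id.
set X := \int[_]_x _.
have X0 : 0 <= X by apply: Rintegral_ge0 => x _; exact: powR_ge0.
(* The end of the proof divides by a power of [X], which is finite because [f] is bounded with
   bounded support. *)
have [X00|Xn0] := eqVneq X 0; first by rewrite X00 powR_ge0.
have Xp : 0 < X by rewrite lt_neqAle eq_sym Xn0.
have iX : intg (mu n.+3) setT (fun x => `|f x| `^ q) by apply: bs_intg; exact: bs_pow.
pose h i x := `|gam * f x * `|f x| `^ (gam - 2) * partial i f x|.
have hE i x : h i x = gam * `|f x| `^ (gam - 1) * `|partial i f x|.
  rewrite /h 3!normrM (gtr0_norm gam0).
  rewrite (ger0_norm (powR_ge0 _ _)); congr (_ * _); rewrite -mulrA; congr (_ * _).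
  have [->|fx0] := eqVneq (f x) 0.
    rewrite normr0 mul0r powR0//; lra.
  rewrite -{1}(powRr1 (normr_ge0 (f x))) -powRD; last by rewrite normr_eq0 (negbTE fx0) implybT.
  by congr (_ `^ _); ring.
have bh i : bs (h i).
  have gam10 : 0 < gam - 1 by lra.
  have b1 := bs_pow gam10 bnf; have [K hK] := bs_bounded b1.
  have [L hL] := bs_bounded (bp i).
  rewrite (_ : h i = fun x => (gam * `|f x| `^ (gam - 1)) * `|partial i f x|); last by apply/funext => x; rewrite hE.
  apply: (bsM (K := L) (bsZ gam b1)) => [|x]; last by rewrite normr_id.
  by apply: measurableT_comp => //; exact: bs_meas.
pose K := gam * Num.sqrt X.
have sX : 0 < Num.sqrt X by rewrite sqrtr_gt0.
have Kp : 0 < K by rewrite mulr_gt0.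
have ip i : intg (mu n.+3) setT (fun x => partial i f x ^+ 2).
  have [L hL] := bs_bounded (bp i).
  by apply: bs_intg; apply: (bsM (bp i) _ hL); exact: bs_meas.
have Ih i : \int[mu n.+3]_x h i x <= K.
  pose s := Num.sqrt X.
  (* Young's inequality with weight [s = sqrt X]. As [2 (gam - 1) = q], the first term integrates to
     [s]; the second integrates to at most [s] by the normalisation of the derivatives. *)
  apply: (@le_trans _ _ (\int[mu n.+3]_x (gam / 2 * (s^-1 * `|f x| `^ q + s * partial i f x ^+ 2)))).
    apply: I_le => //; first exact: bs_intg.
      by apply: intgZ => //; apply: intgD => //; exact: intgZ.
    move=> x _; rewrite hE -!mulrA; apply: ler_wpM2l; first exact: ltW.
    rewrite -gamq2 [2 * (gam - 1)]mulrC powRrM powR_mulrn ?powR_ge0//.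
    rewrite (_ : partial i f x ^+ 2 = `|partial i f x| ^+ 2); last by rewrite real_normK ?num_real.
    set A := _ `^ (gam - 1); set B := `|_|.
    rewrite ler_pdivlMl//.
    have := sqr_ge0 (A - s * B); rewrite -(pmulr_rge0 _ (_ : 0 < s^-1)); last by rewrite invr_gt0.
    rewrite -subr_ge0 => h1; rewrite -subr_ge0.
    rewrite (_ : _ - _ = s^-1 * (A - s * B) ^+ 2 - 0)//.
    by field; rewrite gt_eqF.
  rewrite IZ//; last by apply: intgD => //; exact: intgZ.
  rewrite ID//; [|exact: intgZ|exact: intgZ].
  rewrite IZ// IZ// -/X (_ : K = gam / 2 * (s^-1 * X + s * 1)); last first.
    have Xs : X = s ^+ 2 by rewrite /s sqr_sqrtr.
    rewrite /K -/s; have s0 : 0 < s by []; clearbody s.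
    by rewrite Xs; field; rewrite gt_eqF.
  apply: ler_wpM2l; first by rewrite divr_ge0// ltW.
  by rewrite lerD2l ler_wpM2l ?sqrtr_ge0.
pose u x := K^-1 * `|f x| `^ gam.
have H := @gagliardo_pow R n.+1 C hC C0 u (fun i x => K^-1 * h i x).
have {}H : \int[mu n.+3]_x (u x * u x `^ a) <= C * n.+3%:R.
  rewrite aE; apply: H.
  - by apply: bsZ; exact: bs_pow.
  - by move=> i; exact: bsZ.
  - by move=> x; rewrite mulr_ge0 ?powR_ge0// invr_ge0 ltW.
  - by move=> i x; apply: mulr_ge0; [rewrite invr_ge0 ltW|exact: normr_ge0].
  - move=> x i; have [M bM] := bh i; rewrite IZ//; last exact: bsupp_line bM.
    by rewrite ler_wpM2l ?invr_ge0 ?(ltW Kp)//; exact: normpow_line tf x.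
  - by move=> i; rewrite IZ//; [rewrite ler_pdivrMl// mulr1|exact: bs_intg].
move: H; rewrite (_ : (fun x => u x * u x `^ a) = fun x => (K^-1) `^ (1 + a) * `|f x| `^ q); last first.
  apply/funext => x; have ux0 : 0 <= u x by rewrite mulr_ge0 ?powR_ge0// invr_ge0 ltW.
  rewrite -{1}(powRr1 ux0) -powRD; last by rewrite (gt_eqF (ltr_pwDl ltr01 (ltW a0))).
  by rewrite /u powRM ?powR_ge0 ?invr_ge0 ?(ltW Kp)// -powRrM gamq.
rewrite IZ// -/X => H.
have {}H : X <= C1 * X `^ e.
  move: H; rewrite -powR_inv1 ?(ltW Kp)// -powRrM mulN1r powRN ler_pdivrMl ?powR_gt0//.
  move/le_trans; apply; rewrite /C1 /K powRM ?(ltW gam0) ?sqrtr_ge0//.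
  rewrite -powR12_sqrt// -powRrM (_ : 2^-1 * (1 + a) = e); last by rewrite /e mulrC.
  by rewrite le_eqVlt; apply/orP; left; apply/eqP; ring.
have H2 : X `^ (1 - e) <= C1.
  rewrite powRD; last by rewrite (gt_eqF Xp) implybT.
  by rewrite powRr1 ?(ltW Xp)// powRN ler_pdivrMr// powR_gt0.
have e10 : 0 < 1 - e by rewrite subr_gt0.
have -> : X = (X `^ (1 - e)) `^ (1 - e)^-1.
  by rewrite -powRrM divff ?powRr1// gt_eqF.
by apply: ge0_ler_powR; rewrite ?nnegrE ?powR_ge0// invr_ge0 ltW.
Qed.

End sobolev_inequality.

(** * The space of weak limits of test functions *)

Lemma cvg_sumR (R : realType) (J : Type) (s : seq J) (f : J -> nat -> R) (l : J -> R) :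
  (forall j, f j k @[k --> \oo] --> l j) ->
  \sum_(j <- s) f j k @[k --> \oo] --> \sum_(j <- s) l j.
Proof.
move=> h; elim: s => [|j s IH].
  by under eq_fun do rewrite big_nil; rewrite big_nil; exact: cvg_cst.
by under eq_fun do rewrite big_cons; rewrite big_cons; apply: cvgD.
Qed.

Section H10_space.
Context (R : realType) (N : nat) (Omega : set 'rV[R]_N).
Hypotheses (oO : open Omega) (bO : bounded_set Omega).
Local Notation mu := (lebesgue_rV R N).
Local Notation T := 'rV[R]_N.
Local Notation I f := (\int[mu]_(x in Omega) f x).
Local Notation ebase := (@ebase R N).

Lemma measurable_Omega : measurable Omega.
Proof. exact: open_measurable_rV. Qed.
Local Notation mO := measurable_Omega.

Lemma Omega_finite : (mu Omega < +oo)%E.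
Proof.
have [M [_ hM]] := bO.
pose A : set T := [set x | forall i, `[- (M + 1), M + 1]%classic (x 0 i)].
have mA : measurable A.
  by apply: (@measurable_box R N (fun=> `[- (M + 1), M + 1]%classic)) => i; exact: measurable_itv.
apply: (@le_lt_trans _ _ (mu A)).
  apply: le_measure; rewrite ?inE//; first exact: mO.
  move=> x Ox i /=; rewrite in_itv/= -ler_norml.
  apply: le_trans (hM (M + 1) _ x Ox); last by rewrite ltrDl.
  rewrite /Num.norm/= mx_normrE.
  exact: (le_bigmax _ (fun ij => `|x ij.1 ij.2|) (0, i)).
rewrite /A (@lebesgue_rV_box R N (fun=> `[- (M + 1), M + 1]%classic)); last by move=> i; exact: measurable_itv.
suff /andP[] : (0 <= \prod_(i < N) lebesgue_measure `[(- (M + 1))%R, (M + 1)%R] < +oo)%E by [].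
elim/big_ind: _ => //.
- by rewrite ltry lee_fin ler01.
- move=> x y /andP[x0 xoo] /andP[y0 yoo]; rewrite mule_ge0//=.
  by rewrite lte_mul_pinfty// ge0_fin_numE.
- move=> i _; rewrite measure_ge0/=.
  have := @lebesgue_measure_itv R `[- (M + 1), M + 1]; rewrite /= => ->.
  by case: ifP => _; rewrite ?ltry// -EFinB ltry.
Qed.

Definition vf := ((T -> R) * (T -> 'rV[R]_N))%type.

(** Treats the value and the [N] gradient components as [N + 1] coordinates, so that measurability,
    square integrability and limits are proved once for all of them. *)
Definition vco (w : vf) (o : option 'I_N) (x : T) : R :=
  if o is Some i then w.2 x 0 i else w.1 x.

(** The single vector operation [a v + w]; differences and multiples are instances, so closure
    properties and linearity need one statement each. *)
Definition lincomb (a : R) (v w : vf) : vf :=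
  (fun x => a * v.1 x + w.1 x, fun x => a *: v.2 x + w.2 x).

Definition vsub (v w : vf) := lincomb (-1) w v.

Lemma lincombE a v w o x : vco (lincomb a v w) o x = a * vco v o x + vco w o x.
Proof. by case: o => [i|] //=; rewrite !mxE. Qed.

Lemma vsubE v w o x : vco (vsub v w) o x = vco v o x - vco w o x.
Proof. by rewrite lincombE mulN1r addrC. Qed.

Definition D2 (w : vf) : R := \sum_i I (fun x => w.2 x 0 i ^+ 2).

Definition n2 (w : vf) : R := I (fun x => w.1 x ^+ 2) + D2 w.

Definition measv (w : vf) := forall o, measurable_fun setT (vco w o).

Definition L2v (w : vf) := forall o, L2 mu Omega (vco w o).

Definition gradv (f : T -> R) : vf := (f, fun x => \row_i partial i f x).

(** Distances are measured by the squared norm [n2], which avoids square roots. Measurability is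
    asked on the whole space, so that composition with Borel functions needs no restriction to
    [Omega]. *)
Definition inV (w : vf) := [/\ measv w, L2v w & forall e : R, 0 < e ->
  exists2 f, test_fun Omega f & n2 (vsub (gradv f) w) <= e].

Lemma I_sqr_ge0 (f : T -> R) : 0 <= I (fun x => f x ^+ 2).
Proof. by apply: Rintegral_ge0 => x _; exact: sqr_ge0. Qed.

Lemma D2_ge0 w : 0 <= D2 w.
Proof. by apply: sumr_ge0 => i _; exact: I_sqr_ge0. Qed.

Lemma vco_n2 w o : I (fun x => vco w o x ^+ 2) <= n2 w.
Proof.
case: o => [i|] /=; last by rewrite lerDl D2_ge0.
rewrite /n2 /D2 (bigD1 i)//= addrCA lerDl addr_ge0 ?I_sqr_ge0//.
by apply: sumr_ge0 => j _; exact: I_sqr_ge0.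
Qed.

Lemma D2_le_n2 w : D2 w <= n2 w.
Proof. by rewrite lerDr I_sqr_ge0. Qed.

Lemma n2_ge0 w : 0 <= n2 w.
Proof. exact: le_trans (D2_ge0 w) (D2_le_n2 w). Qed.

Lemma n2_le (a : R) v w : 0 <= a ->
  (forall o, I (fun x => vco v o x ^+ 2) <= a * I (fun x => vco w o x ^+ 2)) ->
  n2 v <= a * n2 w.
Proof.
move=> a0 h; rewrite /n2 mulrDr lerD//; first exact: (h None).
by rewrite /D2 mulr_sumr; apply: ler_sum => i _; exact: (h (Some i)).
Qed.

Lemma n2_eq v w :
  (forall o, I (fun x => vco v o x ^+ 2) = I (fun x => vco w o x ^+ 2)) ->
  n2 v = n2 w.
Proof.
move=> h; rewrite /n2; congr (_ + _); first exact: (h None).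
by apply: eq_bigr => i _; exact: (h (Some i)).
Qed.

Lemma measv_lincomb a v w : measv v -> measv w -> measv (lincomb a v w).
Proof.
move=> mv mw o; rewrite (_ : vco _ _ = fun x => a * vco v o x + vco w o x); last first.
  by apply/funext => x; rewrite lincombE.
by apply: measurable_funD => //; exact: measurable_funM.
Qed.

Lemma L2v_lincomb a v w : L2v v -> L2v w -> L2v (lincomb a v w).
Proof.
move=> mv mw o; rewrite (_ : vco _ _ = fun x => a * vco v o x + vco w o x); last first.
  by apply/funext => x; rewrite lincombE.
by apply: L2D; [exact: mO|apply: L2Z; [exact: mO|exact: mv]|exact: mw].
Qed.

Lemma n2_lincomb a v w : L2v v -> L2v w ->
  n2 (lincomb a v w) <= 2 * a ^+ 2 * n2 v + 2 * n2 w.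
Proof.
move=> Lv Lw.
have h o : I (fun x => vco (lincomb a v w) o x ^+ 2) <=
   2 * a ^+ 2 * I (fun x => vco v o x ^+ 2) + 2 * I (fun x => vco w o x ^+ 2).
  have := I_sqrD mO (L2Z mO a (Lv o)) (Lw o).
  under eq_Rintegral do rewrite -lincombE.
  move/le_trans; apply; under eq_Rintegral do rewrite exprMn.
  by rewrite IZ ?mulrA//; [exact: mO|case: (Lv o)].
rewrite /n2 !mulrDr addrACA lerD//; first exact: (h None).
by rewrite /D2 !mulr_sumr -big_split; apply: ler_sum => i _; exact: (h (Some i)).
Qed.

Lemma n2_vsub_trans u v w : L2v u -> L2v v -> L2v w ->
  n2 (vsub u w) <= 2 * n2 (vsub u v) + 2 * n2 (vsub v w).
Proof.
move=> Lu Lv Lw; have := n2_lincomb 1 (L2v_lincomb (-1) Lv Lu) (L2v_lincomb (-1) Lw Lv).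
rewrite expr1n mulr1; apply: le_trans; rewrite le_eqVlt; apply/orP; left; apply/eqP.
apply: n2_eq => o; apply: I_eq => x _; congr (_ ^+ 2).
by rewrite vsubE lincombE !vsubE; ring.
Qed.

Lemma n2_vsubC u v : n2 (vsub u v) = n2 (vsub v u).
Proof.
by apply: n2_eq => o; apply: I_eq => x _; rewrite !vsubE -sqrrN opprB.
Qed.

Lemma bs_L2 (f : T -> R) : bs f -> L2 mu Omega f.
Proof.
move=> bf; split; first by apply: measurable_funTS; exact: bs_meas.
have [K hK] := bs_bounded bf.
apply: (@integrableS _ _ _ _ setT) => //; first exact: mO.
by apply: bs_intg; apply: (bsM bf _ hK); exact: bs_meas.
Qed.

Lemma gradv_comp f (P : (T -> R) -> Prop) : P f -> (forall i, P (partial i f)) ->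
  forall o, P (vco (gradv f) o).
Proof.
move=> Pf Pp [i|] //; rewrite (_ : vco _ _ = partial i f)//.
by apply/funext => x; rewrite /vco/= mxE.
Qed.

Lemma measv_gradv f : test_fun Omega f -> measv (gradv f).
Proof.
move=> /test_fun_bs [bf bp]; apply: gradv_comp; first exact: bs_meas.
by move=> i; exact: bs_meas.
Qed.

Lemma L2v_gradv f : test_fun Omega f -> L2v (gradv f).
Proof.
move=> /test_fun_bs [bf bp]; apply: gradv_comp; first exact: bs_L2.
by move=> i; exact: bs_L2.
Qed.

Lemma V_meas w : inV w -> measv w. Proof. by case. Qed.
Lemma V_L2 w : inV w -> L2v w. Proof. by case. Qed.

Lemma V_test f : test_fun Omega f -> inV (gradv f).
Proof.
move=> tf; split; [exact: measv_gradv|exact: L2v_gradv|move=> e e0; exists f => //].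
apply: le_trans (ltW e0); have := @n2_le 0 (vsub (gradv f) (gradv f)) (gradv f) (lexx 0).
rewrite mul0r; apply => o; rewrite mul0r.
under eq_Rintegral do rewrite vsubE subrr expr0n.
by rewrite Rintegral_cst ?mul0r//; exact: mO.
Qed.

Lemma V_closed w : measv w -> L2v w ->
  (forall e : R, 0 < e -> exists2 v, inV v & n2 (vsub v w) <= e) -> inV w.
Proof.
move=> mw Lw h; split => // e e0; have e4 : 0 < e / 4 by rewrite divr_gt0.
have [v [mv Lv hv] vw] := h _ e4; have [f tf fv] := hv _ e4.
exists f => //; apply: (le_trans (n2_vsub_trans (L2v_gradv tf) Lv Lw)); lra.
Qed.

Lemma V_lincomb a v w : inV v -> inV w -> inV (lincomb a v w).
Proof.
move=> [mv Lv hv] [mw Lw hw]; split; [exact: measv_lincomb|exact: L2v_lincomb|].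
move=> e e0; pose c := 2 * a ^+ 2 + 2.
have c0 : 0 < c by rewrite ltr_wpDl// mulr_ge0// sqr_ge0.
have a20 : 0 <= 2 * a ^+ 2 by rewrite mulr_ge0// sqr_ge0.
have cE : c = 2 * a ^+ 2 + 2 by []; clearbody c.
have [f tf fv] := hv (e / c) (divr_gt0 e0 c0).
have [g tg gw] := hw (e / c) (divr_gt0 e0 c0).
exists (fun x => a * f x + g x); first by apply: test_funD => //; exact: test_funZ.
have Lf : L2v (vsub (gradv f) v) := L2v_lincomb (-1) Lv (L2v_gradv tf).
have Lg : L2v (vsub (gradv g) w) := L2v_lincomb (-1) Lw (L2v_gradv tg).
have E : n2 (vsub (gradv (fun x => a * f x + g x)) (lincomb a v w)) =
    n2 (lincomb a (vsub (gradv f) v) (vsub (gradv g) w)).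
  apply: n2_eq => o; apply: I_eq => x _; congr (_ ^+ 2).
  rewrite vsubE !lincombE; have -> : vco (gradv (fun x => a * f x + g x)) o x =
      a * vco (gradv f) o x + vco (gradv g) o x; last by ring.
  have df i y : derivable f y (ebase i) by apply: smooth_derivable tf.1.
  have dg i y : derivable g y (ebase i) by apply: smooth_derivable tg.1.
  have dc i y : derivable (cst a : T -> R) y (ebase i) by exact: derivable_cst.
  case: o => [i|] //=; rewrite !mxE.
  rewrite (partialD (f := fun y => a * f y)) => [|y|y]; [|exact: (derivableM (dc i y))|exact: dg].
  rewrite (partialM (dc i) (df i)).
  by rewrite /partial derive_cst mulr0 addr0.
rewrite E; have H := n2_lincomb a Lf Lg; apply: (le_trans H).
apply: (@le_trans _ _ (2 * a ^+ 2 * (e / c) + 2 * (e / c))).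
  by apply: lerD; [exact: ler_wpM2l a20 _ _ fv|exact: ler_wpM2l (ler0n _ 2) _ _ gw].
by rewrite -mulrDl -cE mulrC divfK// gt_eqF.
Qed.

Lemma V_ae v w : inV v -> measv w ->
  (forall o, aeon mu Omega (fun x => vco v o x = vco w o x)) -> inV w.
Proof.
move=> [mv Lv hv] mw vw.
have Lw o : L2 mu Omega (vco w o).
  apply: (L2_dom mO _ (Lv o)); first exact: measurable_funTS.
  by have := vw o; apply: aeon_imp => x _ ->.
split; [exact: mw|exact: Lw|move=> e e0].
have [f tf fv] := hv e e0; exists f; first exact: tf.
apply: le_trans fv; rewrite le_eqVlt; apply/orP; left; apply/eqP.
apply: n2_eq => o; apply: I_eq_ae; [exact: mO| | |].
- by apply: measurable_funX; case: (L2v_lincomb (-1) Lw (L2v_gradv tf) o).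
- by apply: measurable_funX; case: (L2v_lincomb (-1) Lv (L2v_gradv tf) o).
by have := vw o; apply: aeon_imp => x _ E; rewrite !vsubE E.
Qed.

Lemma cvg_n2 (v : nat -> vf) w :
  (forall o, I (fun x => (vco (v k) o x - vco w o x) ^+ 2) @[k --> \oo] --> 0) ->
  n2 (vsub (v k) w) @[k --> \oo] --> 0.
Proof.
move=> h.
have h' o : I (fun x => vco (vsub (v k) w) o x ^+ 2) @[k --> \oo] --> 0.
  rewrite (_ : (fun k => _) = (fun k => I (fun x => (vco (v k) o x - vco w o x) ^+ 2)))//.
  by apply/funext => k; apply: I_eq => x _; rewrite vsubE.
rewrite -[0]addr0; apply: cvgD; first exact: (h' None).
have : \sum_(i < N) I (fun x => vco (vsub (v k) w) (Some i) x ^+ 2) @[k --> \oo] -->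
    \sum_(i < N) (0 : R) by apply: cvg_sumR => i; exact: (h' (Some i)).
by rewrite big1_eq.
Qed.

Lemma V_complete (w : nat -> vf) : (forall k, inV (w k)) ->
  (forall e : R, 0 < e -> \forall K \near \oo, forall m n, (K <= m)%N -> (K <= n)%N ->
    n2 (vsub (w m) (w n)) <= e) ->
  exists2 v, inV v & n2 (vsub (w k) v) @[k --> \oo] --> 0.
Proof.
move=> Vw cw.
have [|g hg] := @boolp.choice _ _ (fun (o : option 'I_N) (g : T -> R) =>
    [/\ measurable_fun setT g, L2 mu Omega g &
     I (fun x => (vco (w k) o x - g x) ^+ 2) @[k --> \oo] --> 0]).
  move=> o.
  apply: L2_complete; first exact: mO.
  - by move=> k; exact: V_meas.
  - by move=> k; exact: V_L2.
  - move=> e e0; have := cw _ e0; apply: filterS => K hK m n Km Kn.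
    apply: le_trans (hK m n Km Kn); apply: le_trans (vco_n2 _ o).
    by rewrite le_eqVlt; apply/orP; left; apply/eqP; apply: I_eq => x _; rewrite vsubE.
pose v : vf := (g None, fun x => \row_i g (Some i) x).
have vE o x : vco v o x = g o x by case: o => [i|] //=; rewrite mxE.
have vE' o : vco v o = g o by apply/funext => x.
have cv : n2 (vsub (w k) v) @[k --> \oo] --> 0.
  by apply: cvg_n2 => o; rewrite vE'; have [] := hg o.
exists v => //; apply: V_closed.
- by move=> o; rewrite vE'; case: (hg o).
- by move=> o; rewrite vE'; case: (hg o).
move=> e e0.
move/cvgrPdist_le: cv => /(_ _ e0) [K _ hK].
exists (w K) => //; have := hK K (leqnn K); rewrite /= sub0r normrN.
by apply: le_trans; exact: ler_norm.
Qed.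

(** One function dominates the value and all gradient components simultaneously. In this form norm
    convergence can be used in terms that are nonlinear in the gradient. *)
Lemma V_subseq (w : nat -> vf) v : (forall k, L2v (w k)) -> L2v v ->
  n2 (vsub (w k) v) @[k --> \oo] --> 0 ->
  exists phi : nat -> nat, exists S : T -> R,
    [/\ forall k, (phi k < phi k.+1)%N, intg mu Omega S,
        (forall x, Omega x -> 0 <= S x) &
        aeon mu Omega (fun x => forall k o,
          (vco (w (phi k)) o x - vco v o x) ^+ 2 <= 2^-1 ^+ k * S x)].
Proof.
move=> Lw Lv cw.
pose r k x := (vco (w k) None x - vco v None x) ^+ 2 +
   \sum_i (vco (w k) (Some i) x - vco v (Some i) x) ^+ 2.
have L (k : nat) (o : option 'I_N) : L2 mu Omega (fun x => vco (w k) o x - vco v o x).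
  by apply: (L2B mO); [exact: Lw|exact: Lv].
have ir k : intg mu Omega (r k).
  apply: intgD; [exact: mO|by case: (L k None)|].
  by apply: intg_sum; [exact: mO|move=> i; case: (L k (Some i))].
have r0 k x : Omega x -> 0 <= r k x.
  by move=> _; rewrite addr_ge0 ?sqr_ge0// sumr_ge0// => i _; exact: sqr_ge0.
have Ir : I (r k) @[k --> \oo] --> 0.
  rewrite (_ : (fun k => I (r k)) = (fun k => n2 (vsub (w k) v)))//.
  apply/funext => k; rewrite /r ID; [|exact: mO|by case: (L k None)|]; last first.
    by apply: intg_sum; [exact: mO|move=> i; case: (L k (Some i))].
  rewrite I_sum; [|exact: mO|by move=> i; case: (L k (Some i))].
  rewrite /n2 /D2; congr (_ + _).
    by apply: I_eq => x _; rewrite -(vsubE (w k) v None x).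
  by apply: eq_bigr => i _; apply: I_eq => x _; rewrite -(vsubE (w k) v (Some i) x).
have [phi [S [phim iS S0 hS]]] := cvg0_subseq_dominated mO ir r0 Ir.
exists phi, S; split => //; move: hS; apply: aeon_imp => x Ox h k o.
apply: le_trans (h k); rewrite /r; case: o => [i|].
  rewrite (bigD1 i)//= addrCA lerDl addr_ge0 ?sqr_ge0// sumr_ge0// => j _.
  exact: sqr_ge0.
by rewrite lerDl sumr_ge0// => j _; exact: sqr_ge0.
Qed.

End H10_space.

Lemma cvg_of_sqr (R : realType) (a : nat -> R) (l S : R) :
  (forall k, (a k - l) ^+ 2 <= 2^-1 ^+ k * S) -> a k @[k --> \oo] --> l.
Proof.
move=> h; apply/cvgrPdist_le => e e0.
have c : (2^-1 : R) ^+ k * S @[k --> \oo] --> 0 * S.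
  apply: cvgM; last exact: cvg_cst.
  by apply: cvg_expr; rewrite ger0_norm ?invr_ge0// invf_lt1// ltr1n.
have e2 : 0 < e ^+ 2 by rewrite exprn_gt0.
move: c; rewrite mul0r => /cvgrPdist_le/(_ _ e2); apply: filterS => k.
rewrite sub0r normrN => hk.
rewrite distrC -(ler_pXn2r (_ : 0 < 2)%N) ?nnegrE ?(ltW e0)//.
rewrite real_normK ?num_real//; apply: (le_trans (h k)); apply: le_trans hk.
exact: ler_norm.
Qed.

(** * One-variable calculus: glueing, Lipschitz bounds, extension from an interval *)

Section calculus2.
Context (R : realType).

Lemma is_derive_quot (V : normedModType R) (F : V -> R) (x v : V) (l : R) :
  is_derive x v F l -> h^-1 *: (F (h *: v + x) - F x) @[h --> 0^'] --> l.
Proof. by move=> [dF <-]; exact: dF. Qed.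

(** Both branches have the same value and slope at [x], so it does not matter which of them [G]
    follows at each nearby point. *)
Lemma is_derive_glue (F K G : R -> R) (x l : R) :
  is_derive x 1 F l -> is_derive x 1 K l -> F x = G x -> K x = G x ->
  (\forall s \near x, G s = F s \/ G s = K s) -> is_derive x 1 G l.
Proof.
move=> /is_derive_quot dF /is_derive_quot dK FG KG h; apply: is_derive_cvg.
apply/cvgrPdist_lt => e e0.
have nh : \forall t \near (0 : R)^', G (t *: 1 + x) = F (t *: 1 + x) \/ G (t *: 1 + x) = K (t *: 1 + x).
  have c : (t *: 1 + x : R) @[t --> (0 : R)^'] --> x.
    apply/cvgrPdist_lt => d d0; near=> t.
    rewrite opprD addrCA subrr addr0 normrN [_ *: _]mulr1.
    by near: t; exact: dnbhs0_lt.
  exact: c h.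
move/cvgrPdist_lt: dF => /(_ _ e0) dF; move/cvgrPdist_lt: dK => /(_ _ e0) dK.
near=> t.
have [->|->] : G (t *: 1 + x) = F (t *: 1 + x) \/ G (t *: 1 + x) = K (t *: 1 + x) by near: t.
  by rewrite -FG; near: t.
by rewrite -KG; near: t.
Unshelve. all: by end_near.
Qed.

Lemma is_derive_sqpos (a s : R) :
  is_derive s 1 (fun s : R => Num.max (s - a) 0 ^+ 2) (2 * Num.max (s - a) 0).
Proof.
have dF (t : R) : is_derive t 1 (fun s : R => (s - a) ^+ 2) (2 * (t - a)).
  have h : is_derive t 1 (fun s : R => s - a) (1 - 0) by exact: is_deriveB.
  rewrite (_ : (fun s : R => (s - a) ^+ 2) = (fun s : R => s - a) * (fun s : R => s - a)).
    apply: (is_derive_eq (is_deriveM h h)).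
    by rewrite subr0 /GRing.scale/= mulr1; ring.
  by apply/funext => u; rewrite expr2.
have d0 (t : R) : is_derive t 1 (cst 0 : R -> R) 0 by exact: is_derive_cst.
have [sa|sa|->] := ltgtP s a.
- rewrite (max_idPr _) ?mulr0; last by rewrite subr_le0 ltW.
  apply: (near_eq_is_derive _ (d0 s)); near=> t.
  rewrite (max_idPr _) ?expr0n// subr_le0 ltW//.
  by near: t; exact: lt_nbhsl.
- rewrite (max_idPl _); last by rewrite subr_ge0 ltW.
  apply: (near_eq_is_derive _ (dF s)); near=> t.
  rewrite (max_idPl _)// subr_ge0 ltW//.
  by near: t; exact: lt_nbhsr.
- have dFa : is_derive a 1 (fun s : R => (s - a) ^+ 2) 0.
    by have := dF a; rewrite subrr mulr0.
  rewrite subrr maxxx mulr0; apply: (is_derive_glue dFa (d0 a)).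
  + by rewrite /= subrr maxxx.
  + by rewrite /= subrr maxxx expr0n.
  + by near=> t; case: (leP (t - a) 0) => _; [right; rewrite expr0n|left].
Unshelve. all: by end_near.
Qed.

Lemma mvt_bound (F h : R -> R) (a b L : R) : a <= b ->
  (forall c, a <= c <= b -> is_derive c 1 F (h c)) ->
  (forall c, a <= c <= b -> `|h c| <= L) -> `|F b - F a| <= L * (b - a).
Proof.
rewrite le_eqVlt => /predU1P[<- _ _|ab dF hL]; first by rewrite !subrr normr0 mulr0.
have [||c] := @MVT R F h a b ab.
- by move=> x; rewrite in_itv/= => /andP[ax xb]; apply: dF; rewrite !ltW.
- apply/(continuous_within_itvP _ ab); split.
  + move=> x; rewrite in_itv/= => /andP[ax xb].
    by apply: is_derive_continuous (dF _ _); rewrite !ltW.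
  + apply: cvg_at_right_filter; apply: is_derive_continuous (dF _ _).
    by rewrite lexx ltW.
  + apply: cvg_at_left_filter; apply: is_derive_continuous (dF _ _).
    by rewrite lexx ltW.
rewrite in_itv/= => /andP[ac cb] ->; rewrite normrM (gtr0_norm (_ : 0 < b - a)) ?subr_gt0//.
apply: ler_wpM2r; first by rewrite subr_ge0 ltW.
by apply: hL; rewrite !ltW.
Qed.

Lemma lipschitz_derive (F h : R -> R) (L : R) :
  (forall c : R, is_derive c 1 F (h c)) -> (forall c : R, `|h c| <= L) ->
  forall s t : R, `|F s - F t| <= L * `|s - t|.
Proof.
move=> dF hL s t; have [st|ts] := leP s t.
  by rewrite distrC [`|s - t|]distrC [X in L * X]ger0_norm ?subr_ge0//; exact: mvt_bound.
by rewrite [X in L * X]gtr0_norm ?subr_gt0//; apply: mvt_bound => //; exact: ltW.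
Qed.

Lemma continuous_bounded_itv (h : R -> R) (M : R) : continuous h ->
  exists K : R, forall s, `|s| <= M -> `|h s| <= K.
Proof.
move=> ch; have [K K0 hK] := continuous_modulus (- M) M ch ltr01.
exists (`|h 0| + (1 + K * M ^+ 2)) => s sM.
have M0 : 0 <= M by apply: le_trans sM.
rewrite -[h s](subrK (h 0)) (le_trans (ler_normD _ _))// addrC lerD2l.
apply: le_trans (hK s 0 _ _) _; [by rewrite -ler_norml|by rewrite oppr_le0 M0|].
rewrite subr0 lerD2l ler_wpM2l// -(real_normK (num_real s)).
by rewrite lerXn2r// nnegrE.
Qed.

Definition clamp (a b s : R) := Num.max a (Num.min s b).

Lemma clamp_in (a b s : R) : a <= b -> a <= clamp a b s <= b.
Proof. by move=> ab; rewrite /clamp le_max lexx ge_max ab/= ge_min lexx orbT. Qed.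

Lemma clamp_id (a b s : R) : a <= s <= b -> clamp a b s = s.
Proof. by move=> /andP[as_ sb]; rewrite /clamp (min_idPl sb) (max_idPr as_). Qed.

Lemma clamp_continuous (a b : R) : continuous (clamp a b).
Proof.
move=> s; apply: (@continuous_max _ _ (cst a) (fun s => Num.min s b)).
  exact: cst_continuous.
apply: (@continuous_min _ _ id (cst b)); [exact: cvg_id|exact: cst_continuous].
Qed.

(** The extension is affine outside [[a, b]], with the slopes at the ends; its derivative is [h]
    composed with [clamp]. The chain rule for functions with bounded derivative thus reaches
    functions, such as [E], that are controlled on an interval only. *)
Lemma extend_C1 (F h : R -> R) (a b : R) : a < b ->
  (forall s : R, a <= s <= b -> is_derive s 1 F (h s)) ->
  (forall s : R, a <= s <= b -> {for s, continuous h}) ->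
  exists G g : R -> R, exists L : R, [/\ (forall s : R, is_derive s 1 G (g s)),
    continuous g, (forall s : R, `|g s| <= L) &
    forall s : R, a <= s <= b -> G s = F s /\ g s = h s].
Proof.
move=> ab dF ch.
pose g s := h (clamp a b s).
have ab' := ltW ab.
have cg : continuous g.
  move=> s; apply: (@continuous_comp _ _ _ (clamp a b) h); first exact: clamp_continuous.
  by apply: ch; exact: clamp_in.
have [K hK] := continuous_bounded_itv (Num.max `|a| `|b|) cg.
pose G s := if s < a then F a + h a * (s - a) else if b < s then F b + h b * (s - b) else F s.
have dT c (t : R) : is_derive t 1 (fun s : R => F c + h c * (s - c)) (h c).
  have d1 : is_derive t 1 (fun s : R => s - c) (1 - 0) by exact: is_deriveB.
  have d2 := @is_deriveZ _ _ _ (fun s : R => s - c) (h c) t 1 _ d1.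
  have d3 : is_derive t 1 (cst (F c) : R -> R) 0 by exact: is_derive_cst.
  apply: (is_derive_eq (is_deriveD d3 d2)).
  by rewrite add0r subr0 /GRing.scale/= mulr1.
exists G, g, K; split => // [s|s|s /andP[as_ sb]].
- have [sa|sa|sa] := ltgtP s a.
  + have -> : g s = h a.
      by rewrite /g /clamp (min_idPl _) ?(ltW (lt_trans sa ab))// (max_idPl _)// ltW.
    apply: (near_eq_is_derive _ (dT a s)); near=> t.
    by rewrite /G ifT//; near: t; exact: lt_nbhsl.
  + have [sb|sb|sb] := ltgtP s b.
    * have -> : g s = h s by rewrite /g clamp_id// !ltW.
      have sab : a <= s <= b by rewrite !ltW.
      apply: (near_eq_is_derive _ (dF s sab)); near=> t.
      rewrite /G ifF; last first.
        by apply/negbTE; rewrite -leNgt ltW//; near: t; exact: lt_nbhsr.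
      by rewrite ifF//; apply/negbTE; rewrite -leNgt ltW//; near: t; exact: lt_nbhsl.
    * have -> : g s = h b.
        by rewrite /g /clamp (min_idPr _) ?(ltW sb)// (max_idPr _).
      apply: (near_eq_is_derive _ (dT b s)); near=> t.
      have bt : b < t by near: t; exact: lt_nbhsr.
      by rewrite /G ifF ?bt//; apply/negbTE; rewrite -leNgt ltW// (lt_trans ab).
    * have -> : g s = h b by rewrite /g clamp_id sb// ab' lexx.
      have bab : a <= b <= b by rewrite ab' lexx.
      rewrite sb; apply: (is_derive_glue (dF b bab) (dT b b)).
      - by rewrite /G ltNge ab' /= ltxx.
      - by rewrite /G ltNge ab' /= ltxx subrr mulr0 addr0.
      near=> t; have ta : a < t by near: t; exact: lt_nbhsr.
      by rewrite /G ltNge (ltW ta)/=; case: ifP => _; [right|left].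
  + have -> : g s = h a by rewrite /g clamp_id sa// lexx ab'.
    have aab : a <= a <= b by rewrite ab' lexx.
    rewrite sa; apply: (is_derive_glue (dF a aab) (dT a a)).
    - by rewrite /G ltxx ltNge ab'.
    - by rewrite /G ltxx ltNge ab'/= subrr mulr0 addr0.
    near=> t; have tb : t < b by near: t; exact: lt_nbhsl.
    by rewrite /G [b < t]ltNge (ltW tb)/=; case: ifP => _; [right|left].
- have -> : g s = g (clamp a b s) by rewrite /g [in RHS]clamp_id// clamp_in.
  apply: hK; have /andP[h1 h2] := clamp_in s ab'.
  rewrite ler_norml; apply/andP; split; last first.
    by rewrite le_max (le_trans h2 (ler_norm b)) orbT.
  rewrite lerNl le_max; apply/orP; left; rewrite -normrN.
  by apply: le_trans (ler_norm _); rewrite lerN2.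
- by rewrite /G ltNge as_ /= ltNge sb /= /g clamp_id// as_.
Unshelve. all: by end_near.
Qed.

End calculus2.

(** * Chain rule, positive part and products in the completion *)

Section chain_rule.
Context (R : realType) (N : nat) (Omega : set 'rV[R]_N).
Hypotheses (oO : open Omega) (bO : bounded_set Omega).
Local Notation mu := (lebesgue_rV R N).
Local Notation T := 'rV[R]_N.
Local Notation I f := (\int[mu]_(x in Omega) f x).
Local Notation ebase := (@ebase R N).
Local Notation mO := (measurable_Omega oO).
Local Notation V := (@inV R N Omega).
Local Notation vf := (@vf R N).
Local Notation aeon := (aeon mu Omega).

Lemma dct0 (r : nat -> T -> R) (g : T -> R) :
  (forall k, measurable_fun Omega (r k)) -> intg mu Omega g ->
  aeon (fun x => r k x @[k --> \oo] --> 0) ->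
  aeon (fun x => forall k, `|r k x| <= g x) -> I (r k) @[k --> \oo] --> 0.
Proof.
move=> mr ig c h; have [//|_ ] := @dct _ _ _ mu Omega mO r (fun=> 0) g mr _ c ig h.
by rewrite Rintegral_cst ?mul0r//; exact: mO.
Qed.

Lemma sqr_le_norm (x y : R) : `|x| <= y -> x ^+ 2 <= y ^+ 2.
Proof.
move=> xy; rewrite -real_normK ?num_real// ler_pXn2r// nnegrE//.
exact: le_trans xy.
Qed.

Lemma intg_cst (c : R) : intg mu Omega (fun=> c).
Proof.
apply: (@measurable_bounded_integrable _ _ _ mu (fun=> c) Omega) => //.
- exact: mO.
- exact: Omega_finite.
- by exists `|c|; split => // M cM x _ /=; exact: ltW.
Qed.

Lemma V_lim (w : nat -> vf) v : (forall k, V (w k)) -> measv v -> L2v Omega v ->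
  n2 Omega (vsub (w k) v) @[k --> \oo] --> 0 -> V v.
Proof.
move=> Vw mv Lv c; apply: (V_closed oO) => // e e0.
move/cvgrPdist_le: c => /(_ _ e0) [K _ hK].
exists (w K) => //; have := hK K (leqnn K); rewrite /= sub0r normrN.
by apply: le_trans; exact: ler_norm.
Qed.

Definition vcomp (F h : R -> R) (w : vf) : vf :=
  (fun x => F (w.1 x), fun x => h (w.1 x) *: w.2 x).

Lemma vcompE F h w o x : vco (vcomp F h w) o x =
  if o is Some i then h (w.1 x) * w.2 x 0 i else F (w.1 x).
Proof. by case: o => [i|] //=; rewrite mxE. Qed.

Lemma measv_vcomp F h w : measurable_fun setT F -> measurable_fun setT h ->
  measv w -> measv (vcomp F h w).
Proof.
move=> mF mh mw o.
rewrite (_ : vco _ o = fun x => if o is Some i then h (w.1 x) * w.2 x 0 i else F (w.1 x)).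
  case: o => [i|]; last exact: (measurableT_comp mF (mw None)).
  by apply: measurable_funM; [exact: (measurableT_comp mh (mw None))|exact: (mw (Some i))].
by apply/funext => x; rewrite vcompE.
Qed.

Lemma smooth_poly (Q : {poly R}) (f : T -> R) : smooth f ->
  smooth (fun x => Q.[f x]) /\
  forall i, partial i (fun x => Q.[f x]) = fun x => Q^`().[f x] * partial i f x.
Proof.
move=> sf; have df i x : derivable f x (ebase i) by exact: smooth_derivable.
elim/poly_ind: Q => [|Q c [sQ dQ]].
  split; first by under eq_fun do rewrite horner0; exact: smooth_cst.
  move=> i; apply/funext => x; rewrite deriv0 horner0 mul0r.
  under eq_fun do rewrite horner0.
  exact: derive_cst.
have dQ' i x : derivable (fun x => Q.[f x]) x (ebase i) by exact: smooth_derivable.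
have dp i x : derivable (fun x => Q.[f x] * f x) x (ebase i) by exact: derivableM.
have dc i x : derivable (cst c : T -> R) x (ebase i) by exact: derivable_cst.
rewrite (_ : (fun x => _) = fun x => Q.[f x] * f x + cst c x); last first.
  by apply/funext => x; rewrite !hornerE.
split; first by apply: smoothD; [exact: smoothM|exact: smooth_cst].
move=> i; rewrite (partialD (dp i) (dc i)) (partialM (dQ' i) (df i)) dQ.
apply/funext => x; rewrite [partial i (cst c) x]derive_cst addr0.
rewrite derivD derivC addr0 derivM derivX mulr1 hornerD hornerM hornerX.
by rewrite [LHS]/=; ring.
Qed.

Lemma bs_comp (F : R -> R) (f : T -> R) : continuous F -> F 0 = 0 -> bs f ->
  bs (fun x => F (f x)).
Proof.
move=> cF F0 bf; have [M hM] := bs_bounded bf.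
have [K hK] := continuous_bounded_itv M cF.
apply: (bs_dom (K := K) bf) => [|x|x ->//]; last exact: hK.
by apply: (measurableT_comp _ (bs_meas bf)); exact: continuous_measurable_fun.
Qed.

(** [F(f)] need not be smooth. The derivative [h] is approximated uniformly on the range of [f] by a
    polynomial; the primitive [Q] with [Q(0) = 0] does not enlarge the support, so [Q(f)] is a test
    function close to [F(f)] together with its gradient. *)
Lemma V_chain_test (f : T -> R) (F h : R -> R) : test_fun Omega f ->
  (forall s : R, is_derive s 1 F (h s)) -> continuous h -> F 0 = 0 ->
  V (vcomp F h (gradv f)).
Proof.
move=> tf dF ch F0; have [bf bp] := test_fun_bs tf.
have cF : continuous F by move=> s; exact: is_derive_continuous (dF s).
have [M0 hM0] := bs_bounded bf.
pose M : R := Num.max M0 1; have M1 : 0 < M by rewrite lt_max ltr01 orbT.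
have hM x : `|f x| <= M by rewrite le_max hM0.
clearbody M.
have [K hK] := continuous_bounded_itv M ch.
have mh : measurable_fun setT (fun x => h (f x)).
  by apply: (measurableT_comp _ (bs_meas bf)); exact: continuous_measurable_fun.
have bo o : bs (vco (vcomp F h (gradv f)) o).
  rewrite (_ : vco _ o = fun x => if o is Some i then partial i f x * h (f x) else F (f x)).
    case: o => [i|]; last exact: bs_comp.
    by apply: (bsM (K := K) (bp i) mh) => x; exact: hK.
  by apply/funext => x; rewrite vcompE; case: o => [i|] //=; rewrite mxE mulrC.
apply: (V_closed oO) => [ o| o|e e0]; [exact: bs_meas (bo o)|exact: (bs_L2 oO (bo o))|].
pose m := fine (mu Omega).
have m0 : 0 <= m by rewrite fine_ge0.
have mE : m = fine (mu Omega) by []; clearbody m.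
have D0 := D2_ge0 Omega (gradv f).
(* The coefficients of [eta^2] in the errors of the value and of the gradient; the [+ 1] keeps [c]
   positive, and [eta] is chosen so that [eta^2 c = e]. *)
pose c : R := M ^+ 2 * m + D2 Omega (gradv f) + 1.
have c0 : 0 < c by rewrite ltr_wpDl// addr_ge0// mulr_ge0// sqr_ge0.
have cE : c = M ^+ 2 * m + D2 Omega (gradv f) + 1 by []; clearbody c.
pose eta : R := Num.sqrt (e / c).
have eta0 : 0 < eta by rewrite sqrtr_gt0 divr_gt0.
have eta2 : eta ^+ 2 = e / c by rewrite sqr_sqrtr// ltW// divr_gt0.
clearbody eta.
have [P hP] := weierstrass ch eta0 M1.
have [Q dQ Q0] := poly_primitive P.
have [sQ pQ] := smooth_poly Q tf.1.
have tQ : test_fun Omega (fun x => Q.[f x]).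
  split => //; apply: compactly_containedS tf.2 => x /=.
  by apply: contra => /eqP ->; rewrite Q0.
exists (gradv (fun x => Q.[f x])); first exact: V_test.
have QF (s : R) : `|s| <= M -> `|Q.[s] - F s| <= eta * M.
  have dG (t : R) : is_derive t 1 (fun s => Q.[s] - F s) (P.[t] - h t).
    have dQt : is_derive t 1 (horner Q) P.[t] by rewrite -dQ; exact: is_derive_poly.
    exact: (is_deriveB dQt (dF t)).
  move=> sM; have := sM; rewrite ler_norml => /andP[sM1 sM2].
  have G0 : Q.[0] - F 0 = 0 by rewrite Q0 F0 subrr.
  have hP' (t : R) : - M <= t -> t <= M -> `|P.[t] - h t| <= eta.
    by move=> t1 t2; apply: hP; rewrite ler_norml t1 t2.
  have [s0|s0] := leP 0 s.
    have H : `|Q.[s] - F s - (Q.[0] - F 0)| <= eta * (s - 0).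
      apply: (@mvt_bound _ (fun s => Q.[s] - F s) (fun t => P.[t] - h t)) => // t /andP[t1 t2].
      by apply: hP'; lra.
    move: H; rewrite G0 !subr0 => H; apply: le_trans H _.
    by rewrite ler_wpM2l// ltW.
  have H : `|Q.[0] - F 0 - (Q.[s] - F s)| <= eta * (0 - s).
    apply: (@mvt_bound _ (fun s => Q.[s] - F s) (fun t => P.[t] - h t)) => //; first exact: ltW.
    by move=> t /andP[t1 t2]; apply: hP'; lra.
  move: H; rewrite G0 !sub0r normrN => H; apply: le_trans H _.
  by rewrite ler_wpM2l ?(ltW eta0)//; lra.
have -> : e = eta ^+ 2 * c by rewrite eta2 divfK// gt_eqF.
have Lo o : L2 mu Omega (vco (vsub (gradv (fun x => Q.[f x])) (vcomp F h (gradv f))) o).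
  apply: (L2v_lincomb oO); last by apply: L2v_gradv.
  by move=> o'; exact: (bs_L2 oO (bo o')).
have A : I (fun x => (vsub (gradv (fun x => Q.[f x])) (vcomp F h (gradv f))).1 x ^+ 2) <= eta ^+ 2 * (M ^+ 2 * m).
  apply: (@le_trans _ _ (I (fun=> eta ^+ 2 * M ^+ 2))); last first.
    by rewrite Rintegral_cst -?mE ?mulrA//; exact: mO.
  apply: I_le; [exact: mO|by case: (Lo None)|exact: intg_cst|].
  move=> x _; have := QF _ (hM x); rewrite -(vsubE (gradv (fun x => Q.[f x])) (vcomp F h (gradv f)) None x) => H.
  rewrite -exprMn -[leLHS]real_normK ?num_real// lerXn2r// nnegrE.
  by rewrite mulr_ge0// ltW.
have B : D2 Omega (vsub (gradv (fun x => Q.[f x])) (vcomp F h (gradv f))) <= eta ^+ 2 * D2 Omega (gradv f).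
  rewrite /D2 mulr_sumr; apply: ler_sum => i _.
  have Lf := L2v_gradv oO tf (Some i).
  rewrite -IZ; [|exact: mO|by case: Lf].
  apply: I_le; [exact: mO|by case: (Lo (Some i))|by apply: intgZ; [exact: mO|case: Lf]|].
  move=> x _; have := vsubE (gradv (fun x => Q.[f x])) (vcomp F h (gradv f)) (Some i) x.
  rewrite /= => ->; rewrite !mxE pQ dQ -mulrBl exprMn ler_wpM2r ?sqr_ge0//.
  by rewrite -[leLHS]real_normK ?num_real// lerXn2r ?nnegrE ?(ltW eta0)// hP.
rewrite cE !mulrDr mulr1.
by apply: (le_trans (lerD A B)); have := sqr_ge0 eta; lra.
Qed.

Lemma chain_meas (F h : R -> R) : (forall s : R, is_derive s 1 F (h s)) -> continuous h ->
  measurable_fun setT F /\ measurable_fun setT h.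
Proof.
move=> dF ch; split; apply: continuous_measurable_fun => // s.
exact: is_derive_continuous (dF s).
Qed.

Lemma L2v_vcomp (F h : R -> R) (L : R) w : measurable_fun setT F -> measurable_fun setT h ->
  (forall s, `|F s| <= L * `|s|) -> (forall s, `|h s| <= L) ->
  measv w -> L2v Omega w -> L2v Omega (vcomp F h w).
Proof.
move=> mF mh hF hh mw Lw o.
apply: (L2_dom mO _ (L2Z mO L (Lw o))).
  by apply: measurable_funTS; exact: measv_vcomp.
apply: aeonW => x _; rewrite vcompE normrM; have L0 : 0 <= L by apply: le_trans (hh 0).
rewrite (ger0_norm L0); case: o => [i|]; last exact: hF.
by rewrite normrM ler_wpM2r.
Qed.

(** The uniform linear bounds pass to the limits and dominate the squared differences; [F] need not
    be differentiable, which allows the positive part. *)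
Lemma V_chain_lim (F h : R -> R) (Fk hk : nat -> R -> R) (L : R) w : V w ->
  measurable_fun setT F -> measurable_fun setT h ->
  (forall k, V (vcomp (Fk k) (hk k) w)) ->
  (forall k s, `|Fk k s| <= L * `|s|) -> (forall k s, `|hk k s| <= L) ->
  (forall s, Fk k s @[k --> \oo] --> F s) -> (forall s, hk k s @[k --> \oo] --> h s) ->
  V (vcomp F h w).
Proof.
move=> Vw mF mh Vk FL hL cF chk; have [mw Lw _] := Vw.
have bnd (u : nat -> R) (l c : R) : (forall k, `|u k| <= c) -> u k @[k --> \oo] --> l -> `|l| <= c.
  move=> h1 h2; have h3 : `|u k| @[k --> \oo] --> `|l| by exact: cvg_norm.
  rewrite -(cvg_lim (@Rhausdorff R) h3); apply: limr_le; first exact: cvgP h3.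
  by near=> k.
have hF s : `|F s| <= L * `|s| by apply: bnd (cF s) => k.
have hh s : `|h s| <= L by apply: bnd (chk s) => k.
apply: (V_lim Vk); [exact: measv_vcomp|exact: L2v_vcomp hF hh _ _|].
apply: cvg_n2 => o; apply: (@dct0 _ (fun x => (2 * L) ^+ 2 * vco w o x ^+ 2)).
- move=> k; apply: measurable_funX; apply: measurable_funB; apply: measurable_funTS.
    exact: (V_meas (Vk k)).
  exact: measv_vcomp.
- by apply: intgZ; [exact: mO|case: (Lw o)].
- apply: aeonW => x _.
  have d : (vco (vcomp (Fk k) (hk k) w) o x - vco (vcomp F h w) o x) @[k --> \oo] --> (0 : R).
    rewrite -[0](subrr (vco (vcomp F h w) o x)); apply: cvgB; last exact: cvg_cst.
    under eq_fun do rewrite vcompE; rewrite vcompE; case: o => [i|]; last exact: cF.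
    by apply: cvgM; [exact: chk|exact: cvg_cst].
  by rewrite /= -[0](mulr0 0); under eq_fun do rewrite expr2; exact: (cvgM d d).
apply: aeonW => x _ k; rewrite ger0_norm ?sqr_ge0// -exprMn.
rewrite -[leRHS]real_normK ?num_real//; apply: sqr_le_norm; rewrite normrM ger0_norm; last first.
  by rewrite mulr_ge0//; apply: le_trans (hh 0).
rewrite !vcompE; apply: (le_trans (ler_normB _ _)); case: o => [i|].
  rewrite !normrM; have := ler_wpM2r (normr_ge0 (w.2 x 0 i)) (hL k (w.1 x)).
  have := ler_wpM2r (normr_ge0 (w.2 x 0 i)) (hh (w.1 x)); rewrite /=; lra.
by have := FL k (w.1 x); have := hF (w.1 x); rewrite /=; lra.
Unshelve. all: by end_near.
Qed.

End chain_rule.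

Section chain_rule2.
Context (R : realType) (N : nat) (Omega : set 'rV[R]_N).
Hypotheses (oO : open Omega) (bO : bounded_set Omega).
Local Notation mu := (lebesgue_rV R N).
Local Notation T := 'rV[R]_N.
Local Notation I f := (\int[mu]_(x in Omega) f x).
Local Notation ebase := (@ebase R N).
Local Notation mO := (measurable_Omega oO).
Local Notation V := (@inV R N Omega).
Local Notation vf := (@vf R N).
Local Notation aeon := (aeon mu Omega).

Lemma V_approx w : V w -> exists2 f : nat -> T -> R, (forall k, test_fun Omega (f k)) &
  n2 Omega (vsub (gradv (f k)) w) @[k --> \oo] --> 0.
Proof.
move=> [_ _ h].
have e0 k : 0 < (2^-1 : R) ^+ k by rewrite exprn_gt0// invr_gt0.
pose f k := projT1 (cid2 (h _ (e0 k))).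
have hf k : test_fun Omega (f k) /\ n2 Omega (vsub (gradv (f k)) w) <= 2^-1 ^+ k.
  by rewrite /f; case: cid2.
exists f => [k|]; first by case: (hf k).
apply: (@squeeze_cvgr _ _ _ _ (fun=> 0) (fun k => (2^-1 : R) ^+ k)).
- by near=> k; rewrite n2_ge0/=; case: (hf k).
- exact: cvg_cst.
- by apply: cvg_expr; rewrite ger0_norm ?invr_ge0// invf_lt1// ltr1n.
Unshelve. all: by end_near.
Qed.

Lemma V_chain (F h : R -> R) (L : R) w : V w ->
  (forall s : R, is_derive s 1 F (h s)) -> continuous h -> (forall s, `|h s| <= L) ->
  F 0 = 0 -> V (vcomp F h w).
Proof.
move=> Vw dF ch hL F0; have [mw Lw _] := Vw.
have [mF mh] := chain_meas dF ch.
have lip := lipschitz_derive dF hL.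
have FL s : `|F s| <= L * `|s| by have := lip s 0; rewrite F0 !subr0.
have L0 : 0 <= L by apply: le_trans (hL 0).
have [f tf cf] := V_approx Vw.
have [phi [S [phim iS S0 hS]]] := V_subseq oO (fun k => L2v_gradv oO (tf k)) Lw cf.
pose g k := gradv (f (phi k)).
have Vg k : V (vcomp F h (g k)) by apply: V_chain_test.
apply: (V_lim oO Vg); [exact: measv_vcomp|exact: (L2v_vcomp oO mF mh FL hL)|].
have half (k : nat) : (2^-1 : R) ^+ k <= 1 by rewrite exprn_ile1// ?invr_ge0// invf_le1// ler1n.
apply: cvg_n2 => o.
apply: (@dct0 _ _ _ oO _ (fun x => 2 * L ^+ 2 * S x + 8 * L ^+ 2 * vco w o x ^+ 2)).
- move=> k; apply: measurable_funX; apply: measurable_funB; apply: measurable_funTS.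
    exact: (V_meas (Vg k)).
  exact: measv_vcomp.
- by apply: intgD; [exact: mO|apply: intgZ => //; exact: mO|apply: intgZ; [exact: mO|case: (Lw o)]].
- move: hS; apply: aeon_imp => x _ hx.
  have c o' : vco (g k) o' x @[k --> \oo] --> vco w o' x.
    by apply: cvg_of_sqr => k; exact: hx.
  have d : (vco (vcomp F h (g k)) o x - vco (vcomp F h w) o x) @[k --> \oo] --> (0 : R).
    rewrite -[0](subrr (vco (vcomp F h w) o x)); apply: cvgB; last exact: cvg_cst.
    under eq_fun do rewrite vcompE; rewrite vcompE; case: o => [i|].
      apply: cvgM; last exact: (c (Some i)).
      by apply: continuous_cvg; [exact: ch|exact: (c None)].
    apply: continuous_cvg; last exact: (c None).
    exact: is_derive_continuous (dF _).
  by rewrite /= -[0](mulr0 0); under eq_fun do rewrite expr2; exact: (cvgM d d).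
move: hS; apply: aeon_imp => x Ox hx k; rewrite ger0_norm ?sqr_ge0//.
have hx' o' : (vco (g k) o' x - vco w o' x) ^+ 2 <= S x.
  by apply: le_trans (hx k o') _; rewrite ler_piMl// S0.
have L2S o' : L ^+ 2 * (vco (g k) o' x - vco w o' x) ^+ 2 <= L ^+ 2 * S x.
  by rewrite ler_wpM2l ?sqr_ge0.
rewrite !vcompE; case: o => [i|]; last first.
  have := sqr_le_norm (lip ((g k).1 x) (w.1 x)); rewrite exprMn real_normK ?num_real//.
  have := L2S None; rewrite /=; have := mulr_ge0 (sqr_ge0 L) (sqr_ge0 (w.1 x)).
  by have := mulr_ge0 (sqr_ge0 L) (S0 _ Ox); rewrite -mulrA; lra.
(* This splitting yields the dominating function: the first term is controlled through [S], the
   second by [2 L] times the fixed gradient of [w]. *)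
rewrite (_ : h ((g k).1 x) * _ - _ = h ((g k).1 x) * ((g k).2 x 0 i - w.2 x 0 i) +
   (h ((g k).1 x) - h (w.1 x)) * w.2 x 0 i); last by ring.
set A := _ * _; set C := (_ - _) * _.
have hA : A ^+ 2 <= L ^+ 2 * S x.
  apply: le_trans (L2S (Some i)); rewrite exprMn /=.
  by rewrite ler_wpM2r ?sqr_ge0//; exact: sqr_le_norm.
have hC : C ^+ 2 <= 4 * L ^+ 2 * w.2 x 0 i ^+ 2.
  rewrite exprMn ler_wpM2r ?sqr_ge0//.
  have -> : 4 * L ^+ 2 = (2 * L) ^+ 2 by ring.
  apply: sqr_le_norm; apply: (le_trans (ler_normB _ _)).
  by have := hL ((g k).1 x); have := hL (w.1 x); lra.
have := sqr_ge0 (A - C); move: hA hC; rewrite /= => hA hC.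
have -> : (A - C) ^+ 2 = 2 * A ^+ 2 + 2 * C ^+ 2 - (A + C) ^+ 2 by ring.
by move: hA hC; rewrite -!mulrA; lra.
Qed.

Definition posv (a : R) (w : vf) : vf :=
  vcomp (fun s => Num.max (s - a) 0) (fun s => if a < s then 1 else 0) w.

(** The derivative of [(s - a)^+] jumps at [a]. The approximations [Fk] are differences of squared
    positive parts whose derivative is the ramp from 0 to 1 on [[a, a + v k]]; [a >= 0] ensures
    [Fk 0 = 0], so that zero boundary values are kept. *)
Lemma V_posv (a : R) w : 0 <= a -> V w -> V (posv a w).
Proof.
move=> a0 Vw.
pose p (s : R) : R := Num.max s 0.
have pE (s : R) : (0 <= s /\ p s = s) \/ (s <= 0 /\ p s = 0).
  by rewrite /p; case: (leP s 0) => h; [right|left; split => //; exact: ltW].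
pose n (k : nat) : R := k.+1%:R; pose v (k : nat) : R := k.+1%:R^-1.
have n0 k : 0 < n k by rewrite ltr0n.
have nV k : n k * v k = 1 by rewrite divff// gt_eqF.
have nVp k : 0 < v k by rewrite invr_gt0.
have harm : v k @[k --> \oo] --> (0 : R) := cvg_harmonic.
have big (s : R) : a < s -> \forall k \near \oo, v k <= s - a.
  move=> sa; have sa' : 0 < s - a by rewrite subr_gt0.
  have := @near_infty_natSinv_lt R (PosNum sa'); apply: filterS => k /= hk'.
  exact: ltW.
clearbody n v.
pose Fk k (s : R) : R := 2^-1 * n k * (p (s - a) ^+ 2 - p (s - (a + v k)) ^+ 2).
pose hk k (s : R) : R := n k * (p (s - a) - p (s - (a + v k))).
have dk k (s : R) : is_derive s 1 (Fk k) (hk k s).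
  have d1 := is_derive_sqpos a s; have d2 := is_derive_sqpos (a + v k) s.
  have := @is_deriveZ _ _ _ _ (2^-1 * n k) s 1 _ (is_deriveB d1 d2).
  by move=> H; apply: (is_derive_eq H); rewrite /hk /p /GRing.scale/=; lra.
have cp c : continuous (fun s : R => p (s - c)).
  move=> s; apply: (@continuous_max _ _ (fun s : R => s - c) (fun=> 0)); last exact: cvg_cst.
  by apply: cvgB; [exact: cvg_id|exact: cvg_cst].
have ck k : continuous (hk k).
  by move=> s; apply: cvgM; [exact: cvg_cst|apply: cvgB; exact: cp].
have hk1 k (s : R) : `|hk k s| <= 1.
  rewrite /hk normrM gtr0_norm// -[leRHS](nV k) ler_pM2l// ler_norml.
  have := nVp k.
  case: (pE (s - a)) => -[h1 ->]; case: (pE (s - (a + v k))) => -[h2 ->];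
  move=> h3; apply/andP; split; lra.
have F0 k : Fk k 0 = 0.
  have q (c : R) : 0 <= c -> p (0 - c) = 0.
    by move=> c0; rewrite /p sub0r; apply/max_idPr; rewrite oppr_le0.
  by rewrite /Fk !q ?addr_ge0 ?(ltW (nVp k))// subrr mulr0.
have lipk k s : `|Fk k s| <= 1 * `|s|.
  by have := lipschitz_derive (dk k) (hk1 k) s 0; rewrite F0 !subr0.
apply: (@V_chain_lim _ _ _ oO _ _ Fk hk 1 w Vw) => //.
- by apply: continuous_measurable_fun; exact: (cp a).
- apply: measurable_fun_ifT => //; exact: measurable_fun_ltr.
- by move=> k; apply: V_chain (hk1 k) (F0 k).
- move=> s; have [sa|sa] := leP s a.
    have -> : Num.max (s - a) 0 = 0 by apply/max_idPr; rewrite subr_le0.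
    rewrite (_ : (fun k => Fk k s) = fun=> 0); first exact: cvg_cst.
    apply/funext => k; rewrite /Fk; have := nVp k.
    case: (pE (s - a)) => -[h1 ->]; case: (pE (s - (a + v k))) => -[h2 ->] h3; try by exfalso; lra.
    + have -> : s - a = 0 by lra.
      by rewrite ?expr0n /= ?subr0 ?mulr0.
    + by rewrite ?expr0n /= ?subr0 ?mulr0.
  rewrite max_l ?subr_ge0 ?(ltW sa)//.
  apply: (@cvg_trans _ ((s - a - 2^-1 * v k) @[k --> \oo])).
    apply: near_eq_cvg; near=> k.
    have h : v k <= s - a by near: k; exact: big.
    have := n0 k; have := nV k; rewrite /Fk; move: h (nVp k).
    case: (pE (s - a)) => -[h1 ->]; case: (pE (s - (a + v k))) => -[h2 ->] h3 h4 h5 h6; try by exfalso; lra.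
    + transitivity (n k * v k * (s - a) - 2^-1 * (n k * v k) * v k); last by field.
      by rewrite h5; lra.
    + have -> : v k = s - a by lra.
      have h7 : n k * (s - a) = 1 by rewrite -h5; congr (_ * _); lra.
      transitivity (2^-1 * (n k * (s - a)) * (s - a)); first by rewrite h7; lra.
      by ring.
  have H : (s - a - 2^-1 * v k) @[k --> \oo] --> s - a - 2^-1 * 0.
    by apply: cvgB; [exact: cvg_cst|apply: cvgM; [exact: cvg_cst|exact: harm]].
  by rewrite mulr0 subr0 in H; exact: H.
move=> s; case: ltP => sa.
  apply: (@cvg_trans _ ((1 : R) @[k --> \oo])); last exact: cvg_cst.
  apply: near_eq_cvg; near=> k.
  have h : v k <= s - a by near: k; exact: big.
  have := nV k; rewrite /hk; move: h (nVp k).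
  case: (pE (s - a)) => -[h1 ->]; case: (pE (s - (a + v k))) => -[h2 ->] h3 h4 h5; try by exfalso; lra.
  + by rewrite -h5; ring.
  + by rewrite -h5 subr0; congr (_ * _); lra.
rewrite (_ : (fun k => hk k s) = fun=> 0); first exact: cvg_cst.
apply/funext => k; rewrite /hk; have := nVp k.
case: (pE (s - a)) => -[h1 ->]; case: (pE (s - (a + v k))) => -[h2 ->] h3; try by exfalso; lra.
+ have -> : s - a = 0 by lra.
  by rewrite subrr mulr0.
+ by rewrite subrr mulr0.
Unshelve. all: by end_near.
Qed.

Lemma V_chain_ab (F h : R -> R) (a b : R) w : V w -> a <= 0 <= b -> a < b ->
  aeon (fun x => a <= w.1 x <= b) -> measurable_fun setT F -> measurable_fun setT h ->
  (forall s : R, a <= s <= b -> is_derive s 1 F (h s)) ->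
  (forall s : R, a <= s <= b -> {for s, continuous h}) -> F 0 = 0 -> V (vcomp F h w).
Proof.
move=> Vw ab0 ab wab mF mh dF ch F0.
have [G [g [L [dG cg gL Gg]]]] := extend_C1 ab dF ch.
have G0 : G 0 = 0 by rewrite (Gg _ ab0).1.
apply: (V_ae oO (V_chain Vw dG cg gL G0)); first by apply: measv_vcomp => //; exact: V_meas Vw.
move=> o; move: wab; apply: aeon_imp => x _ wx; rewrite !vcompE.
by have [E1 E2] := Gg _ wx; case: o => [i|]; rewrite ?E1 ?E2.
Qed.

Definition vmul (v w : vf) : vf :=
  (fun x => v.1 x * w.1 x, fun x => v.1 x *: w.2 x + w.1 x *: v.2 x).

(** Polarisation: [2 v w = (v + w)^2 - v^2 - w^2], where each square comes from the chain rule on a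
    bounded interval. *)
Lemma V_mul (M : R) v w : V v -> V w -> aeon (fun x => `|v.1 x| <= M) ->
  aeon (fun x => `|w.1 x| <= M) -> V (vmul v w).
Proof.
move=> Vv Vw vM wM.
pose K : R := 2 * `|M| + 1; have K0 : 0 < K by rewrite /K ltr_wpDl// mulr_ge0.
have KE : K = 2 * `|M| + 1 by []; clearbody K.
have MM : M <= `|M| := ler_norm M.
have sq u : V u -> aeon (fun x => `|u.1 x| <= K) -> V (vcomp (fun s => s ^+ 2) (fun s => 2 * s) u).
  move=> Vu uK; apply: (@V_chain_ab _ _ (- K) K) => //.
  - by rewrite oppr_le0 (ltW K0).
  - by lra.
  - by move: uK; apply: aeon_imp => x _; rewrite ler_norml.
  - exact: measurable_funM.
  - move=> s _; have dX := @is_derive_id R R s 1.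
    rewrite (_ : (fun s : R => s ^+ 2) = (@idfun R) * (@idfun R)).
      by apply: (is_derive_eq (is_deriveM dX dX)); rewrite /GRing.scale/=; lra.
    by apply/funext => t; rewrite expr2.
  - by move=> s _; apply: cvgM; [exact: cvg_cst|exact: cvg_id].
  - by rewrite expr0n.
have Vs := sq _ (V_lincomb oO 1 Vv Vw) _; have V1 := sq _ Vv _; have V2 := sq _ Vw _.
(* The summand [vsub v v] is zero; it is there because [lincomb] scales one argument and must add
   another. *)
have A : V (lincomb 2^-1 (vsub (vcomp (fun s => s ^+ 2) (fun s => 2 * s) (lincomb 1 v w))
   (lincomb 1 (vcomp (fun s => s ^+ 2) (fun s => 2 * s) v)
      (vcomp (fun s => s ^+ 2) (fun s => 2 * s) w))) (vsub v v)).
  apply: (V_lincomb oO); last exact: (V_lincomb oO (-1) Vv Vv).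
  apply: (V_lincomb oO); last apply: Vs.
    apply: (V_lincomb oO); [apply: V1|apply: V2].
      by move: vM; apply: aeon_imp => x _ h; lra.
    by move: wM; apply: aeon_imp => x _ h; lra.
  move: vM wM; apply: aeon_imp2 => x _ h1 h2 /=; rewrite mul1r.
  by apply: (le_trans (ler_normD _ _)); lra.
apply: (V_ae oO A).
  move=> o; have mv := V_meas Vv; have mw := V_meas Vw.
  rewrite (_ : vco _ o = fun x => if o is Some i then v.1 x * w.2 x 0 i + w.1 x * v.2 x 0 i
     else v.1 x * w.1 x); last by apply/funext => x; case: o => [i|] //=; rewrite !mxE.
  case: o => [i|]; last exact: (measurable_funM (mv None) (mw None)).
  by apply: measurable_funD; apply: measurable_funM;
    [exact: (mv None)|exact: (mw (Some i))|exact: (mw None)|exact: (mv (Some i))].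
move=> o; apply: aeonW => x _.
rewrite lincombE !vsubE lincombE !vcompE subrr addr0.
case: o => [i|] /=; rewrite ?mxE ?mul1r; last by field.
by rewrite ?mxE; field.
Qed.

End chain_rule2.

(** * Weak gradients, Sobolev and Poincare inequalities in the completion *)

Section H10_estimates.
Context (R : realType).

Section any_dim.
Context (N : nat) (Omega : set 'rV[R]_N).
Hypotheses (oO : open Omega) (bO : bounded_set Omega).
Local Notation mu := (lebesgue_rV R N).
Local Notation T := 'rV[R]_N.
Local Notation I f := (\int[mu]_(x in Omega) f x).
Local Notation mO := (measurable_Omega oO).
Local Notation V := (@inV R N Omega).
Local Notation vf := (@vf R N).
Local Notation aeon := (aeon mu Omega).

Lemma I_supp (g : T -> R) : (forall x, ~ Omega x -> g x = 0) -> \int[mu]_x g x = I g.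
Proof.
move=> g0; congr fine; rewrite [RHS]integral_mkcond; apply: eq_integral => x _.
by rewrite patchE; case: ifPn => //; rewrite notin_setE => /g0 ->.
Qed.

Lemma test_fun_supp f x : test_fun Omega f -> ~ Omega x -> f x = 0.
Proof.
move=> [_ [_ sub]] Ox; apply: contrapT => /eqP fx; apply: Ox; apply: sub.
exact: subset_closure.
Qed.

Lemma partial_outside f x i : test_fun Omega f -> ~ Omega x -> partial i f x = 0.
Proof.
by move=> tf Ox; apply: partial_supp => h; exact: Ox (tf.2.2 _ h).
Qed.

Lemma V_weak_grad w f i : V w -> test_fun Omega f ->
  I (fun x => w.1 x * partial i f x) = - I (fun x => w.2 x 0 i * f x).
Proof.
move=> Vw tf; have [g tg cg] := V_approx Vw; have Lw := V_L2 Vw.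
have Lf := L2v_gradv oO tf.
have E k : I (fun x => g k x * partial i f x) = - I (fun x => partial i (g k) x * f x).
  have := integration_by_parts_test i (tg k) tf.
  rewrite I_supp => [->|x Ox]; last by rewrite (test_fun_supp (tg k) Ox) mul0r.
  by rewrite I_supp// => x Ox; rewrite (test_fun_supp tf Ox) mulr0.
have c o h : L2 mu Omega h ->
    I (fun x => vco (gradv (g k)) o x * h x) @[k --> \oo] --> I (fun x => vco w o x * h x).
  move=> Lh; apply: (cvg_L2_sqr mO); [by move=> k; exact: L2v_gradv|exact: Lw| |exact: Lh].
  apply: (@squeeze_cvgr _ _ _ _ (fun=> 0) (fun k => n2 Omega (vsub (gradv (g k)) w))).
  - near=> k; rewrite I_sqr_ge0/=; apply: le_trans (vco_n2 _ _ o).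
    by rewrite le_eqVlt; apply/orP; left; apply/eqP; apply: I_eq => x _; rewrite vsubE.
  - exact: cvg_cst.
  - exact: cg.
have c1 := c None _ (Lf (Some i)); have c2 := cvgN (c (Some i) _ (Lf None)).
have E1 : I (fun x => vco (gradv (g k)) None x * vco (gradv f) (Some i) x) @[k --> \oo] -->
    - I (fun x => vco w (Some i) x * vco (gradv f) None x).
  rewrite (_ : (fun k => _) = (fun k => - I (fun x => vco (gradv (g k)) (Some i) x * vco (gradv f) None x))).
    exact: c2.
  apply/funext => k; have := E k; rewrite /vco /= => E'.
  transitivity (I (fun x => g k x * partial i f x)).
    by apply: I_eq => x _; rewrite mxE.
  by rewrite E'; congr (- _); apply: I_eq => x _; rewrite mxE.
have := cvg_unique _ c1 E1; rewrite /vco /= => <-.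
by apply: I_eq => x _; rewrite mxE.
Unshelve. all: by end_near.
Qed.

(** Turns a bound on the ball [D <= 1/4] into a homogeneous quadratic one. If [D = 0], every
    multiple is admissible, which forces [Q <= 0]. *)
Lemma I_homog (D Q C : R) : 0 <= D -> 0 <= C ->
  (forall t : R, t ^+ 2 * D <= 4^-1 -> t ^+ 2 * Q <= C) -> Q <= 4 * C * D.
Proof.
move=> D0 C0 h; have [D0'|] := ltP 0 D.
  have := h (Num.sqrt (4 * D)^-1); rewrite sqr_sqrtr ?invr_ge0 ?mulr_ge0//.
  have -> : (4 * D)^-1 * D = 4^-1 by field; rewrite gt_eqF.
  by move=> /(_ (lexx _)); rewrite mulrC ler_pdivrMr ?mulr_gt0// mulrCA mulrA.
move=> D0'; have {D0' h}h (t : R) : t ^+ 2 * Q <= C.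
  by apply: h; rewrite (_ : D = 0) ?mulr0 ?invr_ge0//; lra.
suff Q0 : Q <= 0 by apply: le_trans Q0 _; rewrite !mulr_ge0.
rewrite leNgt; apply/negP => Q0; have := h (Num.sqrt ((C + 1) / Q)).
rewrite sqr_sqrtr ?divr_ge0 ?addr_ge0 ?(ltW Q0)// divfK ?gt_eqF//; lra.
Qed.

Definition vscale (t : R) (v : vf) : vf := lincomb (t - 1) v v.

Lemma vscaleE t v o x : vco (vscale t v) o x = t * vco v o x.
Proof. by rewrite lincombE; ring. Qed.

Lemma V_scale t v : V v -> V (vscale t v).
Proof. by move=> Vv; exact: V_lincomb. Qed.

Lemma D2_scale t v : V v -> D2 Omega (vscale t v) = t ^+ 2 * D2 Omega v.
Proof.
move=> Vv; rewrite /D2 mulr_sumr; apply: eq_bigr => i _.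
rewrite -IZ; [|exact: mO|by case: (V_L2 Vv (Some i))].
by apply: I_eq => x _; have := vscaleE t v (Some i) x; rewrite /= => ->; rewrite exprMn.
Qed.

(** The normalisation [1/4] leaves room for replacing [v] by test functions whose partial
    derivatives still have square integral at most 1. *)
Definition sobolev_bound (q C : R) := forall v, V v -> D2 Omega v <= 4^-1 ->
  intg mu Omega (fun x => `|v.1 x| `^ q) /\ I (fun x => `|v.1 x| `^ q) <= C.

(** Derived from the Sobolev bound: [s^2 <= 1 + |s|^q] for [q >= 2], and the domain has finite
    measure; [I_homog] restores homogeneity. *)
Lemma poincare (q C0 : R) : 2 <= q -> sobolev_bound q C0 ->
  exists2 C : R, 0 <= C & forall v, V v -> I (fun x => v.1 x ^+ 2) <= C * D2 Omega v.
Proof.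
move=> q2 sb; pose m : R := fine (mu Omega).
have m0 : 0 <= m by rewrite fine_ge0.
have mE : m = fine (mu Omega) by []; clearbody m.
pose C : R := `|C0|; have C0' : 0 <= C by exact: normr_ge0.
have hC : C0 <= C by exact: ler_norm.
clearbody C; exists (4 * (m + C)) => [|v Vv]; first by rewrite mulr_ge0// addr_ge0.
apply: I_homog; [exact: D2_ge0|exact: addr_ge0|move=> t ht].
have Vt := V_scale t Vv; rewrite -(D2_scale t Vv) in ht.
have [i1 h1] := sb _ Vt ht.
have -> : t ^+ 2 * I (fun x => v.1 x ^+ 2) = I (fun x => (vscale t v).1 x ^+ 2).
  rewrite -IZ; [|exact: mO|by case: (V_L2 Vv None)].
  by apply: I_eq => x _; have := vscaleE t v None x; rewrite /= => ->; rewrite exprMn.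
apply: (@le_trans _ _ (I (fun x => 1 + `|(vscale t v).1 x| `^ q))).
  apply: I_le; [exact: mO|by case: (V_L2 Vt None)| |].
    by apply: intgD => //; [exact: mO|exact: intg_cst].
  move=> x _; set s := (vscale t v).1 x; rewrite -real_normK ?num_real//.
  have [s1|s1] := leP `|s| 1.
    apply: (@le_trans _ _ 1); first by rewrite exprn_ile1.
    by rewrite lerDl powR_ge0.
  rewrite -powR_mulrn//; apply: (@le_trans _ _ (`|s| `^ q)); last by rewrite lerDr.
  by apply: ler_powR => //; exact: ltW.
rewrite ID; [|exact: mO|exact: intg_cst|exact: i1].
rewrite Rintegral_cst; last exact: mO.
by rewrite mul1r -mE; lra.
Qed.

(** Two cases: if [f <= s^(q - th)] the product is at most [s^q]; otherwise
    [s^th <= f^(th/(q - th))] and it is at most the power of [f]. *)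
Lemma young_split (f s th q : R) : 0 <= f -> 0 <= s -> 0 < th -> th < q ->
  f * s `^ th <= f `^ (q / (q - th)) + s `^ q.
Proof.
move=> f0 s0 th0 thq; have qt : 0 < q - th by rewrite subr_gt0.
have [h|h] := leP f (s `^ (q - th)).
  have : f * s `^ th <= s `^ (q - th) * s `^ th by rewrite ler_wpM2r// powR_ge0.
  rewrite -powRD ?subrK; last by rewrite (gt_eqF (lt_trans th0 thq)).
  by move=> H; apply: (le_trans H); rewrite lerDr powR_ge0.
have H : s `^ th <= f `^ (th / (q - th)).
  have -> : s `^ th = (s `^ (q - th)) `^ (th / (q - th)).
    by rewrite -powRrM; congr (_ `^ _); field; rewrite gt_eqF.
  apply: ge0_ler_powR; rewrite ?nnegrE ?powR_ge0//; last exact: ltW.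
  by rewrite divr_ge0// ltW.
have f0' : 0 < f by apply: le_lt_trans h; exact: powR_ge0.
apply: (@le_trans _ _ (f * f `^ (th / (q - th)))); first by rewrite ler_wpM2l.
rewrite -{1}[f](powRr1 f0) -powRD; last by rewrite (gt_eqF f0') implybT.
rewrite (_ : 1 + th / (q - th) = q / (q - th)); last by field; rewrite gt_eqF.
by rewrite lerDl powR_ge0.
Qed.

(** The exponent [q/(q - th)] is conjugate to [q/th]. For [q = 2N/(N-2)] it equals
    [2N/(2N - th (N-2))], the threshold imposed on the source. *)
Lemma source_bound (q C0 th : R) (f : T -> R) : 0 < th < q -> sobolev_bound q C0 ->
  measurable_fun Omega f -> (forall x, 0 <= f x) ->
  intg mu Omega (fun x => f x `^ (q / (q - th))) ->
  exists2 C : R, 0 <= C & forall v, V v -> D2 Omega v <= 4^-1 ->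
    intg mu Omega (fun x => f x * `|v.1 x| `^ th) /\
    I (fun x => f x * `|v.1 x| `^ th) <= C.
Proof.
move=> /andP[th0 thq] sb mf f0 fi.
exists `|I (fun x => f x `^ (q / (q - th))) + C0| => // v Vv Dv.
have [i1 h1] := sb v Vv Dv.
have h x : f x * `|v.1 x| `^ th <= f x `^ (q / (q - th)) + `|v.1 x| `^ q by exact: young_split.
have i2 : intg mu Omega (fun x => f x * `|v.1 x| `^ th).
  apply: (intg_dom_le mO _ (intgD mO fi i1)).
    apply: measurable_funM => //.
    apply: (measurableT_comp (f := fun s : R => s `^ th)); first exact: measurable_powR.
    apply: measurableT_comp => //.
    by apply: measurable_funTS; exact: (V_meas Vv None).
  by move=> x _; rewrite ger0_norm// mulr_ge0// powR_ge0.
split => //; apply: le_trans (ler_norm _).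
apply: (@le_trans _ _ (I (fun x => f x `^ (q / (q - th)) + `|v.1 x| `^ q))).
  by apply: I_le => [|||x _]; [exact: mO|exact: i2|apply: intgD => //; exact: mO|exact: h].
by rewrite ID//; [rewrite lerD2l|exact: mO].
Qed.

End any_dim.

(** Test functions at squared distance at most [1/8] from [v] have partial derivatives of square
    integral at most [2/8 + 2/4 < 1], so [sobolev_test] applies to them; Fatou's lemma along an
    almost everywhere convergent subsequence gives the limit. *)
Lemma sobolev_H10 n (Omega : set 'rV[R]_n.+3) : open Omega -> bounded_set Omega ->
  exists C : R, sobolev_bound Omega (2 * n.+3%:R / n.+1%:R) C.
Proof.
move=> oO bO; have [C C0 hC] := sobolev_test R n; exists C => v Vv Dv.
have mO := measurable_Omega oO.
set q := 2 * _ / _; have q1 : 1 < q.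
  by rewrite /q ltr_pdivlMr// mul1r -natrM ltr_nat; lia.
have cq : continuous (fun s : R => `|s| `^ q).
  by move=> s; exact: is_derive_continuous (is_derive_normpow s q1).
have mq : measurable_fun setT (fun s : R => `|s| `^ q) by exact: continuous_measurable_fun.
have Lv := V_L2 Vv.
have [f tf cf] := V_approx Vv.
have e8 : (0 : R) < 8^-1 by rewrite invr_gt0.
have [K _ hK] : \forall k \near \oo, n2 Omega (vsub (gradv (f k)) v) <= 8^-1.
  by move/cvgrPdist_le: cf => /(_ _ e8); apply: filterS => k; rewrite sub0r normrN; apply: le_trans (ler_norm _).
pose g k := f (k + K)%N.
have tg k : test_fun Omega (g k) := tf _.
have cg : n2 Omega (vsub (gradv (g k)) v) @[k --> \oo] --> 0.
  by apply: (@cvg_subseq _ (fun k => n2 Omega (vsub (gradv (f k)) v)) 0 (fun k => k + K)%N).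
have Lg k := L2v_gradv oO (tg k).
have Dg k i : \int[lebesgue_rV R n.+3]_x (partial i (g k) x) ^+ 2 <= 1.
  rewrite (I_supp (Omega := Omega)) => [|x Ox]; last by rewrite (partial_outside i (tg k) Ox) expr0n.
  have Ld : L2v Omega (vsub (gradv (g k)) v) by exact: (L2v_lincomb oO).
  have := I_sqrD mO (Ld (Some i)) (Lv (Some i)).
  have -> : \int[lebesgue_rV R n.+3]_(x in Omega) (vco (vsub (gradv (g k)) v) (Some i) x + vco v (Some i) x) ^+ 2 =
      \int[lebesgue_rV R n.+3]_(x in Omega) (partial i (g k) x) ^+ 2.
    by apply: I_eq => x _; rewrite vsubE subrK /= mxE.
  move=> H; apply: (le_trans H).
  have h1 := le_trans (vco_n2 Omega (vsub (gradv (g k)) v) (Some i)) (hK (k + K)%N (leq_addl _ _)).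
  have h2 : \int[lebesgue_rV R n.+3]_(x in Omega) vco v (Some i) x ^+ 2 <= 4^-1.
    apply: le_trans Dv; rewrite /D2 (bigD1 i)//= lerDl sumr_ge0// => j _.
    exact: I_sqr_ge0.
  lra.
have [phi [S [phim iS S0 hS]]] := V_subseq oO Lg Lv cg.
apply: (@fatouR _ _ _ _ _ mO (fun k x => `|g (phi k) x| `^ q)).
- by apply: (measurableT_comp mq); apply: measurable_funTS; exact: (V_meas Vv None).
- move=> k; apply: (@integrableS _ _ _ _ setT) => //.
  apply: bs_intg; apply: (bs_comp (F := fun s => `|s| `^ q)) => //.
    by rewrite normr0 powR0// gt_eqF// (lt_trans ltr01).
  by case: (test_fun_bs (tg (phi k))).
- by move=> x _; exact: powR_ge0.
- by move=> k x _; exact: powR_ge0.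
- move=> k; apply: le_trans (hC Omega _ (tg (phi k)) (Dg _)).
  rewrite le_eqVlt; apply/orP; left; apply/eqP; apply/esym; apply: I_supp => x Ox.
  by rewrite (test_fun_supp (tg _) Ox) normr0 powR0// gt_eqF// (lt_trans ltr01).
move: hS; apply: aeon_imp => x _ hx e e0.
have c : `|g (phi k) x| `^ q @[k --> \oo] --> `|v.1 x| `^ q.
  have c0 : g (phi k) x @[k --> \oo] --> v.1 x.
    by apply: cvg_of_sqr => k; exact: (hx k None).
  exact: (cvg_comp _ (fun s : R => `|s| `^ q) c0 (cq _)).
move/cvgrPdist_le: c => /(_ _ e0); apply: filterS => k.
by rewrite ler_norml => /andP[_]; lra.
Qed.

End H10_estimates.

(** * Monotone problems *)

Lemma discriminant (R : realType) (A B E : R) : 0 <= A ->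
  (forall t : R, 0 <= t ^+ 2 * A + 2 * t * B + E) -> B ^+ 2 <= A * E.
Proof.
move=> A0 h; have [A1|] := ltP 0 A.
  have := h (- (B / A)); rewrite sqrrN.
  have -> : (B / A) ^+ 2 * A + 2 * (- (B / A)) * B + E = E - B ^+ 2 / A.
    by field; rewrite gt_eqF.
  by rewrite subr_ge0 ler_pdivrMr// mulrC.
move=> A1; have {A0 A1}A0 : A = 0 by lra.
rewrite A0 mul0r; have [->|B0] := eqVneq B 0; first by rewrite expr0n.
(* For [A = 0] the expression is affine in [t], and this [t] gives it the value [-1]. *)
have := h (- ((E + 1) / (2 * B))); rewrite A0 mulr0 add0r.
have -> : 2 * - ((E + 1) / (2 * B)) * B + E = - 1 by field; rewrite B0.
by rewrite ler0N1.
Qed.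

(** * Riesz representation and a contraction principle for a semi-inner product, [cmb a x y] being
    [a x + y] *)

Section hilbert.
Context (R : realType) (X : Type) (P : X -> Prop) (cmb : R -> X -> X -> X) (q : X -> X -> R).
Local Notation sub x y := (cmb (-1) y x).
Local Notation qd x y := (q (sub x y) (sub x y)).
Hypotheses (Pc : forall a x y, P x -> P y -> P (cmb a x y))
  (qC : forall x y, P x -> P y -> q x y = q y x)
  (ql : forall a x y z, P x -> P y -> P z -> q (cmb a x y) z = a * q x z + q y z)
  (q_ge0 : forall x, P x -> 0 <= q x x)
  (q_complete : forall s : nat -> X, (forall k, P (s k)) ->
    (forall e : R, 0 < e -> exists K, forall m n, (K <= m)%N -> (K <= n)%N -> qd (s m) (s n) <= e) ->
    exists2 x, P x & forall e : R, 0 < e -> exists K, forall k, (K <= k)%N -> qd (s k) x <= e).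

Lemma q_linr a x y z : P x -> P y -> P z -> q z (cmb a x y) = a * q z x + q z y.
Proof.
by move=> Px Py Pz; rewrite qC ?ql// 1?[q x z]qC// 1?[q y z]qC//; exact: Pc.
Qed.

Lemma q_sq a x y : P x -> P y ->
  q (cmb a x y) (cmb a x y) = a ^+ 2 * q x x + 2 * a * q x y + q y y.
Proof.
move=> Px Py; have Pxy := Pc a Px Py.
by rewrite ql// !q_linr// [q y x]qC//; ring.
Qed.

Lemma q_cauchy_schwarz x y : P x -> P y -> q x y ^+ 2 <= q x x * q y y.
Proof.
move=> Px Py; apply: discriminant; first exact: q_ge0.
by move=> t; rewrite -q_sq//; apply/q_ge0/Pc.
Qed.

Lemma qd_trans x y z : P x -> P y -> P z -> qd x z <= 2 * qd x y + 2 * qd y z.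
Proof.
move=> Px Py Pz; have := q_ge0 (Pc (-2) Py (Pc 1 Px Pz)).
rewrite !q_sq// ?q_linr//; do ?exact: Pc.
rewrite [q y x]qC// [q z x]qC// [q z y]qC//; lra.
Qed.

Lemma qdC x y : P x -> P y -> qd x y = qd y x.
Proof. by move=> Px Py; rewrite !q_sq// [q y x]qC//; ring. Qed.

Section riesz.
Variables (L : X -> R) (C : R).
Hypotheses (Ll : forall a x y, P x -> P y -> L (cmb a x y) = a * L x + L y)
  (Lb : forall x, P x -> L x ^+ 2 <= C * q x x).

(* The representative minimises q(x,x) - 2 L(x); minimising sequences are
   Cauchy by the parallelogram identity. *)
Lemma riesz x0 : P x0 -> exists2 x, P x & forall v, P v -> q x v = L v.
Proof.
move=> Px0; pose J x := q x x - 2 * L x.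
pose S := [set J x | x in P].
have lbS : lbound S (- `|C|).
  move=> _ [x Px <-]; rewrite /J.
  have h := Lb Px; have q0 := q_ge0 Px.
  have h1 : L x ^+ 2 <= `|C| * q x x by apply: le_trans h _; rewrite ler_wpM2r// ler_norm.
  have [l0|l0] := leP (L x) 0; first by have := normr_ge0 C; lra.
  suff : 2 * L x <= `|C| + q x x by lra.
  rewrite -(ler_pXn2r (_ : 0 < 2)%N)// ?nnegrE ?addr_ge0 ?mulr_ge0 ?(ltW l0)//.
  by have := sqr_ge0 (`|C| - q x x); rewrite sqrrB sqrrD exprMn; lra.
have iS : has_inf S by split; [exists (J x0), x0|exists (- `|C|)].
pose m := inf S.
have mJ x : P x -> m <= J x by move=> Px; apply: ge_inf; [exact: iS.2|exists x].
have [|s hs] := @boolp.choice _ _ (fun (k : nat) x => P x /\ J x <= m + k.+1%:R^-1).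
  move=> k; have [|_ [x Px <-] hx] := @inf_adherent _ S k.+1%:R^-1 _ iS; first by rewrite invr_gt0.
  by exists x; split => //; exact: ltW.
have Ps k : P (s k) by case: (hs k).
have Js k : J (s k) <= m + k.+1%:R^-1 by case: (hs k).
have inv_small (e : R) : 0 < e -> exists K : nat, forall k, (K <= k)%N -> k.+1%:R^-1 <= e.
  move=> e0; have [K _ hK] := @near_infty_natSinv_lt R (PosNum e0).
  by exists K => k Kk; exact: ltW (hK k Kk).
have cs (e : R) : 0 < e -> exists K, forall m n, (K <= m)%N -> (K <= n)%N -> qd (s m) (s n) <= e.
  move=> e0; have [K hK] := inv_small (e / 4) (divr_gt0 e0 (ltr0n _ 4)).
  exists K => i j Ki Kj; have := hK i Ki; have := hK j Kj.
  (* The midpoint of [s i] and [s j], written with [cmb]; its value of [J] is at least the infimum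
     [m]. *)
  have Pm := Pc 2^-1 (Ps i) (Pc (- 2^-1) (Ps j) (Ps j)).
  have := mJ _ Pm; have := Js i; have := Js j; rewrite /J.
  have Pjj := Pc (- 2^-1) (Ps j) (Ps j).
  rewrite !Ll// !q_sq// q_linr// [q (s j) (s i)]qC//.
  clear hK Js mJ hs; clearbody m.
  move: (q (s j) (s j)) (q (s i) (s i)) (q (s i) (s j)) (L (s i)) (L (s j)) i.+1%:R^-1 j.+1%:R^-1 => a b c f g h k.
  rewrite !expr2; lra.
have [x Px cx] := q_complete Ps cs.
exists x => // v Pv; have V0 := q_ge0 Pv.
(* For all [t], [J (s k + t v) >= m >= J (s k) - 1/(k+1)]. This is a nonnegative quadratic in [t],
   and its discriminant gives the Euler equation up to an error. *)
have eul k : (q (s k) v - L v) ^+ 2 <= q v v * k.+1%:R^-1.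
  apply: discriminant => // t; have := mJ _ (Pc t Pv (Ps k)); have := Js k.
  rewrite /J Ll// q_sq// [q v (s k)]qC//.
  clear Js mJ hs; clearbody m; move: (q v v) (q (s k) v) (q (s k) (s k)) (L v) (L (s k)) k.+1%:R^-1 => a b c f g h; lra.
apply/eqP; rewrite -subr_eq0 -sqrf_eq0 eq_le sqr_ge0 andbT.
apply/ler_addgt0Pr => e e0; rewrite add0r.
have c0 : 0 < 4 * (q v v + 1) by rewrite mulr_gt0// ltr_wpDl.
have [K1 hK1] := inv_small _ (divr_gt0 e0 c0); have [K2 hK2] := cx _ (divr_gt0 e0 c0).
have h1 := hK1 _ (leq_maxl K1 K2); have h2 := hK2 _ (leq_maxr K1 K2).
set k := maxn K1 K2 in h1 h2; have hk := eul k.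
have h3 := q_cauchy_schwarz (Pc (-1) Px (Ps k)) Pv.
have h4 : q (sub (s k) x) v = q (s k) v - q x v by rewrite ql//; ring.
rewrite h4 in h3.
set d := e / _ in h1 h2 *; have dE : d * (4 * (q v v + 1)) = e by rewrite divfK// gt_eqF.
have h5 : q v v * k.+1%:R^-1 <= q v v * d by rewrite ler_wpM2l.
have h6 : qd (s k) x * q v v <= d * q v v by rewrite ler_wpM2r.
have := sqr_ge0 ((q (s k) v - L v) + (q (s k) v - q x v)).
have d0 : 0 < d by exact: divr_gt0.
clear h1 h2; clearbody d; move: h3 h5 h6 hk dE d0; move: (q (s k) v) (q x v) (L v) (qd (s k) x) d k.+1%:R^-1 (q v v) => a b c f g h i.
lra.
Qed.

End riesz.

(** Banach's iteration. In its first argument [K] has Lipschitz constant [1/2] for the norm of [q],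
    hence [4^-1] for squares. Each step freezes this argument and solves a linear problem by
    [riesz]; the iterates are geometrically Cauchy. *)
Lemma nonlinear_riesz (K : X -> X -> R) (G : X -> R) x0 : P x0 ->
  (forall w a x y, P w -> P x -> P y -> K w (cmb a x y) = a * K w x + K w y) ->
  (forall w, P w -> exists C, forall v, P v -> K w v ^+ 2 <= C * q v v) ->
  (forall w1 w2 v, P w1 -> P w2 -> P v ->
    (K w1 v - K w2 v) ^+ 2 <= 4^-1 * qd w1 w2 * q v v) ->
  (forall a x y, P x -> P y -> G (cmb a x y) = a * G x + G y) ->
  (exists C, forall v, P v -> G v ^+ 2 <= C * q v v) ->
  exists2 w, P w & forall v, P v -> q w v + K w v = G v.
Proof.
move=> Px0 Kl Kb Kc Gl [C1 Gb].
have [|S hS] := @boolp.choice _ _ (fun w w' => P w -> P w' /\ forall v, P v -> q w' v = G v - K w v).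
  move=> w; have [Pw|nPw] := pselect (P w); last by exists w.
  have [C2 Kbw] := Kb w Pw.
  have [|v Pv|w' Pw' hw'] := @riesz (fun v => G v - K w v) (2 * C1 + 2 * C2) _ _ x0 Px0.
  - by move=> a x y Px Py; rewrite Gl// Kl//; ring.
  - have := sqr_ge0 (G v + K w v); have := Gb v Pv; have := Kbw v Pv; lra.
  - by exists w'.
pose s k := iter k S x0.
have Ps k : P (s k) by elim: k => //= k IH; case: (hS _ IH).
have sE k v : P v -> q (s k.+1) v = G v - K (s k) v by have [_] := hS _ (Ps k); apply.
have Pd i j := Pc (-1) (Ps j) (Ps i).
have step i j : qd (s i.+1) (s j.+1) <= 4^-1 * qd (s i) (s j).
  have h := Kc _ _ _ (Ps j) (Ps i) (Pd i.+1 j.+1).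
  have E : qd (s i.+1) (s j.+1) = K (s j) (sub (s i.+1) (s j.+1)) - K (s i) (sub (s i.+1) (s j.+1)).
    by rewrite ql// !sE//; ring.
  rewrite -E [qd (s j) (s i)]qdC// in h.
  have := q_ge0 (Pd i.+1 j.+1); have := q_ge0 (Pd i j).
  move: h; move: (qd (s i.+1) (s j.+1)) (qd (s i) (s j)) => a b h b0.
  rewrite le_eqVlt => /predU1P[<-|a0]; first by rewrite mulr_ge0.
  by rewrite expr2 in h; rewrite -(ler_pM2r a0).
pose c := qd (s 1%N) (s 0%N); have c0 : 0 <= c by exact: q_ge0.
have st k : qd (s k.+1) (s k) <= c * 4^-1 ^+ k.
  elim: k => [|k IH]; first by rewrite expr0 mulr1.
  by apply: le_trans (step _ _) _; rewrite exprS mulrCA ler_pM2l.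
have bd j k : qd (s (j + k)%N) (s k) <= 4 * c * 4^-1 ^+ k.
  elim: j k => [|j IH] k.
    rewrite add0n q_sq//.
    have -> : (-1) ^+ 2 * q (s k) (s k) + 2 * -1 * q (s k) (s k) + q (s k) (s k) = 0 by ring.
    by rewrite !mulr_ge0// exprn_ge0// invr_ge0.
  have := qd_trans (Ps (j.+1 + k)%N) (Ps k.+1) (Ps k); have := st k; have := IH k.+1.
  have -> : (j + k.+1 = j.+1 + k)%N by lia.
  by rewrite exprS; lra.
have small (e : R) : 0 < e -> exists K0 : nat, forall k, (K0 <= k)%N -> 4 * c * 4^-1 ^+ k <= e.
  move=> e0; have H : 4 * c * 4^-1 ^+ k @[k --> \oo] --> 4 * c * 0.
    apply: cvgM; [exact: cvg_cst|apply: cvg_expr].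
    by rewrite ger0_norm ?invr_ge0// invf_lt1// ltr1n.
  move: H; rewrite mulr0 => /cvgrPdist_le/(_ _ e0) [K0 _ hK0]; exists K0 => k Kk.
  by have := hK0 k Kk; rewrite /= sub0r normrN; apply: le_trans; exact: ler_norm.
have cs (e : R) : 0 < e -> exists K, forall m n, (K <= m)%N -> (K <= n)%N -> qd (s m) (s n) <= e.
  move=> e0; have [K0 hK0] := small e e0; exists K0 => i j.
  wlog ij : i j / (j <= i)%N.
    move=> H Ki Kj; have [ij|ij] := leqP j i; first exact: H.
    by rewrite qdC//; apply: H => //; exact: ltnW.
  move=> Ki Kj; rewrite -(subnK ij); exact: le_trans (bd _ _) (hK0 _ Kj).
have [w Pw cw] := q_complete Ps cs.
exists w => // v Pv; apply/eqP; rewrite -subr_eq0 -sqrf_eq0 eq_le sqr_ge0 andbT.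
apply/ler_addgt0Pr => e e0; rewrite add0r; have V0 := q_ge0 Pv.
have c1 : 0 < 4 * (q v v + 1) by rewrite mulr_gt0// ltr_wpDl.
have [k0 hk] := cw _ (divr_gt0 e0 c1).
have h1 := hk k0 (leqnn _); have h2 := hk k0.+1 (leqnSn _).
have h3 := q_cauchy_schwarz (Pc (-1) Pw (Ps k0.+1)) Pv.
have h4 := Kc _ _ _ (Ps k0) Pw Pv.
have h5 : q (sub (s k0.+1) w) v = q (s k0.+1) v - q w v by rewrite ql//; ring.
rewrite h5 (sE _ _ Pv) in h3.
set d := e / _ in h1 h2 *; have dE : d * (4 * (q v v + 1)) = e by rewrite divfK// gt_eqF.
have d0 : 0 < d by exact: divr_gt0.
have h6 : qd (s k0) w * q v v <= d * q v v by rewrite ler_wpM2r.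
have h7 : qd (s k0.+1) w * q v v <= d * q v v by rewrite ler_wpM2r.
have := sqr_ge0 ((G v - K (s k0) v - q w v) - (K (s k0) v - K w v)).
move: h3 h4 h6 h7 dE d0; rewrite -mulrA; clear h1 h2 h5; clearbody d.
move: (K (s k0) v) (K w v) (q w v) (G v) (qd (s k0) w * q v v) (qd (s k0.+1) w * q v v) d (q v v) => a b c' f g h i j.
lra.
Qed.

End hilbert.

(** * The bilinear form of the diffusion *)

Section integral_forms.
Context (R : realType) (N : nat) (Omega : set 'rV[R]_N).
Hypotheses (oO : open Omega) (bO : bounded_set Omega).
Local Notation mu := (lebesgue_rV R N).
Local Notation T := 'rV[R]_N.
Local Notation I f := (\int[mu]_(x in Omega) f x).
Local Notation mO := (measurable_Omega oO).
Local Notation V := (@inV R N Omega).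
Local Notation vf := (@vf R N).
Local Notation aeon := (aeon mu Omega).
Local Notation L2 := (L2 mu Omega).

Lemma I_cauchy_schwarz (f g : T -> R) : L2 f -> L2 g ->
  I (fun x => f x * g x) ^+ 2 <= I (fun x => f x ^+ 2) * I (fun x => g x ^+ 2).
Proof.
move=> Lf Lg; rewrite mulrC; apply: discriminant; first exact: I_sqr_ge0.
move=> t; have [_ f2] := Lf; have [_ g2] := Lg; have fg := L2M mO Lf Lg.
suff -> : t ^+ 2 * I (fun x => g x ^+ 2) + 2 * t * I (fun x => f x * g x) + I (fun x => f x ^+ 2)
   = I (fun x => (f x + t * g x) ^+ 2) by exact: I_sqr_ge0.
rewrite -!IZ//; try exact: mO.
have i1 : intg mu Omega (fun x => t ^+ 2 * g x ^+ 2) by apply: intgZ => //; exact: mO.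
have i2 : intg mu Omega (fun x => 2 * t * (f x * g x)) by apply: intgZ => //; exact: mO.
rewrite -ID//; last exact: mO.
rewrite -ID//; [|exact: mO|by apply: intgD => //; exact: mO].
by apply: I_eq => x _; ring.
Qed.

Lemma cvg_sqr_le (a e : nat -> R) (l C : R) : (forall k, (a k - l) ^+ 2 <= C * e k) ->
  e k @[k --> \oo] --> 0 -> a k @[k --> \oo] --> l.
Proof.
move=> h ce; apply/cvgrPdist_le => d d0.
have : C * e k @[k --> \oo] --> C * 0 by apply: cvgM => //; exact: cvg_cst.
have d2 : 0 < d ^+ 2 by rewrite exprn_gt0.
rewrite mulr0 => /cvgrPdist_le/(_ _ d2); apply: filterS => k.
rewrite sub0r normrN => hk; rewrite distrC -(ler_pXn2r (_ : 0 < 2)%N) ?nnegrE ?(ltW d0)//.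
rewrite real_normK ?num_real//; apply: (le_trans (h k)); apply: le_trans hk.
exact: ler_norm.
Qed.

Definition gsq (w : vf) (x : T) : R := dotv (w.2 x) (w.2 x).

Lemma gsqE w x : gsq w x = \sum_i w.2 x 0 i ^+ 2.
Proof. by rewrite /gsq /dotv; apply: eq_bigr => i _; rewrite expr2. Qed.

Lemma gsq_ge0 w x : 0 <= gsq w x.
Proof. by rewrite gsqE sumr_ge0// => i _; exact: sqr_ge0. Qed.

Lemma intg_gsq w : L2v Omega w -> intg mu Omega (gsq w).
Proof.
move=> Lw; rewrite (_ : gsq w = fun x => \sum_i w.2 x 0 i ^+ 2).
  by apply: intg_sum; [exact: mO|move=> i; case: (Lw (Some i))].
by apply/funext => x; rewrite gsqE.
Qed.

Lemma I_gsq w : L2v Omega w -> I (gsq w) = D2 Omega w.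
Proof.
move=> Lw; rewrite /D2 -I_sum; [|exact: mO|by move=> i; case: (Lw (Some i))].
by apply: I_eq => x _; rewrite gsqE.
Qed.

Lemma n2E w : L2v Omega w -> n2 Omega w = I (fun x => w.1 x ^+ 2 + gsq w x).
Proof.
move=> Lw; rewrite ID; [by rewrite I_gsq|exact: mO|by case: (Lw None)|exact: intg_gsq].
Qed.

Lemma dotv_young (x y : T) : 2 * `|dotv x y| <= dotv x x + dotv y y.
Proof.
rewrite /dotv -big_split /=; apply: (@le_trans _ _ (2 * \sum_i `|x 0 i * y 0 i|)).
  by rewrite ler_pM2l// ler_norm_sum.
rewrite mulr_sumr; apply: ler_sum => i _; rewrite normrM.
have := sqr_ge0 (`|x 0 i| - `|y 0 i|); rewrite sqrrB !real_normK ?num_real// !expr2; lra.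
Qed.

Lemma measurable_dotv (f g : T -> T) : (forall i, measurable_fun setT (fun x => f x 0 i)) ->
  (forall i, measurable_fun setT (fun x => g x 0 i)) ->
  measurable_fun setT (fun x => dotv (f x) (g x)).
Proof.
by move=> mf mg; apply: measurable_sum => i; apply: measurable_funM.
Qed.

Lemma intg_bdotv (c : T -> R) (M : R) w v : measurable_fun setT c -> (forall x, `|c x| <= M) ->
  measv w -> L2v Omega w -> measv v -> L2v Omega v ->
  intg mu Omega (fun x => c x * dotv (w.2 x) (v.2 x)).
Proof.
move=> mc cM mw Lw mv Lv.
apply: (intg_dom_le mO _ (intgZ mO M (intgD mO (intg_gsq Lw) (intg_gsq Lv)))).
  apply: measurable_funTS; apply: measurable_funM => //.
  by apply: measurable_dotv => i; [exact: (mw (Some i))|exact: (mv (Some i))].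
move=> x _; rewrite normrM; apply: ler_pM => //.
have := dotv_young (w.2 x) (v.2 x); have := normr_ge0 (dotv (w.2 x) (v.2 x)); rewrite /gsq; lra.
Qed.

Section bform.
Variables (b : T -> R) (al be : R).
Hypotheses (mb : measurable_fun setT b) (al0 : 0 < al) (bb : forall x, al <= b x <= be).

(** The mass term is auxiliary: a large [lam] makes gradient-dependent lower-order terms
    contractive, while [lam = 0] is the form of the equation itself. *)
Definition bform (lam : R) (w v : vf) : R :=
  I (fun x => b x * dotv (w.2 x) (v.2 x)) + lam * I (fun x => w.1 x * v.1 x).

Lemma b_norm x : `|b x| <= be.
Proof. by have /andP[h1 h2] := bb x; rewrite ger0_norm// (le_trans (ltW al0)). Qed.

Lemma intg_form w v : V w -> V v -> intg mu Omega (fun x => b x * dotv (w.2 x) (v.2 x)).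
Proof. by move=> [mw Lw _] [mv Lv _]; exact: (intg_bdotv mb b_norm). Qed.

Lemma intg_mul w v : V w -> V v -> intg mu Omega (fun x => w.1 x * v.1 x).
Proof. by move=> Vw Vv; apply: (L2M mO); [exact: (V_L2 Vw None)|exact: (V_L2 Vv None)]. Qed.

Lemma bformC lam w v : bform lam w v = bform lam v w.
Proof.
rewrite /bform; congr (_ + _ * _); apply: I_eq => x _; last by rewrite mulrC.
by congr (_ * _); apply: eq_bigr => i _; rewrite mulrC.
Qed.

Lemma bform_linl lam a x y z : V x -> V y -> V z ->
  bform lam (lincomb a x y) z = a * bform lam x z + bform lam y z.
Proof.
move=> Vx Vy Vz; rewrite /bform.
have -> : I (fun t => b t * dotv ((lincomb a x y).2 t) (z.2 t)) =
    a * I (fun t => b t * dotv (x.2 t) (z.2 t)) + I (fun t => b t * dotv (y.2 t) (z.2 t)).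
  rewrite -IZ; [|exact: mO|exact: intg_form].
  rewrite -ID; [|exact: mO|by apply: intgZ; [exact: mO|exact: intg_form]|exact: intg_form].
  apply: I_eq => t _; rewrite mulrCA -mulrDr; congr (_ * _).
  by rewrite /dotv mulr_sumr -big_split; apply: eq_bigr => i _; rewrite /= !mxE; ring.
have -> : I (fun t => (lincomb a x y).1 t * z.1 t) =
    a * I (fun t => x.1 t * z.1 t) + I (fun t => y.1 t * z.1 t).
  rewrite -IZ; [|exact: mO|exact: intg_mul].
  rewrite -ID; [|exact: mO|by apply: intgZ; [exact: mO|exact: intg_mul]|exact: intg_mul].
  by apply: I_eq => t _ /=; ring.
by ring.
Qed.

Lemma bform_diag lam v : V v ->
  al * D2 Omega v + lam * I (fun x => v.1 x ^+ 2) <= bform lam v v <=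
  be * D2 Omega v + lam * I (fun x => v.1 x ^+ 2).
Proof.
move=> Vv; have Lv := V_L2 Vv; have ig := intg_gsq Lv.
have -> : I (fun x => v.1 x ^+ 2) = I (fun x => v.1 x * v.1 x).
  by apply: I_eq => x _; rewrite expr2.
rewrite -I_gsq// -[al * _]IZ//; last exact: mO.
rewrite -[be * _]IZ//; last exact: mO.
rewrite /bform !lerD2r; apply/andP; split.
  apply: I_le; [exact: mO|by apply: intgZ => //; exact: mO|exact: intg_form|].
  by move=> x _; apply: ler_wpM2r; [exact: (gsq_ge0 v x)|by case/andP: (bb x)].
apply: I_le; [exact: mO|exact: intg_form|by apply: intgZ => //; exact: mO|].
by move=> x _; apply: ler_wpM2r; [exact: (gsq_ge0 v x)|by case/andP: (bb x)].
Qed.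

Lemma bform_ge0 lam v : 0 <= lam -> V v -> 0 <= bform lam v v.
Proof.
move=> l0 Vv; have /andP[h _] := bform_diag lam Vv; apply: le_trans h.
by rewrite addr_ge0// mulr_ge0 ?(ltW al0) ?D2_ge0 ?I_sqr_ge0.
Qed.

Lemma bform_lam lam w v : bform lam w v = bform 0 w v + lam * I (fun x => w.1 x * v.1 x).
Proof. by rewrite /bform mul0r addr0. Qed.

Lemma bform_complete lam c : 0 <= lam -> 0 < c ->
  (forall v, V v -> c * n2 Omega v <= bform lam v v) ->
  forall s : nat -> vf, (forall k, V (s k)) ->
    (forall e : R, 0 < e -> exists K, forall m n, (K <= m)%N -> (K <= n)%N ->
       bform lam (vsub (s m) (s n)) (vsub (s m) (s n)) <= e) ->
    exists2 x, V x & forall e : R, 0 < e -> exists K, forall k, (K <= k)%N ->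
       bform lam (vsub (s k) x) (vsub (s k) x) <= e.
Proof.
move=> l0 c0 hc s Vs cs.
have [e e0|v Vv cv] := V_complete oO Vs.
  have [K hK] := cs (c * e) (mulr_gt0 c0 e0); exists K => // k /= Kk m n km kn.
  rewrite -(ler_pM2l c0); apply: le_trans (hc _ _) (hK _ _ _ _); try exact: leq_trans Kk _.
  exact: V_lincomb.
exists v => // e e0; have be0 : 0 <= be.
  by have /andP[h1 h2] := bb 0; apply: le_trans (le_trans (ltW al0) h1) h2.
have c1 : 0 < be + lam + 1 by rewrite ltr_wpDl// addr_ge0.
move/cvgrPdist_le: cv => /(_ _ (divr_gt0 e0 c1)) [K _ hK]; exists K => k Kk.
have Vd := V_lincomb oO (-1) Vv (Vs k).
have /andP[_ h] := bform_diag lam Vd; apply: (le_trans h).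
have := hK k Kk; rewrite /= sub0r normrN ger0_norm ?n2_ge0// ler_pdivlMr//.
apply: le_trans; rewrite /n2 /vsub.
have := D2_ge0 Omega (lincomb (-1) v (s k)); have := I_sqr_ge0 Omega (lincomb (-1) v (s k)).1.
set A := Rintegral _ _ _; set B := D2 _ _ => A0 B0.
have := mulr_ge0 l0 B0; have := mulr_ge0 be0 A0.
by rewrite mulrDr !mulrDl; lra.
Qed.

Lemma bform_cauchy_schwarz lam x y : 0 <= lam -> V x -> V y ->
  bform lam x y ^+ 2 <= bform lam x x * bform lam y y.
Proof.
move=> l0; apply: (@q_cauchy_schwarz R vf V (@lincomb R N) (bform lam)).
- by move=> a u v; exact: V_lincomb.
- by move=> u v _ _; exact: bformC.
- by move=> a u v z; exact: bform_linl.
- by move=> u; exact: bform_ge0.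
Qed.

Lemma cvg_form lam (w : nat -> vf) w0 v : 0 <= lam -> (forall k, V (w k)) -> V w0 -> V v ->
  n2 Omega (vsub (w k) w0) @[k --> \oo] --> 0 ->
  bform lam (w k) v @[k --> \oo] --> bform lam w0 v.
Proof.
move=> l0 Vw V0 Vv c; apply: (cvg_sqr_le _ c (C := (be + lam) * bform lam v v)) => k.
have be0 : 0 <= be.
  by have /andP[h1 h2] := bb 0; apply: le_trans (le_trans (ltW al0) h1) h2.
have Vd : V (vsub (w k) w0) := V_lincomb oO (-1) V0 (Vw k).
have -> : bform lam (w k) v - bform lam w0 v = bform lam (vsub (w k) w0) v.
  by rewrite (bform_linl lam (-1) V0 (Vw k) Vv) mulN1r addrC.
apply: (le_trans (bform_cauchy_schwarz l0 Vd Vv)).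
rewrite mulrAC ler_wpM2r ?bform_ge0//.
have /andP[_ h] := bform_diag lam Vd; apply: (le_trans h).
have := D2_ge0 Omega (vsub (w k) w0); have := I_sqr_ge0 Omega (vsub (w k) w0).1.
rewrite /n2; set A := Rintegral _ _ _; set B := D2 _ _ => A0 B0.
have := mulr_ge0 l0 B0; have := mulr_ge0 be0 A0.
by rewrite mulrDr !mulrDl; lra.
Qed.

End bform.
End integral_forms.

(** * Solvability and comparison for Lipschitz lower-order terms *)

Section monotone_iteration.
Context (R : realType) (N : nat) (Omega : set 'rV[R]_N).
Hypotheses (oO : open Omega) (bO : bounded_set Omega).
Local Notation mu := (lebesgue_rV R N).
Local Notation T := 'rV[R]_N.
Local Notation I f := (\int[mu]_(x in Omega) f x).
Local Notation mO := (measurable_Omega oO).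
Local Notation V := (@inV R N Omega).
Local Notation vf := (@vf R N).
Local Notation aeon := (aeon mu Omega).
Local Notation L2 := (L2 mu Omega).
Variables (b : T -> R) (al be : R).
Hypotheses (mb : measurable_fun setT b) (al0 : 0 < al) (bb : forall x, al <= b x <= be).
Local Notation bform := (bform Omega b).

Definition vzero : vf := (fun=> 0, fun=> 0).

Lemma vzeroE o x : vco vzero o x = 0.
Proof. by case: o => [i|] //=; rewrite mxE. Qed.

Lemma V_zero : V vzero.
Proof.
apply: (V_ae oO (V_test oO (test_fun0 Omega))) => o.
  by rewrite (_ : vco _ _ = fun=> 0)//; apply/funext => x; exact: vzeroE.
apply: aeonW => x _; rewrite vzeroE; case: o => [i|] //=; rewrite mxE.
exact: derive_cst.
Qed.

(** [L] is the square of a Lipschitz constant, jointly in the value and the gradient. Vanishing at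
    the zero pair puts [H w] in [L^2] and lets the iteration start from 0; the sign allows
    comparison with the linear problem. *)
Definition lip_op (H : vf -> T -> R) (L : R) :=
  [/\ forall w, measv w -> measurable_fun setT (H w),
      forall w v x, (H w x - H v x) ^+ 2 <= L * ((w.1 x - v.1 x) ^+ 2 + gsq (vsub w v) x),
      forall x, H vzero x = 0 & forall w x, 0 <= H w x].

Lemma vsubE1 (w v : vf) x : (vsub w v).1 x = w.1 x - v.1 x.
Proof. exact: (vsubE w v None x). Qed.

Lemma I_n2_dist w v : V w -> V v ->
  I (fun x => (w.1 x - v.1 x) ^+ 2 + gsq (vsub w v) x) = n2 Omega (vsub w v).
Proof.
move=> Vw Vv; rewrite (n2E oO (V_L2 (V_lincomb oO (-1) Vv Vw))).
by apply: I_eq => x _; rewrite vsubE1.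
Qed.

Section operator.
Variables (H : vf -> T -> R) (L : R).
Hypothesis hH : lip_op H L.

Lemma intg_dist w v : V w -> V v ->
  intg mu Omega (fun x => (w.1 x - v.1 x) ^+ 2 + gsq (vsub w v) x).
Proof.
move=> Vw Vv; apply: (intgD mO).
  by case: (L2B mO (V_L2 Vw None) (V_L2 Vv None)).
by apply: (intg_gsq oO); exact: (V_L2 (V_lincomb oO (-1) Vv Vw)).
Qed.

Lemma op_diff_L2 w v : V w -> V v -> L2 (fun x => H w x - H v x).
Proof.
move=> Vw Vv; have [mH HL _ _] := hH; have m : measurable_fun Omega (fun x => H w x - H v x).
  by apply: measurable_funTS; apply: measurable_funB; apply: mH; [exact: V_meas Vw|exact: V_meas Vv].
split => //; apply: (intg_dom_le mO _ (intgZ mO L (intg_dist Vw Vv))).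
  exact: measurable_funX.
by move=> x _; rewrite ger0_norm ?sqr_ge0.
Qed.

Lemma op_L2 w : V w -> L2 (H w).
Proof.
move=> Vw; have [_ _ H0 _] := hH; have := op_diff_L2 Vw V_zero.
by under eq_fun do rewrite H0 subr0.
Qed.

Lemma intg_op w v : V w -> V v -> intg mu Omega (fun x => H w x * v.1 x).
Proof. by move=> Vw Vv; apply: (L2M mO (op_L2 Vw)); exact: (V_L2 Vv None). Qed.

Lemma op_lip w1 w2 v : 0 <= L -> V w1 -> V w2 -> V v ->
  (I (fun x => H w1 x * v.1 x) - I (fun x => H w2 x * v.1 x)) ^+ 2 <=
  L * n2 Omega (vsub w1 w2) * I (fun x => v.1 x ^+ 2).
Proof.
move=> L0 V1 V2 Vv; have [_ HL _ _] := hH; have Ld := op_diff_L2 V1 V2.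
rewrite -IB; [|exact: mO|exact: intg_op|exact: intg_op].
under eq_Rintegral do rewrite -mulrBl.
apply: (le_trans (I_cauchy_schwarz oO Ld (V_L2 Vv None))).
apply: ler_wpM2r; first exact: I_sqr_ge0.
rewrite -(I_n2_dist V1 V2) -IZ; [|exact: mO|exact: intg_dist].
apply: I_le => [|||x _]; [exact: mO|by case: Ld|apply: intgZ; [exact: mO|exact: intg_dist]|exact: HL].
Qed.

Lemma cvg_op (w : nat -> vf) w0 v : 0 <= L -> (forall k, V (w k)) -> V w0 -> V v ->
  n2 Omega (vsub (w k) w0) @[k --> \oo] --> 0 ->
  I (fun x => H (w k) x * v.1 x) @[k --> \oo] --> I (fun x => H w0 x * v.1 x).
Proof.
move=> L0 Vw V0 Vv c; apply: (cvg_sqr_le _ c (C := L * I (fun x => v.1 x ^+ 2))) => k.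
by apply: (le_trans (op_lip L0 (Vw k) V0 Vv)); rewrite mulrAC.
Qed.

Variable lam : R.
Hypotheses (al_lam : al <= lam) (L_lam : 4 * L <= al * lam) (L0 : 0 <= L).

Let lam0 : 0 < lam. Proof. exact: lt_le_trans al_lam. Qed.

Lemma bform_coercive v : V v -> al * n2 Omega v <= bform lam v v.
Proof.
move=> Vv; have /andP[h _] := bform_diag oO mb al0 bb lam Vv; apply: le_trans h.
by rewrite /n2 mulrDr addrC lerD2l ler_wpM2r ?I_sqr_ge0.
Qed.

Lemma bform_mass v : V v -> lam * I (fun x => v.1 x ^+ 2) <= bform lam v v.
Proof.
move=> Vv; have /andP[h _] := bform_diag oO mb al0 bb lam Vv; apply: le_trans h.
by rewrite lerDr mulr_ge0 ?D2_ge0// ltW.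
Qed.

(** The Lipschitz error is shared between the two parts of the form: [al] times the full norm
    controls the difference of the arguments, [lam] times the mass controls the test function. The
    condition [4 L <= al lam] then gives the contraction factor of [nonlinear_riesz]. *)
Lemma small_lip (n i a c : R) : 0 <= n -> 0 <= i -> al * n <= a -> lam * i <= c ->
  L * n * i <= 4^-1 * a * c.
Proof.
move=> n0 i0 h1 h2.
have h3 : (al * n) * (lam * i) <= a * c.
  by apply: ler_pM => //; rewrite mulr_ge0// ltW.
have h4 : (4 * L) * (n * i) <= (al * lam) * (n * i) by apply: ler_wpM2r => //; exact: mulr_ge0.
have E1 : (al * n) * (lam * i) = (al * lam) * (n * i) by ring.
have E2 : (4 * L) * (n * i) = 4 * (L * n * i) by ring.
by rewrite -mulrA; lra.
Qed.

Lemma lam_solve (G : vf -> R) :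
  (forall a x y, V x -> V y -> G (lincomb a x y) = a * G x + G y) ->
  (exists C, forall v, V v -> G v ^+ 2 <= C * n2 Omega v) ->
  exists2 w, V w & forall v, V v -> bform lam w v + I (fun x => H w x * v.1 x) = G v.
Proof.
move=> Gl [C Gb]; have c0 : 0 < al by [].
have nb v : V v -> n2 Omega v <= al^-1 * bform lam v v.
  by move=> Vv; rewrite mulrC ler_pdivlMr// mulrC; exact: bform_coercive.
apply: (@nonlinear_riesz R vf V (@lincomb R N) (bform lam) _ _ _ _ _ (fun w v => I (fun x => H w x * v.1 x)) G vzero).
- by move=> a x y; exact: V_lincomb.
- by move=> x y _ _; exact: bformC.
- by move=> a x y z Vx Vy Vz; exact: (bform_linl oO mb al0 bb lam a Vx Vy Vz).
- by move=> x; exact: (bform_ge0 oO mb al0 bb (ltW lam0)).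
- by apply: (bform_complete oO mb al0 bb (ltW lam0) c0) => v; exact: bform_coercive.
- exact: V_zero.
- move=> w a x y Vw Vx Vy; rewrite -IZ; [|exact: mO|exact: intg_op].
  rewrite -ID; [|exact: mO|by apply: intgZ; [exact: mO|exact: intg_op]|exact: intg_op].
  by apply: I_eq => t _ /=; ring.
- move=> w Vw; exists (I (fun x => H w x ^+ 2) * al^-1) => v Vv.
  apply: (le_trans (I_cauchy_schwarz oO (op_L2 Vw) (V_L2 Vv None))).
  rewrite -mulrA ler_wpM2l ?I_sqr_ge0//; apply: le_trans (nb v Vv); exact: (vco_n2 _ _ None).
- move=> w1 w2 v V1 V2 Vv; apply: (le_trans (op_lip L0 V1 V2 Vv)).
  apply: small_lip; [exact: n2_ge0|exact: I_sqr_ge0| |exact: bform_mass].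
  by apply: bform_coercive; exact: V_lincomb.
- exact: Gl.
- exists (`|C| * al^-1) => v Vv; apply: (le_trans (Gb v Vv)).
  apply: (@le_trans _ _ (`|C| * n2 Omega v)); first by rewrite ler_wpM2r ?n2_ge0// ler_norm.
  by rewrite -mulrA ler_wpM2l// nb.
Qed.

(* Testing with the positive part d of w1 - w2. *)
Lemma lam_compare w1 w2 : V w1 -> V w2 ->
  (forall v, V v -> (forall x, 0 <= v.1 x) ->
     bform lam w1 v + I (fun x => H w1 x * v.1 x) <= bform lam w2 v + I (fun x => H w2 x * v.1 x)) ->
  aeon (fun x => w1.1 x <= w2.1 x).
Proof.
move=> V1 V2 h; have [mH HL _ _] := hH.
have Vs : V (vsub w1 w2) := V_lincomb oO (-1) V2 V1.
pose d := posv 0 (vsub w1 w2); have Vd : V d by exact: V_posv.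
have d0 x : 0 <= d.1 x by rewrite /d /posv /= le_max lexx orbT.
have hd := h d Vd d0.
pose ind x : R := if 0 < (vsub w1 w2).1 x then 1 else 0.
have dE1 x : d.1 x = ind x * (w1.1 x - w2.1 x).
  rewrite /d /posv /ind [LHS]/= subr0 -vsubE1; case: ifPn => h1.
    by rewrite mul1r; apply/max_idPl; exact: ltW.
  by rewrite mul0r; apply/max_idPr; rewrite leNgt.
have dE2 x i : d.2 x 0 i = ind x * (vsub w1 w2).2 x 0 i by rewrite /d /posv /vcomp [LHS]mxE.
have ind2 x : ind x * ind x = ind x by rewrite /ind; case: ifP => _; rewrite ?mulr1 ?mulr0.
have E1 : bform lam w1 d - bform lam w2 d = bform lam d d.
  have -> : bform lam w1 d - bform lam w2 d = bform lam (vsub w1 w2) d.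
    by rewrite (bform_linl oO mb al0 bb lam (-1) V2 V1 Vd) mulN1r addrC.
  rewrite /bform; congr (_ + _ * _); apply: I_eq => x _.
    congr (_ * _); rewrite /dotv; apply: eq_bigr => i _.
    by rewrite dE2 [RHS]mulrACA ind2 mulrCA.
  by rewrite vsubE1 dE1 [RHS]mulrACA ind2 mulrCA.
(* Where [w1 > w2], the difference of the operators is bounded by the value and gradient of [d]
   itself, so that it can be absorbed by [bform lam d d]. *)
pose r x := ind x * (H w2 x - H w1 x).
have mind : measurable_fun setT ind.
  apply: measurable_fun_ifT => //; apply: measurable_fun_ltr => //.
  exact: (V_meas Vs None).
have r2 x : r x ^+ 2 <= L * (d.1 x ^+ 2 + gsq d x).
  have -> : d.1 x ^+ 2 + gsq d x = ind x * ((w2.1 x - w1.1 x) ^+ 2 + gsq (vsub w2 w1) x).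
    rewrite mulrDr dE1 exprMn [ind x ^+ 2]expr2 ind2 -sqrrN opprB; congr (_ + _).
    rewrite !gsqE mulr_sumr; apply: eq_bigr => i _.
    rewrite dE2 exprMn [ind x ^+ 2]expr2 ind2 -sqrrN; congr (_ * _ ^+ 2).
    by have := vsubE w1 w2 (Some i) x; have := vsubE w2 w1 (Some i) x; rewrite /= => -> ->; rewrite opprB.
  rewrite exprMn [ind x ^+ 2]expr2 ind2 [leRHS]mulrCA; apply: ler_wpM2l; last exact: HL.
  by rewrite /ind; case: ifP.
have id : intg mu Omega (fun x => d.1 x ^+ 2 + gsq d x).
  by apply: (intgD mO); [case: (V_L2 Vd None)|exact: (intg_gsq oO (V_L2 Vd))].
have mr : measurable_fun Omega r.
  apply: measurable_funTS; apply: measurable_funM => //.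
  by apply: measurable_funB; apply: mH; [exact: V_meas V2|exact: V_meas V1].
have ir : intg mu Omega (fun x => r x ^+ 2).
  apply: (intg_dom_le mO _ (intgZ mO L id)); first exact: measurable_funX.
  by move=> x _; rewrite ger0_norm ?sqr_ge0.
have E2 : I (fun x => H w2 x * d.1 x) - I (fun x => H w1 x * d.1 x) = I (fun x => r x * d.1 x).
  rewrite -IB; [|exact: mO|exact: intg_op|exact: intg_op].
  by apply: I_eq => x _; rewrite -mulrBl /r dE1 mulrACA mulrA ind2 mulrCA mulrA.
have cs : I (fun x => r x * d.1 x) ^+ 2 <= 4^-1 * bform lam d d * bform lam d d.
  apply: (le_trans (I_cauchy_schwarz oO (conj mr ir : L2 r) (V_L2 Vd None))).
  apply: (@le_trans _ _ (L * n2 Omega d * I (fun x => d.1 x ^+ 2))).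
    apply: ler_wpM2r; first exact: I_sqr_ge0.
    rewrite (n2E oO (V_L2 Vd)) -IZ//; last exact: mO.
    by apply: I_le => [|||x _]; [exact: mO|exact: ir|apply: intgZ => //; exact: mO|exact: r2].
  by apply: small_lip; [exact: n2_ge0|exact: I_sqr_ge0|exact: bform_coercive|exact: bform_mass].
have q0 : bform lam d d <= 0.
  have := bform_ge0 oO mb al0 bb (ltW lam0) Vd.
  move: cs hd E1 E2; set q := bform lam d d; set rr := I (fun x => r x * d.1 x).
  move=> cs hd E1 E2 q0; rewrite leNgt; apply/negP => q1.
  have h1 : q <= rr by lra.
  have : q ^+ 2 <= rr ^+ 2 by rewrite ler_pXn2r// nnegrE// (le_trans q0).
  have := mulr_gt0 q1 q1; rewrite !expr2 in cs *; lra.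
have := bform_mass Vd => h1.
have h2 : I (fun x => d.1 x ^+ 2) <= 0.
  by rewrite -(ler_pM2l lam0) mulr0; apply: le_trans q0.
have h3 := I_eq0_ae mO (V_L2 Vd None).2 (aeonW mu (fun x _ => sqr_ge0 (d.1 x))) h2.
move: h3; apply: aeon_imp => x _ /eqP; rewrite sqrf_eq0 => /eqP hx.
have E : d.1 x = Num.max (w1.1 x - w2.1 x) 0 by rewrite -vsubE1 /d /posv [LHS]/= subr0.
have : w1.1 x - w2.1 x <= d.1 x by rewrite E le_max lexx.
by rewrite (hx : d.1 x = 0) subr_le0.
Qed.

End operator.

Lemma I_eq0 (g : T -> R) : (forall x, Omega x -> g x = 0) -> I g = 0.
Proof.
move=> h; have -> : I g = I (fun=> 0) by apply: I_eq => x Ox; rewrite h.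
by rewrite Rintegral_cst ?mul0r//; exact: mO.
Qed.

Lemma bform_zerol lam v : bform lam vzero v = 0.
Proof.
rewrite /bform !I_eq0 ?mulr0 ?addr0// => x _; rewrite ?mul0r//.
by rewrite /dotv big1 ?mulr0// => i _; rewrite mxE mul0r.
Qed.

(* The iterates of the coercive problem, started at 0, increase and stay below
   the supersolution W. *)
Lemma monotone_solution (H : vf -> T -> R) (L : R) (F : vf -> R) (W : vf) (h : T -> R) :
  lip_op H L -> 0 <= L ->
  (forall a x y, V x -> V y -> F (lincomb a x y) = a * F x + F y) ->
  (exists C, forall v, V v -> F v ^+ 2 <= C * n2 Omega v) ->
  (forall v, V v -> (forall x, 0 <= v.1 x) -> 0 <= F v) ->
  V W -> aeon (fun x => 0 <= W.1 x) -> L2 h -> (forall x, h x <= H W x) ->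
  (forall v, V v -> bform 0 W v + I (fun x => h x * v.1 x) = F v) ->
  exists w, [/\ V w, aeon (fun x => 0 <= w.1 x <= W.1 x) &
    forall v, V v -> bform 0 w v + I (fun x => H w x * v.1 x) = F v].
Proof.
move=> hH L0 Fl [C1 Fb] Fpos VW W0 Lh hHW eW; have [_ _ H0 _] := hH.
(* The first entry gives coercivity in the full norm, the second the contraction condition
   [4 L <= al lam]. *)
pose lam : R := Num.max al (4 * L / al).
have al_lam : al <= lam by rewrite le_max lexx.
have L_lam : 4 * L <= al * lam by rewrite [leRHS]mulrC -ler_pdivrMr// /lam le_max lexx orbT.
clearbody lam; have lam0 : 0 < lam by exact: lt_le_trans al_lam.
(* One step of the iteration: the mass of the new iterate on the left, of the old one on the right.
   In the limit the two cancel. *)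
have [|S hS] := @boolp.choice _ _ (fun z w => V z -> V w /\ forall v, V v ->
    bform lam w v + I (fun x => H w x * v.1 x) = F v + lam * I (fun x => z.1 x * v.1 x)).
  move=> z; have [Vz|nVz] := pselect (V z); last by exists z.
  have [| |w Vw hw] := lam_solve hH al_lam L_lam L0 (G := fun v => F v + lam * I (fun x => z.1 x * v.1 x)).
  - move=> a x y Vx Vy; rewrite Fl//.
    have -> : I (fun t => z.1 t * (lincomb a x y).1 t) = a * I (fun t => z.1 t * x.1 t) + I (fun t => z.1 t * y.1 t).
      rewrite -IZ; [|exact: mO|exact: intg_mul].
      rewrite -ID; [|exact: mO|by apply: intgZ; [exact: mO|exact: intg_mul]|exact: intg_mul].
      by apply: I_eq => t _ /=; ring.
    by ring.
  - pose Z := I (fun x => z.1 x ^+ 2); exists (2 * `|C1| + 2 * (lam ^+ 2 * Z)) => v Vv.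
    have h1 : F v ^+ 2 <= `|C1| * n2 Omega v.
      by apply: le_trans (Fb v Vv) _; rewrite ler_wpM2r ?n2_ge0// ler_norm.
    pose J := lam * I (fun x => z.1 x * v.1 x).
    have h2 : J ^+ 2 <= lam ^+ 2 * Z * n2 Omega v.
      rewrite exprMn -mulrA ler_wpM2l ?sqr_ge0//.
      apply: (le_trans (I_cauchy_schwarz oO (V_L2 Vz None) (V_L2 Vv None))).
      by rewrite ler_wpM2l ?I_sqr_ge0//; exact: (vco_n2 _ _ None).
    rewrite -/J; move: h1 h2; clearbody J Z; move: (F v) (n2 Omega v) => p t h1 h2.
    have := sqr_ge0 (p - J); lra.
  by exists w.
pose s k := iter k S vzero.
have Vs k : V (s k) by elim: k => [|k IH] /=; [exact: V_zero|case: (hS _ IH)].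
have eS k v : V v -> bform lam (s k.+1) v + I (fun x => H (s k.+1) x * v.1 x) =
    F v + lam * I (fun x => (s k).1 x * v.1 x) by have [_] := hS _ (Vs k); apply.
have s0E : s 0%N = vzero by []; clearbody s.
have lemul z1 z2 v : V z1 -> V z2 -> V v -> (forall x, 0 <= v.1 x) ->
    aeon (fun x => z1.1 x <= z2.1 x) ->
    lam * I (fun x => z1.1 x * v.1 x) <= lam * I (fun x => z2.1 x * v.1 x).
  move=> V1 V2 Vv v0 h12; rewrite ler_pM2l//; apply: I_le_ae; [exact: mO|exact: intg_mul|exact: intg_mul|].
  by move: h12; apply: aeon_imp => x _ hx; exact: ler_wpM2r.
have cmp := lam_compare hH al_lam L_lam.
have pos k : aeon (fun x => 0 <= (s k).1 x).
  elim: k => [|k IH]; first by apply: aeonW => x _; rewrite s0E.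
  apply: (cmp _ _ V_zero (Vs k.+1)).
  move=> v Vv v0; rewrite bform_zerol add0r (eS _ _ Vv).
  rewrite I_eq0 => [|x _]; last by rewrite H0 mul0r.
  rewrite addr_ge0 ?Fpos//; apply: le_trans (lemul vzero (s k) v V_zero (Vs k) Vv v0 IH).
  by rewrite I_eq0 ?mulr0// => x _; rewrite mul0r.
have inc k : aeon (fun x => (s k).1 x <= (s k.+1).1 x).
  elim: k => [|k IH]; first by rewrite s0E; exact: (pos 1%N).
  apply: (cmp _ _ (Vs k.+1) (Vs k.+2)) => v Vv v0; rewrite (eS _ _ Vv) (eS _ _ Vv) lerD2l.
  exact: (lemul _ _ _ (Vs k) (Vs k.+1) Vv v0 IH).
have leW k : aeon (fun x => (s k).1 x <= W.1 x).
  elim: k => [|k IH]; first by rewrite s0E.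
  apply: (cmp _ _ (Vs k.+1) VW) => v Vv v0; rewrite (eS _ _ Vv).
  have -> : bform lam W v = F v - I (fun x => h x * v.1 x) + lam * I (fun x => W.1 x * v.1 x).
    by rewrite bform_lam -(eW v Vv); ring.
  have := lemul _ _ _ (Vs k) VW Vv v0 IH.
  have : I (fun x => h x * v.1 x) <= I (fun x => H W x * v.1 x).
    apply: I_le; [exact: mO|exact: (L2M mO Lh (V_L2 Vv None))|exact: (intg_op hH)|].
    by move=> x _; apply: ler_wpM2r.
  lra.
have mon j k : (k <= j)%N -> aeon (fun x => (s k).1 x <= (s j).1 x).
  elim: j => [|j IH]; first by rewrite leqn0 => /eqP ->; apply: aeonW.
  rewrite leq_eqVlt => /predU1P[->|kj]; first by apply: aeonW.
  by have := inc j; have := IH kj; apply: aeon_imp2 => x _; exact: le_trans.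
pose c k := I (fun x => (s k).1 x ^+ 2).
have cinc : {homo c : k j / (k <= j)%N >-> k <= j}.
  move=> k j kj; apply: I_le_ae; [exact: mO|by case: (V_L2 (Vs k) None)|by case: (V_L2 (Vs j) None)|].
  have := mon j k kj; have := pos k; apply: aeon_imp2 => x _ h1 h2.
  by rewrite ler_pXn2r ?nnegrE// (le_trans h1).
have cb k : c k <= I (fun x => W.1 x ^+ 2).
  apply: I_le_ae; [exact: mO|by case: (V_L2 (Vs k) None)|by case: (V_L2 VW None)|].
  have := leW k; have := pos k; apply: aeon_imp2 => x _ h1 h2.
  by rewrite ler_pXn2r ?nnegrE// (le_trans h1).
(* For [0 <= x <= y] one has [(y - x)^2 <= y^2 - x^2]. The integrals [c k] increase and are bounded
   by that of [W^2], so the iterates are Cauchy in [L^2]. *)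
have l2 j k : (k <= j)%N -> I (fun x => ((s j).1 x - (s k).1 x) ^+ 2) <= c j - c k.
  move=> kj; rewrite -IB; [|exact: mO|by case: (V_L2 (Vs j) None)|by case: (V_L2 (Vs k) None)].
  have [_ i1] := L2B mO (V_L2 (Vs j) None) (V_L2 (Vs k) None).
  apply: I_le_ae; [exact: mO|exact: i1| |].
    by apply: (intgB mO); [case: (V_L2 (Vs j) None)|case: (V_L2 (Vs k) None)].
  have := mon j k kj; have := pos k; apply: aeon_imp2 => x _ h1 h2 /=.
  have := mulr_ge0 h1 (_ : 0 <= (s j).1 x - (s k).1 x); rewrite subr_ge0 => /(_ h2).
  rewrite !expr2; lra.
(* Upgrades [L^2] convergence to convergence of gradients: the two iteration equations are
   subtracted and tested with the difference [d], and the operator term costs at most half of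
   [bform lam d d]. *)
have qstep j k : bform lam (vsub (s j.+1) (s k.+1)) (vsub (s j.+1) (s k.+1)) <=
    4 * lam * I (fun x => ((s j).1 x - (s k).1 x) ^+ 2).
  pose d := vsub (s j.+1) (s k.+1); have Vd : V d := V_lincomb oO (-1) (Vs k.+1) (Vs j.+1).
  rewrite -/d; have E1 : bform lam d d = bform lam (s j.+1) d - bform lam (s k.+1) d.
    by rewrite {1}/d (bform_linl oO mb al0 bb lam (-1) (Vs k.+1) (Vs j.+1) Vd) mulN1r addrC.
  have dE : d = vsub (s j.+1) (s k.+1) by [].
  clearbody d.
  have Ld := L2B mO (V_L2 (Vs j) None) (V_L2 (Vs k) None).
  have E2 : I (fun x => (s j).1 x * d.1 x) - I (fun x => (s k).1 x * d.1 x) =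
      I (fun x => ((s j).1 x - (s k).1 x) * d.1 x).
    rewrite -(IB mO (intg_mul oO (Vs j) Vd) (intg_mul oO (Vs k) Vd)).
    by apply: I_eq => x _; rewrite mulrBl.
  have cs1 := I_cauchy_schwarz oO Ld (V_L2 Vd None).
  have cs2 := op_lip hH L0 (Vs j.+1) (Vs k.+1) Vd.
  have co := bform_coercive al_lam Vd; have ma := bform_mass lam Vd.
  have := small_lip al_lam L_lam (n2_ge0 Omega d) (I_sqr_ge0 Omega d.1) co ma.
  have := bform_ge0 oO mb al0 bb (ltW lam0) Vd.
  have e1 := eS j d Vd; have e2 := eS k d Vd.
  have i0 := I_sqr_ge0 Omega (fun x => (s j).1 x - (s k).1 x).
  move: cs1 cs2 ma E1 E2 e1 e2 i0; rewrite -dE /=.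
  set q := bform lam d d; set X := I (fun x => ((s j).1 x - (s k).1 x) * d.1 x); set Y := I (fun x => d.1 x ^+ 2).
  set Z := I (fun x => ((s j).1 x - (s k).1 x) ^+ 2).
  set K1 := I (fun x => H (s j.+1) x * d.1 x); set K2 := I (fun x => H (s k.+1) x * d.1 x).
  move=> cs1 cs2 ma E1 E2 e1 e2 Z0 q0 sl.
  have qE : q = lam * X - (K1 - K2).
    by rewrite E1 -E2; lra.
  have {}sl : (K1 - K2) ^+ 2 <= (2^-1 * q) ^+ 2 by apply: (le_trans cs2); apply: (le_trans sl); lra.
  have kq : - (2^-1 * q) <= K1 - K2.
    have : `|K1 - K2| <= 2^-1 * q.
      by rewrite -(ler_pXn2r (_ : 0 < 2)%N) ?nnegrE ?mulr_ge0 ?invr_ge0// real_normK ?num_real.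
    by rewrite ler_norml => /andP[].
  have h1 : q <= 2 * (lam * X) by lra.
  have h2 : q ^+ 2 <= 4 * lam * Z * q.
    apply: (@le_trans _ _ ((2 * (lam * X)) ^+ 2)); first by rewrite ler_pXn2r// nnegrE// (le_trans q0).
    have := ler_wpM2l (ltW lam0) (ler_wpM2l Z0 ma).
    have := ler_wpM2l (sqr_ge0 lam) cs1; rewrite !exprMn !expr2; lra.
  move: q0; rewrite le_eqVlt => /predU1P[<-|q0]; first by rewrite !mulr_ge0// ltW.
  by rewrite -(ler_pM2r q0) -expr2.
have [cc] : exists l : R, c k @[k --> \oo] --> l.
  exists (sup (range c)); apply: nondecreasing_cvgn => //.
  by exists (I (fun x => W.1 x ^+ 2)) => _ [k _ <-].
move=> hcc.
have [e e0|w Vw cw] := V_complete oO (fun k => Vs k.+1).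
  have e1 : 0 < e * al / (8 * lam) by rewrite divr_gt0 ?mulr_gt0.
  move/cvgrPdist_le: hcc => /(_ _ e1) [K _ hK]; exists K => // k0 /= Kk m n km kn.
  rewrite -(ler_pM2l al0).
  apply: (le_trans (bform_coercive al_lam (V_lincomb oO (-1) (Vs n.+1) (Vs m.+1)))).
  apply: (le_trans (qstep m n)).
  have hl : I (fun x => ((s m).1 x - (s n).1 x) ^+ 2) <= `|cc - c m| + `|cc - c n|.
    have [mn|mn] := leqP n m.
      apply: (le_trans (l2 _ _ mn)); have -> : c m - c n = (cc - c n) - (cc - c m) by ring.
      by apply: (le_trans (ler_norm _)); rewrite [leRHS]addrC; exact: ler_normB.
    under eq_Rintegral do rewrite -sqrrN opprB.
    apply: (le_trans (l2 _ _ (ltnW mn))); have -> : c n - c m = (cc - c m) - (cc - c n) by ring.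
    by apply: (le_trans (ler_norm _)); exact: ler_normB.
  have h1 := hK m (leq_trans Kk km); have h2 := hK n (leq_trans Kk kn).
  have {}hl := le_trans hl (lerD h1 h2).
  have := ler_wpM2l (mulr_ge0 (ler0n _ 4) (ltW lam0)) hl.
  have -> : 4 * lam * (e * al / (8 * lam) + e * al / (8 * lam)) = al * e.
    by field; rewrite gt_eqF.
  by apply.
exists w; split => //.
  have [phi [S' [_ _ _ hS']]] := V_subseq oO (fun k => V_L2 (Vs k.+1)) (V_L2 Vw) cw.
  have hb := aeon_all (fun k => pos (phi k).+1); have hb' := aeon_all (fun k => leW (phi k).+1).
  have hh : aeon (fun x => forall k, 0 <= (s (phi k).+1).1 x <= W.1 x).
    by move: hb hb'; apply: aeon_imp2 => x _ h1 h2 k; rewrite h1 h2.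
  move: hh hS'; apply: aeon_imp2 => x _ h1 h2.
  have cx : (s (phi k).+1).1 x @[k --> \oo] --> w.1 x by apply: cvg_of_sqr => k; exact: (h2 k None).
  rewrite -(cvg_lim (@Rhausdorff R) cx); apply/andP; split.
    by apply: limr_ge; [exact: cvgP cx|near=> k; case/andP: (h1 k)].
  by apply: limr_le; [exact: cvgP cx|near=> k; case/andP: (h1 k)].
move=> v Vv.
have c1 : bform lam (s k.+1) v + I (fun x => H (s k.+1) x * v.1 x) @[k --> \oo] -->
    bform lam w v + I (fun x => H w x * v.1 x).
  exact: (cvgD (cvg_form oO mb al0 bb (ltW lam0) (fun k => Vs k.+1) Vw Vv cw)
    (cvg_op hH L0 (fun k => Vs k.+1) Vw Vv cw)).
have c2 : F v + lam * I (fun x => (s k.+1).1 x * v.1 x) @[k --> \oo] -->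
    F v + lam * I (fun x => w.1 x * v.1 x).
  apply: cvgD; first exact: cvg_cst.
  apply: cvgM; first exact: cvg_cst.
  apply: (cvg_L2_sqr mO) => //; [by move=> k; exact: (V_L2 (Vs k.+1) None)|exact: (V_L2 Vw None)| |exact: (V_L2 Vv None)].
  apply: (@squeeze_cvgr _ _ _ _ (fun=> 0) (fun k => n2 Omega (vsub (s k.+1) w))).
  - near=> k; rewrite I_sqr_ge0/=; apply: le_trans (vco_n2 _ _ None).
    by rewrite le_eqVlt; apply/orP; left; apply/eqP; apply: I_eq => x _; rewrite vsubE.
  - exact: cvg_cst.
  - exact: cw.
have c3 := @cvg_subseq _ _ _ (fun k => k.+1) (fun k => ltnSn k.+1) c1.
have c4 : bform lam (s k.+2) v + I (fun x => H (s k.+2) x * v.1 x) @[k --> \oo] -->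
    F v + lam * I (fun x => w.1 x * v.1 x).
  by under eq_fun do rewrite eS//.
have := etrans (esym (cvg_lim (@Rhausdorff R) c3)) (cvg_lim (@Rhausdorff R) c4).
rewrite bform_lam; move: (bform 0 w v) (F v) (lam * _) (I (fun x => H w x * v.1 x)) => q1 q2 q3 q4 E.
by apply: (addIr q3); rewrite -E addrAC.
Unshelve. all: by end_near.
Qed.

End monotone_iteration.

(** * Strong convergence of the solutions for an increasing family of operators *)

Section decreasing_solutions.
Context (R : realType) (N : nat) (Omega : set 'rV[R]_N).
Hypotheses (oO : open Omega) (bO : bounded_set Omega).
Local Notation mu := (lebesgue_rV R N).
Local Notation T := 'rV[R]_N.
Local Notation I f := (\int[mu]_(x in Omega) f x).
Local Notation mO := (measurable_Omega oO).
Local Notation V := (@inV R N Omega).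
Local Notation vf := (@vf R N).
Local Notation aeon := (aeon mu Omega).
Local Notation L2 := (L2 mu Omega).
Variables (b : T -> R) (al be : R).
Hypotheses (mb : measurable_fun setT b) (al0 : 0 < al) (bb : forall x, al <= b x <= be).
Local Notation bform := (bform Omega b).
Variables (CP CF : R) (F : vf -> R).
Hypotheses (CP0 : 0 <= CP) (CF0 : 0 <= CF)
  (hP : forall v, V v -> I (fun x => v.1 x ^+ 2) <= CP * D2 Omega v)
  (Fl : forall a x y, V x -> V y -> F (lincomb a x y) = a * F x + F y)
  (Fb : forall v, V v -> F v ^+ 2 <= CF * D2 Omega v)
  (Fpos : forall v, V v -> (forall x, 0 <= v.1 x) -> 0 <= F v).

(** Poincare's inequality takes over from the mass term, so coercivity in the full norm holds for
    [lam = 0]. *)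
Lemma n2_le_form v : V v -> al / (CP + 1) * n2 Omega v <= bform 0 v v.
Proof.
move=> Vv; have /andP[h _] := bform_diag oO mb al0 bb 0 Vv; apply: le_trans h.
have c0 : 0 < CP + 1 by rewrite ltr_wpDl.
rewrite mul0r addr0 mulrAC ler_pdivrMr// -mulrA ler_pM2l//.
by have := hP Vv; rewrite /n2; lra.
Qed.

Lemma posv_form u : V u -> bform 0 u (posv 0 u) = bform 0 (posv 0 u) (posv 0 u).
Proof.
move=> Vu; rewrite /bform !mul0r !addr0; apply: I_eq => x _; congr (_ * _).
rewrite /dotv; apply: eq_bigr => i _; rewrite /posv /= !mxE.
by case: ifP => _; rewrite ?mul1r ?mul0r ?mulr0.
Qed.

Lemma linear_solution : exists W, [/\ V W, aeon (fun x => 0 <= W.1 x) &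
  forall v, V v -> bform 0 W v = F v].
Proof.
have c0 : 0 < al / (CP + 1) by rewrite divr_gt0// ltr_wpDl.
have [|W VW hW] := @riesz R vf V (@lincomb R N) (bform 0) (fun a x y => @V_lincomb _ _ _ oO a x y)
  (fun x y _ _ => bformC Omega b 0 x y)
  (fun a x y z Vx Vy Vz => bform_linl oO mb al0 bb 0 a Vx Vy Vz)
  (fun x => bform_ge0 oO mb al0 bb (lexx 0) (v := x))
  (bform_complete oO mb al0 bb (lexx 0) c0 n2_le_form) F (CF / al) Fl _ _ (V_zero oO).
  move=> v Vv; apply: (le_trans (Fb Vv)).
  have /andP[h _] := bform_diag oO mb al0 bb 0 Vv.
  rewrite -mulrA ler_wpM2l// ler_pdivlMl//; apply: le_trans h; rewrite mul0r addr0//.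
(* [u] is [-W]. Testing with its positive part [d] gives [bform 0 d d = - F d <= 0], hence
   [d = 0]. *)
exists W; split => //; pose u := vsub (@vzero R N) W.
have Vu : V u := V_lincomb oO (-1) VW (V_zero oO).
pose d := posv 0 u; have Vd : V d by exact: V_posv.
have E : bform 0 d d = - F d.
  rewrite -posv_form// /u (bform_linl oO mb al0 bb 0 (-1) VW (V_zero oO) Vd).
  by rewrite hW// (bform_zerol oO) addr0 mulN1r.
have F0 : 0 <= F d by apply: Fpos => // x; rewrite /d /posv /= le_max lexx orbT.
have n0 : n2 Omega d <= 0.
  by rewrite -(ler_pM2l c0) mulr0; apply: (le_trans (n2_le_form Vd)); rewrite E oppr_le0.
have h2 : I (fun x => d.1 x ^+ 2) <= 0 := le_trans (vco_n2 _ d None) n0.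
have := I_eq0_ae mO (V_L2 Vd None).2 (aeonW mu (fun x _ => sqr_ge0 (d.1 x))) h2.
apply: aeon_imp => x _ /eqP; rewrite sqrf_eq0 => /eqP hx.
have Ed : d.1 x = Num.max (u.1 x) 0 by rewrite /d /posv [LHS]/= subr0.
have : u.1 x <= d.1 x by rewrite Ed le_max lexx.
by rewrite (hx : d.1 x = 0) /u vsubE1 /= sub0r oppr_le0.
Qed.

Variables (H : nat -> vf -> T -> R) (L : nat -> R).
Hypotheses (hH : forall n, lip_op (H n) (L n)) (L0 : forall n, 0 <= L n)
  (Hinc : forall n w x, H n w x <= H n.+1 w x).

Definition solves n w := [/\ V w, aeon (fun x => 0 <= w.1 x) &
  forall v, V v -> bform 0 w v + I (fun x => H n w x * v.1 x) = F v].

Lemma F_n2 : exists C, forall v, V v -> F v ^+ 2 <= C * n2 Omega v.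
Proof.
exists CF => v Vv; apply: (le_trans (Fb Vv)); rewrite ler_wpM2l//.
exact: D2_le_n2.
Qed.

(** For [n <= m] the difference [d = w n - w m] is nonnegative, and the sign of the operators gives
    [bform 0 (w n) d <= F d]. Expanded, this is [bform 0 d d <= a m - a n] for the energies
    [a n = bform 0 (w n) (w n) - 2 F (w n)], which are therefore nondecreasing, and at most 0.
    Convergence of the gradients follows with no uniform bound on the operators. *)
Lemma decreasing_solutions : exists w : nat -> vf, [/\ forall n, solves n (w n),
  forall n, aeon (fun x => (w n.+1).1 x <= (w n).1 x) &
  exists2 w', V w' & n2 Omega (vsub (w n) w') @[n --> \oo] --> 0].
Proof.
have [W [VW W0 eW]] := linear_solution.
have [w0 sw0] : exists w0, solves 0%N w0.
  have h0 x : 0 <= H 0%N W x by have [_ _ _ h] := hH 0%N.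
  have Lz : L2 (fun=> 0).
    by split => //; under eq_fun do rewrite expr0n; exact: (intg_cst oO bO).
  have eW' v : V v -> bform 0 W v + I (fun x => 0 * v.1 x) = F v.
    by move=> Vv; rewrite (I_eq0 oO) ?addr0 ?eW// => x _; rewrite mul0r.
  have [w0 [Vw0 b0 e0]] := monotone_solution oO bO mb al0 bb (hH 0%N) (L0 0%N) Fl F_n2 Fpos VW W0 Lz h0 eW'.
  by exists w0; split => //; move: b0; apply: aeon_imp => x _ /andP[].
have [|G hG] := @boolp.choice _ _ (fun (nw : nat * vf) w' => solves nw.1 nw.2 ->
    solves nw.1.+1 w' /\ aeon (fun x => w'.1 x <= nw.2.1 x)).
  move=> [n w] /=; have [sw|nsw] := pselect (solves n w); last by exists w.
  have [Vw wp ew] := sw.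
  (* [w] solves the problem for [H n], and [H n w <= H n.+1 w] makes it a supersolution for
     [H n.+1]. *)
  have [w' [Vw' b' e']] := monotone_solution oO bO mb al0 bb (hH n.+1) (L0 n.+1) Fl F_n2 Fpos Vw wp
    (op_L2 oO (hH n) Vw) (Hinc n w) ew.
  exists w' => _; split; first split => //.
    by move: b'; apply: aeon_imp => x _ /andP[].
  by move: b'; apply: aeon_imp => x _ /andP[].
pose w := fix w n := if n is k.+1 then G (k, w k) else w0.
have sw n : solves n (w n) by elim: n => // n IH; exact: (hG (n, w n) IH).1.
have dw n : aeon (fun x => (w n.+1).1 x <= (w n).1 x) by exact: (hG (n, w n) (sw n)).2.
clearbody w.
exists w; split => //.
have Vw n : V (w n) by case: (sw n).
have mon j k : (k <= j)%N -> aeon (fun x => (w j).1 x <= (w k).1 x).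
  elim: j => [|j IH]; first by rewrite leqn0 => /eqP ->; apply: aeonW.
  rewrite leq_eqVlt => /predU1P[->|kj]; first by apply: aeonW.
  by have := dw j; have := IH kj; apply: aeon_imp2 => x _ h1 h2; exact: le_trans h1.
pose q := bform 0; pose a n := q (w n) (w n) - 2 * F (w n).
have qC x y : q x y = q y x by exact: bformC.
have Hpos n d : V d -> aeon (fun x => 0 <= d.1 x) -> q (w n) d <= F d.
  move=> Vd d0; have [_ _ e] := sw n; rewrite -(e d Vd) lerDl.
  apply: (I_ge0_ae mO); first exact: (intg_op oO (hH n) (Vw n) Vd).
  by move: d0; apply: aeon_imp => x _ d0; rewrite mulr_ge0//; have [_ _ _ h] := hH n.
have q0 v : V v -> 0 <= q v v := bform_ge0 oO mb al0 bb (lexx 0).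
have a_le0 n : a n <= 0.
  have := Hpos n (w n) (Vw n) _; have [_ w0' _] := sw n => /(_ w0').
  by have := q0 _ (Vw n); rewrite /a; lra.
have qdiff n m : (n <= m)%N -> q (vsub (w n) (w m)) (vsub (w n) (w m)) <= a m - a n.
  move=> nm; have Vd : V (vsub (w n) (w m)) := V_lincomb oO (-1) (Vw m) (Vw n).
  have h := Hpos n _ Vd _.
  have {}h : q (w n) (vsub (w n) (w m)) <= F (vsub (w n) (w m)).
    by apply: h; move: (mon m n nm); apply: aeon_imp => x _ hx; rewrite vsubE1 subr_ge0.
  have E1 : F (vsub (w n) (w m)) = F (w n) - F (w m).
    by rewrite /vsub (Fl (-1) (Vw m) (Vw n)) mulN1r addrC.
  have lin u : V u -> q (vsub (w n) (w m)) u = q (w n) u - q (w m) u.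
    by move=> Vu; rewrite /q (bform_linl oO mb al0 bb 0 (-1) (Vw m) (Vw n) Vu) mulN1r addrC.
  have E2 := lin _ Vd.
  have E3 : q (w n) (vsub (w n) (w m)) = q (w n) (w n) - q (w n) (w m).
    by rewrite qC (lin _ (Vw n)) [q (w m) (w n)]qC.
  have E4 : q (w m) (vsub (w n) (w m)) = q (w n) (w m) - q (w m) (w m).
    by rewrite qC (lin _ (Vw m)).
  rewrite E2 E3 E4 /a; rewrite E1 E3 in h.
  move: h; move: (q (w n) (w n)) (q (w n) (w m)) (q (w m) (w m)) (F (w n)) (F (w m)) => *; lra.
have ainc : {homo a : n m / (n <= m)%N >-> n <= m}.
  move=> n m nm; rewrite -subr_ge0; apply: le_trans (qdiff n m nm); apply: q0.
  exact: (V_lincomb oO (-1) (Vw m) (Vw n)).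
have ca : a n @[n --> \oo] --> sup (range a).
  apply: nondecreasing_cvgn => //; exists 0 => _ [n _ <-]; exact: a_le0.
have c0 : 0 < al / (CP + 1) by rewrite divr_gt0// ltr_wpDl.
have [e e0|w' Vw' cw'] := V_complete oO Vw; last by exists w'.
have e1 : 0 < al / (CP + 1) * e / 2 by rewrite divr_gt0// mulr_gt0.
move/cvgrPdist_le: ca => /(_ _ e1) [K _ hK]; exists K => // k0 /= Kk m n km kn.
rewrite -(ler_pM2l c0).
wlog nm : m n km kn / (n <= m)%N.
  move=> hw; have [nm|nm] := leqP n m; first exact: hw.
  by rewrite n2_vsubC; apply: hw => //; exact: ltnW.
rewrite n2_vsubC; apply: (le_trans (n2_le_form (V_lincomb oO (-1) (Vw m) (Vw n)))).
apply: (le_trans (qdiff n m nm)).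
have h1 := hK m (leq_trans Kk km); have h2 := hK n (leq_trans Kk kn).
have -> : a m - a n = (sup (range a) - a n) - (sup (range a) - a m) by ring.
apply: (le_trans (ler_norm _)); apply: (le_trans (ler_normB _ _)).
apply: (le_trans (lerD h2 h1)).
by move: (al / (CP + 1) * e) => z; lra.
Qed.

End decreasing_solutions.

(** * The change of unknown and the regularised operators *)

Section inf_convolution.
Context (R : realType).
Variables (D : set R) (g : R -> R).
Hypotheses (D0 : D !=set0) (g_ge0 : forall t, D t -> 0 <= g t).

(** Pasch-Hausdorff envelope: the largest Lipschitz function with constant [n.+1] below [g] on [D].
    It is defined on the whole line although [g] matters on [D] only, and it increases with [n]. *)
Definition infconv (n : nat) (s : R) : R :=
  inf [set g t + n.+1%:R * `|s - t| | t in D].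

Let lb0 n s : lbound [set g t + n.+1%:R * `|s - t| | t in D] 0.
Proof. by move=> _ [t Dt <-]; rewrite addr_ge0 ?g_ge0// mulr_ge0. Qed.

Let has_inf_infconv n s : has_inf [set g t + n.+1%:R * `|s - t| | t in D].
Proof.
by split; [have [t Dt] := D0; exists (g t + n.+1%:R * `|s - t|), t|exists 0; exact: lb0].
Qed.

Lemma infconv_le n s t : D t -> infconv n s <= g t + n.+1%:R * `|s - t|.
Proof. by move=> Dt; apply: ge_inf; [exact: (has_inf_infconv n s).2|exists t]. Qed.

Lemma infconv_glb n s c : (forall t, D t -> c <= g t + n.+1%:R * `|s - t|) -> c <= infconv n s.
Proof.
by move=> h; apply: lb_le_inf; [exact: (has_inf_infconv n s).1|move=> _ [t Dt <-]; exact: h].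
Qed.

Lemma infconv_ge0 n s : 0 <= infconv n s.
Proof. by apply: infconv_glb => t Dt; rewrite addr_ge0 ?g_ge0// mulr_ge0. Qed.

Lemma infconv_lip n s t : `|infconv n s - infconv n t| <= n.+1%:R * `|s - t|.
Proof.
have h s' t' : infconv n s' - infconv n t' <= n.+1%:R * `|s' - t'|.
  rewrite lerBlDr addrC -lerBlDr; apply: infconv_glb => r Dr.
  rewrite lerBlDr; apply: (le_trans (infconv_le n s' Dr)).
  rewrite -addrA lerD2l -mulrDr ler_wpM2l// [leRHS]addrC.
  exact: ler_distD.
by rewrite ler_norml lerNl opprB h distrC h.
Qed.

Lemma infconv_mono n s : infconv n s <= infconv n.+1 s.
Proof.
apply: infconv_glb => t Dt; apply: (le_trans (infconv_le n s Dt)).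
by rewrite lerD2l ler_wpM2r// ler_nat.
Qed.

Lemma continuous_infconv n : continuous (infconv n).
Proof.
move=> s; apply/cvgrPdist_le => e e0; near=> t.
apply: (le_trans (infconv_lip n s t)).
rewrite mulrC -ler_pdivlMr//; near: t.
by apply: cvgr_dist_le => //; rewrite divr_gt0.
Unshelve. all: by end_near.
Qed.

(** The envelope is evaluated at moving points [u n] and with indices [m n], as happens along the
    approximate solutions; the cap [(m n).+1] is eventually above [g s]. *)
Lemma cvg_infconv (u : nat -> R) (m : nat -> nat) s : (forall n, (n <= m n)%N) ->
  (\forall t \near s, D t) -> {for s, continuous g} ->
  u n @[n --> \oo] --> s ->
  Num.min (infconv (m n) (u n)) (m n).+1%:R @[n --> \oo] --> g s.
Proof.
move=> hm Ds cg us; have Dss : D s by exact: nbhs_singleton.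
apply/cvgrPdist_le => e e0.
have /nbhs_ballP[d /= d0 hd] : \forall t \near s, D t /\ `|g s - g t| <= e.
  near=> t; split; first by near: t.
  by near: t; move/cvgrPdist_le: cg; exact.
near=> n.
have un : `|s - u n| < d / 2.
  by near: n; move/cvgrPdist_lt: us; apply; rewrite divr_gt0.
(* Competitors [t] at distance at least [d] from [s] are at distance at least [d/2] from [u n]; from
   this index on their penalty alone exceeds [g s]. *)
have n1 : g s / (d / 2) <= (m n).+1%:R.
  near: n; exists (Num.truncn (g s / (d / 2))) => // k /= hk.
  apply: ltW; apply: lt_le_trans (truncnS_gt _) _; by rewrite ler_nat ltnS (leq_trans hk)//.
have n2 : g s <= (m n).+1%:R.
  near: n; exists (Num.truncn (g s)) => // k /= hk.
  apply: ltW; apply: lt_le_trans (truncnS_gt _) _; by rewrite ler_nat ltnS (leq_trans hk)//.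
have [Du gu] : D (u n) /\ `|g s - g (u n)| <= e.
  by apply: hd; rewrite /ball/=; lra.
rewrite ler_norml; apply/andP; split.
  have h1 : Num.min (infconv (m n) (u n)) (m n).+1%:R <= g (u n).
    rewrite ge_min; apply/orP; left; apply: (le_trans (infconv_le (m n) (u n) Du)).
    by rewrite subrr normr0 mulr0 addr0.
  by move: gu; rewrite ler_norml => /andP[h2 _]; lra.
rewrite lerBlDr -lerBlDl le_min; apply/andP; split; last lra.
apply: infconv_glb => t Dt; have [td|td] := ltP `|s - t| d.
  have [_] := hd t td; rewrite ler_norml => /andP[_ h].
  by have := mulr_ge0 (ler0n R (m n).+1) (normr_ge0 (u n - t)); lra.
have h3 : d / 2 <= `|u n - t|.
  by have := ler_normD (s - u n) (u n - t); rewrite addrA subrK; lra.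
have h4 : g s <= (m n).+1%:R * `|u n - t|.
  rewrite ler_pdivrMr ?divr_gt0// in n1; apply: (le_trans n1).
  by rewrite ler_wpM2l.
by have := g_ge0 Dt; lra.
Unshelve. all: by end_near.
Qed.

End inf_convolution.

(** * The change of unknown and the transformed singular coefficient *)

Section ode.
Context (R : realType).

(* E solves E' = E^p, E(0) = 1 on its maximal interval, so that 1 + u = E(w)
   turns div(Du / (1 + u)^p) into div(Dw). *)
Record ode_data (p : R) := OdeData {
  ode : R -> R; ode_dom : set R; ode_pt : nat -> R;
  ode_dom_le : forall s t, ode_dom s -> 0 <= t <= s -> ode_dom t;
  ode_dom_open : forall s, ode_dom s -> \forall t \near s, ode_dom t;
  ode0 : ode 0 = 1;
  ode_gt0 : forall s, ode_dom s -> 0 < ode s;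
  ode_deriv : forall s, ode_dom s -> is_derive s 1 ode (ode s `^ p);
  ode_meas : measurable_fun setT ode;
  ode_pt_dom : forall k, ode_dom (ode_pt k) /\ 0 <= ode_pt k;
  ode_ptE : forall k, ode (ode_pt k) = k.+1%:R }.

(** Explicit solutions: the exponential for [p = 1], otherwise [(1 + r s)^(1/r)] with [r = 1 - p],
    on the set where [1 + r s > 0]. For [p > 1] that set ends at [1/(p - 1)], where the solution
    blows up. *)
Lemma ode_exists (p : R) : inhabited (ode_data p).
Proof.
have [->|p1] := eqVneq p 1.
  have dE (s : R) : setT s -> is_derive s 1 (@expR R) (expR s `^ 1).
    by move=> _; rewrite powRr1 ?expR_ge0//; exact: is_derive_expR.
  have pt k : setT (ln k.+1%:R : R) /\ 0 <= ln k.+1%:R :> R by split => //; rewrite ln_ge0// ler1n.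
  have ptE k : expR (ln k.+1%:R) = k.+1%:R :> R by rewrite lnK// posrE.
  by exists; apply: (@OdeData 1 (@expR R) setT (fun k => ln k.+1%:R)) => //;
    [move=> s _; exact: filterT|exact: expR0|move=> s _; exact: expR_gt0].
pose r : R := 1 - p; have r0 : r != 0 by rewrite /r subr_eq0 eq_sym.
have rE : p = 1 - r by rewrite /r; ring.
clearbody r.
have c0 s : {for s, continuous (fun s : R => 1 + r * s)}.
  by apply: cvgD; [exact: cvg_cst|apply: cvgM; [exact: cvg_cst|exact: cvg_id]].
exists; apply: (@OdeData p (fun s => (1 + r * s) `^ r^-1) [set s | 0 < 1 + r * s]
    (fun k => (k.+1%:R `^ r - 1) / r)) => /=.
- move=> s t s0 /andP[t0 ts]; have [r1|r1] := leP 0 r.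
    by have := mulr_ge0 r1 t0; lra.
  by have := ler_wnM2l (ltW r1) ts; lra.
- move=> s s0; have := c0 s; move/cvgrPdist_lt => /(_ _ s0); apply: filterS => t.
  by rewrite ltr_norml => /andP[_]; rewrite ltrBlDr ltrDl.
- by rewrite mulr0 addr0 powR1.
- by move=> s s0; exact: powR_gt0.
- move=> s s0.
  have d1 : is_derive s 1 (fun s : R => 1 + r * s) (0 + r * 1).
    have di := @is_derive_id R R s 1; have dc : is_derive s 1 (cst 1 : R -> R) 0 by exact: is_derive_cst.
    exact: (is_deriveD dc (@is_deriveZ _ _ _ _ r s 1 _ di)).
  have d2 := @is_derive1_powR R r^-1 _ s0.
  have := is_derive1_comp (g := fun s : R => 1 + r * s) d2 d1.
  move=> H; apply: (is_derive_eq H); rewrite add0r mulr1 [r^-1 * _]mulrC -mulrA mulVf// mulr1.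
  by rewrite -powRrM rE; congr (_ `^ _); field.
- apply: (measurableT_comp (f := fun s : R => s `^ r^-1)); first exact: measurable_powR.
  by apply: continuous_measurable_fun; exact: c0.
- move=> k; split; first by rewrite mulrC divfK// addrC subrK powR_gt0.
  have [r1|] := ltP 0 r.
    rewrite divr_ge0 ?(ltW r1)// subr_ge0 -[leLHS](powRr0 k.+1%:R) ler_powR ?ler1n//.
    exact: ltW.
  rewrite le_eqVlt (negbTE r0)/= => r1.
  rewrite -mulrNN -invrN opprB divr_ge0 ?oppr_ge0 ?(ltW r1)//.
  by rewrite subr_ge0 -[leRHS](powRr0 k.+1%:R) ler_powR ?ler1n// ltW.
- by move=> k; rewrite mulrC divfK// addrC subrK -powRrM mulfV// powRr1.
Qed.

Variables (p : R) (O : ode_data p).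
Hypothesis p0 : 0 < p.
Local Notation E := (ode O).
Local Notation dom := (ode_dom O).

Lemma ode_lt s t : dom t -> 0 <= s -> s < t -> E s < E t.
Proof.
move=> Dt s0 st.
have Dc c : s <= c <= t -> dom c.
  by move=> /andP[c1 c2]; apply: ode_dom_le Dt _; rewrite c2 (le_trans s0).
have dE c : s <= c <= t -> is_derive c 1 E (E c `^ p) by move=> /Dc; exact: ode_deriv.
have [||c] := @MVT R E (fun c => E c `^ p) s t st.
- by move=> x; rewrite in_itv/= => /andP[h1 h2]; apply: dE; rewrite !ltW.
- by apply: derivable_within_continuous => x; rewrite in_itv/= => /dE [].
rewrite in_itv/= => /andP[h1 h2] h; rewrite -subr_gt0 h mulr_gt0 ?subr_gt0//.
by rewrite powR_gt0// ode_gt0//; apply: Dc; rewrite !ltW.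
Qed.

Lemma ode_le s t : dom t -> 0 <= s -> s <= t -> E s <= E t.
Proof. by move=> Dt s0; rewrite le_eqVlt => /predU1P[->//|/(ode_lt Dt s0)/ltW]. Qed.

Lemma ode_ge1 s : dom s -> 0 <= s -> 1 <= E s.
Proof. by move=> Ds s0; rewrite -(ode0 O); exact: ode_le. Qed.

(** Mean value theorem, with [1 <= E^p <= E(t)^p] between 0 and [s]. It compares [u = E(w) - 1] with
    [w], so a singularity at [u = 0] is one of the same order at [w = 0]. *)
Lemma ode_sub1 s t : dom t -> 0 <= s <= t -> s <= E s - 1 <= E t `^ p * s.
Proof.
move=> Dt /andP[s0 st].
have Dc c : 0 <= c <= s -> dom c.
  by move=> /andP[c1 c2]; apply: ode_dom_le Dt _; rewrite c1 (le_trans c2).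
have dE c : 0 <= c <= s -> is_derive c 1 E (E c `^ p) by move=> /Dc; exact: ode_deriv.
move: s0; rewrite le_eqVlt => /predU1P[<-|s0]; first by rewrite ode0 subrr mulr0 lexx.
have [||c] := @MVT R E (fun c => E c `^ p) 0 s s0.
- by move=> x; rewrite in_itv/= => /andP[h1 h2]; apply: dE; rewrite !ltW.
- by apply: derivable_within_continuous => x; rewrite in_itv/= => /dE [].
rewrite in_itv/= ode0 subr0 => /andP[h1 h2] ->.
have Dcc : dom c by apply: Dc; rewrite !ltW.
rewrite -[leLHS]mul1r !ler_pM2r//; have c1 := ode_ge1 Dcc (ltW h1); apply/andP; split.
  by rewrite -[leLHS](powRr0 (E c)) ler_powR// ltW.
apply: ge0_ler_powR; rewrite ?nnegrE ?ltW// ?ode_gt0//.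
exact: ode_lt Dt (ltW h1) (lt_le_trans h2 st).
Qed.

Lemma ode_continuous s : dom s -> {for s, continuous E}.
Proof. by move=> Ds; exact: is_derive_continuous (ode_deriv Ds). Qed.

Variable th : R.
Hypothesis th1 : 1 <= th.

Definition gcoef (s : R) : R := (E s - 1) `^ (- th) * E s `^ (2 * p).

Lemma gcoef_ge0 s : 0 <= gcoef s.
Proof. by rewrite mulr_ge0 ?powR_ge0. Qed.

Lemma ode_gt1 s : dom s -> 0 < s -> 0 < E s - 1.
Proof. by move=> Ds s0; rewrite subr_gt0 -(ode0 O); exact: ode_lt. Qed.

Lemma gcoef_continuous s : dom s -> 0 < s -> {for s, continuous gcoef}.
Proof.
move=> Ds s0; apply: cvgM.
  apply: (cvg_comp (fun s => E s - 1) (fun y => y `^ (- th)) (G := nbhs (E s - 1))); last first.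
    by apply: powR_continuous; exact: ode_gt1.
  by apply: cvgB; [exact: ode_continuous|exact: cvg_cst].
apply: (cvg_comp E (fun y => y `^ (2 * p)) (G := nbhs (E s))); first exact: ode_continuous.
by apply: powR_continuous; exact: ode_gt0.
Qed.

Lemma gcoef_ub s t : dom t -> 0 < s -> s <= t -> gcoef s <= s `^ (- th) * E t `^ (2 * p).
Proof.
move=> Dt s0 st; have h : 0 <= s <= t by rewrite st ltW.
have Ds := ode_dom_le Dt h.
have /andP[h1 _] := ode_sub1 Dt h.
apply: ler_pM; rewrite ?powR_ge0//.
  rewrite !powRN lef_pV2 ?posrE ?powR_gt0//; last exact: ode_gt1.
  by apply: ge0_ler_powR => //; rewrite ?nnegrE ?(le_trans _ h1)// ?(le_trans ler01 th1)// ltW.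
apply: ge0_ler_powR; rewrite ?nnegrE ?mulr_ge0 ?(ltW p0)//.
- by rewrite ltW// ode_gt0.
- by rewrite ltW// ode_gt0.
- exact: (ode_le Dt (ltW s0) st).
Qed.

Lemma gcoef_lb : exists t c : R, [/\ 0 < t, 0 < c, dom t &
  forall s : R, 0 < s -> s <= t -> c / s <= gcoef s].
Proof.
have [D1 pos1] := ode_pt_dom O 1; set t1 := ode_pt O 1 in D1 pos1.
have t10 : 0 < t1.
  rewrite lt_def pos1 andbT; apply/eqP => t0; have := ode_ptE O 1.
  by rewrite -/t1 t0 ode0 => /eqP; rewrite eq_sym pnatr_eq1.
pose M := E t1 `^ p; have M0 : 0 < M by rewrite powR_gt0// ode_gt0.
pose t := Num.min t1 1; have t0 : 0 < t by rewrite lt_min t10 ltr01.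
have tt1 : t <= t1 by rewrite ge_min lexx.
have t1' : t <= 1 by rewrite ge_min lexx orbT.
exists t, (M `^ (- th)); split => //; first by rewrite powR_gt0.
  by apply: ode_dom_le D1 _; rewrite tt1 ltW.
move=> s s0 st; have h : 0 <= s <= t1 by rewrite (le_trans st tt1) ltW.
have Ds := ode_dom_le D1 h; have /andP[h1 h2] := ode_sub1 D1 h.
have e1 : 1 <= E s := ode_ge1 Ds (ltW s0).
have h3 : (M * s) `^ (- th) <= (E s - 1) `^ (- th).
  rewrite !powRN lef_pV2 ?posrE ?powR_gt0 ?mulr_gt0//; last exact: ode_gt1.
  by apply: ge0_ler_powR => //; rewrite ?nnegrE ?(le_trans _ h1)// ?(le_trans ler01 th1)// ?mulr_ge0 ?ltW.
have h4 : 1 <= E s `^ (2 * p).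
  by rewrite -[leLHS](powRr0 (E s)) ler_powR// mulr_ge0// ltW.
apply: (@le_trans _ _ ((M * s) `^ (- th))).
  rewrite powRM; [|exact: ltW|exact: ltW].
  apply: ler_wpM2l; first exact: powR_ge0.
  rewrite powRN lef_pV2 ?posrE ?powR_gt0//.
  by apply: ge1r_powR => //; rewrite s0 (le_trans st).
by apply: (le_trans h3); rewrite ler_peMr ?powR_ge0.
Qed.

End ode.

(** * Saturation of the squared gradient *)

Section saturation.
Context (R : realType).

Lemma sqrrD_le (x y : R) : (x + y) ^+ 2 <= 2 * x ^+ 2 + 2 * y ^+ 2.
Proof. have := sqr_ge0 (x - y); lra. Qed.

Definition ksat (n r : R) : R := n * r / (n + `|r|).

Lemma ksat_bounds n r : 0 < n -> 0 <= r -> [/\ 0 <= ksat n r, ksat n r <= n & ksat n r <= r].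
Proof.
move=> n0 r0; rewrite /ksat (ger0_norm r0); have nr : 0 < n + r by rewrite ltr_pwDl.
split; first by rewrite divr_ge0 ?mulr_ge0// ltW.
  by rewrite ler_pdivrMr// ler_pM2l// lerDr ltW.
by rewrite ler_pdivrMr// mulrC ler_wpM2l// lerDl.
Qed.

Lemma ksat_mono n m r : 0 < n -> n <= m -> 0 <= r -> ksat n r <= ksat m r.
Proof.
move=> n0 nm r0; rewrite /ksat (ger0_norm r0); have m0 := lt_le_trans n0 nm.
have h1 : 0 < n + r by rewrite ltr_pwDl.
have h2 : 0 < m + r by rewrite ltr_pwDl.
rewrite ler_pdivrMr// mulrAC ler_pdivlMr//.
have := mulr_ge0 (mulr_ge0 r0 r0) (_ : 0 <= m - n); rewrite subr_ge0 => /(_ nm); lra.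
Qed.

(** Here [a], [c] are squared gradients and [d] is the squared gradient of the difference. Squaring
    is not Lipschitz, but the product of the denominators dominates [n (a + c)], so the saturated
    square is. *)
Lemma ksat_lip n a c d : 0 < n -> 0 <= a -> 0 <= c -> (a - c) ^+ 2 <= d * (2 * (a + c)) ->
  0 <= d -> (ksat n a - ksat n c) ^+ 2 <= 2 * n * d.
Proof.
move=> n0 a0 c0 h d0; rewrite /ksat (ger0_norm a0) (ger0_norm c0).
have h1 : 0 < n + a by rewrite ltr_pwDl.
have h2 : 0 < n + c by rewrite ltr_pwDl.
have -> : n * a / (n + a) - n * c / (n + c) = n ^+ 2 * (a - c) / ((n + a) * (n + c)).
  by field; rewrite !gt_eqF.
pose P := (n + a) * (n + c); have P0 : 0 < P by exact: mulr_gt0.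
rewrite -/P exprMn exprVn ler_pdivrMr ?exprn_gt0// exprMn.
have p1 : n * (a + c) <= P by rewrite /P; have := mulr_ge0 a0 c0; have := sqr_ge0 n; lra.
have p2 : n ^+ 2 <= P.
  rewrite /P; have := mulr_ge0 a0 c0; have := mulr_ge0 (ltW n0) a0; have := mulr_ge0 (ltW n0) c0; lra.
have p3 : n ^+ 2 * (n * (a + c)) <= P * P.
  by apply: ler_pM => //; [exact: sqr_ge0|rewrite mulr_ge0 ?addr_ge0// ltW].
have q1 := ler_wpM2l (sqr_ge0 (n ^+ 2)) h.
have q2 := ler_wpM2l (mulr_ge0 (mulr_ge0 (ler0n R 2) (ltW n0)) d0) p3.
apply: (le_trans q1); apply: (@le_trans _ _ (2 * n * d * (P * P))); last by rewrite [P ^+ 2]expr2.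
apply: le_trans q2; rewrite le_eqVlt; apply/orP; left; apply/eqP; ring.
Qed.

Lemma cvg_ksat (r : nat -> R) (l : R) (m : nat -> nat) : (forall k, (k <= m k)%N) ->
  r k @[k --> \oo] --> l -> ksat (m k).+1%:R (r k) @[k --> \oo] --> l.
Proof.
move=> hm rl.
have i0 : (m k).+1%:R^-1 @[k --> \oo] --> (0 : R).
  apply: (@squeeze_cvgr _ _ _ _ (fun=> 0) (fun k => k.+1%:R^-1 : R)); [|exact: cvg_cst|exact: cvg_harmonic].
  by near=> k; rewrite invr_ge0 ler0n/= lef_pV2 ?posrE// ler_nat ltnS.
have c : r k / (1 + `|r k| * (m k).+1%:R^-1) @[k --> \oo] --> l / (1 + `|l| * 0).
  apply: cvgM => //; apply: cvgV; first by rewrite mulr0 addr0 oner_neq0.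
  by apply: cvgD; [exact: cvg_cst|apply: cvgM => //; exact: cvg_norm].
rewrite mulr0 addr0 divr1 in c.
rewrite (_ : (fun k => _) = (fun k => r k / (1 + `|r k| * (m k).+1%:R^-1))) //.
apply/funext => k; rewrite /ksat.
have n0 : 0 < (m k).+1%:R :> R by [].
have h : 0 < (m k).+1%:R + `|r k| by rewrite ltr_pwDl.
by field; rewrite !gt_eqF//= mulr1 addr_gt0.
Unshelve. all: by end_near.
Qed.

End saturation.

Section truncation.
Context (R : realType) (N : nat) (Omega : set 'rV[R]_N).
Hypotheses (oO : open Omega) (bO : bounded_set Omega).
Local Notation mu := (lebesgue_rV R N).
Local Notation T := 'rV[R]_N.
Local Notation mO := (measurable_Omega oO).
Local Notation V := (@inV R N Omega).
Local Notation vf := (@vf R N).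
Local Notation aeon := (aeon mu Omega).

Definition minv (S : R) (w : vf) : vf :=
  (fun x => Num.min (w.1 x) S, fun x => if S < w.1 x then 0 else w.2 x).

Lemma V_minv S w : 0 <= S -> V w -> V (minv S w).
Proof.
move=> S0 Vw; rewrite (_ : minv S w = vsub w (posv S w)).
  exact: (V_lincomb oO (-1) (V_posv oO bO S0 Vw) Vw).
rewrite /minv /vsub /lincomb /posv /vcomp; congr pair; apply/funext => x /=.
  rewrite mulN1r addrC; case: (leP (w.1 x) S) => h.
    by rewrite max_r ?subr_le0// subr0.
  by rewrite max_l ?subr_ge0 ?ltW//; ring.
by case: ifP => _; rewrite scaleN1r ?scale1r ?scale0r ?oppr0 ?add0r ?addNr.
Qed.

(** [phi F(min(w, S))] with the gradient of the product rule. Truncation at [S] keeps the argument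
    of [F] in an interval where [F] is differentiable. *)
Definition testv (phi : vf) (F h : R -> R) (S : R) (w : vf) : vf :=
  (fun x => phi.1 x * F ((minv S w).1 x),
   fun x => F ((minv S w).1 x) *: phi.2 x + (phi.1 x * h ((minv S w).1 x)) *: (minv S w).2 x).

Lemma V_testF (F h : R -> R) (S : R) w : 0 < S -> V w -> aeon (fun x => 0 <= w.1 x) ->
  measurable_fun setT F -> measurable_fun setT h ->
  (forall s : R, 0 <= s <= S -> is_derive s 1 F (h s)) ->
  (forall s : R, 0 <= s <= S -> {for s, continuous h}) -> F 0 = 0 ->
  V (vcomp F h (minv S w)).
Proof.
move=> S0 Vw w0 mF mh dF ch F0.
apply: (V_chain_ab oO bO (V_minv (ltW S0) Vw) _ S0 _ mF mh dF ch F0); first by rewrite lexx ltW.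
move: w0; apply: aeon_imp => x _ h0 /=.
by rewrite le_min h0 (ltW S0) ge_min lexx orbT.
Qed.

Lemma V_testv (M : R) (phi : vf) (F h : R -> R) (S : R) w : 0 < S -> V w ->
  aeon (fun x => 0 <= w.1 x) -> V phi -> (forall x, `|phi.1 x| <= M) ->
  measurable_fun setT F -> measurable_fun setT h ->
  (forall s : R, 0 <= s <= S -> is_derive s 1 F (h s)) ->
  (forall s : R, 0 <= s <= S -> {for s, continuous h}) ->
  V (testv phi F h S w).
Proof.
move=> S0 Vw w0 Vp pM mF mh dF ch.
(* The chain rule needs a function vanishing at 0; the product is recovered as
   [phi G(min(w, S)) + F(0) phi]. *)
pose G s := F s - F 0.
have dG (s : R) : 0 <= s <= S -> is_derive s 1 G (h s).
  move=> hs; have dc : is_derive s 1 (cst (F 0) : R -> R) 0 by exact: is_derive_cst.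
  by have H := is_deriveB (dF s hs) dc; apply: (is_derive_eq H); rewrite subr0.
have mG : measurable_fun setT G by apply: measurable_funB.
have VG : V (vcomp G h (minv S w)) by apply: V_testF => //; rewrite /G subrr.
have [K hK] : exists K : R, forall s, 0 <= s <= S -> `|G s| <= K.
  have [G' [g' [L [dG' _ gL Gg]]]] := extend_C1 S0 dG ch.
  exists (L * S) => s hs; have [<- _] := Gg s hs.
  have G0 : G' 0 = 0 by rewrite (Gg 0 _).1 ?/G ?subrr// lexx ltW.
  have := lipschitz_derive dG' gL s 0; rewrite G0 !subr0 => h1; apply: (le_trans h1).
  have /andP[s0 sS] := hs; rewrite ger0_norm// ler_wpM2l//.
  exact: le_trans (normr_ge0 _) (gL 0).
have Vm : V (vmul phi (vcomp G h (minv S w))).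
  apply: (@V_mul _ _ _ oO bO (Num.max M K)) => //.
    by apply: aeonW => x _; rewrite le_max pM.
  move: w0; apply: aeon_imp => x _ h0 /=; rewrite le_max; apply/orP; right.
  by apply: hK; rewrite le_min h0 (ltW S0) ge_min lexx orbT.
have := V_lincomb oO (F 0) Vp Vm; congr inV.
rewrite /lincomb /vmul /vcomp /testv; congr pair; apply/funext => x /=.
  by rewrite /G; ring.
by apply/rowP => i; rewrite !mxE /G; ring.
Qed.

End truncation.

(** * The regularised problems *)

Section approximation.
Context (R : realType) (N : nat) (Omega : set 'rV[R]_N).
Hypotheses (oO : open Omega) (bO : bounded_set Omega).
Local Notation mu := (lebesgue_rV R N).
Local Notation T := 'rV[R]_N.
Local Notation I f := (\int[mu]_(x in Omega) f x).
Local Notation mO := (measurable_Omega oO).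
Local Notation V := (@inV R N Omega).
Local Notation vf := (@vf R N).
Local Notation aeon := (aeon mu Omega).
Variables (p th B : R) (O : ode_data p).
Hypotheses (p0 : 0 < p) (th1 : 1 <= th) (B0 : 0 < B).

Definition gdom : set R := [set s | ode_dom O s /\ 0 < s].

Local Notation g := (gcoef O th).
Local Notation gn := (infconv gdom g).

Lemma gdom_nonempty : gdom !=set0.
Proof. by have [t [c [t0 _ Dt _]]] := gcoef_lb O p0 th1; exists t. Qed.

Lemma gdom_ge0 t : gdom t -> 0 <= g t. Proof. by move=> _; exact: gcoef_ge0. Qed.

(** A product of Lipschitz factors is Lipschitz when both are bounded, hence the cap [n.+1] on the
    envelope besides the saturation of the squared gradient. *)
Definition hop (n : nat) (w : vf) (x : T) : R :=
  B * (Num.min (gn n (w.1 x)) n.+1%:R * ksat n.+1%:R (gsq w x)).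

(** Cauchy-Schwarz for the difference of squares as a scalar product of difference and sum, followed
    by the parallelogram bound on the sum. This is the hypothesis of [ksat_lip]. *)
Lemma gsq_diff (w v : vf) x : (gsq w x - gsq v x) ^+ 2 <= gsq (vsub w v) x * (2 * (gsq w x + gsq v x)).
Proof.
pose a i := w.2 x 0 i - v.2 x 0 i; pose c i := w.2 x 0 i + v.2 x 0 i.
have E1 : gsq w x - gsq v x = \sum_i a i * c i.
  by rewrite !gsqE -sumrB; apply: eq_bigr => i _; rewrite /a /c subr_sqr.
have E2 : gsq (vsub w v) x = \sum_i a i ^+ 2.
  by rewrite gsqE; apply: eq_bigr => i _; have := vsubE w v (Some i) x; rewrite /= => ->.
have h : (\sum_i a i * c i) ^+ 2 <= (\sum_i a i ^+ 2) * (\sum_i c i ^+ 2).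
  apply: discriminant; first by apply: sumr_ge0 => i _; exact: sqr_ge0.
  move=> t; rewrite !mulr_sumr -!big_split; apply: sumr_ge0 => i _ /=.
  have -> : t ^+ 2 * a i ^+ 2 + 2 * t * (a i * c i) + c i ^+ 2 = (t * a i + c i) ^+ 2 by ring.
  exact: sqr_ge0.
rewrite E1 E2; apply: (le_trans h); rewrite ler_wpM2l//.
  by apply: sumr_ge0 => i _; exact: sqr_ge0.
rewrite !gsqE -big_split mulr_sumr; apply: ler_sum => i _ /=; rewrite /c.
have := sqr_ge0 (w.2 x 0 i - v.2 x 0 i); rewrite sqrrB sqrrD; lra.
Qed.

Definition hlip (n : nat) : R := B ^+ 2 * (2 * n.+1%:R ^+ 4 + 4 * n.+1%:R ^+ 3).

Lemma hlip_ge0 n : 0 <= hlip n.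
Proof. by rewrite mulr_ge0 ?sqr_ge0// addr_ge0// mulr_ge0// exprn_ge0. Qed.

Lemma hop_lip n : lip_op (hop n) (hlip n).
Proof.
have n0 : 0 < n.+1%:R :> R by [].
have gmin s : 0 <= Num.min (gn n s) n.+1%:R <= n.+1%:R.
  by rewrite le_min ge_min lexx orbT ler0n infconv_ge0//; [exact: gdom_nonempty|exact: gdom_ge0].
split.
- move=> w mw; have msq : measurable_fun setT (gsq w).
    by apply: measurable_dotv => i; exact: (mw (Some i)).
  apply: measurable_funM => //; apply: measurable_funM.
    apply: measurable_minr => //; apply: (measurableT_comp (f := gn n)); last exact: (mw None).
    by apply: continuous_measurable_fun; apply: continuous_infconv; [exact: gdom_nonempty|exact: gdom_ge0].
  apply: (measurableT_comp (f := ksat n.+1%:R)) => //.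
  apply: continuous_measurable_fun => s; apply: cvgM.
    by apply: cvgM; [exact: cvg_cst|exact: cvg_id].
  apply: cvgV; first by rewrite gt_eqF// ltr_pwDl.
  by apply: cvgD; [exact: cvg_cst|apply: cvg_norm; exact: cvg_id].
- move=> w v x; rewrite /hop -mulrBr exprMn /hlip -mulrA ler_wpM2l ?sqr_ge0//.
  have h1 := infconv_lip gdom_nonempty gdom_ge0 n (w.1 x) (v.1 x).
  have h2 : `|Num.min (gn n (w.1 x)) n.+1%:R - Num.min (gn n (v.1 x)) n.+1%:R| <= n.+1%:R * `|w.1 x - v.1 x|.
    apply: le_trans h1; rewrite !minEle.
    have [a1|a1] := leP (gn n (w.1 x)) n.+1%:R; have [a2|a2] := leP (gn n (v.1 x)) n.+1%:R => //.
    + rewrite distrC [leRHS]distrC !ger0_norm ?subr_ge0//; lra.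
    + rewrite !ger0_norm ?subr_ge0//; lra.
    + by rewrite subrr normr0.
  have h3 := gmin (w.1 x); have h4 := gmin (v.1 x).
  have [k1 k2 _] := ksat_bounds n0 (gsq_ge0 w x).
  have k3 := ksat_lip n0 (gsq_ge0 w x) (gsq_ge0 v x) (gsq_diff w v x) (gsq_ge0 _ x).
  move: h2 h3 h4 k1 k2 k3; move: (Num.min _ _) (Num.min _ _) (ksat _ _) (ksat _ _) (gsq (vsub w v) x) => c a l k d.
  move: (w.1 x - v.1 x) => e h2 /andP[a0 an] /andP[c0 cn] k0 kn kl.
  have h5 := sqr_le_norm h2; rewrite exprMn real_normK ?num_real// in h5.
  have k2 : k ^+ 2 <= n.+1%:R ^+ 2 by rewrite ler_pXn2r ?nnegrE ?ler0n.
  have c2 : c ^+ 2 <= n.+1%:R ^+ 2 by rewrite ler_pXn2r ?nnegrE ?ler0n.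
  (* The difference is split as [k (a - c) + c (k - l)] with [k] and [c] at most [n + 1]. The first
     part produces the fourth power in [hlip], the second, through [ksat_lip], the third power. *)
  have q1 : k ^+ 2 * (a - c) ^+ 2 <= n.+1%:R ^+ 2 * (n.+1%:R ^+ 2 * e ^+ 2) by apply: ler_pM => //; exact: sqr_ge0.
  have q2 : c ^+ 2 * (k - l) ^+ 2 <= n.+1%:R ^+ 2 * (2 * n.+1%:R * d) by apply: ler_pM => //; exact: sqr_ge0.
  have d0 : 0 <= d.
    by have := le_trans (sqr_ge0 (k - l)) kl; rewrite pmulr_rge0// mulr_gt0.
  have q3 : (a * k - c * l) ^+ 2 <= 2 * (k ^+ 2 * (a - c) ^+ 2) + 2 * (c ^+ 2 * (k - l) ^+ 2).
    have -> : (a * k - c * l) = k * (a - c) + c * (k - l) by ring.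
    by rewrite -!exprMn; exact: sqrrD_le.
  have q4 : 0 <= n.+1%:R ^+ 3 * e ^+ 2 by rewrite mulr_ge0 ?sqr_ge0 ?exprn_ge0.
  have q5 : 0 <= n.+1%:R ^+ 4 * d by rewrite mulr_ge0 ?exprn_ge0.
  apply: (le_trans q3); clear h1 h2 h5 k2 c2 kl an cn kn q3 gmin; move: q1 q2 q4 q5; move: n.+1%:R n0 => m _.
  have -> : m ^+ 2 * (m ^+ 2 * e ^+ 2) = m ^+ 4 * e ^+ 2 by ring.
  have -> : m ^+ 2 * (2 * m * d) = 2 * (m ^+ 3 * d) by ring.
  have -> : (2 * m ^+ 4 + 4 * m ^+ 3) * (e ^+ 2 + d) =
    2 * (m ^+ 4 * e ^+ 2) + 2 * (m ^+ 4 * d) + 4 * (m ^+ 3 * e ^+ 2) + 4 * (m ^+ 3 * d) by ring.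
  move: (m ^+ 4 * e ^+ 2) (m ^+ 4 * d) (m ^+ 3 * e ^+ 2) (m ^+ 3 * d) (k ^+ 2 * _) (c ^+ 2 * _) => x1 x2 x3 x4 x5 x6.
  lra.
- move=> x; rewrite /hop (_ : gsq _ x = 0) ?/ksat ?mulr0 ?mul0r ?mulr0//.
  by rewrite gsqE big1// => i _; rewrite mxE expr0n.
- move=> w x; have /andP[g0 _] := gmin (w.1 x); have [k1 _ _] := ksat_bounds n0 (gsq_ge0 w x).
  by apply: mulr_ge0; [exact: ltW|exact: mulr_ge0].
Qed.

Lemma hop_mono n w x : hop n w x <= hop n.+1 w x.
Proof.
rewrite /hop ler_pM2l//; have [k1 _ _] := ksat_bounds (ltr0Sn R n) (gsq_ge0 w x).
apply: ler_pM => //.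
- by rewrite le_min ler0n infconv_ge0//; [exact: gdom_nonempty|exact: gdom_ge0].
- rewrite le_min; apply/andP; split.
    rewrite ge_min; apply/orP; left; apply: infconv_mono; [exact: gdom_nonempty|exact: gdom_ge0].
  by rewrite ge_min ler_nat leqnSn orbT.
- by apply: ksat_mono => //; [rewrite ler_nat|exact: gsq_ge0].
Qed.

Lemma hop_le n w x t : gdom t -> hop n w x <= B * (g t + n.+1%:R * `|w.1 x - t|) * gsq w x.
Proof.
move=> Dt; rewrite /hop -mulrA ler_pM2l//.
have [k1 _ k2] := ksat_bounds (ltr0Sn R n) (gsq_ge0 w x).
apply: ler_pM => //.
  by rewrite le_min ler0n infconv_ge0//; [exact: gdom_nonempty|exact: gdom_ge0].
rewrite ge_min; apply/orP; left; exact: (infconv_le gdom_nonempty gdom_ge0).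
Qed.

Lemma gdom_open s : gdom s -> \forall t \near s, gdom t.
Proof.
move=> [Ds s0]; near=> t; split; near: t; first exact: ode_dom_open.
exact: lt_nbhsr.
Unshelve. all: by end_near.
Qed.

Lemma cvg_hop (w : nat -> vf) (m : nat -> nat) w' x : (forall k, (k <= m k)%N) ->
  gdom (w'.1 x) -> (forall o, vco (w k) o x @[k --> \oo] --> vco w' o x) ->
  hop (m k) (w k) x @[k --> \oo] --> B * (g (w'.1 x) * gsq w' x).
Proof.
move=> hm Dw c; apply: cvgM; first exact: cvg_cst.
have cg : gsq (w k) x @[k --> \oo] --> gsq w' x.
  rewrite gsqE; under eq_fun do rewrite gsqE; apply: cvg_sumR => i.
  by rewrite expr2; under eq_fun do rewrite expr2; apply: cvgM; exact: (c (Some i)).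
apply: cvgM; last exact: cvg_ksat.
have gx : {for w'.1 x, continuous g} by case: Dw => *; exact: gcoef_continuous.
apply: (cvg_infconv gdom_nonempty gdom_ge0 hm (gdom_open Dw) gx).
exact: (c None).
Qed.

Variables (b : T -> R) (al be : R).
Hypotheses (mb : measurable_fun setT b) (al0 : 0 < al) (bb : forall x, al <= b x <= be).
Variables (CP CF : R) (F : vf -> R).
Hypotheses (CP0 : 0 <= CP) (CF0 : 0 <= CF)
  (hP : forall v, V v -> I (fun x => v.1 x ^+ 2) <= CP * D2 Omega v)
  (Fl : forall a x y, V x -> V y -> F (lincomb a x y) = a * F x + F y)
  (Fb : forall v, V v -> F v ^+ 2 <= CF * D2 Omega v)
  (Fpos : forall v, V v -> (forall x, 0 <= v.1 x) -> 0 <= F v).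

(** After passing to a subsequence only [k <= m k] is remembered about the indices; this suffices
    for [cvg_hop]. *)
Lemma approximate_solutions : exists (w : nat -> vf) (m : nat -> nat) (w' : vf) (S : T -> R),
  [/\ forall k, (k <= m k)%N,
      forall k, solves Omega b F hop (m k) (w k),
      V w' /\ aeon (fun x => 0 <= w'.1 x),
      intg mu Omega S &
      aeon (fun x => (forall k o, vco (w k) o x ^+ 2 <= S x) /\
        forall o, vco (w k) o x @[k --> \oo] --> vco w' o x)].
Proof.
have [w [sw _ [w' Vw' cw]]] := decreasing_solutions oO bO mb al0 bb CP0 CF0 hP Fl Fb Fpos
  hop_lip hlip_ge0 hop_mono.
have Vw k : V (w k) by case: (sw k).
have [phi [S [phim iS S0 hS]]] := V_subseq oO (fun k => V_L2 (Vw k)) (V_L2 Vw') cw.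
have c0 : aeon (fun x => forall o, vco (w (phi k)) o x @[k --> \oo] --> vco w' o x).
  by move: hS; apply: aeon_imp => x _ hx o; apply: cvg_of_sqr => k; exact: hx.
exists (fun k => w (phi k)), phi, w', (fun x => 2 * S x + 2 * (w'.1 x ^+ 2 + gsq w' x)); split.
- exact: increasing_ge.
- by move=> k; exact: sw.
- split => //.
  have posk k : aeon (fun x => 0 <= (w (phi k)).1 x) by case: (sw (phi k)).
  have pos := aeon_all posk.
  move: pos c0; apply: aeon_imp2 => x _ h c; have cx : (w (phi k)).1 x @[k --> \oo] --> w'.1 x := c None.
  rewrite -(cvg_lim (@Rhausdorff R) cx); apply: limr_ge; first exact: cvgP cx.
  by near=> k; exact: h.
- apply: (intgD mO); apply: (intgZ mO) => //; apply: (intgD mO); first by case: (V_L2 Vw' None).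
  exact: (intg_gsq oO (V_L2 Vw')).
move: hS c0; apply: aeon_imp2 => x Ox hx c; split => // k o.
have h1 : vco w' o x ^+ 2 <= w'.1 x ^+ 2 + gsq w' x.
  rewrite gsqE; case: o => [i|] /=; last by rewrite lerDl sumr_ge0// => i _; exact: sqr_ge0.
  rewrite (bigD1 i)//= addrCA lerDl addr_ge0 ?sqr_ge0// sumr_ge0// => j _; exact: sqr_ge0.
have h2 : (vco (w (phi k)) o x - vco w' o x) ^+ 2 <= S x.
  by apply: (le_trans (hx k o)); rewrite ler_piMl ?S0// exprn_ile1 ?invr_ge0// invf_le1// ler1n.
have := sqrrD_le (vco (w (phi k)) o x - vco w' o x) (vco w' o x); rewrite subrK; lra.
Unshelve. all: by end_near.
Qed.

End approximation.

(** * Positivity of the limit *)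

Section bump.
Context (R : realType).

(** The classical flat function [exp(-1/t)] with a polynomial factor in [1/t]: this family is stable
    under differentiation, whereas the exponential alone is not. *)
Definition flat (Q : {poly R}) (t : R) : R := if 0 < t then Q.[t^-1] * expR (- t^-1) else 0.

Lemma poly_exp_bound (Q : {poly R}) : exists2 C : R, 0 <= C &
  forall s : R, 0 <= s -> `|Q.[s]| <= C * expR s.
Proof.
have mon (i : nat) (s : R) : 0 <= s -> s ^+ i <= i`!%:R * expR s.
  move=> s0; case: i => [|i]; first by rewrite expr0 mul1r (le_trans _ (expR_ge1Dx s))// lerDl.
  have := expR_ge1Dxn i s0; rewrite -ler_pdivrMl ?ltr0n ?fact_gt0// mulrC => h.
  by apply: le_trans h; rewrite lerDr.
exists (\sum_(i < size Q) `|Q`_i| * i`!%:R) => [|s s0].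
  by apply: sumr_ge0 => i _; rewrite mulr_ge0.
rewrite horner_coef mulr_suml; apply: (le_trans (ler_norm_sum _ _ _)).
apply: ler_sum => i _; rewrite normrM -mulrA ler_wpM2l// ger0_norm ?exprn_ge0//.
exact: mon.
Qed.

(** Polynomial factor of the derivative: differentiating [Q(1/t) exp(-1/t)] gives
    [t^-2 (Q - Q')(1/t) exp(-1/t)]. *)
Definition flat' (Q : {poly R}) : {poly R} := 'X^2 * (Q - Q^`()).

Lemma is_derive_flat Q (t : R) : is_derive t 1 (flat Q) (flat (flat' Q) t).
Proof.
have [t0|t0|->] := ltgtP t 0.
- have d0 : is_derive t 1 (cst 0 : R -> R) 0 by exact: is_derive_cst.
  have -> : flat (flat' Q) t = 0 by rewrite /flat ltNge (ltW t0).
  apply: (near_eq_is_derive _ d0); near=> s; rewrite /flat.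
  have s0 : s < 0 by near: s; exact: lt_nbhsl.
  by rewrite ltNge (ltW s0).
- have tn : t != 0 by rewrite gt_eqF.
  have di : is_derive t 1 (fun s : R => s^-1) (- t ^- 2 *: 1).
    exact: (@is_deriveV R idfun t 1 1 tn (is_derive_id t 1)).
  have dQ : is_derive (t^-1) 1 (horner Q) Q^`().[t^-1] by exact: is_derive_poly.
  have d1 := is_derive1_comp (g := fun s : R => s^-1) dQ di.
  have dN : is_derive t 1 (fun s : R => - s^-1) (- (- t ^- 2 *: 1)) by exact: is_deriveN.
  have d2 := is_derive1_comp (g := fun s : R => - s^-1) (is_derive_expR (- t^-1)) dN.
  have d3 := is_deriveM d1 d2.
  have d4 : is_derive t 1 (fun s : R => Q.[s^-1] * expR (- s^-1)) (flat (flat' Q) t).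
    apply: (is_derive_eq d3); rewrite /flat t0 /flat' /GRing.scale /= !hornerE /=.
    by rewrite -exprVn; ring.
  apply: (near_eq_is_derive _ d4); near=> s; rewrite /flat.
  have s0 : 0 < s by near: s; exact: lt_nbhsr.
  by rewrite s0.
(* At 0 the difference quotient is [h] times [h^-2 Q(1/h) exp(-1/h)]; the second factor is bounded,
   as the exponential outgrows the polynomial. *)
have [C C0 hC] := poly_exp_bound ('X^2 * Q).
rewrite [flat (flat' Q) 0]/flat ltxx.
apply: is_derive_cvg; apply/cvgr0Pnorm_le => e e0; near=> h.
rewrite /flat ltxx subr0 addr0 [h *: 1]mulr1; case: ifP => h0; last by rewrite scaler0 normr0 ltW.
have hi : 0 <= h^-1 by rewrite invr_ge0 ltW.
have := hC _ hi; rewrite hornerM hornerXn => b1.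
have h1 : 0 < h^-1 by rewrite invr_gt0.
have b2 : `|h^-1 ^+ 2 * (Q.[h^-1] * expR (- h^-1))| <= C.
  rewrite mulrA normrM (ger0_norm (expR_ge0 _)) expRN.
  by rewrite ler_pdivrMr ?expR_gt0.
rewrite [_ *: _](_ : _ = h * (h^-1 ^+ 2 * (Q.[h^-1] * expR (- h^-1)))); last first.
  by rewrite /GRing.scale/= expr2 !mulrA divff ?gt_eqF// mul1r.
rewrite normrM (gtr0_norm h0); apply: (@le_trans _ _ (h * (C + 1))).
  by rewrite ler_wpM2l ?(ltW h0)// (le_trans b2)// lerDl.
have hs : `|h| <= e / (C + 1).
  by near: h; apply: dnbhs0_le; rewrite divr_gt0// ltr_wpDl.
by rewrite (gtr0_norm h0) ler_pdivlMr ?ltr_wpDl in hs.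
Unshelve. all: by end_near.
Qed.

Lemma flat1_gt0 (t : R) : (0 < flat 1 t) = (0 < t).
Proof. by rewrite /flat; case: ifP => h; rewrite ?ltxx// hornerC mul1r expR_gt0. Qed.

Lemma flat1_le0 (t : R) : t <= 0 -> flat 1 t = 0.
Proof. by move=> h; rewrite /flat ltNge h. Qed.

Lemma flat1_ge0 (t : R) : 0 <= flat 1 t.
Proof. by have [h|h] := leP t 0; [rewrite flat1_le0|rewrite ltW// flat1_gt0]. Qed.

Variable n : nat.
Local Notation ebase := (@ebase R n).

Definition flat_coord (i : 'I_n) (a c : R) Q (x : 'rV[R]_n) : R := flat Q (a * x 0 i + c).

Lemma is_derive_flat_coord i (a c : R) Q j x :
  is_derive x (ebase j) (flat_coord i a c Q) (a * (i == j)%:R * flat_coord i a c (flat' Q) x).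
Proof.
apply: is_derive_cvg; rewrite /flat_coord.
pose u : R := a * (i == j)%:R.
have di : is_derive (0 : R) 1 (fun h : R => u * h + (a * x 0 i + c)) u.
  have d1 := @is_deriveZ _ _ _ _ u (0 : R) 1 _ (is_derive_id (0 : R) 1).
  have d2 : is_derive (0 : R) 1 (cst (a * x 0 i + c) : R -> R) 0 by exact: is_derive_cst.
  by apply: (is_derive_eq (is_deriveD d1 d2)); rewrite addr0 /GRing.scale/= mulr1.
have E0 : u * 0 + (a * x 0 i + c) = a * x 0 i + c by rewrite mulr0 add0r.
have df := is_derive_flat Q (u * 0 + (a * x 0 i + c)).
have := is_derive_quot (is_derive1_comp (g := fun h : R => u * h + (a * x 0 i + c)) df di).
rewrite /= E0 [_ * u]mulrC => H; apply: cvg_trans H; apply: near_eq_cvg; near=> h.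
rewrite /= addr0 [h *: 1]mulr1; congr (_ *: (flat Q _ - _)).
by rewrite !mxE eqxx /= eq_sym /u [(j == i)]eq_sym; case: (i == j) => /=; ring.
Unshelve. all: by end_near.
Qed.

Lemma smooth_flat_coord i (a c : R) Q : smooth (flat_coord i a c Q).
Proof.
apply: (@smooth_closed _ _ (fun f => exists k Q, f = fun x => k * flat_coord i a c Q x)); last first.
  by exists 1, Q; apply/funext => x; rewrite mul1r.
move=> _ [k [Q' ->]].
have d j x : is_derive x (ebase j) (fun x => k * flat_coord i a c Q' x)
    (k * (a * (i == j)%:R * flat_coord i a c (flat' Q') x)).
  exact: (@is_deriveZ _ _ _ _ k x _ _ (is_derive_flat_coord i a c Q' j x)).
split.
- move=> x; have c1 : continuous (flat Q') by move=> t; exact: is_derive_continuous (is_derive_flat Q' t).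
  have c2 : continuous (fun s : R => k * flat Q' (a * s + c)).
    move=> s; apply: cvgM; first exact: cvg_cst.
    apply: (cvg_comp (fun s => a * s + c) (flat Q') _ (c1 _)).
    by apply: cvgD; [apply: cvgM; [exact: cvg_cst|exact: cvg_id]|exact: cvg_cst].
  apply: (@continuous_comp _ _ _ (fun x : 'rV[R]_n => x 0 i) (fun s : R => k * flat Q' (a * s + c)) x).
    exact: coord_continuous.
  exact: c2.
- by move=> j x; case: (d j x).
- move=> j; exists (k * (a * (i == j)%:R)), (flat' Q').
  by apply/funext => x; rewrite -mulrA; case: (d j x) => _ <-.
Qed.

Lemma smooth_prod (J : Type) (s : seq J) (f : J -> 'rV[R]_n -> R) :
  (forall j, smooth (f j)) -> smooth (fun x => \prod_(j <- s) f j x).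
Proof.
move=> sf; elim: s => [|j s IH].
  by rewrite (_ : (fun x => _) = cst 1); [exact: smooth_cst|apply/funext => x; rewrite big_nil].
rewrite (_ : (fun x => _) = fun x => f j x * \prod_(j <- s) f j x); first exact: smoothM.
by apply/funext => x; rewrite big_cons.
Qed.

Definition cube (y : 'rV[R]_n) (r : R) : set 'rV[R]_n := [set x | forall i, `|x 0 i - y 0 i| < r].
Definition ccube (y : 'rV[R]_n) (r : R) : set 'rV[R]_n := [set x | forall i, `|x 0 i - y 0 i| <= r].

Lemma ccube_compact y r : compact (ccube y r).
Proof.
have := @rV_compact _ _ (fun i => `[y 0 i - r, y 0 i + r]%classic) (fun i => @segment_compact R _ _).
congr compact; apply/seteqP; split => x h i; have := h i; rewrite /= in_itv/= ler_distl//.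
Qed.

Lemma ccube_closed y r : closed (ccube y r).
Proof. by apply: compact_closed; [exact: norm_hausdorff|exact: ccube_compact]. Qed.

(** A product of one-sided flat functions, one for each face of the cube; it is positive exactly
    where every factor is. *)
Lemma bump_exists (Omega : set 'rV[R]_n) y (r : R) : ccube y r `<=` Omega ->
  exists2 z, test_fun Omega z & (forall x, 0 <= z x) /\ forall x, 0 < z x <-> cube y r x.
Proof.
move=> sub.
pose z x := \prod_(i < n) (flat_coord i 1 (r - y 0 i) 1 x * flat_coord i (-1) (r + y 0 i) 1 x).
have z0 x : 0 <= z x by apply: prodr_ge0 => i _; rewrite mulr_ge0// flat1_ge0.
have zc x : 0 < z x <-> cube y r x.
  split=> [h i|h].
    have {h} : z x != 0 by rewrite gt_eqF.
    rewrite /z (bigD1 i)//= mulf_eq0 negb_or => /andP[h _].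
    have : flat_coord i 1 (r - y 0 i) 1 x * flat_coord i (-1) (r + y 0 i) 1 x != 0 by exact: h.
    rewrite mulf_eq0 negb_or /flat_coord => /andP[h1 h2].
    have p1 : 0 < 1 * x 0 i + (r - y 0 i) by rewrite -flat1_gt0 lt_def h1 flat1_ge0.
    have p2 : 0 < -1 * x 0 i + (r + y 0 i) by rewrite -flat1_gt0 lt_def h2 flat1_ge0.
    by rewrite ltr_norml; apply/andP; split; lra.
  apply: prodr_gt0 => i _; have := h i; rewrite ltr_norml => /andP[h1 h2].
  by rewrite mulr_gt0// /flat_coord flat1_gt0; lra.
exists z => //; split.
  by apply: smooth_prod => i; apply: smoothM; exact: smooth_flat_coord.
have cc : closure [set x | z x != 0] `<=` ccube y r.
  rewrite [X in _ `<=` X](closure_id _).1; last exact: ccube_closed.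
  apply: closure_subset.
  move=> x /= zx i; have : 0 < z x by rewrite lt_def zx z0.
  by move/zc => /(_ i)/ltW.
split; last exact: subset_trans cc sub.
apply: (@subclosed_compact _ (closure [set x | z x != 0]) (ccube y r)); [exact: closed_closure|exact: ccube_compact|exact: cc].
Qed.

End bump.

(** * Exponential weights and flat cut-offs *)

Section weights.
Context (R : realType).

(** If [z^(tau - kap)] is at least [2 C], the exponent is at most [-z^tau / 2] and the exponential
    beats the power; otherwise [z] is at most [Z] and all factors are bounded. *)
Lemma exp_absorb (tau kap C : R) : 1 <= tau -> 0 < kap < tau -> 0 <= C ->
  exists2 M : R, 0 <= M & forall z : R, 0 < z ->
    z `^ (2 * tau + 2) * expR (C * z `^ kap - z `^ tau) <= M.
Proof.
move=> t1 /andP[k0 kt] C0; have d0 : 0 < tau - kap by rewrite subr_gt0.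
pose Z : R := (2 * C) `^ (tau - kap)^-1.
exists (Z `^ (2 * tau + 2) * expR (C * Z `^ kap) + 8 ^+ 4 + 1) => [|z z0].
  by rewrite !addr_ge0 ?mulr_ge0 ?powR_ge0 ?expR_ge0.
have A0 : 0 <= Z `^ (2 * tau + 2) * expR (C * Z `^ kap) by rewrite mulr_ge0 ?powR_ge0 ?expR_ge0.
have B0 : (0 : R) <= 8 ^+ 4 by [].
have [h|h] := leP (2 * C) (z `^ (tau - kap)); last first.
  have zZ : z <= Z.
    have -> : z = (z `^ (tau - kap)) `^ (tau - kap)^-1.
      by rewrite -powRrM mulfV ?powRr1 ?gt_eqF// ltW.
    by apply: ge0_ler_powR; rewrite ?nnegrE ?invr_ge0 ?powR_ge0 ?mulr_ge0//; exact: ltW.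
  apply: (@le_trans _ _ (Z `^ (2 * tau + 2) * expR (C * Z `^ kap))); last lra.
  apply: ler_pM; rewrite ?powR_ge0 ?expR_ge0//.
    by apply: ge0_ler_powR; rewrite ?nnegrE ?powR_ge0//; lra.
  rewrite ler_expR; apply: (@le_trans _ _ (C * z `^ kap)); first by rewrite gerBl powR_ge0.
  by rewrite ler_wpM2l//; apply: ge0_ler_powR; rewrite ?nnegrE ?powR_ge0//; exact: ltW.
have h1 : C * z `^ kap - z `^ tau <= - (z `^ tau / 2).
  have -> : z `^ tau = z `^ (tau - kap) * z `^ kap.
    by rewrite -powRD ?subrK//; rewrite (gt_eqF z0) implybT.
  have := ler_wpM2r (powR_ge0 z kap) h; lra.
apply: (@le_trans _ _ (z `^ (2 * tau + 2) * expR (- (z `^ tau / 2)))).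
  by rewrite ler_wpM2l ?powR_ge0// ler_expR.
have [z1|z1] := leP z 1.
  apply: (@le_trans _ _ 1); last lra.
  rewrite -[leRHS]mulr1; apply: ler_pM; rewrite ?powR_ge0 ?expR_ge0//.
    have p1 : 1 `^ (2 * tau + 2) = 1 :> R by rewrite powR1.
    by rewrite -[leRHS]p1; apply: ge0_ler_powR; rewrite ?nnegrE//; lra.
  by rewrite -expR0 ler_expR oppr_le0 divr_ge0 ?powR_ge0.
(* Uses [z > 1] and [tau >= 1]. Together with [(y/8)^4 <= exp(y/2)] this is the origin of [8^4] in
   the bound. *)
have h2 : z `^ (2 * tau + 2) <= (z `^ tau) ^+ 4.
  rewrite -powR_mulrn ?powR_ge0// -powRrM; apply: ler_powR; [exact: ltW|lra].
have h3 : (z `^ tau / 8) ^+ 4 <= expR (z `^ tau / 2).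
  have -> : z `^ tau / 2 = 4%:R * (z `^ tau / 8) by lra.
  rewrite expRM_natl; apply: lerXn2r; rewrite ?nnegrE ?divr_ge0 ?powR_ge0 ?expR_ge0//.
  by apply: le_trans (expR_ge1Dx _); rewrite lerDr.
rewrite expRN ler_pdivrMr ?expR_gt0//.
rewrite expr_div_n ler_pdivrMr ?exprn_gt0// in h3.
apply: (le_trans h2); apply: (le_trans h3); rewrite mulrC ler_wpM2r ?expR_ge0//; lra.
Qed.

(** With [z = 1/t] the cut-off is [exp(-z^tau)]. Either the error factor is at most [eps], or its
    being larger bounds [s^-a] by a multiple of [z^kap] with [kap = (2 tau + 2) a/(1 + a)], and the
    cut-off then absorbs the weight. The condition on [tau] is exactly [kap < tau]; it can be met
    because [a < 1]. *)
Lemma weight_bound (a c K eps : R) (tau : nat) : 0 < a < 1 -> 0 <= c -> 0 <= K -> 0 < eps ->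
  (0 < tau)%N -> 2 * a < tau%:R * (1 - a) ->
  exists2 M : R, 0 <= M & forall s t : R, 0 < s <= 1 -> 0 < t ->
    expR (c * s `^ (- a)) * flat 1 (t ^+ tau) * (K * (s `^ (1 + a) * t ^- (2 * tau + 2))) <=
    eps * (expR (c * s `^ (- a)) * flat 1 (t ^+ tau)) + M.
Proof.
move=> /andP[a0 a1] c0; rewrite le_eqVlt => /predU1P[<- e0 _ _|K0 e0 tau0 ht].
  exists 0 => // s t _ _; rewrite mul0r mulr0 addr0.
  by rewrite !mulr_ge0 ?expR_ge0 ?flat1_ge0 ?ltW.
have tau1 : 1 <= tau%:R :> R by rewrite ler1n.
pose e := a / (1 + a); have e1 : 0 < e by rewrite divr_gt0// addr_gt0.
pose kap := (2 * tau%:R + 2) * e.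
have kb : 0 < kap < tau%:R.
  apply/andP; split; first by apply: mulr_gt0 => //; lra.
  by rewrite /kap /e mulrA ltr_pdivrMr ?addr_gt0//; lra.
pose C := c * (K / eps) `^ e; have C0 : 0 <= C by rewrite mulr_ge0// powR_ge0.
have [M M0 hM] := exp_absorb tau1 kb C0.
exists (K * M) => [|s t /andP[s0 s1] t0]; first by rewrite mulr_ge0// ltW.
set z := t^-1; have z0 : 0 < z by rewrite invr_gt0.
have fE : flat 1 (t ^+ tau) = expR (- z `^ tau%:R).
  by rewrite /flat exprn_gt0// hornerC mul1r powR_mulrn ?ltW// exprVn.
have zE : t ^- (2 * tau + 2) = z `^ (2 * tau%:R + 2).
  by rewrite -exprVn -powR_mulrn ?ltW// natrD natrM.
rewrite fE zE; set X := s `^ (1 + a) * _; set P := expR _ * expR _.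
have P0 : 0 <= P by rewrite mulr_ge0 ?expR_ge0.
have [h|h] := leP (K * X) eps.
  by apply: ler_wpDr; [rewrite mulr_ge0// ltW|rewrite mulrC ler_wpM2r].
apply: ler_wpDl; first by rewrite mulr_ge0// ltW.
have Zp : 0 < z `^ (2 * tau%:R + 2) by rewrite powR_gt0.
have h1 : s `^ (- (1 + a)) <= K / eps * z `^ (2 * tau%:R + 2).
  have S0 : 0 < s `^ (1 + a) by rewrite powR_gt0.
  rewrite powRN -(ler_pM2l S0) mulfV ?gt_eqF//.
  have -> : s `^ (1 + a) * (K / eps * z `^ (2 * tau%:R + 2)) = K * X / eps.
    by rewrite /X; field; rewrite gt_eqF.
  by rewrite ler_pdivlMr// mul1r ltW.
have h2 : s `^ (- a) <= (K / eps) `^ e * z `^ kap.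
  have -> : s `^ (- a) = (s `^ (- (1 + a))) `^ e.
    by rewrite -powRrM /e; congr (_ `^ _); field; rewrite gt_eqF// addr_gt0.
  have -> : z `^ kap = (z `^ (2 * tau%:R + 2)) `^ e by rewrite -powRrM.
  have KE : 0 <= K / eps by rewrite divr_ge0// ltW.
  rewrite -powRM; [|exact: KE|exact: powR_ge0].
  apply: ge0_ler_powR; [exact: ltW|exact: powR_ge0|by rewrite nnegrE mulr_ge0 ?powR_ge0|exact: h1].
have h3 : X <= z `^ (2 * tau%:R + 2).
  rewrite /X ler_piMl ?powR_ge0//.
  have p1 : 1 `^ (1 + a) = 1 :> R by rewrite powR1.
  by rewrite -[leRHS]p1; apply: ge0_ler_powR; rewrite ?nnegrE//; lra.
have h4 : P <= expR (C * z `^ kap - z `^ tau%:R).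
  rewrite /P -expRD ler_expR lerD2r /C -mulrA ler_wpM2l//.
rewrite mulrCA ler_pM2l//; apply: le_trans (hM z z0).
rewrite mulrC; apply: ler_pM => //.
by rewrite /X mulr_ge0 ?powR_ge0.
Qed.

(** The squared positive part makes the weight and its derivative vanish continuously at [s0], so
    only small values of the solution are tested. *)
Definition expw (a c s0 s : R) : R := expR (c * s `^ (- a)) * Num.max (s0 - s) 0 ^+ 2.

Definition expw' (a c s0 s : R) : R :=
  - (c * a * s `^ (- (1 + a))) * expw a c s0 s
  - expR (c * s `^ (- a)) * (2 * Num.max (s0 - s) 0).

Lemma is_derive_expw (a c s0 s : R) : 0 < s -> is_derive s 1 (expw a c s0) (expw' a c s0 s).
Proof.
move=> sp.
have d1 : is_derive s 1 (fun s : R => s `^ (- a)) (- a * s `^ (- a - 1)) by exact: is_derive1_powR.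
have d2 := @is_deriveZ _ _ _ _ c s 1 _ d1.
have d3 := is_derive1_comp (g := fun s : R => c * s `^ (- a)) (is_derive_expR _) d2.
have d4 : is_derive s 1 (fun s : R => - s) (- 1) by have := is_deriveN (is_derive_id s 1).
have d5 := is_derive1_comp (g := fun s : R => - s) (is_derive_sqpos (- s0) (- s)) d4.
have d6 := is_deriveM d3 d5.
rewrite (_ : expw a c s0 = (fun s : R => expR (c * s `^ (- a))) *
    (fun s : R => Num.max (- s - - s0) 0 ^+ 2)).
  apply: (is_derive_eq d6); rewrite /expw' /expw /GRing.scale /= opprK [- s + s0]addrC.
  have -> : - (1 + a) = - a - 1 by ring.
  by ring.
apply/funext => t; rewrite /expw; have E : - t - - s0 = s0 - t by ring.
by rewrite -E.
Qed.

Lemma continuous_expw' (a c s0 s : R) : 0 < s -> {for s, continuous (expw' a c s0)}.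
Proof.
move=> sp; have cp (e : R) : {for s, continuous (fun s : R => s `^ e)} by exact: powR_continuous.
have ce : {for s, continuous (fun s : R => expR (c * s `^ (- a)))}.
  apply: (@continuous_comp _ _ _ (fun s : R => c * s `^ (- a)) (@expR R)).
    by apply: cvgM; [exact: cvg_cst|exact: cp].
  exact: continuous_expR.
have cm : {for s, continuous (fun s : R => Num.max (s0 - s) 0)}.
  apply: (@continuous_max _ _ (fun s : R => s0 - s) (fun=> 0)); last exact: cvg_cst.
  by apply: cvgB; [exact: cvg_cst|exact: cvg_id].
have cw : {for s, continuous (expw a c s0)} := is_derive_continuous (is_derive_expw a c s0 sp).
apply: cvgB; apply: cvgM => //.
  by apply: cvgN; apply: cvgM; [exact: cvg_cst|exact: cp].
by apply: cvgM; [exact: cvg_cst|exact: cm].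
Qed.

Lemma measurable_expw (a c s0 d : R) : measurable_fun setT (fun s : R => expw a c s0 (s + d)) /\
  measurable_fun setT (fun s : R => expw' a c s0 (s + d)).
Proof.
have md : measurable_fun setT (fun s : R => s + d) by exact: measurable_funD.
have me : measurable_fun setT (fun s : R => expR (c * (s + d) `^ (- a))).
  apply: measurableT_comp => //; apply: measurable_funM => //.
  by apply: (measurableT_comp (f := fun s : R => s `^ (- a))); [exact: measurable_powR|exact: md].
have mm : measurable_fun setT (fun s : R => Num.max (s0 - (s + d)) 0).
  by apply: measurable_maxr => //; exact: measurable_funB.
have mw : measurable_fun setT (fun s : R => expw a c s0 (s + d)).
  by apply: measurable_funM => //; exact: measurable_funX.
split => //; apply: measurable_funB; apply: measurable_funM => //.
  apply: measurableT_comp => //; apply: measurable_funM => //.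
  by apply: (measurableT_comp (f := fun s : R => s `^ (- (1 + a)))); [exact: measurable_powR|exact: md].
exact: measurable_funM.
Qed.

Lemma expw_ge0 (a c s0 s : R) : 0 <= expw a c s0 s.
Proof. by rewrite mulr_ge0 ?expR_ge0 ?sqr_ge0. Qed.

Lemma expw_out (a c s0 s : R) : s0 <= s -> expw a c s0 s = 0 /\ expw' a c s0 s = 0.
Proof.
move=> h; have E : Num.max (s0 - s) 0 = 0 by apply/max_idPr; rewrite subr_le0.
by rewrite /expw' /expw E expr0n /= !mulr0 subr0.
Qed.

(** The derivative of the squared factor has the favourable sign and is dropped. What remains is the
    logarithmic derivative of the exponential, of order [s^-(1+a)]. *)
Lemma expw'_le (a c s0 s : R) : expw' a c s0 s <= - (c * a * s `^ (- (1 + a))) * expw a c s0 s.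
Proof. by rewrite /expw' gerBl mulr_ge0 ?expR_ge0// mulr_ge0// le_max lexx orbT. Qed.

Lemma expw_blowup (a c s0 K : R) : 0 < a -> 0 < c -> 0 < s0 -> exists2 d : R, 0 < d &
  forall s, 0 < s -> s <= d -> K <= expw a c s0 s.
Proof.
move=> a0 c0 s00; pose L : R := `|K| * 4 / (s0 ^+ 2 * c) + 1.
have L0 : 0 < L by rewrite ltr_wpDl// divr_ge0 ?mulr_ge0// ltW// exprn_gt0.
exists (Num.min (s0 / 2) (L `^ (- a^-1))) => [|s sp].
  by rewrite lt_min divr_gt0//= powR_gt0.
rewrite le_min => /andP[h1 h2].
have h3 : L <= s `^ (- a).
  have -> : L = (L `^ (- a^-1)) `^ (- a).
    by rewrite -powRrM mulrNN mulVf ?powRr1 ?gt_eqF// ltW.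
  rewrite ![_ `^ (- a)]powRN lef_pV2 ?posrE ?powR_gt0//.
  by apply: ge0_ler_powR => //; rewrite ?nnegrE ?powR_ge0//; exact: ltW.
rewrite /expw max_l; last lra.
have h4 : c * L <= expR (c * s `^ (- a)).
  apply: le_trans (expR_ge1Dx _); apply: (@le_trans _ _ (c * s `^ (- a))); last by rewrite lerDr.
  by rewrite ler_pM2l.
have h5 : (s0 / 2) ^+ 2 <= (s0 - s) ^+ 2 by apply: lerXn2r; rewrite ?nnegrE; lra.
apply: (@le_trans _ _ (c * L * (s0 / 2) ^+ 2)); last first.
  by apply: ler_pM => //; rewrite ?sqr_ge0// mulr_ge0// ltW.
apply: (le_trans (ler_norm K)).
have -> : c * L * (s0 / 2) ^+ 2 = `|K| + c * (s0 / 2) ^+ 2.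
  by rewrite /L; field; rewrite !gt_eqF.
by rewrite lerDl mulr_ge0 ?sqr_ge0// ltW.
Qed.

Lemma dotv_young_scaled n (x y : 'rV[R]_n) (t A : R) : 0 < A ->
  t * dotv x y <= A * dotv x x + t ^+ 2 / (4 * A) * dotv y y.
Proof.
move=> A0; rewrite /dotv !mulr_sumr -big_split; apply: ler_sum => i _ /=.
rewrite -subr_ge0.
have -> : A * (x 0 i * x 0 i) + t ^+ 2 / (4 * A) * (y 0 i * y 0 i) - t * (x 0 i * y 0 i) =
    (2 * A * x 0 i - t * y 0 i) ^+ 2 / (4 * A) by field; rewrite gt_eqF.
by rewrite divr_ge0 ?sqr_ge0// mulr_ge0// ltW.
Qed.

End weights.

Lemma four_terms (R : realType) (x1 x2 x3 x4 x5 x6 x7 : R) :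
  x1 <= x2 + x5 -> x3 <= - x6 -> x4 <= x7 -> x7 + x2 <= x6 -> x1 + x3 + x4 <= x5.
Proof. lra. Qed.

Lemma weight_identity (R : realType) (be K0 s t : R) (tau : nat) : s != 0 -> t != 0 ->
  be ^+ 2 * tau%:R ^+ 2 * K0 / 4 * (s * t ^- (2 * tau + 2)) =
  (be * (tau%:R * t ^- tau.+1)) ^+ 2 / (4 * s^-1) * K0.
Proof.
move=> s0 t0; have -> : (2 * tau + 2 = tau.+1 + tau.+1)%N by lia.
rewrite exprD; have x0 : t ^+ tau.+1 != 0 by exact: expf_neq0.
by move: (t ^+ tau.+1) x0 (tau%:R : R) => x x0 q; field; rewrite x0 s0.
Qed.

(** * Local positivity of the limit *)

Section positivity.
Context (R : realType) (N : nat) (Omega : set 'rV[R]_N).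
Hypotheses (oO : open Omega) (bO : bounded_set Omega).
Local Notation mu := (lebesgue_rV R N).
Local Notation T := 'rV[R]_N.
Local Notation I f := (\int[mu]_(x in Omega) f x).
Local Notation mO := (measurable_Omega oO).
Local Notation V := (@inV R N Omega).
Local Notation vf := (@vf R N).
Local Notation aeon := (aeon mu Omega).
Variables (p th B : R) (O : ode_data p).
Hypotheses (p0 : 0 < p) (th1 : 1 <= th) (th2 : th < 2) (B0 : 0 < B).
Variables (b : T -> R) (al be : R).
Hypotheses (mb : measurable_fun setT b) (al0 : 0 < al) (bb : forall x, al <= b x <= be).
Local Notation g := (gcoef O th).
Local Notation hop := (hop th B O).
Variable f : T -> R.
Hypothesis intF : forall v, V v -> intg mu Omega (fun x => f x * v.1 x).
Variables (w : nat -> vf) (m : nat -> nat) (w' : vf).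
Hypotheses (hm : forall k, (k <= m k)%N)
  (sw : forall k, solves Omega b (fun v => I (fun x => f x * v.1 x)) hop (m k) (w k))
  (Vw' : V w') (w'0 : aeon (fun x => 0 <= w'.1 x))
  (cw : aeon (fun x => forall o, vco (w k) o x @[k --> \oo] --> vco w' o x)).

(** Makes [w k + dl k] positive where [w k] may vanish. The envelope of index [m k] penalises this
    displacement by exactly [(m k + 1) dl k = 1], whence its value at [w k] is at most
    [g (w k + dl k) + 1]. *)
Definition shift (k : nat) : R := (m k).+1%:R^-1.
Local Notation dl := shift.

Lemma dl0 k : 0 < dl k. Proof. by rewrite invr_gt0. Qed.

Lemma be0 : 0 < be.
Proof. by have /andP[h1 h2] := bb 0; apply: lt_le_trans al0 (le_trans h1 h2). Qed.

Lemma L2_intg (u : T -> R) : L2 mu Omega u -> intg mu Omega u.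
Proof.
move=> [mu' u2]; apply: (intg_dom_le mO mu' (intgD mO (intg_cst oO bO 1) u2)) => x _.
rewrite -[u x ^+ 2]real_normK ?num_real//; have := sqr_ge0 (`|u x| - 1).
have := normr_ge0 (u x); lra.
Qed.

(** Near 0, [g] is of order [s^-th], which [s^-(1+a)] dominates. The constant [c] is large enough
    for the weight to absorb the singular term and, in addition, one unit of [s^-(1+a)] reserved for
    Young's inequality. *)
Lemma coefficient_bound (a : R) : th <= 1 + a -> exists s0 : R, exists c : R,
  [/\ 0 < s0, s0 <= 1, 0 < c, gdom O s0 & forall s : R, 0 < s -> s <= s0 ->
    B * (g s + 1) + s `^ (- (1 + a)) <= al * (c * s `^ (- (1 + a)))].
Proof.
move=> tha; have [t [c' [t0 _ Dt _]]] := gcoef_lb O p0 th1.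
pose s0 : R := Num.min t 1; have s00 : 0 < s0 by rewrite lt_min t0 ltr01.
have s0t : s0 <= t by rewrite ge_min lexx.
have s01 : s0 <= 1 by rewrite ge_min lexx orbT.
have Ds0 : ode_dom O s0 by apply: ode_dom_le Dt _; rewrite s0t ltW.
clearbody s0; pose E0 := ode O s0 `^ (2 * p); have E00 : 0 <= E0 by exact: powR_ge0.
exists s0, ((B * (E0 + 1) + 1) / al); split => //.
  by rewrite divr_gt0// ltr_wpDl// mulr_ge0 ?addr_ge0// ltW.
move=> s sp ss0; set A := s `^ (- (1 + a)).
have h1 := gcoef_ub p0 th1 Ds0 sp ss0.
have s1 : 0 < s <= 1 by rewrite sp (le_trans ss0).
have A1 : 1 <= A.
  rewrite /A -[leLHS](powRr0 s); apply: ger_powR => //.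
  by rewrite oppr_le0; exact: le_trans (le_trans ler01 th1) tha.
have h2 : s `^ (- th) <= A by rewrite /A; apply: ger_powR => //; rewrite lerN2.
have h3 := ler_wpM2r E00 h2.
rewrite mulrA [al * _]mulrC divfK ?gt_eqF// mulrDl mul1r lerD2r -mulrA ler_pM2l//.
by rewrite mulrDl mul1r; move: h1 h3; rewrite -/E0 [A * _]mulrC; lra.
Qed.

Variables (z : T -> R) (c0 : R).
Hypotheses (tz : test_fun Omega z) (z0 : forall x, 0 <= z x) (c00 : 0 < c0)
  (fz : aeon (fun x => 0 < z x -> c0 <= f x)).

(** The test function is the weight of [w k + dl k] times a flat function of [z]. Pointwise,
    diffusion and singular term cost at most half of the gain [c0 v] from the source plus a
    constant, so the integrals of the test functions are bounded; where [w' = 0] and [z > 0] these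
    functions tend to infinity. *)
Lemma local_positivity : aeon (fun x => 0 < z x -> 0 < w'.1 x).
Proof.
have dp k : 0 < dl k by exact: dl0.
have bep := be0.
have [a [a0 a1 tha]] : exists a : R, [/\ 0 < a, a < 1 & th <= 1 + a].
  exists (th / 2); split; first by rewrite divr_gt0// (lt_le_trans ltr01).
    by rewrite ltr_pdivrMr// mul1r.
  by have := th2; lra.
have [s0 [c [s00 s01 cp Ds0 hc]]] := coefficient_bound tha.
pose c1 := c / a; have c10 : 0 < c1 by exact: divr_gt0.
have c1E : c1 * a = c by rewrite divfK// gt_eqF.
(* Order of flatness of the cut-off [exp(-z^-tau)], large enough for the condition of
   [weight_bound]. *)
pose tau := (Num.truncn (2 * a / (1 - a))).+1.
have tau0 : (0 < tau)%N by [].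
have ht : 2 * a < tau%:R * (1 - a).
  by rewrite -ltr_pdivrMr ?subr_gt0//; exact: truncnS_gt.
clearbody tau; pose rho t := flat 1 (t ^+ tau) : R.
pose rho' t := flat (flat' 1) (t ^+ tau) * (tau%:R * t ^+ tau.-1) : R.
have drho (t : R) : is_derive t 1 rho (rho' t).
  have dX : is_derive t 1 (fun t : R => t ^+ tau) (tau%:R * t ^+ tau.-1).
    have := is_derive_poly ('X^tau : {poly R}) t; rewrite derivXn hornerMn hornerXn -mulr_natl.
    by rewrite (_ : horner 'X^tau = fun t : R => t ^+ tau)//; apply/funext => u; rewrite hornerXn.
  exact: (is_derive1_comp (g := fun t : R => t ^+ tau) (is_derive_flat 1 (t ^+ tau)) dX).
have crho : continuous rho'.
  move=> t; apply: cvgM; last by apply: cvgM; [exact: cvg_cst|exact: exprn_continuous].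
  apply: (@continuous_comp _ _ _ (fun t : R => t ^+ tau) (flat (flat' 1))).
    exact: exprn_continuous.
  exact: is_derive_continuous (is_derive_flat _ _).
have rho0 : rho 0 = 0 by rewrite /rho expr0n gtn_eqF//= flat1_le0.
have rho_ge0 t : 0 <= rho t by exact: flat1_ge0.
have rho_le1 t : rho t <= 1.
  rewrite /rho /flat; case: ifP => // h; rewrite hornerC mul1r.
  by rewrite -[leRHS]expR0 ler_expR oppr_le0 invr_ge0 ltW.
have rho_pos t : 0 < t -> 0 < rho t by move=> tp; rewrite flat1_gt0 exprn_gt0.
(* The logarithmic derivative of the cut-off; its square produces the power [2 tau + 2] of
   [weight_bound]. *)
have rho'E t : 0 < t -> rho' t = rho t * (tau%:R * t ^- tau.+1).
  move=> tp; rewrite /rho' /rho /flat exprn_gt0// /flat' -polyC1 derivC subr0 polyC1 mulr1.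
  rewrite hornerXn -polyC1 hornerC mul1r.
  have E : t ^+ tau = t ^+ tau.-1 * t by rewrite -exprSr prednK.
  have tn : t != 0 by rewrite gt_eqF.
  have x0 : t ^+ tau.-1 != 0 by exact: expf_neq0.
  rewrite [t ^+ tau.+1]exprSr E; clear E; move: (t ^+ tau.-1) x0 (expR _) (tau%:R : R) => x x0 ee q.
  by field; rewrite x0 tn.
have rho'0 : 0 < 0 :> R -> False by rewrite ltxx.
have Vr : V (vcomp rho rho' (gradv z)) by exact: V_chain_test.
set r := vcomp rho rho' (gradv z) in Vr.
have [K0 hK0] : exists K0 : R, forall x, dotv ((gradv z).2 x) ((gradv z).2 x) <= K0.
  have [_ bp] := test_fun_bs tz.
  have [h hh] := @boolp.choice _ _ (fun i M => forall x, `|partial i z x| <= M) (fun i => bs_bounded (bp i)).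
  exists (\sum_i h i ^+ 2) => x; rewrite /dotv; apply: ler_sum => i _.
  by rewrite !mxE -expr2; apply: sqr_le_norm.
have K00 : 0 <= K0 by apply: le_trans (hK0 0); rewrite -/(gsq _ _) gsq_ge0.
pose K : R := be ^+ 2 * tau%:R ^+ 2 * K0 / 4.
have KK0 : 0 <= K.
  apply: divr_ge0 => //; apply: mulr_ge0 => //; apply: mulr_ge0; exact: sqr_ge0.
have aa : 0 < a < 1 by rewrite a0.
have ec : 0 < c0 / 2 by rewrite divr_gt0.
have [M M0 hM] := weight_bound aa (ltW c10) KK0 ec tau0 ht.
pose F k (s : R) := expw a c1 s0 (s + dl k).
pose h k (s : R) := expw' a c1 s0 (s + dl k).
have Vw k : V (w k) by case: (sw k).
have wp k : aeon (fun x => 0 <= (w k).1 x) by case: (sw k).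
pose v k := testv r (F k) (h k) s0 (w k).
have Vv k : V (v k).
  have [mF mh] := measurable_expw a c1 s0 (dl k).
  apply: (@V_testv _ _ _ oO bO 1 r (F k) (h k) s0 (w k) s00 (Vw k) (wp k) Vr _ mF mh).
  - by move=> x; rewrite /= ger0_norm.
  - move=> s /andP[sp _]; have sd : 0 < s + dl k by rewrite ltr_wpDl.
    have d1 : is_derive s 1 (fun s : R => s + dl k) (1 + 0).
      by have := is_deriveD (is_derive_id s 1) (is_derive_cst (dl k) s (1 : R)).
    have := is_derive1_comp (g := fun s : R => s + dl k) (is_derive_expw a c1 s0 sd) d1.
    by move=> H; apply: (is_derive_eq H); rewrite addr0 mulr1.
  - move=> s /andP[sp _]; have sd : 0 < s + dl k by rewrite ltr_wpDl.
    apply: (@continuous_comp _ _ _ (fun s : R => s + dl k) (expw' a c1 s0)).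
      by apply: cvgD; [exact: cvg_id|exact: cvg_cst].
    exact: continuous_expw'.
have v0 k x : 0 <= (v k).1 x by rewrite /v /= mulr_ge0// expw_ge0.
have vout k x : 0 <= (w k).1 x -> s0 <= (w k).1 x + dl k ->
    (v k).1 x = 0 /\ dotv ((w k).2 x) ((v k).2 x) = 0.
  move=> wx hs; have hmn : s0 <= Num.min ((w k).1 x) s0 + dl k.
    by case: (leP ((w k).1 x) s0) => _ //; rewrite lerDl ltW.
  have [e1 e2] := expw_out a c1 hmn.
  rewrite /v /= /F /h e1 e2 mulr0; split => //.
  by rewrite /dotv big1// => i _; rewrite !mxE !mul0r addr0 mulr0.
(* The derivative of the weight contributes a negative term of size [al c A |Dw|^2] with
   [A = s^-(1+a)]. It absorbs the singular term and the part [A |Dw|^2] that Young's inequality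
   takes from the cross term with the gradient of [z]; the other part of the cross term is handled
   by [weight_bound]. *)
have key k x : 0 <= (w k).1 x -> b x * dotv ((w k).2 x) ((v k).2 x) + hop (m k) (w k) x * (v k).1 x
    <= c0 / 2 * (v k).1 x + M.
  move=> wx; have [hs|hs] := leP s0 ((w k).1 x + dl k).
    by have [-> ->] := vout k x wx hs; rewrite !mulr0 !add0r.
  have ws0 : (w k).1 x < s0 by apply: le_lt_trans hs; rewrite lerDl ltW.
  have mn : Num.min ((w k).1 x) s0 = (w k).1 x by apply/min_idPl; exact: ltW.
  set s := (w k).1 x + dl k in hs.
  have sp : 0 < s by rewrite /s ltr_wpDl.
  have Ds : gdom O s.
    by case: Ds0 => D _; split => //; apply: ode_dom_le D _; rewrite !ltW.
  set P := expw a c1 s0 s; have P0 : 0 <= P := expw_ge0 a c1 s0 s.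
  have P' := expw'_le a c1 s0 s.
  set A := s `^ (- (1 + a)) in P'; have A0 : 0 < A by rewrite powR_gt0.
  set G := gsq (w k) x; have G0 : 0 <= G := gsq_ge0 (w k) x.
  have v1 : (v k).1 x = rho (z x) * P by rewrite /v /= mn.
  have v2 : dotv ((w k).2 x) ((v k).2 x) =
      P * (rho' (z x) * dotv ((w k).2 x) ((gradv z).2 x)) + rho (z x) * expw' a c1 s0 s * G.
    rewrite /G /gsq /dotv !mulr_sumr -big_split; apply: eq_bigr => i _ /=.
    by rewrite mn ltNge (ltW ws0)/= !mxE /P /h /F -/s; ring.
  have [zx|zx] := leP (z x) 0.
    have zx0 : z x = 0 by apply/eqP; rewrite eq_le zx z0.
    have r'0 : rho' 0 = 0.
      by rewrite /rho' /flat expr0n gtn_eqF//= ltxx mul0r.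
    by rewrite v1 v2 zx0 rho0 r'0 !(mul0r, mulr0, add0r, addr0).
  (* The envelope is compared with [g] at the shifted point [s]; the penalty of the shift is the
     [+ 1]. *)
  have hopk : hop (m k) (w k) x <= B * (g s + 1) * G.
    have := hop_le p0 th1 B0 (m k) (w k) x Ds.
    have -> : (m k).+1%:R * `|(w k).1 x - s| = 1.
      rewrite /s opprD addrA subrr add0r normrN gtr0_norm// /shift mulfV//.
    by [].
  have hcs := hc s sp (ltW hs); rewrite -/A in hcs.
  have /andP[b1 b2] := bb x.
  set y := tau%:R * z x ^- tau.+1.
  have y0 : 0 <= y by rewrite mulr_ge0// invr_ge0 exprn_ge0// ltW.
  have yg := dotv_young_scaled ((w k).2 x) ((gradv z).2 x) (b x * y) A0.
  have yK : (b x * y) ^+ 2 / (4 * A) * dotv ((gradv z).2 x) ((gradv z).2 x) <=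
      K * (s `^ (1 + a) * z x ^- (2 * tau + 2)).
    have -> : K * (s `^ (1 + a) * z x ^- (2 * tau + 2)) = (be * y) ^+ 2 / (4 * A) * K0.
      have ss : s `^ (1 + a) != 0 by rewrite gt_eqF// powR_gt0.
      by rewrite /A powRN (weight_identity be K0 tau ss (lt0r_neq0 zx)).
    apply: ler_pM.
    - by rewrite divr_ge0 ?sqr_ge0// mulr_ge0// ltW.
    - exact: gsq_ge0 (gradv z) x.
    - rewrite ler_pM2r ?invr_gt0 ?mulr_gt0//; apply: lerXn2r; rewrite ?nnegrE.
      + by rewrite mulr_ge0// (le_trans (ltW al0)).
      + by rewrite mulr_ge0// ltW.
      + exact: ler_wpM2r.
    - exact: hK0.
  have wb : P * rho (z x) * (K * (s `^ (1 + a) * z x ^- (2 * tau + 2))) <= c0 / 2 * (P * rho (z x)) + M.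
    have s1 : 0 < s <= 1 by rewrite sp (le_trans (ltW hs)).
    have := hM s (z x) s1 zx; rewrite -/(rho (z x)).
    set ee := expR _; set q := Num.max (s0 - s) 0 ^+ 2; set X := K * _.
    have q0 : 0 <= q by exact: sqr_ge0.
    have q1 : q <= 1.
      rewrite /q max_l ?subr_ge0 ?(ltW hs)//; apply: exprn_ile1; first by rewrite subr_ge0 ltW.
      by rewrite lerBlDr (le_trans s01)// lerDl ltW.
    have -> : P = ee * q by [].
    move=> H; have := ler_wpM2l q0 H.
    have := ler_wpM2r M0 q1; rewrite mul1r.
    move: (rho (z x)) => rr h1 h2; apply: le_trans (_ : q * (c0 / 2 * (ee * rr) + M) <= _).
      by apply: le_trans h2; rewrite le_eqVlt; apply/orP; left; apply/eqP; ring.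
    have -> : q * (c0 / 2 * (ee * rr) + M) = c0 / 2 * (ee * q * rr) + q * M by ring.
    by rewrite lerD2l.
  rewrite v1 v2 (rho'E _ zx) -/y.
  apply: (le_trans _ (le_trans wb _)); last first.
    by rewrite [rho (z x) * P]mulrC.
  have PR : 0 <= P * rho (z x) by exact: mulr_ge0.
  have t1 := ler_wpM2l PR (le_trans yg (lerD (lexx _) yK)).
  have t2 : b x * (rho (z x) * expw' a c1 s0 s * G) <= - (P * rho (z x) * (al * (c * A)) * G).
    have rG : 0 <= rho (z x) * G by exact: mulr_ge0.
    have cA : 0 <= c * A * P by apply: mulr_ge0 => //; apply: mulr_ge0; exact: ltW.
    have hb : b x * expw' a c1 s0 s <= - (al * (c * A * P)).
      apply: (@le_trans _ _ (b x * - (c * A * P))).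
        apply: ler_wpM2l; first exact: le_trans (ltW al0) b1.
        by move: P'; rewrite c1E mulNr.
      by rewrite mulrN lerN2 ler_wpM2r.
    have -> : b x * (rho (z x) * expw' a c1 s0 s * G) = b x * expw' a c1 s0 s * (rho (z x) * G) by ring.
    apply: (le_trans (ler_wpM2r rG hb)).
    by rewrite le_eqVlt; apply/orP; left; apply/eqP; ring.
  have t3 : hop (m k) (w k) x * (rho (z x) * P) <= P * rho (z x) * (B * (g s + 1)) * G.
    have := ler_wpM2r PR hopk => H; rewrite [rho (z x) * P]mulrC; apply: (le_trans H).
    by rewrite le_eqVlt; apply/orP; left; apply/eqP; ring.
  have t4 : P * rho (z x) * (B * (g s + 1)) * G + P * rho (z x) * A * G <= P * rho (z x) * (al * (c * A)) * G.
    have := ler_wpM2r G0 (ler_wpM2l PR hcs); rewrite mulrDr mulrDl; lra.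
  have t5 : dotv ((w k).2 x) ((w k).2 x) = G by [].
  rewrite t5 in t1.
  have E1 : b x * (P * (rho (z x) * y * dotv ((w k).2 x) ((gradv z).2 x))) =
     P * rho (z x) * (b x * y * dotv ((w k).2 x) ((gradv z).2 x)) by ring.
  rewrite mulrDr E1; rewrite mulrDr in t1.
  have E2 : P * rho (z x) * (A * G) = P * rho (z x) * A * G by ring.
  rewrite E2 in t1.
  set X1 := P * rho (z x) * (b x * y * _) in t1 *; set X2 := P * rho (z x) * A * G in t1 t4.
  set X3 := b x * (rho (z x) * _ * G) in t2 *; set X4 := hop (m k) (w k) x * _ in t3 *.
  set X5 := P * rho (z x) * (K * _) in t1 *.
  set X6 := P * rho (z x) * (al * _) * G in t2 t4; set X7 := P * rho (z x) * (B * _) * G in t3 t4.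
  by move: t1 t2 t3 t4; exact: four_terms.
pose mm : R := fine (mu Omega).
have int_bd k : intg mu Omega (fun x => b x * dotv ((w k).2 x) ((v k).2 x)).
  exact: (intg_form oO mb al0 bb (Vw k) (Vv k)).
have int_h k : intg mu Omega (fun x => hop (m k) (w k) x * (v k).1 x).
  exact: (intg_op oO (hop_lip N O p0 th1 B0 (m k)) (Vw k) (Vv k)).
have iv k : intg mu Omega (v k).1 by exact: (L2_intg (V_L2 (Vv k) None)).
have Iv k : I (v k).1 <= 2 / c0 * (M * mm).
  have [_ _ /(_ _ (Vv k))] := sw k; rewrite /bform mul0r addr0 -ID//; last exact: mO.
  move=> E.
  have h1 : I (fun x => c0 * (v k).1 x) <= I (fun x => f x * (v k).1 x).
    apply: (I_le_ae mO); [exact: (intgZ mO)|exact: (intF (Vv k))|].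
    move: fz; apply: aeon_imp => x _ hf; rewrite /v /=.
    have [zx|zx] := leP (z x) 0; last by rewrite ler_wpM2r ?hf// mulr_ge0// expw_ge0.
    have zx0 : z x = 0 by apply/eqP; rewrite eq_le zx z0.
    by rewrite zx0 rho0 mul0r !mulr0.
  have h2 : I (fun x => f x * (v k).1 x) <= I (fun x => c0 / 2 * (v k).1 x + M).
    rewrite -E; apply: (I_le_ae mO).
    - by apply: (intgD mO).
    - by apply: (intgD mO); [exact: (intgZ mO)|exact: (intg_cst oO bO)].
    by move: (wp k); apply: aeon_imp => x _; exact: key.
  rewrite ID in h2; [|exact: mO|exact: (intgZ mO)|exact: (intg_cst oO bO)].
  rewrite Rintegral_cst in h2; last exact: mO.
  rewrite IZ in h2; [|exact: mO|exact: iv].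
  rewrite IZ in h1; [|exact: mO|exact: iv].
  have : c0 / 2 * I (v k).1 <= M * mm by have := le_trans h1 h2; rewrite -/mm; lra.
  rewrite -ler_pdivlMl; last exact: ec.
  by rewrite invf_div.
(* By Fatou's lemma the integral of [L ind] is bounded by a constant independent of [L], so [ind]
   vanishes almost everywhere, although [rho (z x) > 0] wherever [z x > 0]. *)
pose ind x : R := if w'.1 x <= 0 then rho (z x) else 0.
have mind : measurable_fun setT ind.
  apply: measurable_fun_ifT => //; first by apply: measurable_fun_ler => //; exact: (V_meas Vw' None).
  exact: (V_meas Vr None).
have i0 x : 0 <= ind x by rewrite /ind; case: ifP.
have Kind (L : R) : 0 <= L -> intg mu Omega (fun x => L * ind x) /\ I (fun x => L * ind x) <= 2 / c0 * (M * mm).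
  move=> L0; apply: (@fatouR _ _ _ _ _ mO (fun k => (v k).1)) => //.
  - by apply: measurable_funTS; exact: measurable_funM.
  - by move=> x _; exact: mulr_ge0.
  have hw := aeon_all wp.
  move: cw hw; apply: aeon_imp2 => x _ cx wx e e0.
  have cx1 : (w k).1 x @[k --> \oo] --> w'.1 x := cx None.
  rewrite /ind; case: ifPn => wx0; last by rewrite mulr0; near=> k; rewrite addr_ge0// ltW.
  have [d d0 hd] := expw_blowup L a0 c10 s00.
  have cs : (w k).1 x + dl k @[k --> \oo] --> w'.1 x + 0.
    apply: cvgD => //.
    apply: (@squeeze_cvgr _ _ _ _ (fun=> 0) (fun k => k.+1%:R^-1 : R)); [|exact: cvg_cst|exact: cvg_harmonic].
    by near=> k; rewrite ltW ?dl0//= /shift lef_pV2 ?posrE// ler_nat ltnS.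
  have d2 : 0 < Num.min d s0 by rewrite lt_min d0.
  near=> k.
  have hk : (w k).1 x + dl k <= Num.min d s0.
    have : `|w'.1 x + 0 - ((w k).1 x + dl k)| <= Num.min d s0.
      by near: k; move/cvgrPdist_le: cs => /(_ _ d2).
    by rewrite ler_norml => /andP[h1 _]; move: h1 wx0; rewrite addr0; lra.
  move: hk; rewrite le_min => /andP[hk1 hk2].
  have ws : (w k).1 x <= s0 by apply: le_trans hk2; rewrite lerDl ltW.
  rewrite /v /= (min_idPl ws) /F mulrC; apply: ler_wpDr; first exact: ltW.
  by apply: ler_wpM2l => //; apply: hd => //; rewrite ltr_wpDl.
have [i1 _] := Kind 1 ler01.
rewrite (_ : (fun x => 1 * ind x) = ind) in i1; last by apply/funext => x; rewrite mul1r.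
have I0 : I ind <= 0.
  rewrite leNgt; apply/negP => Ip.
  pose C := 2 / c0 * (M * mm).
  have C0 : 0 <= C by rewrite /C !mulr_ge0 ?invr_ge0 ?(ltW c00) ?fine_ge0.
  have L0 : 0 <= (C + 1) / I ind by rewrite divr_ge0 ?addr_ge0// ltW.
  have [_] := Kind _ L0; rewrite IZ//; last exact: mO.
  by rewrite divfK ?gt_eqF// -/C; lra.
have := I_eq0_ae mO i1 (aeonW mu (fun x _ => i0 x)) I0.
apply: aeon_imp => x _; rewrite /ind; case: (leP (w'.1 x) 0) => // _ hr zx.
by have := rho_pos _ zx; rewrite hr ltxx.
Unshelve. all: by end_near.
Qed.

End positivity.

(** * Energy estimates and the limit equation *)

(** With [y = 4 D + 1 >= 1] all constants are absorbed into [y^(th/2)]; dividing by it leaves the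
    positive power [1 - th/2] of [y]. *)
Lemma growth_bound (R : realType) (D B A1 A2 th : R) : 0 <= D -> 0 < B -> 0 <= A1 -> 0 <= A2 ->
  1 <= th < 2 -> B * D <= A1 + A2 * (4 * D + 1) `^ (th / 2) ->
  4 * D + 1 <= (1 + 4 * (A1 + A2) / B) `^ (1 - th / 2)^-1.
Proof.
move=> D0 B0 A10 A20 /andP[th1 th2] h.
set y := 4 * D + 1 in h *; have y1 : 1 <= y by rewrite /y; lra.
have y0 : 0 < y by apply: lt_le_trans y1.
set q := y `^ (th / 2) in h; have q1 : 1 <= q.
  by rewrite /q -[leLHS](powRr0 y) ler_powR// divr_ge0//; lra.
set K := 1 + 4 * (A1 + A2) / B.
have K0 : 0 <= K by rewrite addr_ge0// divr_ge0 ?mulr_ge0 ?addr_ge0// ltW.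
have yK : y <= K * q.
  have h1 : 4 * D <= 4 * (A1 + A2 * q) / B by rewrite ler_pdivlMr//; move: h; lra.
  have h2 : 4 * (A1 + A2 * q) / B <= 4 * (A1 + A2) / B * q.
    have -> : 4 * (A1 + A2) / B * q = 4 * (A1 * q + A2 * q) / B by ring.
    by rewrite ler_pM2r ?invr_gt0// ler_pM2l// lerD2r ler_peMr.
  by rewrite /K mulrDl mul1r /y; lra.
have e0 : 0 < 1 - th / 2 by rewrite subr_gt0 ltr_pdivrMr// mul1r.
have yE : y `^ (1 - th / 2) <= K.
  have q0 : 0 < q by apply: lt_le_trans q1.
  rewrite -(ler_pM2r q0); apply: le_trans yK; rewrite /q -powRD ?subrK ?powRr1 ?(ltW y0)//.
  by rewrite (gt_eqF y0) implybT.
have -> : y = (y `^ (1 - th / 2)) `^ (1 - th / 2)^-1.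
  by rewrite -powRrM mulfV ?gt_eqF// powRr1 ?(ltW y0).
by apply: ge0_ler_powR => //; rewrite ?nnegrE ?powR_ge0 ?invr_ge0// ltW.
Qed.

(** Read as [(1 + u)^th - 1 >= u^th], it lets the test function of the energy estimate cancel the
    singular factor [u^-th]. *)
Lemma powR_superadd (R : realType) (u th : R) : 1 <= th -> 0 < u -> u `^ th + 1 <= (1 + u) `^ th.
Proof.
move=> th1 u0; have v0 : 0 < 1 + u by rewrite addr_gt0.
have E (t : R) : 0 < t -> t `^ th = t * t `^ (th - 1).
  by move=> t0; rewrite -{2}[t](powRr1 (ltW t0)) -powRD ?(addrC 1) ?subrK// (gt_eqF t0) implybT.
rewrite (E _ v0) (E _ u0) mulrDl mul1r addrC; apply: lerD.
  by rewrite -[leLHS](powRr0 (1 + u)) ler_powR ?lerDl ?subr_ge0// ltW.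
rewrite ler_pM2l//; apply: ge0_ler_powR; rewrite ?nnegrE ?subr_ge0 ?lerDr//; exact: ltW.
Qed.

Lemma powR_subadd (R : realType) (u th : R) : 1 <= th -> 0 <= u ->
  (1 + u) `^ th <= 2 `^ th * (1 + u `^ th).
Proof.
move=> th1 u0; have t0 : 0 <= th by apply: le_trans th1.
have h0 : (0 : R) <= 2 `^ th := powR_ge0 _ _.
have [u1|u1] := leP u 1.
  apply: (@le_trans _ _ (2 `^ th)); last by rewrite ler_peMr// lerDl powR_ge0.
  by apply: ge0_ler_powR; rewrite ?nnegrE//; lra.
apply: (@le_trans _ _ ((2 * u) `^ th)).
  by apply: ge0_ler_powR; rewrite ?nnegrE//; lra.
by rewrite powRM// ler_wpM2l// lerDr.
Qed.

(** * Energy of the truncated limit and integrability of the gradient term *)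

Section limit.
Context (R : realType) (N : nat) (Omega : set 'rV[R]_N).
Hypotheses (oO : open Omega) (bO : bounded_set Omega).
Local Notation mu := (lebesgue_rV R N).
Local Notation T := 'rV[R]_N.
Local Notation I f := (\int[mu]_(x in Omega) f x).
Local Notation mO := (measurable_Omega oO).
Local Notation V := (@inV R N Omega).
Local Notation vf := (@vf R N).
Local Notation aeon := (aeon mu Omega).

(** [fatouR] is applied to tails of the sequence, on which [l + e] is a uniform bound; absolute
    values repair the nonnegativity that is known only almost everywhere. *)
Lemma fatou_cvg (f_ : nat -> T -> R) (f : T -> R) (c : nat -> R) (l : R) :
  measurable_fun Omega f -> (forall n, intg mu Omega (f_ n)) -> (forall x, 0 <= f x) ->
  aeon (fun x => forall n, 0 <= f_ n x) -> (forall n, I (f_ n) <= c n) ->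
  c n @[n --> \oo] --> l ->
  aeon (fun x => forall e, 0 < e -> \forall n \near \oo, f x <= f_ n x + e) ->
  intg mu Omega f /\ I f <= l.
Proof.
move=> mf if_ f0 f_0 fc cl h.
have main (e : R) : 0 < e -> intg mu Omega f /\ I f <= l + e.
  move=> e0; have [K _ hK] : \forall k \near \oo, c k <= l + e.
    move/cvgrPdist_le: cl => /(_ _ e0); apply: filterS => k.
    by rewrite distrC ler_norml => /andP[_]; rewrite lerBlDl.
  apply: (@fatouR _ _ _ _ _ mO (fun n x => `|f_ (n + K)%N x|)) => //.
  - by move=> n; exact: (intg_abs (if_ (n + K)%N)).
  - move=> n; apply: le_trans (hK (n + K)%N (leq_addl _ _)).
    apply: le_trans (fc (n + K)%N); rewrite le_eqVlt; apply/orP; left; apply/eqP.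
    have m1 := intg_meas (if_ (n + K)%N); apply: (I_eq_ae mO) => //.
      exact: measurableT_comp.
    by move: f_0; apply: aeon_imp => x _ hx; rewrite ger0_norm.
  move: h f_0; apply: aeon_imp2 => x _ hx f_x d d0.
  have [K2 _ hK2] := hx d d0; exists K2 => // n /= Kn.
  by rewrite ger0_norm//; apply: hK2 => /=; rewrite (leq_trans Kn)// leq_addr.
split; first by case: (main 1 ltr01).
by apply/ler_addgt0Pr => e /main[].
Qed.

Variables (p th B : R) (O : ode_data p).
Hypotheses (p0 : 0 < p) (th1 : 1 <= th) (th2 : th < 2) (B0 : 0 < B).
Variables (b : T -> R) (al be : R).
Hypotheses (mb : measurable_fun setT b) (al0 : 0 < al) (bb : forall x, al <= b x <= be).
Local Notation g := (gcoef O th).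
Local Notation hop := (hop th B O).
Local Notation E := (ode O).
Variable f : T -> R.
Hypotheses (mf : measurable_fun setT f) (f0 : forall x, 0 <= f x) (intf : intg mu Omega f)
  (intF : forall v, V v -> intg mu Omega (fun x => f x * v.1 x)).
Variables (CP CS : R).
Hypotheses (CS0 : 0 <= CS) (CP0 : 0 <= CP)
  (hP : forall v, V v -> I (fun x => v.1 x ^+ 2) <= CP * D2 Omega v)
  (hS : forall v, V v -> D2 Omega v <= 4^-1 ->
    intg mu Omega (fun x => f x * `|v.1 x| `^ th) /\ I (fun x => f x * `|v.1 x| `^ th) <= CS).
Variables (w : nat -> vf) (m : nat -> nat) (w' : vf).
Hypotheses (hm : forall k, (k <= m k)%N)
  (sw : forall k, solves Omega b (fun v => I (fun x => f x * v.1 x)) hop (m k) (w k))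
  (Vw' : V w') (pos : aeon (fun x => 0 < w'.1 x))
  (cw : aeon (fun x => forall o, vco (w k) o x @[k --> \oo] --> vco w' o x)).

Lemma sol_V k : V (w k). Proof. by case: (sw k). Qed.

Lemma sol_ge0 : aeon (fun x => forall k, 0 <= (w k).1 x).
Proof. by apply: aeon_all => k; case: (sw k). Qed.

Lemma hop_ge0 n (v : vf) (x : T) : 0 <= hop n v x.
Proof. by have [_ _ _ h] := hop_lip N O p0 th1 B0 n; exact: h. Qed.

Lemma intg_hop k v : V v -> intg mu Omega (fun x => hop (m k) (w k) x * v.1 x).
Proof. by move=> Vv; exact: (intg_op oO (hop_lip N O p0 th1 B0 (m k)) (sol_V k) Vv). Qed.

Lemma energy_le k v : V v -> aeon (fun x => 0 <= dotv ((w k).2 x) (v.2 x)) ->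
  I (fun x => hop (m k) (w k) x * v.1 x) <= I (fun x => f x * v.1 x).
Proof.
move=> Vv hd; have [_ _ /(_ _ Vv) <-] := sw k; rewrite lerDr /bform mul0r addr0.
apply: (I_ge0_ae mO); first exact: (intg_form oO mb al0 bb (sol_V k) Vv).
move: hd; apply: aeon_imp => x _ hx; rewrite mulr_ge0//.
by have /andP[h _] := bb x; apply: le_trans h; exact: ltW.
Qed.

(** Multiplying [v] by [(4 D2 + 1)^(-1/2)] brings it into the normalised range; homogeneity of
    degree [th] returns the power [th/2]. The [+ 1] avoids dividing by a vanishing energy. *)
Lemma scaled_source v : V v -> intg mu Omega (fun x => f x * `|v.1 x| `^ th) /\
  I (fun x => f x * `|v.1 x| `^ th) <= CS * (4 * D2 Omega v + 1) `^ (th / 2).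
Proof.
move=> Vv; set y := 4 * D2 Omega v + 1.
have D0 := D2_ge0 Omega v; have y0 : 0 < y by rewrite /y; lra.
pose t : R := (Num.sqrt y)^-1; have t0 : 0 < t by rewrite invr_gt0 sqrtr_gt0.
have t2 : t ^+ 2 = y^-1 by rewrite exprVn sqr_sqrtr// ltW.
have Dt : D2 Omega (vscale t v) <= 4^-1.
  rewrite (D2_scale oO t Vv) t2 mulrC ler_pdivrMr// /y; lra.
have [i1 h1] := hS (V_scale oO t Vv) Dt.
have E1 x : f x * `|(vscale t v).1 x| `^ th = t `^ th * (f x * `|v.1 x| `^ th).
  have := vscaleE t v None x; rewrite /= => ->.
  by rewrite normrM (gtr0_norm t0) powRM ?(ltW t0)// mulrCA.
have tt0 : 0 < t `^ th by rewrite powR_gt0.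
have i2 : intg mu Omega (fun x => f x * `|v.1 x| `^ th).
  have := intgZ mO (t `^ th)^-1 i1; congr intg; apply/funext => x.
  by rewrite E1 mulrA mulVf ?mul1r// gt_eqF.
split => //.
have : t `^ th * I (fun x => f x * `|v.1 x| `^ th) <= CS.
  by rewrite -IZ//; [under eq_Rintegral do rewrite -E1|exact: mO].
rewrite -ler_pdivlMl// mulrC => H; apply: (le_trans H).
have -> : (t `^ th)^-1 = y `^ (th / 2).
  have tE : t = y `^ (- 2^-1) by rewrite /t powRN powR12_sqrt// ltW.
  by rewrite tE -powRN -powRrM; congr (_ `^ _); field.
by [].
Qed.

(** The unknown [u] truncated at height [k.+1], since [E] takes the value [k.+2] at [ode_pt O k.+1].
    The truncation is needed as long as [w'] is not known to stay in the domain of [E]. *)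
Definition uk (k : nat) : vf := vcomp (fun s => E s - 1) (fun s => E s `^ p) (minv (ode_pt O k.+1) w').

Lemma pt_gt0 k : 0 < ode_pt O k.+1.
Proof.
have [_ h] := ode_pt_dom O k.+1; rewrite lt_def h andbT; apply/eqP => t0.
by have := ode_ptE O k.+1; rewrite t0 ode0 => /eqP; rewrite eq_sym pnatr_eq1.
Qed.

Lemma pt_dom k s : 0 <= s <= ode_pt O k.+1 -> ode_dom O s.
Proof. by have [h _] := ode_pt_dom O k.+1 => hs; exact: ode_dom_le h hs. Qed.

Lemma measurable_odep (q : R) : measurable_fun setT (fun s : R => E s `^ q).
Proof.
apply: (measurableT_comp (f := fun s : R => s `^ q)); first exact: measurable_powR.
exact: ode_meas.
Qed.

Lemma is_derive_ode_powR (q s : R) : ode_dom O s ->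
  is_derive s 1 (fun s => E s `^ q) (q * E s `^ (q - 1) * E s `^ p).
Proof.
move=> Ds; have := is_derive1_powR q (ode_gt0 Ds) => d1.
exact: (is_derive1_comp d1 (ode_deriv Ds)).
Qed.

Lemma continuous_ode_powR (q s : R) : ode_dom O s -> {for s, continuous (fun s => E s `^ q)}.
Proof. by move=> Ds; exact: is_derive_continuous (is_derive_ode_powR q Ds). Qed.

Lemma is_derive_subr1 (F : R -> R) (s l : R) : is_derive s 1 F l -> is_derive s 1 (fun s => F s - 1) l.
Proof.
move=> dF; have dc : is_derive s 1 (cst 1 : R -> R) 0 by exact: is_derive_cst.
by have H := is_deriveB dF dc; apply: (is_derive_eq H); rewrite subr0.
Qed.

Lemma w'_ge0 : aeon (fun x => 0 <= w'.1 x).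
Proof. by move: pos; apply: aeon_imp => x _ /ltW. Qed.

Lemma V_uk k : V (uk k).
Proof.
apply: (V_testF oO bO (pt_gt0 k) Vw' w'_ge0).
- by apply: measurable_funB => //; exact: ode_meas.
- exact: measurable_odep.
- by move=> s hs; apply: is_derive_subr1; exact: ode_deriv (pt_dom hs).
- by move=> s hs; exact: continuous_ode_powR (pt_dom hs).
- by rewrite ode0 subrr.
Qed.

Lemma gsq_uk k x : gsq (uk k) x =
  if ode_pt O k.+1 < w'.1 x then 0 else E (w'.1 x) `^ (2 * p) * gsq w' x.
Proof.
rewrite /uk !gsqE; case: ifPn => h.
  by rewrite big1// => i _; rewrite /= h !mxE mulr0 expr0n.
rewrite mulr_sumr; apply: eq_bigr => i _; rewrite /= (negbTE h) mxE.
rewrite -leNgt in h; rewrite (min_idPl h) exprMn; congr (_ * _).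
by rewrite -powR_mulrn ?powR_ge0// -powRrM mulrC.
Qed.

(** The diffusion term is dropped. Below the truncation [g psi >= E^(2p)], so the limit of the
    lower-order term controls [B |D uk|^2], however degenerate the diffusion is; on the right
    [psi <= 2^th (1 + uk^th)]. [growth_bound] closes the estimate, with a constant independent of
    [k]. *)
Lemma uk_energy : exists C : R, forall k, D2 Omega (uk k) <= C.
Proof.
exists ((1 + 4 * (2 `^ th * I f + 2 `^ th * CS) / B) `^ (1 - th / 2)^-1) => k.
have D0 := D2_ge0 Omega (uk k).
suff h : B * D2 Omega (uk k) <= 2 `^ th * I f + 2 `^ th * CS * (4 * D2 Omega (uk k) + 1) `^ (th / 2).
  have If0 : 0 <= I f by apply: (I_ge0_ae mO intf); exact: aeonW.
  have := @growth_bound R (D2 Omega (uk k)) B (2 `^ th * I f) (2 `^ th * CS) th D0 B0.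
  rewrite !mulr_ge0 ?powR_ge0// th1 th2 => /(_ isT isT isT h) H; apply: le_trans H; lra.
set s := ode_pt O k.+1; have s0 : 0 < s := pt_gt0 k.
pose psi (t : R) := E t `^ th - 1; pose psi' (t : R) := th * E t `^ (th - 1) * E t `^ p.
have dom t : 0 <= t <= s -> ode_dom O t by exact: pt_dom.
have mpsi : measurable_fun setT psi by apply: measurable_funB => //; exact: measurable_odep.
have mpsi' : measurable_fun setT psi'.
  by apply: measurable_funM; [apply: measurable_funM => //|]; exact: measurable_odep.
have dpsi (t : R) : 0 <= t <= s -> is_derive t 1 psi (psi' t).
  by move=> /dom ht; apply: is_derive_subr1; exact: is_derive_ode_powR.
have cpsi' (t : R) : 0 <= t <= s -> {for t, continuous psi'}.
  move=> /dom ht; apply: cvgM; [apply: cvgM; first exact: cvg_cst|]; exact: continuous_ode_powR.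
have psi0 : psi 0 = 0 by rewrite /psi ode0 powR1 subrr.
pose v n := vcomp psi psi' (minv s (w n)).
have Vv n : V (v n).
  by apply: (V_testF oO bO s0 (sol_V n) _ mpsi mpsi' dpsi cpsi' psi0); case: (sw n).
have psi_ge0 t : 0 <= t <= s -> 0 <= psi t.
  move=> ht; have /andP[t0 _] := ht; have E1 := ode_ge1 (dom t ht) t0.
  by rewrite /psi subr_ge0 -[leLHS](powRr0 (E t)) ler_powR// (le_trans ler01).
have psi'_ge0 t : 0 <= psi' t by rewrite !mulr_ge0 ?powR_ge0// (le_trans ler01).
have mn n x : 0 <= (w n).1 x -> 0 <= Num.min ((w n).1 x) s <= s.
  by move=> h; rewrite le_min h (ltW s0) ge_min lexx orbT.
have en n : I (fun x => hop (m n) (w n) x * (v n).1 x) <= I (fun x => f x * (v n).1 x).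
  apply: energy_le => //; apply: aeonW => x _; rewrite /v /=.
  case: ifP => _; first by rewrite /dotv big1// => i _; rewrite !mxE !mulr0.
  rewrite /dotv sumr_ge0// => i _; rewrite mxE mulrCA mulr_ge0// -expr2 sqr_ge0//.
have vle t : 0 <= t <= s -> psi t <= E s `^ th.
  move=> ht; have /andP[t0 ts] := ht; rewrite /psi lerBlDr; apply: ler_wpDr => //.
  have ss : 0 <= s <= s by rewrite lexx ltW.
  apply: ge0_ler_powR.
  - exact: le_trans ler01 th1.
  - by rewrite nnegrE; apply: ltW; apply: ode_gt0; exact: dom.
  - by rewrite nnegrE; apply: ltW; apply: ode_gt0; exact: dom.
  - by apply: (ode_le (dom _ ss)).
have cv : aeon (fun x => (v n).1 x @[n --> \oo] --> psi (Num.min (w'.1 x) s)).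
  move: cw w'_ge0; apply: aeon_imp2 => x _ c wx; have c1 : (w n).1 x @[n --> \oo] --> w'.1 x := c None.
  have c2 : Num.min ((w n).1 x) s @[n --> \oo] --> Num.min (w'.1 x) s.
    apply: (cvg_comp _ (fun t : R => Num.min t s) c1).
    by apply: (@continuous_min _ _ id (fun=> s)); [exact: cvg_id|exact: cvg_cst].
  apply: (cvg_comp _ psi c2); apply: is_derive_continuous (dpsi _ _).
  by rewrite le_min wx (ltW s0) ge_min lexx orbT.
have mlim : measurable_fun setT (fun x => psi (Num.min (w'.1 x) s)).
  apply: (measurableT_comp mpsi); apply: measurable_minr => //; exact: (V_meas Vw' None).
have [ilim clim] : intg mu Omega (fun x => f x * psi (Num.min (w'.1 x) s)) /\
    I (fun x => f x * (v n).1 x) @[n --> \oo] --> I (fun x => f x * psi (Num.min (w'.1 x) s)).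
  apply: (@dct _ _ _ _ _ mO (fun n x => f x * (v n).1 x) _ (fun x => E s `^ th * f x)).
  - by move=> n; apply: measurable_funTS; apply: measurable_funM => //; exact: (V_meas (Vv n) None).
  - by apply: measurable_funTS; exact: measurable_funM.
  - by move: cv; apply: aeon_imp => x _ c; apply: cvgM => //; exact: cvg_cst.
  - exact: (intgZ mO).
  move: sol_ge0; apply: aeon_imp => x _ wx n; rewrite normrM (ger0_norm (f0 x)) mulrC ler_wpM2r//.
  by rewrite /v /= ger0_norm ?psi_ge0 ?vle ?mn.
have [_] : intg mu Omega (fun x => B * gsq (uk k) x) /\
    I (fun x => B * gsq (uk k) x) <= I (fun x => f x * psi (Num.min (w'.1 x) s)).
  apply: (@fatou_cvg (fun n x => hop (m n) (w n) x * (v n).1 x) _ _ _ _ _ _ _ en clim);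
    [|by move=> n; exact: intg_hop| | |].
- apply: measurable_funTS; apply: measurable_funM => //; apply: measurable_dotv => i; exact: (V_meas (V_uk k) (Some i)).
- by move=> x; rewrite mulr_ge0 ?gsq_ge0// ltW.
- move: sol_ge0; apply: aeon_imp => x _ wx n; rewrite mulr_ge0 ?hop_ge0//=.
  by apply: psi_ge0; exact: mn.
- have aux : aeon (fun x => (forall k, 0 <= (w k).1 x) /\ 0 < w'.1 x).
    by move: sol_ge0 pos; apply: aeon_imp2.
  have aux2 : aeon (fun x => ((v n).1 x @[n --> \oo] --> psi (Num.min (w'.1 x) s)) /\
      forall o, vco (w k) o x @[k --> \oo] --> vco w' o x) by move: cv cw; apply: aeon_imp2.
  move: aux aux2; apply: aeon_imp2 => x _ [wx px] [cvx cwx] e e0.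
  rewrite gsq_uk -/s; case: ifPn => hs.
    rewrite mulr0; near=> n; apply: ler_wpDl; last exact: ltW.
    by rewrite mulr_ge0 ?hop_ge0//=; apply: psi_ge0; exact: mn.
  rewrite -leNgt in hs.
  have Dx : ode_dom O (w'.1 x) by apply: dom; rewrite hs ltW.
  have c3 : hop (m n) (w n) x * (v n).1 x @[n --> \oo] -->
      B * (g (w'.1 x) * gsq w' x) * psi (Num.min (w'.1 x) s).
    by apply: cvgM; [exact: (cvg_hop p0 th1 hm (conj Dx px) cwx)|exact: cvx].
  rewrite (min_idPl hs) in c3.
  have lb : B * (E (w'.1 x) `^ (2 * p) * gsq w' x) <= B * (g (w'.1 x) * gsq w' x) * psi (w'.1 x).
    rewrite -mulrA ler_pM2l// mulrAC ler_wpM2r ?gsq_ge0//.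
    have u0 := ode_gt1 Dx px; rewrite /gcoef mulrAC ler_peMl ?powR_ge0//.
    rewrite powRN mulrC ler_pdivlMr ?powR_gt0// mul1r /psi lerBrDr.
    by have := powR_superadd th1 u0; have -> : 1 + (E (w'.1 x) - 1) = E (w'.1 x) by ring.
  move/cvgrPdist_le: c3 => /(_ _ e0); apply: filterS => n.
  by rewrite ler_norml => /andP[_]; lra.
rewrite IZ; [|exact: mO|exact: (intg_gsq oO (V_L2 (V_uk k)))].
rewrite (I_gsq oO (V_L2 (V_uk k))) => H; apply: (le_trans H).
have [i1 h1] := scaled_source (V_uk k).
apply: (@le_trans _ _ (I (fun x => 2 `^ th * (f x + f x * `|(uk k).1 x| `^ th)))).
  apply: (I_le_ae mO) => //; first by apply: (intgZ mO); exact: (intgD mO).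
  move: w'_ge0; apply: aeon_imp => x _ wx.
  have hx : 0 <= Num.min (w'.1 x) s <= s by rewrite le_min wx (ltW s0) ge_min lexx orbT.
  have /andP[hx0 _] := hx; have E1 := ode_ge1 (dom _ hx) hx0.
  rewrite /uk /= -/s ger0_norm ?subr_ge0// -{2}[f x]mulr1 -mulrDr mulrCA ler_wpM2l//.
  have u0 : 0 <= E (Num.min (w'.1 x) s) - 1 by rewrite subr_ge0.
  have := powR_subadd th1 u0; rewrite addrC subrK /psi => h2.
  by apply: le_trans h2; rewrite gerBl.
rewrite IZ; [|exact: mO|exact: (intgD mO)].
rewrite ID; [|exact: mO|exact: intf|exact: i1].
by rewrite mulrDr lerD2l -mulrA ler_wpM2l ?powR_ge0.
Unshelve. all: by end_near.
Qed.

(** Where [w'] exceeds all these points, [uk k] equals [k.+1] for every [k]. The uniform energy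
    bound and Poincare's inequality bound its [L^2] norm, so that set is null. *)
Lemma below_some_point : aeon (fun x => exists k, w'.1 x <= ode_pt O k.+1).
Proof.
have [C hC] := uk_energy.
pose A : set R := \bigcap_k [set s : R | ode_pt O k.+1 < s].
have mA : measurable A.
  by apply: bigcapT_measurable => k; rewrite -[X in measurable X]set_itvoy; exact: measurable_itv.
pose ind x : R := \1_A (w'.1 x).
have mind : measurable_fun setT ind.
  by apply: (measurableT_comp (f := \1_A : R -> R)); [exact: measurable_indic|exact: (V_meas Vw' None)].
have i01 x : 0 <= ind x <= 1 by rewrite /ind indicE; case: (_ \in _); rewrite lexx ler01.
have iind : intg mu Omega ind.
  apply: (intg_dom_le mO (measurable_funTS mind) (intg_cst oO bO 1)) => x _.
  by rewrite ger0_norm; case/andP: (i01 x).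
have h k : k.+1%:R * I ind <= CP * C.
  apply: (@le_trans _ _ (I (fun x => (uk k).1 x ^+ 2))); last first.
    by apply: (le_trans (hP (V_uk k))); exact: ler_wpM2l.
  rewrite -IZ//; last exact: mO.
  apply: (I_le mO); [exact: (intgZ mO)|by case: (V_L2 (V_uk k) None)|move=> x _].
  rewrite /ind indicE; case: (boolP (_ \in _)) => [|_]; last by rewrite mulr0 sqr_ge0.
  rewrite inE => /(_ k Logic.I)/= hx; rewrite mulr1 /uk /= (min_idPr (ltW hx)) ode_ptE.
  have -> : k.+2%:R - 1 = k.+1%:R :> R by rewrite -[k.+2%:R]natr1 addrK.
  by rewrite expr2; apply: ler_peMr; rewrite ?ler0n ?ler1n.
have I0 : I ind <= 0.
  rewrite leNgt; apply/negP => Ip.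
  have h2 := h (Num.truncn (CP * C / I ind)).
  have := truncnS_gt (CP * C / I ind); rewrite ltr_pdivrMr// => h3.
  by have := lt_le_trans h3 h2; rewrite ltxx.
have := I_eq0_ae mO iind (aeonW mu (fun x _ => (andP (i01 x)).1)) I0.
apply: aeon_imp => x _; rewrite /ind indicE; case: (boolP (_ \in _)) => [_ /eqP|]; first by rewrite oner_eq0.
rewrite notin_setE => hA _; apply: contrapT => hn; apply: hA => k _ /=.
by rewrite ltNge; apply/negP => hk; apply: hn; exists k.
Qed.

Lemma in_dom : aeon (fun x => ode_dom O (w'.1 x)).
Proof.
move: below_some_point w'_ge0; apply: aeon_imp2 => x _ [k hk] wx.
by apply: (@pt_dom k); rewrite wx hk.
Qed.

(** The constant 1 does not vanish on the boundary; it is replaced by [min(1, (n+1) w n)], which is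
    eventually 1 at almost every point because [w' > 0]. The total is bounded by the integral of
    [f]. *)
Lemma quadratic_integrable : intg mu Omega (fun x => g (w'.1 x) * gsq w' x).
Proof.
pose v n := vcomp (fun s => n.+1%:R * s) (fun=> n.+1%:R) (minv n.+1%:R^-1 (w n)).
have n0 n : 0 < n.+1%:R^-1 :> R by rewrite invr_gt0.
have Vv n : V (v n).
  apply: (V_testF oO bO (n0 n) (sol_V n)).
  - by case: (sw n).
  - exact: measurable_funM.
  - exact: measurable_cst.
  - move=> s _; have := @is_deriveZ _ _ _ _ (n.+1%:R : R) s 1 _ (is_derive_id s 1).
    by move=> H; apply: (is_derive_eq H); rewrite /GRing.scale/= mulr1.
  - by move=> s _; exact: cvg_cst.
  - by rewrite mulr0.
have vb n x : 0 <= (w n).1 x -> 0 <= (v n).1 x <= 1.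
  move=> wx; rewrite /v /=; apply/andP; split.
    by apply: mulr_ge0 => //; rewrite le_min wx; exact: ltW.
  apply: (@le_trans _ _ (n.+1%:R * n.+1%:R^-1)); last by rewrite mulfV.
  by apply: ler_wpM2l; [exact: ler0n|rewrite ge_min lexx orbT].
have en n : I (fun x => hop (m n) (w n) x * (v n).1 x) <= I f.
  apply: le_trans (energy_le (Vv n) _) _.
    apply: aeonW => x _; rewrite /v /=; case: ifP => _.
      by rewrite /dotv big1// => i _; rewrite !mxE !mulr0.
    rewrite /dotv sumr_ge0// => i _; rewrite mxE mulrCA mulr_ge0// -expr2 sqr_ge0//.
  apply: (I_le_ae mO) => //; first exact: intF.
  move: sol_ge0; apply: aeon_imp => x _ wx; rewrite -[leRHS]mulr1 ler_wpM2l//.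
  by case/andP: (vb n x (wx n)).
have aux : aeon (fun x => (forall k, 0 <= (w k).1 x) /\ 0 < w'.1 x).
  by move: sol_ge0 pos; apply: aeon_imp2.
have mg : measurable_fun setT (fun x => g (w'.1 x) * gsq w' x).
  apply: measurable_funM; last by apply: measurable_dotv => i; exact: (V_meas Vw' (Some i)).
  apply: (measurableT_comp (f := g)); last exact: (V_meas Vw' None).
  apply: measurable_funM.
    apply: (measurableT_comp (f := fun s : R => s `^ (- th))); first exact: measurable_powR.
    by apply: measurable_funB => //; exact: ode_meas.
  apply: (measurableT_comp (f := fun s : R => s `^ (2 * p))); first exact: measurable_powR.
  exact: ode_meas.
have [i1 _] : intg mu Omega (fun x => B * (g (w'.1 x) * gsq w' x)) /\
    I (fun x => B * (g (w'.1 x) * gsq w' x)) <= I f.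
  apply: (@fatou_cvg (fun n x => hop (m n) (w n) x * (v n).1 x) _ (fun=> I f)) => //.
  - by apply: measurable_funTS; exact: measurable_funM.
  - by move=> n; exact: intg_hop.
  - by move=> x; apply: mulr_ge0; [exact: ltW|apply: mulr_ge0; [exact: gcoef_ge0|exact: gsq_ge0]].
  - move: sol_ge0; apply: aeon_imp => x _ wx n; rewrite mulr_ge0 ?hop_ge0//.
    by case/andP: (vb n x (wx n)).
  - exact: cvg_cst.
  have aux2 : aeon (fun x => ode_dom O (w'.1 x) /\ forall o, vco (w k) o x @[k --> \oo] --> vco w' o x).
    by move: in_dom cw; apply: aeon_imp2.
  move: aux aux2; apply: aeon_imp2 => x _ [wx px] [Dx c] e e0.
  have c3 := cvg_hop (B := B) p0 th1 hm (conj Dx px) c.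
  have c1 : (w n).1 x @[n --> \oo] --> w'.1 x := c None.
  have p2 : 0 < w'.1 x / 2 by rewrite divr_gt0.
  near=> n.
  have h1 : B * (g (w'.1 x) * gsq w' x) <= hop (m n) (w n) x + e.
    have : `|B * (g (w'.1 x) * gsq w' x) - hop (m n) (w n) x| <= e.
      by near: n; move/cvgrPdist_le: c3 => /(_ _ e0).
    by rewrite ler_norml => /andP[_]; lra.
  have h2 : n.+1%:R^-1 <= (w n).1 x.
    have h3 : `|w'.1 x - (w n).1 x| <= w'.1 x / 2.
      by near: n; move/cvgrPdist_le: c1 => /(_ _ p2).
    have h4 : n.+1%:R^-1 < w'.1 x / 2.
      by near: n; exact: (@near_infty_natSinv_lt R (PosNum p2)).
    apply: (le_trans (ltW h4)); move: h3; rewrite ler_norml => /andP[_].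
    by move: (w'.1 x) ((w n).1 x) => q1 q2; lra.
  by rewrite /v /= (min_idPr h2) mulfV// mulr1.
have := intgZ mO B^-1 i1; congr intg; apply/funext => x.
by rewrite mulrA mulVf ?mul1r// gt_eqF.
Unshelve. all: by end_near.
Qed.

End limit.

(** * Scale-invariant cut-off functions *)

Section cutoff.
Context (R : realType).

(** Quadratic spline with nodes 0, 1/2 and 1, rising from 0 to 1. Squared positive parts make it
    continuously differentiable, with slope at most 2. *)
Definition sstep (t : R) : R :=
  2 * Num.max (t - 0) 0 ^+ 2 - 4 * Num.max (t - 2^-1) 0 ^+ 2 + 2 * Num.max (t - 1) 0 ^+ 2.
Definition sstep' (t : R) : R :=
  2 * (2 * Num.max (t - 0) 0) - 4 * (2 * Num.max (t - 2^-1) 0) + 2 * (2 * Num.max (t - 1) 0).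

Lemma is_derive_sstep (t : R) : is_derive t 1 sstep (sstep' t).
Proof.
have d1 := @is_deriveZ _ _ _ _ (2 : R) t 1 _ (is_derive_sqpos 0 t).
have d2 := @is_deriveZ _ _ _ _ (4 : R) t 1 _ (is_derive_sqpos 2^-1 t).
have d3 := @is_deriveZ _ _ _ _ (2 : R) t 1 _ (is_derive_sqpos 1 t).
exact: (is_deriveD (is_deriveB d1 d2) d3).
Qed.

Lemma continuous_sstep' : continuous sstep'.
Proof.
have c (a : R) : continuous (fun t : R => 2 * Num.max (t - a) 0).
  move=> t; apply: cvgM; first exact: cvg_cst.
  apply: (@continuous_max _ _ (fun s : R => s - a) (fun=> 0)); last exact: cvg_cst.
  by apply: cvgB; [exact: cvg_id|exact: cvg_cst].
by move=> t; apply: cvgD; [apply: cvgB|]; apply: cvgM; try exact: cvg_cst; exact: c.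
Qed.

Lemma sstep_bounds t : [/\ 0 <= sstep t, sstep t <= 1 & `|sstep' t| <= 2].
Proof.
have pE (s : R) : (0 <= s /\ Num.max s 0 = s) \/ (s <= 0 /\ Num.max s 0 = 0).
  by case: (leP s 0) => h; [right|left; split => //; exact: ltW].
rewrite /sstep /sstep'.
case: (pE (t - 0)) => -[h1 ->]; case: (pE (t - 2^-1)) => -[h2 ->]; case: (pE (t - 1)) => -[h3 ->];
  rewrite ler_norml; split; try apply/andP; try split; try by exfalso; lra.
all: try lra.
all: have := sqr_ge0 (1 - t); have := sqr_ge0 t; have := mulr_ge0 (_ : 0 <= t) (_ : 0 <= 1 - t).
all: nra.
Qed.

Lemma sstep_le0 t : t <= 0 -> sstep t = 0 /\ sstep' t = 0.
Proof.
move=> h; rewrite /sstep /sstep' !max_r ?expr0n /=; lra.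
Qed.

Lemma sstep_ge1 t : 1 <= t -> sstep t = 1 /\ sstep' t = 0.
Proof. by move=> h; rewrite /sstep /sstep' !max_l; try lra; split; field. Qed.

(** Vanishes for [u <= 1/K] and for [u >= 2 K], and equals 1 for [2/K <= u <= K]. Both factors are
    one fixed profile in [c u], with [c = K] or [c = 1/K], so that [u |cutf'|] is scale
    invariant. *)
Definition cutf (K u : R) : R := sstep (K * u - 1) * (1 - sstep (K^-1 * u - 1)).
Definition cutf' (K u : R) : R :=
  K * sstep' (K * u - 1) * (1 - sstep (K^-1 * u - 1)) - sstep (K * u - 1) * (K^-1 * sstep' (K^-1 * u - 1)).

Lemma is_derive_cutf K (u : R) : is_derive u 1 (cutf K) (cutf' K u).
Proof.
have dl (c : R) : is_derive u 1 (fun u : R => c * u - 1) c.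
  have d1 := @is_deriveZ _ _ _ _ c u 1 _ (is_derive_id u 1).
  by apply: (is_derive_eq (is_derive_subr1 d1)); rewrite /GRing.scale/= mulr1.
have ds (c : R) := is_derive1_comp (g := fun u : R => c * u - 1) (is_derive_sstep (c * u - 1)) (dl c).
have d1 : is_derive u 1 (cst 1 : R -> R) 0 by exact: is_derive_cst.
have d2 : is_derive u 1 (fun u : R => 1 - sstep (K^-1 * u - 1)) (0 - sstep' (K^-1 * u - 1) * K^-1).
  exact: (is_deriveB d1 (ds K^-1)).
have d3 : is_derive u 1 (fun u : R => sstep (K * u - 1)) (sstep' (K * u - 1) * K) by exact: (ds K).
apply: (is_derive_eq (is_deriveM d3 d2)); rewrite /cutf' /GRing.scale /=; ring.
Qed.

Lemma continuous_cutf' K : continuous (cutf' K).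
Proof.
have cl (c : R) : continuous (fun u : R => c * u - 1).
  by move=> u; apply: cvgB; [apply: cvgM; [exact: cvg_cst|exact: cvg_id]|exact: cvg_cst].
have cs : continuous sstep by move=> t; exact: is_derive_continuous (is_derive_sstep t).
have c1 (c : R) : continuous (fun u : R => sstep (c * u - 1)).
  by move=> u; apply: (@continuous_comp _ _ _ (fun u : R => c * u - 1) sstep u); [exact: cl|exact: cs].
have c2 (c : R) : continuous (fun u : R => sstep' (c * u - 1)).
  by move=> u; apply: (@continuous_comp _ _ _ (fun u : R => c * u - 1) sstep' u); [exact: cl|exact: continuous_sstep'].
move=> u; apply: cvgB.
  apply: cvgM; first by apply: cvgM; [exact: cvg_cst|exact: c2].
  by apply: cvgB; [exact: cvg_cst|exact: c1].
by apply: cvgM; [exact: c1|apply: cvgM; [exact: cvg_cst|exact: c2]].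
Qed.

(** The slope of a step in [c u] is at most [2 c] and vanishes for [c u >= 2], so each of the two
    factors contributes at most 4 to the last bound. *)
Lemma cutf_bounds K u : 0 < K -> 0 <= u ->
  [/\ 0 <= cutf K u, cutf K u <= 1 & `|cutf' K u| * u <= 8].
Proof.
move=> K0 u0; rewrite /cutf /cutf'.
have [a0 a1 a2] := sstep_bounds (K * u - 1); have [b0 b1 b2] := sstep_bounds (K^-1 * u - 1).
have V0 : 0 < K^-1 by rewrite invr_gt0.
split; first by rewrite mulr_ge0// subr_ge0.
  by rewrite -[leRHS]mulr1; apply: ler_pM; rewrite ?subr_ge0// lerBlDr lerDl.
have key (c : R) : 0 < c -> c * `|sstep' (c * u - 1)| * u <= 4.
  move=> c0; have [h|h] := leP 2 (c * u).
    by rewrite (sstep_ge1 _).2 ?normr0 ?mulr0 ?mul0r//; lra.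
  have [_ _ s2] := sstep_bounds (c * u - 1).
  rewrite mulrAC; apply: (@le_trans _ _ (2 * 2)); last lra.
  by apply: ler_pM => //; [rewrite mulr_ge0// ltW|exact: ltW].
apply: (@le_trans _ _ (K * `|sstep' (K * u - 1)| * u + K^-1 * `|sstep' (K^-1 * u - 1)| * u)); last first.
  by have := key _ K0; have := key _ V0; lra.
rewrite -mulrDl ler_wpM2r//; apply: (le_trans (ler_normB _ _)); apply: lerD.
  rewrite normrM normrM (gtr0_norm K0) [X in _ * X]ger0_norm ?subr_ge0//.
  by rewrite ler_piMr ?mulr_ge0 ?(ltW K0)// lerBlDr lerDl.
rewrite normrM normrM (gtr0_norm V0) (ger0_norm a0).
by rewrite ler_piMl ?mulr_ge0 ?(ltW V0).
Qed.

Lemma cutf_out K u : 0 < K -> K * u <= 1 \/ 2 * K <= u -> cutf K u = 0 /\ cutf' K u = 0.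
Proof.
move=> K0 [h|h]; rewrite /cutf /cutf'.
  have [-> ->] : sstep (K * u - 1) = 0 /\ sstep' (K * u - 1) = 0 by apply: sstep_le0; lra.
  by split; ring.
have [-> ->] : sstep (K^-1 * u - 1) = 1 /\ sstep' (K^-1 * u - 1) = 0.
  by apply: sstep_ge1; rewrite lerBrDr ler_pdivlMl//; lra.
by split; ring.
Qed.

Lemma cutf_in K u : 0 < K -> 2 <= K * u -> u <= K -> cutf K u = 1 /\ cutf' K u = 0.
Proof.
move=> K0 h1 h2; rewrite /cutf /cutf'.
have [-> ->] : sstep (K * u - 1) = 1 /\ sstep' (K * u - 1) = 0 by apply: sstep_ge1; lra.
have [-> ->] : sstep (K^-1 * u - 1) = 0 /\ sstep' (K^-1 * u - 1) = 0.
  by apply: sstep_le0; rewrite subr_le0 ler_pdivrMl// mulr1.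
by split; ring.
Qed.

End cutoff.

Lemma dbl_succ (k : nat) : ((k.*2.+1).+2 = 2 * k.+1 + 1)%N.
Proof. by rewrite mul2n doubleS addn1. Qed.

(** * Passage to the limit in the weak equation *)

Section weak_equation.
Context (R : realType) (N : nat) (Omega : set 'rV[R]_N).
Hypotheses (oO : open Omega) (bO : bounded_set Omega).
Local Notation mu := (lebesgue_rV R N).
Local Notation T := 'rV[R]_N.
Local Notation I f := (\int[mu]_(x in Omega) f x).
Local Notation mO := (measurable_Omega oO).
Local Notation V := (@inV R N Omega).
Local Notation vf := (@vf R N).
Local Notation aeon := (aeon mu Omega).

Variables (p th B : R) (O : ode_data p).
Hypotheses (p0 : 0 < p) (th1 : 1 <= th) (th2 : th < 2) (B0 : 0 < B).
Variables (b : T -> R) (al be : R).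
Hypotheses (mb : measurable_fun setT b) (al0 : 0 < al) (bb : forall x, al <= b x <= be).
Local Notation g := (gcoef O th).
Local Notation hop := (hop th B O).
Local Notation E := (ode O).
Variable f : T -> R.
Hypotheses (mf : measurable_fun setT f) (f0 : forall x, 0 <= f x) (intf : intg mu Omega f)
  (intF : forall v, V v -> intg mu Omega (fun x => f x * v.1 x)).
Variables (CP CS : R).
Hypotheses (CS0 : 0 <= CS) (CP0 : 0 <= CP)
  (hP : forall v, V v -> I (fun x => v.1 x ^+ 2) <= CP * D2 Omega v)
  (hS : forall v, V v -> D2 Omega v <= 4^-1 ->
    intg mu Omega (fun x => f x * `|v.1 x| `^ th) /\ I (fun x => f x * `|v.1 x| `^ th) <= CS).
Variables (w : nat -> vf) (m : nat -> nat) (w' : vf).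
Hypotheses (hm : forall k, (k <= m k)%N)
  (sw : forall k, solves Omega b (fun v => I (fun x => f x * v.1 x)) hop (m k) (w k))
  (Vw' : V w') (pos : aeon (fun x => 0 < w'.1 x))
  (cw : aeon (fun x => forall o, vco (w k) o x @[k --> \oo] --> vco w' o x)).

Variable S : T -> R.
Hypotheses (iS : intg mu Omega S) (dS : aeon (fun x => forall k o, vco (w k) o x ^+ 2 <= S x)).

Local Notation domE := (in_dom oO bO p0 th1 th2 B0 mb al0 bb mf f0 intf CS0 CP0 hP hS hm sw Vw' pos cw).
Local Notation quadI := (quadratic_integrable oO bO p0 th1 th2 B0 mb al0 bb mf f0 intf intF CS0 CP0 hP hS hm sw Vw' pos cw).

Definition sol : vf := vcomp (fun s => E s - 1) (fun s => E s `^ p) w'.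

(** Almost everywhere the truncations [uk] coincide with [sol] from some index on, and componentwise
    they differ from it by at most [|sol|]. The uniform energy bound and Fatou's lemma put [sol] in
    [L^2]; dominated convergence then gives convergence in norm. *)
Lemma V_sol : V sol.
Proof.
have [C hC] := uk_energy oO bO p0 th1 th2 B0 mb al0 bb mf f0 intf CS0 hS hm sw Vw' pos cw.
have below := below_some_point oO bO p0 th1 th2 B0 mb al0 bb mf f0 intf CS0 CP0 hP hS hm sw Vw' pos cw.
have Vk := V_uk oO bO O Vw' pos.
have msol : measv sol.
  apply: measv_vcomp; [|exact: measurable_odep|exact: V_meas Vw'].
  by apply: measurable_funB => //; exact: ode_meas.
have low k x : w'.1 x <= ode_pt O k.+1 -> forall o, vco (uk O w' k) o x = vco sol o x.
  move=> h o; rewrite /uk /sol !vcompE /= (min_idPl h).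
  by case: o => [i|] //; rewrite ltNge h.
have ev : aeon (fun x => \forall k \near \oo, forall o, vco (uk O w' k) o x = vco sol o x).
  move: below; apply: aeon_imp => x _ [k0 hk0]; exists k0 => // k /= kk; apply: low.
  apply: le_trans hk0 _; rewrite leNgt; apply/negP => h.
  have [D0 _] := ode_pt_dom O k0.+1; have [_ q0] := ode_pt_dom O k.+1.
  by have := ode_lt D0 q0 h; rewrite !ode_ptE ltr_nat ltnS ltnS ltnNge kk.
have bnd : aeon (fun x => forall k o, `|vco (uk O w' k) o x - vco sol o x| <= `|vco sol o x|).
  have hh := w'_ge0 pos; move: domE hh; apply: aeon_imp2 => x _ Dx wx k o.
  have [h|h] := leP (w'.1 x) (ode_pt O k.+1); first by rewrite low// subrr normr0.
  rewrite /uk /sol !vcompE /= h (min_idPr (ltW h)); case: o => [i|].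
    by rewrite mxE mulr0 sub0r normrN.
  have [_ q0] := ode_pt_dom O k.+1.
  have h1 : E (ode_pt O k.+1) <= E (w'.1 x) by apply: ode_le => //; exact: ltW.
  have h2 : 1 <= E (ode_pt O k.+1) by rewrite ode_ptE ler1n.
  rewrite distrC !ger0_norm ?subr_ge0 ?(le_trans h2)//; lra.
have Lsol : L2v Omega sol.
  move=> o; split; first by apply: measurable_funTS; exact: msol.
  suff [//] : intg mu Omega (fun x => vco sol o x ^+ 2) /\ I (fun x => vco sol o x ^+ 2) <= CP * C + C.
  apply: (@fatouR _ _ _ _ _ mO (fun k x => vco (uk O w' k) o x ^+ 2)).
  - by apply: measurable_funX; apply: measurable_funTS; exact: msol.
  - by move=> k; case: (V_L2 (Vk k) o).
  - by move=> x _; exact: sqr_ge0.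
  - by move=> k x _; exact: sqr_ge0.
  - move=> k; apply: (le_trans (vco_n2 _ _ o)); rewrite /n2; apply: lerD => //.
    by apply: (le_trans (hP (Vk k))); exact: ler_wpM2l.
  move: ev; apply: aeon_imp => x _ hx e e0; apply: filterS hx => k ->.
  by rewrite lerDl ltW.
apply: (V_lim oO Vk msol Lsol); apply: cvg_n2 => o.
apply: (@dct0 _ _ _ oO _ (fun x => vco sol o x ^+ 2)).
- move=> k; apply: measurable_funX; apply: measurable_funB; apply: measurable_funTS; last exact: msol.
  exact: (V_meas (Vk k)).
- by case: (Lsol o).
- move: ev; apply: aeon_imp => x _ hx; apply: cvg_near_cst; apply: filterS hx => k ->.
  by rewrite subrr expr0n.
move: bnd; apply: aeon_imp => x _ hx k; rewrite ger0_norm ?sqr_ge0//.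
by rewrite -[leRHS]real_normK ?num_real//; apply: sqr_le_norm.
Qed.

Lemma gsq_sol x : gsq sol x = E (w'.1 x) `^ (2 * p) * gsq w' x.
Proof.
rewrite !gsqE mulr_sumr; apply: eq_bigr => i _; rewrite /= mxE exprMn; congr (_ * _).
by rewrite -powR_mulrn ?powR_ge0// -powRrM mulrC.
Qed.

Section test_function.
Variables (phi : vf) (M : R).
Hypotheses (Vp : V phi) (pM : forall x, `|phi.1 x| <= M).

(** Residual of the equation for [w'] tested with [phi] times the cut-off of [u], expanded by the
    product rule; the second term carries the derivative of the cut-off. *)
Definition cut_integrand (K : R) (x : T) : R :=
  cutf K (E (w'.1 x) - 1) * (b x * dotv (w'.2 x) (phi.2 x)) +
  b x * phi.1 x * (cutf' K (E (w'.1 x) - 1) * E (w'.1 x) `^ p) * gsq w' x +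
  B * (g (w'.1 x) * gsq w' x) * (phi.1 x * cutf K (E (w'.1 x) - 1)) -
  f x * (phi.1 x * cutf K (E (w'.1 x) - 1)).

Lemma M_ge0 : 0 <= M. Proof. exact: le_trans (normr_ge0 _) (pM 0). Qed.

Lemma be_ge0 : 0 <= be.
Proof. by have /andP[h1 h2] := bb 0; apply: le_trans (ltW al0) (le_trans h1 h2). Qed.

Lemma measurable_cut (K : R) : measurable_fun Omega (cut_integrand K).
Proof.
have mw := V_meas Vw' None.
have mu1 : measurable_fun setT (fun x => E (w'.1 x) - 1).
  apply: (measurableT_comp (f := fun t => E t - 1)); last exact: mw.
  by apply: measurable_funB => //; exact: ode_meas.
have m1 : measurable_fun setT (fun x => cutf K (E (w'.1 x) - 1)).
  apply: (measurableT_comp (f := cutf K)) => //; apply: continuous_measurable_fun => t.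
  exact: is_derive_continuous (is_derive_cutf K t).
have m2 : measurable_fun setT (fun x => cutf' K (E (w'.1 x) - 1)).
  apply: (measurableT_comp (f := cutf' K)) => //; apply: continuous_measurable_fun.
  exact: continuous_cutf'.
have m3 : measurable_fun setT (fun x => E (w'.1 x) `^ p).
  by apply: (measurableT_comp (f := fun t => E t `^ p)); [exact: measurable_odep|exact: mw].
have m4 : measurable_fun setT (gsq w') by apply: measurable_dotv => i; exact: (V_meas Vw' (Some i)).
have m5 : measurable_fun setT (fun x => dotv (w'.2 x) (phi.2 x)).
  by apply: measurable_dotv => i; [exact: (V_meas Vw' (Some i))|exact: (V_meas Vp (Some i))].
have m6 := V_meas Vp None.
have m7 : measurable_fun setT (fun x => phi.1 x * cutf K (E (w'.1 x) - 1)) by exact: (measurable_funM m6 m1).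
have m8 := intg_meas quadI.
have TS (h : T -> R) : measurable_fun setT h -> measurable_fun Omega h by exact: measurable_funTS.
apply: measurable_funB; last by apply: TS; exact: measurable_funM.
apply: measurable_funD; last first.
  apply: measurable_funM; last exact: TS.
  by apply: measurable_funM => //; exact: measurable_cst.
apply: TS; apply: measurable_funD; first by apply: measurable_funM => //; exact: measurable_funM.
apply: measurable_funM => //; apply: measurable_funM; last exact: measurable_funM.
exact: (measurable_funM mb m6).
Qed.

(** The cut-off is fixed while the approximations converge. On its support [u >= 1/K] and
    [1 + u <= 2 K + 1], so [g] is at most [K^th (2 K + 1)^(2p)]; with the squared gradients
    dominated by multiples of [S], dominated convergence applies. *)
Lemma cut_identity (k : nat) : I (cut_integrand k.+1%:R) = 0.
Proof.
set K : R := k.+1%:R; have K0 : 0 < K by exact: ltr0Sn.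
have K1 : 1 <= K by rewrite /K ler1n.
(* Here [E = 2 K + 1], so the truncation level is the upper end of the support of the cut-off, and
   [F] and [h] vanish at [s]. *)
pose s := ode_pt O (k.*2.+1).+1; have s0 : 0 < s := pt_gt0 O _.
have Es : E s - 1 = 2 * K.
  by rewrite /s ode_ptE dbl_succ natrD natrM addrK.
have dom t : 0 <= t <= s -> ode_dom O t by exact: pt_dom.
pose F (t : R) := cutf K (E t - 1); pose h (t : R) := cutf' K (E t - 1) * E t `^ p.
have ccut : continuous (cutf K) by move=> t; exact: is_derive_continuous (is_derive_cutf K t).
have mE1 : measurable_fun setT (fun t => E t - 1) by apply: measurable_funB => //; exact: ode_meas.
have mF : measurable_fun setT F.
  by apply: (measurableT_comp (f := cutf K)) => //; exact: continuous_measurable_fun.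
have mh : measurable_fun setT h.
  apply: measurable_funM; last exact: measurable_odep.
  apply: (measurableT_comp (f := cutf' K)) => //; apply: continuous_measurable_fun.
  exact: continuous_cutf'.
have dF (t : R) : 0 <= t <= s -> is_derive t 1 F (h t).
  move=> /dom Dt; have d1 := is_derive_subr1 (ode_deriv Dt).
  exact: (is_derive1_comp (g := fun t => E t - 1) (is_derive_cutf K (E t - 1)) d1).
have ch (t : R) : 0 <= t <= s -> {for t, continuous h}.
  move=> /dom Dt; apply: cvgM; last exact: continuous_ode_powR.
  apply: (@continuous_comp _ _ _ (fun t => E t - 1) (cutf' K)); last exact: continuous_cutf'.
  by apply: cvgB; [exact: ode_continuous|exact: cvg_cst].
have [Fs hs] : F s = 0 /\ h s = 0.
  have hE : 2 * K <= E s - 1 by rewrite Es.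
  have [e1 e2] := cutf_out K0 (or_intror hE).
  by rewrite /F /h e1 e2 mul0r.
have Ft t : 0 <= t <= s -> [/\ 0 <= F t, F t <= 1 & `|h t| <= 8 * K * (2 * K + 1) `^ p].
  move=> ht; have /andP[t0 ts] := ht; have E1 := ode_ge1 (dom t ht) t0.
  have u0 : 0 <= E t - 1 by rewrite subr_ge0.
  have [c1 c2 c3] := cutf_bounds K0 u0; split => //.
  rewrite /h normrM [X in _ * X]ger0_norm ?powR_ge0//; apply: ler_pM; rewrite ?powR_ge0//.
    have [hu|hu] := leP (K * (E t - 1)) 1.
      by rewrite (cutf_out K0 (or_introl hu)).2 normr0 mulr_ge0// ltW.
    rewrite mulrC; apply: (@le_trans _ _ (K * (`|cutf' K (E t - 1)| * (E t - 1)))); last by rewrite ler_pM2l.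
    by rewrite mulrCA ler_peMr// ltW.
  have ss : 0 <= s <= s by rewrite lexx ltW.
  have E2 : E t <= E s by apply: (ode_le (dom _ ss)).
  by apply: ge0_ler_powR; rewrite ?nnegrE; try lra; exact: ltW.
pose v n := testv phi F h s (w n).
have Vv n : V (v n).
  by apply: (@V_testv _ _ _ oO bO M phi F h s (w n) s0 (sol_V sw n) _ Vp pM mF mh dF ch); case: (sw n).
pose mn (t : R) := Num.min t s.
have mnb t : 0 <= t -> 0 <= mn t <= s by move=> t0; rewrite /mn le_min t0 (ltW s0) ge_min lexx orbT.
pose r n x := b x * dotv ((w n).2 x) ((v n).2 x) + hop (m n) (w n) x * (v n).1 x - f x * (v n).1 x.
pose r' (v0 : vf) (H0 : R) x := F (mn (v0.1 x)) * (b x * dotv (v0.2 x) (phi.2 x)) +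
   b x * phi.1 x * h (mn (v0.1 x)) * gsq v0 x + H0 * (phi.1 x * F (mn (v0.1 x))) -
   f x * (phi.1 x * F (mn (v0.1 x))).
have rE n x : r n x = r' (w n) (hop (m n) (w n) x) x.
  rewrite /r /r'; congr (_ + _ - _).
  (* Above the truncation level [h] vanishes, so the truncated gradient in [testv] may be replaced
     by the full one. *)
  have hz : s < (w n).1 x -> h (mn ((w n).1 x)) = 0 by move=> hw; rewrite /mn (min_idPr (ltW hw)).
  rewrite /v /= -/(mn _); move: (F (mn ((w n).1 x))) (h (mn ((w n).1 x))) hz => Fx hx hz.
  transitivity (b x * (Fx * dotv ((w n).2 x) (phi.2 x) + phi.1 x * hx * gsq (w n) x)); last by ring.
  congr (_ * _); rewrite /gsq /dotv !mulr_sumr -big_split; apply: eq_bigr => i _; rewrite /= !mxE.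
  case: ifP => hw; last by ring.
  by rewrite hz// mxE; ring.
have ir1 n := intg_form oO mb al0 bb (sol_V sw n) (Vv n).
have ir2 n := intg_hop oO p0 th1 B0 sw n (Vv n).
have Ir n : I (r n) = 0.
  have [_ _ /(_ _ (Vv n))] := sw n; rewrite /bform mul0r addr0 => e.
  rewrite /r IB; [|exact: mO|by apply: (intgD mO)|exact: intF].
  by rewrite ID// ?e ?subrr//; exact: mO.
have lim : aeon (fun x => r n x @[n --> \oo] --> cut_integrand K x).
  have ww := sol_ge0 sw.
  have a1 : aeon (fun x => (forall n, 0 <= (w n).1 x) /\ 0 < w'.1 x) by move: ww pos; apply: aeon_imp2.
  have a2 : aeon (fun x => ode_dom O (w'.1 x) /\ forall o, vco (w k) o x @[k --> \oo] --> vco w' o x).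
    by move: domE cw; apply: aeon_imp2.
  move: a1 a2; apply: aeon_imp2 => x _ [wx px] [Dx c].
  have mb' := mnb _ (ltW px).
  have c1 : mn ((w n).1 x) @[n --> \oo] --> mn (w'.1 x).
    apply: (cvg_comp _ (fun t : R => Num.min t s) (c None)).
    by apply: (@continuous_min _ _ id (fun=> s)); [exact: cvg_id|exact: cvg_cst].
  have cF : F (mn ((w n).1 x)) @[n --> \oo] --> F (mn (w'.1 x)).
    apply: (cvg_comp _ F c1); exact: is_derive_continuous (dF _ mb').
  have chh : h (mn ((w n).1 x)) @[n --> \oo] --> h (mn (w'.1 x)).
    exact: (cvg_comp _ h c1 (ch _ mb')).
  have cg : gsq (w n) x @[n --> \oo] --> gsq w' x.
    rewrite gsqE; under eq_fun do rewrite gsqE; apply: cvg_sumR => i.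
    by rewrite expr2; under eq_fun do rewrite expr2; apply: cvgM; exact: (c (Some i)).
  have cd : dotv ((w n).2 x) (phi.2 x) @[n --> \oo] --> dotv (w'.2 x) (phi.2 x).
    by apply: cvg_sumR => i; apply: cvgM; [exact: (c (Some i))|exact: cvg_cst].
  have cH : hop (m n) (w n) x @[n --> \oo] --> B * (g (w'.1 x) * gsq w' x).
    exact: (cvg_hop p0 th1 hm (conj Dx px) c).
  have EF : F (mn (w'.1 x)) = cutf K (E (w'.1 x) - 1) /\
      h (mn (w'.1 x)) = cutf' K (E (w'.1 x) - 1) * E (w'.1 x) `^ p.
    rewrite /mn; case: (leP (w'.1 x) s) => // hw.
    have Es2 : 2 * K <= E (w'.1 x) - 1.
      by rewrite -Es lerD2r; apply: ode_le => //; exact: ltW.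
    by have [-> ->] := cutf_out K0 (or_intror Es2); rewrite mul0r.
  have [EF1 EF2] := EF.
  have -> : cut_integrand K x = r' w' (B * (g (w'.1 x) * gsq w' x)) x.
    by rewrite /r' EF1 EF2.
  under eq_fun do rewrite rE; rewrite /r'.
  apply: cvgB; last by do 2 (apply: cvgM; first exact: cvg_cst); exact: cF.
  apply: cvgD; last by apply: cvgM => //; apply: cvgM => //; exact: cvg_cst.
  apply: cvgD; first by apply: cvgM => //; apply: cvgM => //; exact: cvg_cst.
  by apply: cvgM => //; apply: cvgM => //; exact: cvg_cst.
pose NS x : R := N%:R * S x.
pose g0 : R := K `^ th * (2 * K + 1) `^ (2 * p).
pose H0 : R := 8 * K * (2 * K + 1) `^ p.
pose G x := be * (NS x + gsq phi x) + be * M * H0 * NS x + B * g0 * M * NS x + M * f x.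
have iG : intg mu Omega G.
  have iNS : intg mu Omega NS by exact: (intgZ mO).
  apply: (intgD mO); last exact: (intgZ mO).
  apply: (intgD mO); last exact: (intgZ mO).
  apply: (intgD mO); last exact: (intgZ mO).
  by apply: (intgZ mO); apply: (intgD mO) => //; exact: (intg_gsq oO (V_L2 Vp)).
have dom_r : aeon (fun x => forall n, `|r n x| <= G x).
  move: (sol_ge0 sw) dS; apply: aeon_imp2 => x _ wx Sx n; rewrite rE /r'.
  have mb' := mnb _ (wx n); have [F0 F1 hb] := Ft _ mb'.
  have NSx : gsq (w n) x <= NS x.
    rewrite gsqE /NS; apply: (@le_trans _ _ (\sum_(i < N) S x)).
      by apply: ler_sum => i _; exact: (Sx n (Some i)).
    by rewrite sumr_const card_ord mulr_natl.
  have G0 := gsq_ge0 (w n) x; have NS0 := le_trans G0 NSx.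
  have M0 := M_ge0; have B1 := be_ge0; have bx := b_norm al0 bb x.
  have H00 : 0 <= H0 by rewrite !mulr_ge0 ?powR_ge0// ltW.
  have g00 : 0 <= g0 by rewrite mulr_ge0 ?powR_ge0.
  apply: (le_trans (ler_normB _ _)); apply: lerD; last first.
    rewrite normrM (ger0_norm (f0 x)) mulrC ler_wpM2r// normrM (ger0_norm F0).
    by rewrite -[leRHS]mulr1; apply: ler_pM.
  apply: (le_trans (ler_normD _ _)); apply: lerD; last first.
    have P1 : 0 <= B * g0 * NS x * M := mulr_ge0 (mulr_ge0 (mulr_ge0 (ltW B0) g00) NS0) M0.
    have h1 : hop (m n) (w n) x * (`|phi.1 x| * F (mn ((w n).1 x))) <= B * g0 * NS x * M.
      have [hK|hK] := leP (K * (E (mn ((w n).1 x)) - 1)) 1.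
        rewrite {1}/F (cutf_out K0 (or_introl hK)).1 !mulr0; exact: P1.
      have [hw|hw] := leP s ((w n).1 x).
        by rewrite /mn (min_idPr hw) Fs !mulr0; exact: P1.
      have mnE : mn ((w n).1 x) = (w n).1 x by apply/min_idPl; exact: ltW.
      rewrite mnE in hK F0 F1 *.
      have Dw : ode_dom O ((w n).1 x) by apply: dom; rewrite wx ltW.
      have wp : 0 < (w n).1 x.
        rewrite lt_def wx andbT; apply/eqP => w0; move: hK; rewrite w0 ode0 subrr mulr0.
        by rewrite ltr10.
      have gw : g ((w n).1 x) <= g0.
        have u0 := ode_gt1 Dw wp; rewrite /gcoef /g0; apply: ler_pM; rewrite ?powR_ge0//.
          have -> : K `^ th = (K^-1) `^ (- th) by rewrite -powR_inv1 ?(ltW K0)// -powRrM mulrNN mul1r.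
          rewrite !powRN lef_pV2 ?posrE ?powR_gt0 ?invr_gt0//.
          apply: ge0_ler_powR; rewrite ?nnegrE ?invr_ge0.
          + exact: le_trans ler01 th1.
          + exact: ltW.
          + exact: ltW.
          + by rewrite -[leLHS]mulr1 ler_pdivrMl// ltW.
        have ss : 0 <= s <= s by rewrite lexx ltW.
        have E2 : E ((w n).1 x) <= E s by apply: (ode_le (dom _ ss)) => //; exact: ltW.
        apply: ge0_ler_powR; rewrite ?nnegrE.
        + by rewrite mulr_ge0// ltW.
        + by apply: ltW; exact: ode_gt0.
        + by rewrite addr_ge0// mulr_ge0// ltW.
        + by move: E2 Es; lra.
      have hh := hop_le p0 th1 B0 (m n) (w n) x (conj Dw wp).
      rewrite subrr normr0 mulr0 addr0 in hh.
      apply: ler_pM; first exact: hop_ge0 p0 th1 B0 _ _ _.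
      - by rewrite mulr_ge0.
      - apply: (le_trans hh); apply: ler_pM => //.
          by rewrite mulr_ge0 ?gcoef_ge0// ltW.
        by rewrite ler_pM2l.
      - by rewrite -[leRHS]mulr1; apply: ler_pM.
    rewrite (normrM (hop (m n) (w n) x)) (normrM (phi.1 x)) (ger0_norm F0) (ger0_norm (hop_ge0 O p0 th1 B0 _ _ _)).
    by apply: (le_trans h1); rewrite mulrAC.
  apply: (le_trans (ler_normD _ _)); apply: lerD; last first.
    have N0 := normr_ge0 (b x); have N1 := normr_ge0 (phi.1 x).
    rewrite (normrM (b x * phi.1 x * h _)) (normrM (b x * phi.1 x)) (normrM (b x)) (ger0_norm G0).
    apply: ler_pM => //; try exact: mulr_ge0 (mulr_ge0 N0 N1) (normr_ge0 _).
    by apply: ler_pM => //; try exact: mulr_ge0 N0 N1; apply: ler_pM.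
  rewrite (normrM (F _)) (ger0_norm F0); apply: (@le_trans _ _ (1 * `|b x * dotv ((w n).2 x) (phi.2 x)|)).
    by rewrite ler_wpM2r.
  rewrite mul1r normrM; apply: ler_pM => //.
  have := dotv_young ((w n).2 x) (phi.2 x); have := normr_ge0 (dotv ((w n).2 x) (phi.2 x)).
  rewrite -/(gsq (w n) x) -/(gsq phi x); move: NSx; lra.
have mr n : measurable_fun Omega (r n).
  by apply: measurable_funB; [apply: measurable_funD|]; apply: intg_meas; [exact: ir1|exact: ir2|exact: intF].
have mc := measurable_cut K.
have [_ cI] := @dct _ _ _ mu Omega mO r (cut_integrand K) G mr mc lim iG dom_r.
have c0 : I (r n) @[n --> \oo] --> 0 by under eq_fun do rewrite Ir; exact: cvg_cst.
exact: (etrans (esym (cvg_lim (@Rhausdorff R) cI)) (cvg_lim (@Rhausdorff R) c0)).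
Qed.

(** Combined with [u |cutf'| <= 8], this bounds the derivative term of [cut_integrand] by a multiple
    of [g |Dw|^2 + |Du|^2], integrable by the two energy estimates. For [u <= 1] the part with [g]
    suffices, as [u u^-th >= 1]; for [u > 1] the other part does. *)
Lemma ode_weight t : ode_dom O t -> 0 < t -> E t `^ p <= (E t - 1) * (g t + E t `^ (2 * p)).
Proof.
move=> Dt t0; have u0 := ode_gt1 Dt t0; have E1 := ode_ge1 Dt (ltW t0).
have h1 : E t `^ p <= E t `^ (2 * p) by rewrite ler_powR// mulr_natl mulr2n lerDl ltW.
have [u1|u1] := leP (E t - 1) 1.
  have h2 : 1 <= (E t - 1) * (E t - 1) `^ (- th).
    rewrite powRN ler_pdivlMr ?powR_gt0// mul1r; apply: ge1r_powR => //.
    by rewrite u0.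
  apply: (le_trans h1); rewrite mulrDr /gcoef mulrA.
  apply: ler_wpDr; first by rewrite mulr_ge0 ?powR_ge0// ltW.
  by rewrite ler_peMl ?powR_ge0.
apply: (le_trans h1); rewrite mulrDr; apply: ler_wpDl; first by rewrite mulr_ge0 ?gcoef_ge0// ltW.
by rewrite ler_peMl ?powR_ge0// ltW.
Qed.

(** The cut-off is now removed. At almost every point [u] eventually lies where it equals 1 with
    zero derivative, so the integrand is eventually constant in [K]; the derivative term is
    dominated through [ode_weight]. *)
Lemma weak_identity : I (fun x => b x * dotv (w'.2 x) (phi.2 x)) +
  B * I (fun x => g (w'.1 x) * gsq w' x * phi.1 x) = I (fun x => f x * phi.1 x).
Proof.
have M0 := M_ge0; have B1 := be_ge0.
pose r x := b x * dotv (w'.2 x) (phi.2 x) + B * (g (w'.1 x) * gsq w' x * phi.1 x) - f x * phi.1 x.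
have mp : measurable_fun Omega phi.1 by apply: measurable_funTS; exact: (V_meas Vp None).
have i1 : intg mu Omega (fun x => b x * dotv (w'.2 x) (phi.2 x)) := intg_form oO mb al0 bb Vw' Vp.
have i2 : intg mu Omega (fun x => g (w'.1 x) * gsq w' x * phi.1 x).
  apply: (intg_dom_le mO _ (intgZ mO M quadI)).
    by apply: measurable_funM => //; exact: intg_meas quadI.
  move=> x _; have q0 : 0 <= g (w'.1 x) * gsq w' x by rewrite mulr_ge0 ?gcoef_ge0 ?gsq_ge0.
  by rewrite normrM (ger0_norm q0) mulrC ler_wpM2r.
have i3 := intF Vp.
have ir : intg mu Omega r by apply: (intgB mO) => //; apply: (intgD mO) => //; exact: (intgZ mO).
have mr := intg_meas ir.
pose G x := be * (gsq w' x + gsq phi x) + be * M * (8 * (g (w'.1 x) * gsq w' x + gsq sol x)) +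
  B * M * (g (w'.1 x) * gsq w' x) + M * f x.
have iG : intg mu Omega G.
  apply: (intgD mO); last exact: (intgZ mO).
  apply: (intgD mO); last exact: (intgZ mO (B * M) quadI).
  apply: (intgD mO).
    by apply: (intgZ mO); apply: (intgD mO); apply: (intg_gsq oO); exact: V_L2.
  apply: (intgZ mO); apply: (intgZ mO); apply: (intgD mO); first exact: quadI.
  exact: (intg_gsq oO (V_L2 V_sol)).
have aux : aeon (fun x => ode_dom O (w'.1 x) /\ 0 < w'.1 x) by move: domE pos; apply: aeon_imp2.
have lim : aeon (fun x => cut_integrand k.+1%:R x @[k --> \oo] --> r x).
  move: aux; apply: aeon_imp => x _ [Dx px]; have u0 := ode_gt1 Dx px.
  apply: cvg_near_cst; near=> k.
  have k2 : 2 / (E (w'.1 x) - 1) <= k.+1%:R.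
    near: k; exists (Num.truncn (2 / (E (w'.1 x) - 1))) => // k /= hk.
    by apply: ltW; apply: lt_le_trans (truncnS_gt _) _; rewrite ler_nat ltnS.
  have k1 : E (w'.1 x) - 1 <= k.+1%:R.
    near: k; exists (Num.truncn (E (w'.1 x) - 1)) => // k /= hk.
    by apply: ltW; apply: lt_le_trans (truncnS_gt _) _; rewrite ler_nat ltnS.
  rewrite ler_pdivrMr// in k2.
  have [e1 e2] := cutf_in (ltr0Sn R k) k2 k1.
  by rewrite /cut_integrand /r e1 e2; ring.
have dom_r : aeon (fun x => forall k, `|cut_integrand k.+1%:R x| <= G x).
  move: aux; apply: aeon_imp => x _ [Dx px] k; have u0 := ode_gt1 Dx px.
  have [c1 c2 c3] := cutf_bounds (ltr0Sn R k) (ltW u0).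
  have bx := b_norm al0 bb x; have q0 : 0 <= g (w'.1 x) * gsq w' x by rewrite mulr_ge0 ?gcoef_ge0 ?gsq_ge0.
  have G0 := gsq_ge0 w' x.
  rewrite /cut_integrand /G; set cu := cutf _ _ in c1 c2 *; set cu' := cutf' _ _ in c3 *.
  apply: (le_trans (ler_normB _ _)); apply: lerD; last first.
    rewrite normrM (ger0_norm (f0 x)) mulrC ler_wpM2r// normrM (ger0_norm c1).
    by rewrite -[leRHS]mulr1; apply: ler_pM.
  apply: (le_trans (ler_normD _ _)); apply: lerD; last first.
    rewrite normrM normrM (ger0_norm q0) (gtr0_norm B0) normrM (ger0_norm c1) mulrAC.
    apply: ler_wpM2r => //; apply: ler_wpM2l; first exact: ltW.
    by rewrite -[leRHS]mulr1; apply: ler_pM.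
  apply: (le_trans (ler_normD _ _)); apply: lerD.
    rewrite normrM (ger0_norm c1); apply: (@le_trans _ _ (1 * `|b x * dotv (w'.2 x) (phi.2 x)|)).
      by rewrite ler_wpM2r.
    rewrite mul1r normrM; apply: ler_pM => //.
    have := dotv_young (w'.2 x) (phi.2 x); have := normr_ge0 (dotv (w'.2 x) (phi.2 x)).
    rewrite -/(gsq w' x) -/(gsq phi x); lra.
  have h8 : `|cu'| * E (w'.1 x) `^ p * gsq w' x <= 8 * (g (w'.1 x) * gsq w' x + gsq sol x).
    rewrite gsq_sol -mulrDl mulrA; apply: ler_wpM2r => //.
    apply: (le_trans (ler_wpM2l (normr_ge0 cu') (ode_weight Dx px))).
    by rewrite mulrA; apply: ler_wpM2r => //; rewrite addr_ge0 ?gcoef_ge0 ?powR_ge0.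
  rewrite !normrM (ger0_norm G0) (ger0_norm (powR_ge0 _ _)) -[leLHS]mulrA.
  apply: ler_pM => //; rewrite ?mulr_ge0 ?powR_ge0//.
  by apply: ler_pM.
have [_ cI] := @dct _ _ _ mu Omega mO (fun k => cut_integrand k.+1%:R) r G
  (fun k => measurable_cut k.+1%:R) mr lim iG dom_r.
have c0 : I (cut_integrand k.+1%:R) @[k --> \oo] --> (0 : R).
  by under eq_fun do rewrite cut_identity; exact: cvg_cst.
have := etrans (esym (cvg_lim (@Rhausdorff R) cI)) (cvg_lim (@Rhausdorff R) c0).
rewrite /r IB; [|exact: mO|by apply: (intgD mO) => //; exact: (intgZ mO)|exact: i3].
rewrite ID; [|exact: mO|exact: i1|exact: (intgZ mO)].
by rewrite (IZ mO B i2) => h; apply: subr0_eq; apply: h; try exact: eventually_filter.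
Unshelve. all: by end_near.
Qed.

Lemma weak_identity_sol : I (fun x => b x / (1 + sol.1 x) `^ p * dotv (sol.2 x) (phi.2 x)) +
  B * I (fun x => gsq sol x / sol.1 x `^ th * phi.1 x) = I (fun x => f x * phi.1 x).
Proof.
rewrite -weak_identity; congr (_ + B * _); last first.
  apply: I_eq => x _; congr (_ * _); rewrite gsq_sol /gcoef powRN /=.
  by rewrite mulrC mulrA.
have E1 x : 1 + sol.1 x = E (w'.1 x) by rewrite /sol /=; ring.
have E2 x : dotv (sol.2 x) (phi.2 x) = E (w'.1 x) `^ p * dotv (w'.2 x) (phi.2 x).
  by rewrite /dotv mulr_sumr; apply: eq_bigr => i _; rewrite /= mxE mulrA.
apply: (I_eq_ae mO).
- rewrite (_ : (fun x => _) = fun x => b x * E (w'.1 x) `^ (- p) * dotv (sol.2 x) (phi.2 x)).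
    apply: measurable_funTS; apply: measurable_funM.
      apply: measurable_funM => //; apply: (measurableT_comp (f := fun t => E t `^ (- p))).
        exact: measurable_odep.
      exact: (V_meas Vw' None).
    by apply: measurable_dotv => i; [exact: (V_meas V_sol (Some i))|exact: (V_meas Vp (Some i))].
  by apply/funext => x; rewrite E1 powRN.
- exact: intg_meas (intg_form oO mb al0 bb Vw' Vp).
move: domE; apply: aeon_imp => x _ Dx; rewrite E1 E2 mulrA divfK//.
by rewrite gt_eqF// powR_gt0// ode_gt0.
Qed.

End test_function.
End weak_equation.

(** Cubes with rational centres and radii [1/(j+1)] suffice, and they are countably many. If a ball
    of radius [e] around [x] lies in [Omega], a radius below [e/2] keeps the closed cube around a
    nearby rational point inside that ball. *)
Lemma cube_cover (R : realType) (N : nat) (Omega : set 'rV[R]_N) (P : 'rV[R]_N -> Prop) :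
  open Omega ->
  (forall y r, 0 < r -> ccube y r `<=` Omega ->
    aeon (lebesgue_rV R N) Omega (fun x => cube y r x -> P x)) ->
  aeon (lebesgue_rV R N) Omega P.
Proof.
move=> oO h.
pose Q (k : nat) (x : 'rV[R]_N) := forall c : ('rV[rat]_N * nat)%type, unpickle k = Some c ->
  ccube (map_mx ratr c.1) c.2.+1%:R^-1 `<=` Omega ->
  cube (map_mx ratr c.1) c.2.+1%:R^-1 x -> P x.
have hQ k : aeon (lebesgue_rV R N) Omega (Q k).
  rewrite /Q; case: (unpickle k) => [c|]; last by apply: aeonW.
  have [sub|sub] := pselect (ccube (map_mx ratr c.1) (c.2.+1%:R^-1 : R) `<=` Omega); last first.
    by apply: aeonW => x _ c' [<-].
  have c0 : 0 < (c.2.+1%:R^-1 : R) by rewrite invr_gt0.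
  by have := h _ _ c0 sub; apply: aeon_imp => x _ hx c' [<-] _; exact: hx.
move: (aeon_all hQ); apply: aeon_imp => x Ox hx.
have /nbhs_ballP[e /= e0' eU] := open_nbhs_nbhs (conj oO Ox).
have e0 : 0 < e by [].
pose j := Num.truncn (2 / e); pose r : R := j.+1%:R^-1.
have r0 : 0 < r by rewrite invr_gt0.
have re : 2 * r < e.
  rewrite /r ltr_pdivrMr// mulrC -ltr_pdivrMr//; exact: truncnS_gt.
have hq (i : 'I_N) : exists q : rat, `|x 0 i - ratr q| < r.
  have [|q] := @rat_in_itvoo R (x 0 i - r) (x 0 i + r); first by lra.
  by rewrite in_itv/= => /andP[h1 h2]; exists q; rewrite ltr_norml; apply/andP; split; lra.
pose c : 'rV[rat]_N := \row_i projT1 (cid (hq i)).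
have hc i : `|x 0 i - (map_mx ratr c : 'rV[R]_N) 0 i| < r by rewrite !mxE; case: cid.
apply: (hx (pickle (c, j)) (c, j) (pickleK _)) => /=; last exact: hc.
move=> z hz; apply: eU; split => // i k.
have h1 := hc k; have h2 := hz k; rewrite -/r in h2.
rewrite ord1 /ball/=; move: h1 h2; rewrite ltr_norml ler_norml => /andP[h1 h2] /andP[h3 h4].
by rewrite ltr_norml; apply/andP; split; lra.
Qed.

(** * Existence for Borel data with pointwise bounds *)

Section existence.
Context (R : realType) (n : nat) (Omega : set 'rV[R]_n.+3).
Hypotheses (oO : open Omega) (bO : bounded_set Omega).
Local Notation mu := (lebesgue_rV R n.+3).
Local Notation T := 'rV[R]_n.+3.
Local Notation I f := (\int[mu]_(x in Omega) f x).
Local Notation mO := (measurable_Omega oO).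
Local Notation V := (@inV R n.+3 Omega).
Local Notation vf := (@vf R n.+3).
Local Notation aeon := (aeon mu Omega).
Variables (p th B : R).
Hypotheses (p0 : 0 < p) (th1 : 1 <= th) (th2 : th < 2) (B0 : 0 < B).
Variables (b : T -> R) (al be : R).
Hypotheses (mb : measurable_fun setT b) (al0 : 0 < al) (bb : forall x, al <= b x <= be).
Variable f : T -> R.
Hypotheses (mf : measurable_fun setT f) (f0 : forall x, 0 <= f x).

Section source.
Variables (q CS : R).
Hypotheses (intf : intg mu Omega f) (CS0 : 0 <= CS)
  (hS : forall v, V v -> D2 Omega v <= 4^-1 ->
    intg mu Omega (fun x => f x * `|v.1 x| `^ th) /\ I (fun x => f x * `|v.1 x| `^ th) <= CS).

Lemma source_small v : V v -> D2 Omega v <= 4^-1 ->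
  intg mu Omega (fun x => f x * v.1 x) /\ `|I (fun x => f x * v.1 x)| <= I f + CS.
Proof.
move=> Vv Dv; have [i1 h1] := hS Vv Dv.
have h x : `|f x * v.1 x| <= f x + f x * `|v.1 x| `^ th.
  rewrite normrM (ger0_norm (f0 x)) -[X in _ <= X + _]mulr1 -mulrDr; apply: ler_wpM2l => //.
  have [s1|s1] := leP `|v.1 x| 1; first by apply: (le_trans s1); rewrite lerDl powR_ge0.
  have : `|v.1 x| `^ 1 <= `|v.1 x| `^ th by rewrite ler_powR// ltW.
  by rewrite powRr1//; lra.
have iG : intg mu Omega (fun x => f x + f x * `|v.1 x| `^ th) by exact: (intgD mO).
have i2 : intg mu Omega (fun x => f x * v.1 x).
  apply: (intg_dom_le mO _ iG) => [|x _]; last exact: h.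
  by apply: measurable_funTS; apply: measurable_funM => //; exact: (V_meas Vv None).
split => //; apply: (le_trans (le_normr_Rintegral mO i2)).
apply: (@le_trans _ _ (I (fun x => f x + f x * `|v.1 x| `^ th))).
  by apply: (I_le mO); [exact: (intg_abs i2)|exact: iG|move=> x _; exact: h].
by rewrite ID//; [rewrite lerD2l|exact: mO].
Qed.

Lemma source_intg v : V v -> intg mu Omega (fun x => f x * v.1 x).
Proof.
move=> Vv; have D0 := D2_ge0 Omega v; pose y := 4 * D2 Omega v + 1.
have y0 : 0 < y by rewrite /y; lra.
have Dt : D2 Omega (vscale y^-1 v) <= 4^-1.
  rewrite (D2_scale oO _ Vv) exprVn mulrC ler_pdivrMr ?exprn_gt0//.
  by have := sqr_ge0 (D2 Omega v); rewrite /y; nra.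
have [i1 _] := source_small (V_scale oO y^-1 Vv) Dt.
rewrite (_ : (fun x => f x * v.1 x) = fun x => y * (f x * (vscale y^-1 v).1 x)).
  exact: (intgZ mO y i1).
by apply/funext => x; have /= -> := vscaleE y^-1 v None x; rewrite mulrCA mulVKf ?gt_eqF.
Qed.

(** Makes the source a bounded functional for the gradient norm: the bound of [source_small] on
    small multiples of [v] becomes quadratic by [I_homog]. *)
Lemma source_dual v : V v ->
  I (fun x => f x * v.1 x) ^+ 2 <= 4 * (I f + CS) ^+ 2 * D2 Omega v.
Proof.
move=> Vv; apply: I_homog; [exact: D2_ge0|exact: sqr_ge0|move=> t].
rewrite -(D2_scale oO t Vv) => Dt; have [_ h] := source_small (V_scale oO t Vv) Dt.
have e : t * I (fun x => f x * v.1 x) = I (fun x => f x * (vscale t v).1 x).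
  rewrite -(IZ mO t (source_intg Vv)); apply: I_eq => x _.
  by have /= -> := vscaleE t v None x; rewrite mulrCA.
rewrite -exprMn e -[leLHS]real_normK ?num_real//; apply: lerXn2r => //.
by rewrite nnegrE; exact: le_trans (normr_ge0 _) h.
Qed.

End source.

Lemma existence : intg mu Omega (fun x => f x `^ (2 * n.+3%:R / (2 * n.+3%:R - th * n.+1%:R))) ->
  (forall y r, 0 < r -> ccube y r `<=` Omega ->
    exists2 c, 0 < c & aeon (fun x => cube y r x -> c <= f x)) ->
  intg mu Omega f /\ exists u : vf, [/\ V u, aeon (fun x => 0 < u.1 x),
    intg mu Omega (fun x => gsq u x / u.1 x `^ th) &
    forall (phi : vf) (M : R), V phi -> (forall x, `|phi.1 x| <= M) ->
      I (fun x => b x / (1 + u.1 x) `^ p * dotv (u.2 x) (phi.2 x)) +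
      B * I (fun x => gsq u x / u.1 x `^ th * phi.1 x) = I (fun x => f x * phi.1 x)].
Proof.
set m0 := (_ / _) => intfe loc.
have [C0] := sobolev_H10 oO bO; set q := _ / _ => sb.
have n1 : 0 < n.+1%:R :> R by rewrite ltr0n.
have n13 : n.+3%:R = n.+1%:R + 2 :> R by rewrite -[n.+3]addn2 natrD.
have q2 : 2 <= q by rewrite /q n13 ler_pdivlMr//; lra.
have thq : 0 < th < q by rewrite (lt_le_trans ltr01 th1) (lt_le_trans th2 q2).
have d0 : 0 < 2 * n.+3%:R - th * n.+1%:R :> R.
  by rewrite n13; move: n1 th2; set a : R := n.+1%:R; nra.
have m0E : m0 = q / (q - th).
  have e : q - th = (2 * n.+3%:R - th * n.+1%:R) / n.+1%:R.
    by rewrite mulrBl mulfK ?gt_eqF.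
  by rewrite e invf_div mulrA divfK ?gt_eqF.
have m01 : 1 <= m0.
  rewrite /m0 ler_pdivlMr// mul1r; have := mulr_ge0 (le_trans ler01 th1) (ltW n1); lra.
have intf : intg mu Omega f.
  apply: (intg_dom_le mO _ (intgD mO (intg_cst oO bO 1) intfe)) => [|x _].
    exact: measurable_funTS.
  rewrite ger0_norm//; have [s1|s1] := leP (f x) 1.
    by apply: (le_trans s1); rewrite lerDl powR_ge0.
  have : f x `^ 1 <= f x `^ m0 by rewrite ler_powR// ltW.
  by rewrite powRr1//; lra.
split => //; rewrite m0E in intfe.
have [CP CP0 hP] := poincare oO bO q2 sb.
have [CS CS0 hS] := source_bound oO thq sb (measurable_funTS mf) f0 intfe.
have intF v : V v -> intg mu Omega (fun x => f x * v.1 x) by exact: (source_intg intf hS).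
have [Od] := ode_exists p.
pose F (v : vf) := I (fun x => f x * v.1 x).
have CF0 : 0 <= 4 * (I f + CS) ^+ 2 by rewrite mulr_ge0 ?sqr_ge0.
have Fl a x y : V x -> V y -> F (lincomb a x y) = a * F x + F y.
  move=> Vx Vy; rewrite /F -(IZ mO a (intF _ Vx)) -ID; [|exact: mO|exact: (intgZ mO a (intF _ Vx))|exact: (intF _ Vy)].
  by apply: I_eq => z _ /=; ring.
have Fb v : V v -> F v ^+ 2 <= 4 * (I f + CS) ^+ 2 * D2 Omega v by exact: (source_dual intf hS).
have Fpos v : V v -> (forall x, 0 <= v.1 x) -> 0 <= F v.
  by move=> _ v0; apply: Rintegral_ge0 => x _; rewrite mulr_ge0.
have [w [m [w' [S [hm sw [Vw' w'0] iS Sw]]]]] :=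
  approximate_solutions oO bO Od p0 th1 B0 mb al0 bb CP0 CF0 hP Fl Fb Fpos.
have dS : aeon (fun x => forall k o, vco (w k) o x ^+ 2 <= S x).
  by move: Sw; apply: aeon_imp => x _ [].
have cw : aeon (fun x => forall o, vco (w k) o x @[k --> \oo] --> vco w' o x).
  by move: Sw; apply: aeon_imp => x _ [].
have pos : aeon (fun x => 0 < w'.1 x).
  apply: (cube_cover oO) => y r r0 sub.
  have [z tz [z0 zE]] := bump_exists sub; have [c c0 fc] := loc y r r0 sub.
  have fz : aeon (fun x => 0 < z x -> c <= f x) by move: fc; apply: aeon_imp => x _ h /zE.
  have := local_positivity oO bO p0 th1 th2 B0 mb al0 bb intF hm sw Vw' cw tz z0 c0 fz.
  by apply: aeon_imp => x _ h /zE.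
have dom := in_dom oO bO p0 th1 th2 B0 mb al0 bb mf f0 intf CS0 CP0 hP hS hm sw Vw' pos cw.
exists (sol Od w'); split.
- exact: (V_sol oO bO p0 th1 th2 B0 mb al0 bb mf f0 intf CS0 CP0 hP hS hm sw Vw' pos cw).
- by move: dom pos; apply: aeon_imp2 => x _ Dx px; exact: ode_gt1 Dx px.
- have := quadratic_integrable oO bO p0 th1 th2 B0 mb al0 bb mf f0 intf intF CS0 CP0 hP hS hm sw Vw' pos cw.
  rewrite (_ : (fun x => gcoef _ _ _ * _) = fun x => gsq (sol Od w') x / (sol Od w').1 x `^ th)//.
  by apply/funext => x; rewrite gsq_sol /gcoef powRN /= [RHS]mulrC mulrA.
move=> phi M Vp pM.
exact: (weak_identity_sol oO bO p0 th1 th2 B0 mb al0 bb mf f0 intf intF CS0 CP0 hP hS hm sw Vw' pos cw iS dS Vp pM).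
Qed.

End existence.

(** * Representatives and Lebesgue norms *)

Section ae_integral.
Context d (T : measurableType d) (R : realType) (mu : {measure set T -> \bar R}).

Import HBNNSimple.

Local Notation nnint f :=
  (ereal_sup [set sintegral mu h | h in [set h : {nnsfun T >-> R} | forall x, ((h x)%:E <= f x)%E]]).

(** A simple function below [f], multiplied by the indicator of the complement of a null set, keeps
    its integral and lies below [g]. Simple functions are used because the functions of the
    statement are only almost everywhere equal to Borel ones. *)
Lemma nnintegral_ae_le (f g : T -> \bar R) : (forall x, 0 <= g x)%E ->
  {ae mu, forall x, f x = g x} -> (nnint f <= nnint g)%E.
Proof.
move=> g0 [A [mA A0 sub]]; apply: ge_ereal_sup => _ [h hf <-].
pose k := proj_nnsfun h (measurableC mA).
have kE x : k x = h x * \1_(~` A) x by [].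
have -> : sintegral mu h = sintegral mu k.
  rewrite -!integralT_nnsfun; apply: ae_eq_integral => //.
  - exact/measurable_EFinP.
  - exact/measurable_EFinP.
  exists A; split => //= x hx; apply: contrapT => Ax; apply: hx => _.
  have e : k x = h x by rewrite kE indicE mem_set// mulr1.
  exact: (congr1 EFin (esym e)).
apply: ereal_sup_ubound; exists k => // x; rewrite kE indicE.
have [Ax|Ax] := pselect (A x).
  by rewrite memNset// mulr0.
rewrite mem_set// mulr1; apply: (le_trans (hf x)).
have -> // : f x = g x by apply: contrapT => e; apply: Ax; exact: sub.
Qed.

(* The integral of a function that is not measurable is a difference of
   suprema over simple functions; it still only depends on the values a.e. *)
Lemma integral_ae (D : set T) (f g : T -> \bar R) :
  {ae mu, forall x, D x -> f x = g x} ->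
  (\int[mu]_(x in D) f x = \int[mu]_(x in D) g x)%E.
Proof.
move=> h; have e : {ae mu, forall x, (f \_ D) x = (g \_ D) x}.
  apply: filterS h => x hx; rewrite !patchE; case: ifPn => // /set_mem; exact: hx.
have e' : {ae mu, forall x, (g \_ D) x = (f \_ D) x} by apply: filterS e => x ->.
rewrite /integral; congr (_ - _)%E; apply/eqP; rewrite eq_le; apply/andP; split;
  apply: nnintegral_ae_le => [x|]; rewrite ?funepos_ge0 ?funeneg_ge0//.
- by apply: filterS e => x ex; rewrite !funeposE ex.
- by apply: filterS e' => x ex; rewrite !funeposE ex.
- by apply: filterS e => x ex; rewrite !funenegE ex.
- by apply: filterS e' => x ex; rewrite !funenegE ex.
Qed.

Lemma Rintegral_ae (D : set T) (f g : T -> R) : aeon mu D (fun x => f x = g x) ->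
  \int[mu]_(x in D) f x = \int[mu]_(x in D) g x.
Proof.
move=> h; congr fine; apply: integral_ae.
exact: (aeon_imp (Q := fun x => (f x)%:E = (g x)%:E) (fun x _ hx => congr1 EFin hx) h).
Qed.

End ae_integral.

Lemma cube_compactly_contained (R : realType) (N : nat) (Omega : set 'rV[R]_N) y r :
  ccube y r `<=` Omega -> compactly_contained (cube y r) Omega.
Proof.
move=> sub.
have h : closure (cube y r) `<=` ccube y r.
  rewrite [X in _ `<=` X](closure_id _).1; last exact: ccube_closed.
  by apply: closureS => x hx i; exact: ltW.
split; last exact: subset_trans sub.
by apply: (subclosed_compact _ (ccube_compact (y := y) (r := r)) h); exact: closed_closure.
Qed.

(** * From Lebesgue classes to Borel pairs and back *)

Section conversions.
Context (R : realType) (N : nat) (Omega : set 'rV[R]_N).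
Hypotheses (oO : open Omega) (bO : bounded_set Omega).
Local Notation mu := (lebesgue_rV R N).
Local Notation T := 'rV[R]_N.
Local Notation I f := (\int[mu]_(x in Omega) f x).
Local Notation mO := (measurable_Omega oO).
Local Notation V := (@inV R N Omega).
Local Notation aeon := (aeon mu Omega).

Lemma ess_inf_on_gt0 (o : set T) (f : T -> R) : (0 < ess_inf_on o f)%E ->
  exists2 c : R, 0 < c & aeon (fun x => o x -> c <= f x).
Proof.
rewrite /ess_inf_on; have := ess_inf_le mu (patch (cst +oo%E) o (EFin \o f)).
set e := ess_inf _ _ => ae e0.
have {}ae : {ae mu, forall x, o x -> (e <= (f x)%:E)%E}.
  by apply: filterS ae => x h ox; move: h; rewrite /patch (mem_set ox).
case: e e0 ae => [r r0 ae|_ ae|e0 _]; last by rewrite ltNge leNye in e0.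
  by exists r => //; apply: filterS ae => x h _ ox; have := h ox; rewrite lee_fin.
by exists 1 => //; apply: filterS ae => x h _ ox; have := h ox; rewrite leye_eq.
Qed.

(** The norm for the exponent [+oo] is defined by cases; when the whole space is null, any bound
    holds almost everywhere and [M = 0] serves. *)
Lemma Linfty_bound (f : T -> R) : in_Lp Omega +oo%E f ->
  exists2 M : R, 0 <= M & aeon (fun x => `|f x| <= M).
Proof.
move=> [_]; rewrite /Lp_norm unlock; case: ifPn => [m0|m0 _]; last first.
  exists 0 => //; exists setT; split => //.
  by apply/eqP; rewrite eq_le measure_ge0 andbT leNgt.
set h := (_ \o _); have := ess_sup_ge mu h.
set e := ess_sup _ _ => ae ey.
exists `|fine e| => //; apply: filterS ae => x; rewrite /h /= patchE => + Ox.
rewrite mem_set//= => hx; rewrite -lee_fin; apply: le_trans hx _.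
case: e ey => [r _|//|_]; last by rewrite leNye.
by rewrite lee_fin ler_norm.
Qed.

Lemma LpE (r : R) (f : T -> R) : r != 0 ->
  Lp_norm Omega r%:E f = ((\int[mu]_(x in Omega) (`|f x| `^ r)%:E) `^ r^-1)%E.
Proof.
move=> r0; rewrite /Lp_norm unlock; congr (_ `^ _)%E.
rewrite [RHS]integral_mkcond; apply: eq_integral => x _; rewrite !patchE.
by case: ifPn => //= _; rewrite normr0 powR0.
Qed.

Lemma Lp_ae (r : R) (f g : T -> R) : r != 0 -> aeon (fun x => f x = g x) ->
  Lp_norm Omega r%:E f = Lp_norm Omega r%:E g.
Proof.
move=> r0 h; rewrite (LpE f r0) (LpE g r0); congr (_ `^ _)%E; apply: integral_ae.
apply: (aeon_imp (Q := fun x => (`|f x| `^ r)%:E = (`|g x| `^ r)%:E) _ h) => x _ hx.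
by rewrite hx.
Qed.

Lemma Lp_intg (r : R) (f : T -> R) : r != 0 -> measurable_fun Omega f ->
  (Lp_norm Omega r%:E f < +oo)%E <-> intg mu Omega (fun x => `|f x| `^ r).
Proof.
move=> r0 mf; rewrite LpE//; have mp : measurable_fun Omega (fun x => `|f x| `^ r).
  apply: (measurableT_comp (f := fun s : R => s `^ r)); first exact: measurable_powR.
  exact: measurableT_comp.
have e : (\int[mu]_(x in Omega) `|(`|f x| `^ r)%:E| = \int[mu]_(x in Omega) (`|f x| `^ r)%:E)%E.
  by apply: eq_integral => x _; rewrite gee0_abs// lee_fin powR_ge0.
split => [h|/integrableP[_]]; last by rewrite /= e; exact: poweR_lty.
apply/integrableP; split; first exact/measurable_EFinP.
by rewrite /= e; apply: lty_poweRy h; rewrite invr_eq0.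
Qed.

Lemma powR2 (x : R) : `|x| `^ 2 = x ^+ 2.
Proof. by rewrite powR_mulrn// real_normK ?num_real. Qed.

Lemma Lp_norm2E (f : T -> R) : L2 mu Omega f ->
  Lp_norm Omega 2%:E f = (Num.sqrt (I (fun x => f x ^+ 2)))%:E.
Proof.
move=> [mf f2]; rewrite LpE//; under eq_integral do rewrite powR2.
by rewrite -(EFin_I mO f2) poweR_EFin powR12_sqrt// I_sqr_ge0.
Qed.

Lemma L2_Lp (f : T -> R) : measurable_fun Omega f ->
  (Lp_norm Omega 2%:E f < +oo)%E <-> L2 mu Omega f.
Proof.
move=> mf; rewrite (Lp_intg _ mf)//.
rewrite (_ : (fun x => _) = (fun x => f x ^+ 2)); last by apply/funext => x; exact: powR2.
by split => [h|[]].
Qed.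

Lemma H10_of_V w : V w -> H10 Omega w.1 w.2.
Proof.
move=> Vw; have mw := V_meas Vw; have Lw := V_L2 Vw.
have inL o : in_Lp Omega 2%:E (vco w o).
  split; first by exists (vco w o) => //; exact: aeonW.
  by apply/L2_Lp; [case: (Lw o)|exact: Lw].
split.
  split; [exact: (inL None)|by move=> i; exact: (inL (Some i))|].
  by move=> phi tphi i; exact: V_weak_grad.
have [f tf cf] := V_approx Vw.
have c o : Lp_norm Omega 2%:E (vco (vsub (gradv (f k)) w) o) @[k --> \oo] --> 0%E.
  have Ld k : L2 mu Omega (vco (vsub (gradv (f k)) w) o).
    exact: (L2v_lincomb oO (-1) Lw (L2v_gradv oO (tf k)) o).
  under eq_fun do rewrite (Lp_norm2E (Ld _)).
  have cI : I (fun x => vco (vsub (gradv (f k)) w) o x ^+ 2) @[k --> \oo] --> 0.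
    apply: (@squeeze_cvgr _ _ _ _ (fun=> 0) (fun k => n2 Omega (vsub (gradv (f k)) w))).
    - by apply: nearW => k; rewrite I_sqr_ge0 vco_n2.
    - exact: cvg_cst.
    - exact: cf.
  apply/fine_cvgP; split; first by apply: nearW => k.
  have := cvg_comp _ (@Num.sqrt R) cI (@sqrt_continuous R 0); rewrite sqrtr0.
  exact.
exists f; split => // [|i].
  rewrite (_ : (fun k => _) = fun k => Lp_norm Omega 2%:E (vco (vsub (gradv (f k)) w) None)).
    exact: (c None).
  by apply/funext => k; congr Lp_norm; apply/funext => x; rewrite vsubE.
rewrite (_ : (fun k => _) = fun k => Lp_norm Omega 2%:E (vco (vsub (gradv (f k)) w) (Some i))).
  exact: (c (Some i)).
by apply/funext => k; congr Lp_norm; apply/funext => x; rewrite vsubE /= mxE.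
Qed.

(** Lebesgue norms depend on values almost everywhere only, so the test functions approximating
    [(phi, Dphi)] approximate any Borel pair that represents it. *)
Lemma V_of_H10 phi Dphi (w : vf R N) : H10 Omega phi Dphi -> measv w ->
  aeon (fun x => phi x = w.1 x) -> (forall i, aeon (fun x => Dphi x 0 i = w.2 x 0 i)) -> V w.
Proof.
move=> [[[_ phi2] Dphi2 _] [f [tf cf cDf]]] mw e1 e2.
have n20 : 2 != 0 :> R by [].
have Lw : L2v Omega w.
  move=> o; apply/L2_Lp; first by apply: measurable_funTS; exact: mw.
  case: o => [i|] /=; last by rewrite -(Lp_ae n20 e1).
  by rewrite -(Lp_ae n20 (e2 i)); case: (Dphi2 i).
have c o : I (fun x => (vco (gradv (f k)) o x - vco w o x) ^+ 2) @[k --> \oo] --> 0.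
  have Ld k : L2 mu Omega (fun x => vco (gradv (f k)) o x - vco w o x).
    have := L2v_lincomb oO (-1) Lw (L2v_gradv oO (tf k)) o.
    by rewrite (_ : vco _ o = fun x => vco (gradv (f k)) o x - vco w o x)//; apply/funext => x; rewrite vsubE.
  have : Lp_norm Omega 2%:E (fun x => vco (gradv (f k)) o x - vco w o x) @[k --> \oo] --> 0%E.
    case: o {Ld} => [i|].
      rewrite (_ : (fun k => _) = fun k => Lp_norm Omega 2%:E (fun x => partial i (f k) x - Dphi x 0 i)).
        exact: cDf.
      apply/funext => k; apply: (Lp_ae n20).
      by move: (e2 i); apply: aeon_imp => x _ -> /=; rewrite mxE.
    rewrite (_ : (fun k => _) = fun k => Lp_norm Omega 2%:E (f k \- phi)); first exact: cf.
    apply/funext => k; apply: (Lp_ae n20).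
    by move: e1; apply: aeon_imp => x _ /= ->.
  under eq_fun do rewrite (Lp_norm2E (Ld _)).
  move=> /fine_cvgP[_] h; have h2 := cvgM h h; rewrite mulr0 in h2.
  pose Q k := I (fun x => (vco (gradv (f k)) o x - vco w o x) ^+ 2).
  rewrite (_ : (fun k => _) = fun k => Num.sqrt (Q k) * Num.sqrt (Q k)); first exact: h2.
  by apply/funext => k; rewrite -expr2 sqr_sqrtr ?I_sqr_ge0.
have := cvg_n2 c => c0.
split => // e ep; move/cvgrPdist_le: c0 => /(_ _ ep) [K _ hK].
exists (f K) => //; have := hK K (leqnn K); rewrite /= sub0r normrN; exact: le_trans (ler_norm _).
Qed.

End conversions.

Theorem theorem1p3 (R : realType) (N : nat) (hN : (3 <= N)%N)
  (Omega : set 'rV[R]_N) (Omega_open : open Omega)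
  (Omega_bounded : bounded_set Omega)
  (B : R) (hB : 0 < B)
  (b : 'rV[R]_N -> R) (alpha beta : R) (halpha : 0 < alpha) (hbeta : 0 < beta)
  (b_meas : lebesgue_measurable_fun Omega b)
  (b_bound : {ae lebesgue_rV R N, forall x, Omega x -> alpha <= b x <= beta})
  (theta p : R) (htheta : 1 <= theta < 2) (hp : 0 < p) (hptheta : theta - 1 < p)
  (m : \bar R)
  (hm : ((2 * N%:R / (2 * N%:R - theta * (N%:R - 2)))%:E <= m)%E)
  (f : 'rV[R]_N -> R) (f_Lm : in_Lp Omega m f)
  (f_pos : {ae lebesgue_rV R N, forall x, Omega x -> 0 < f x})
  (f_inf : forall omega : set 'rV[R]_N,
    compactly_contained omega Omega -> (0 < ess_inf_on omega f)%E) :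
  exists (u : 'rV[R]_N -> R) (Du : 'rV[R]_N -> 'rV[R]_N),
    [/\ H10 Omega u Du,
        {ae lebesgue_rV R N, forall x, Omega x -> 0 < u x},
        in_Lp Omega 1%:E (fun x => dotv (Du x) (Du x) / u x `^ theta) &
        forall (phi : 'rV[R]_N -> R) (Dphi : 'rV[R]_N -> 'rV[R]_N),
          H10 Omega phi Dphi -> in_Lp Omega +oo%E phi ->
          \int[lebesgue_rV R N]_(x in Omega)
             (b x / (1 + u x) `^ p * dotv (Du x) (Dphi x)) +
          B * \int[lebesgue_rV R N]_(x in Omega)
             (dotv (Du x) (Du x) / u x `^ theta * phi x) =
          \int[lebesgue_rV R N]_(x in Omega) (f x * phi x)].

Proof.
destruct N as [|[|[|n]]] => //.
have mO := measurable_Omega Omega_open.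
pose mu := lebesgue_rV R n.+3.
have /andP[th1 th2] := htheta.
have [b1 mb1 eb] := b_meas.
have [[f1 mf1 ef] f_fin] := f_Lm.
(* The almost everywhere bound does not imply [alpha <= beta] when [Omega] is null, hence the
   maximum. Then [b'] and [f'] are Borel representatives clamped so that their bounds hold at every
   point, as [existence] requires. *)
pose beta' := Num.max alpha beta.
pose b' x := Num.max alpha (Num.min beta' (b1 x)).
pose f' x := Num.max (f1 x) 0.
have mb' : measurable_fun setT b'.
  apply: (measurable_maxr (f := fun=> alpha)); first exact: measurable_cst.
  by apply: (measurable_minr (f := fun=> beta')); first exact: measurable_cst.
have mf' : measurable_fun setT f'.
  by apply: (measurable_maxr (g := fun=> 0)) => //; exact: measurable_cst.
have bb' x : alpha <= b' x <= beta'.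
  by rewrite /b' le_max lexx /= ge_max ge_min lexx andbT /beta' le_max lexx.
have f'0 x : 0 <= f' x by rewrite /f' le_max lexx orbT.
have eb' : aeon mu Omega (fun x => b x = b' x).
  apply: (aeon_imp2 _ eb b_bound) => x _ ->; rewrite /b' => /andP[h1 h2].
  by rewrite (min_idPr _) ?(max_idPr _)// /beta' le_max h2 orbT.
have ef' : aeon mu Omega (fun x => f x = f' x).
  by apply: (aeon_imp2 _ ef f_pos) => x _ -> h; rewrite /f' (max_idPl _)// ltW.
have n13 : n.+3%:R - 2 = n.+1%:R :> R by rewrite -[n.+3]addn2 natrD addrK.
rewrite n13 in hm; set m0 := _ / _ in hm.
have intfe : intg mu Omega (fun x => f' x `^ m0).
  have mp : measurable_fun Omega (fun x => f' x `^ m0).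
    apply: measurable_funTS; apply: (measurableT_comp (f := fun s : R => s `^ m0)).
      exact: measurable_powR.
    exact: mf'.
  have d0 : 0 < 2 * n.+3%:R - theta * n.+1%:R :> R.
    have h : n.+3%:R = n.+1%:R + 2 :> R by rewrite -n13 subrK.
    have n1 : 0 < n.+1%:R :> R by rewrite ltr0n.
    by rewrite h; move: n1 th2; set a : R := n.+1%:R; nra.
  have m00 : 0 < m0 by rewrite divr_gt0// mulr_gt0// ltr0n.
  (* For finite [m = r] the domination is by [1 + f'^r], for [m = +oo] by a constant; both are
     integrable since [Omega] has finite measure. The value [-oo] contradicts the lower bound on
     [m]. *)
  case: m hm {f_Lm} f_fin => [r hr f_fin|_ f_fin|//].
    rewrite lee_fin in hr; have r0 : r != 0 by rewrite gt_eqF// (lt_le_trans m00).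
    rewrite (Lp_ae r0 ef') in f_fin.
    have ir := (Lp_intg r0 (measurable_funTS mf')).1 f_fin.
    apply: (intg_dom_le mO mp (intgD mO (intg_cst Omega_open Omega_bounded 1) ir)) => x _.
    rewrite !ger0_norm ?powR_ge0//; have [s1|s1] := leP (f' x) 1.
      apply: (@le_trans _ _ 1); last by rewrite lerDl powR_ge0.
      have : f' x `^ m0 <= 1 `^ m0 by apply: ge0_ler_powR; rewrite ?nnegrE//; exact: ltW.
      by rewrite powR1.
    have h : f' x `^ m0 <= f' x `^ r by rewrite ler_powR// ltW.
    by apply: (le_trans h); rewrite lerDr.
  have [M M0 hM] := Linfty_bound (conj (ex_intro2 _ _ f1 mf1 ef) f_fin).
  apply: (intg_dom mO mp (intg_cst Omega_open Omega_bounded (M `^ m0))).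
  apply: (aeon_imp2 _ hM ef') => x _ h e; rewrite ger0_norm ?powR_ge0//.
  apply: ge0_ler_powR; rewrite ?nnegrE//; first exact: ltW.
  by rewrite -e (le_trans (ler_norm _)).
have loc y r : 0 < r -> ccube y r `<=` Omega ->
    exists2 c, 0 < c & aeon mu Omega (fun x => cube y r x -> c <= f' x).
  move=> _ /cube_compactly_contained/f_inf/(ess_inf_on_gt0 Omega) [c c0 fc].
  by exists c => //; apply: (aeon_imp2 _ fc ef') => x _ h <-.
have [intf' [u [Vu pos iq idn]]] :=
  existence Omega_open Omega_bounded hp th1 th2 hB mb' halpha bb' mf' f'0 intfe loc.
exists u.1, u.2; split => //; first exact: H10_of_V.
  have mq : measurable_fun setT (fun x => dotv (u.2 x) (u.2 x) / u.1 x `^ theta).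
    rewrite (_ : (fun x => _) = fun x => gsq u x * u.1 x `^ (- theta)); last first.
      by apply/funext => x; rewrite powRN.
    apply: measurable_funM; first by apply: measurable_dotv => i; exact: (V_meas Vu (Some i)).
    apply: (measurableT_comp (f := fun s : R => s `^ (- theta))); first exact: measurable_powR.
    exact: (V_meas Vu None).
  split; first by eexists; [exact: mq|exact: aeonW].
  apply/(Lp_intg _ (measurable_funTS mq)); first exact: oner_neq0.
  have := intg_abs iq; congr (intg _ _ _); apply/funext => x.
  by rewrite powRr1.
move=> phi Dphi Hphi phioo; have [M M0 hM] := Linfty_bound phioo.
have [[[[p1 mp1 ep] _] hD _] _] := Hphi.
have [|D1 hD1] := @boolp.choice _ _ (fun (i : 'I_n.+3) (g : 'rV[R]_n.+3 -> R) =>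
    measurable_fun setT g /\ aeon mu Omega (fun x => Dphi x 0 i = g x)).
  by move=> i; have [[g mg eg] _] := hD i; exists g.
(* Borel representative of the test pair, clamped at the essential bound of [phi] so that it is
   bounded at every point. *)
pose v : vf R n.+3 := (fun x => Num.max (- M) (Num.min M (p1 x)), fun x => \row_i D1 i x).
have ev : aeon mu Omega (fun x => phi x = v.1 x).
  apply: (aeon_imp2 _ ep hM) => x _ -> /=; rewrite ler_norml => /andP[h1 h2].
  by rewrite (min_idPr _) ?(max_idPr _).
have eD i : aeon mu Omega (fun x => Dphi x 0 i = v.2 x 0 i).
  by apply: (aeon_imp _ (hD1 i).2) => x _ ->; rewrite /= mxE.
have mv : measv v.
  case=> [i|] /=; last first.
    apply: (measurable_maxr (f := fun=> - M)); first exact: measurable_cst.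
    by apply: (measurable_minr (f := fun=> M)); first exact: measurable_cst.
  rewrite (_ : vco _ _ = D1 i); first exact: (hD1 i).1.
  by apply/funext => x; rewrite /= mxE.
have Vv : inV Omega v by exact: (V_of_H10 Omega_open Hphi mv ev eD).
have bv x : `|v.1 x| <= M.
  rewrite ler_norml /= le_max lexx /= ge_max ge_min lexx andbT.
  by rewrite (le_trans _ M0)// oppr_le0.
have eDD : aeon mu Omega (fun x => Dphi x = v.2 x).
  suff h : aeon mu Omega (fun x => forall i : 'I_n.+3, Dphi x 0 i = v.2 x 0 i).
    by apply: (aeon_imp _ h) => x _ hx; apply/rowP.
  (* [aeon_all] intersects null sets over natural numbers, so the finitely many coordinates are
     indexed by their values; indices beyond the dimension hold vacuously. *)
  have h k : aeon mu Omega (fun x => forall i : 'I_n.+3, i = k :> nat -> Dphi x 0 i = v.2 x 0 i).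
    have [kn|kn] := ltnP k n.+3; last first.
      by apply: aeonW => x _ i ik; have := ltn_ord i; rewrite ik ltnNge kn.
    apply: (aeon_imp _ (eD (Ordinal kn))) => x _ hx i ik.
    by rewrite (_ : i = Ordinal kn)//; exact: val_inj.
  by apply: (aeon_imp _ (aeon_all h)) => x _ hx i; exact: (hx i).
have e1 : \int[mu]_(x in Omega) (b x / (1 + u.1 x) `^ p * dotv (u.2 x) (Dphi x)) =
    \int[mu]_(x in Omega) (b' x / (1 + u.1 x) `^ p * dotv (u.2 x) (v.2 x)).
  by apply: Rintegral_ae; apply: (aeon_imp2 _ eb' eDD) => x _ -> ->.
have e2 : \int[mu]_(x in Omega) (dotv (u.2 x) (u.2 x) / u.1 x `^ theta * phi x) =
    \int[mu]_(x in Omega) (gsq u x / u.1 x `^ theta * v.1 x).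
  by apply: Rintegral_ae; apply: (aeon_imp _ ev) => x _ ->.
have e3 : \int[mu]_(x in Omega) (f x * phi x) = \int[mu]_(x in Omega) (f' x * v.1 x).
  by apply: Rintegral_ae; apply: (aeon_imp2 _ ef' ev) => x _ -> ->.
by rewrite e1 e2 e3; exact: idn Vv bv.
Qed.
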